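(* Let $M^3_{\mathrm{reg}}\subset\mathbb{R}^6$ be a smooth regular $3$-manifold parametrised near $p$ (the origin) in Monge form by $f(x,y,z)=(x,y,z,f_1(x,y,z),f_2(x,y,z),f_3(x,y,z))$, where the $f_i$ have zero constant and linear parts. Suppose that its curvature locus $\Delta_v$ at $p$ is substantial (i.e. non-planar). Let $V(M_f)$ be the common zero set of the $3\times 3$ minors of the matrix $M_f$. Then: (i) $\Delta_v$ is a Roman Steiner surface if and only if $V(M_f)$ is 6 real lines of multiplicity 1. (ii) $\Delta_v$ is a Cross-cap surface if and only if $V(M_f)$ is 2 real lines and 4 complex lines of multiplicity 1. (iii) $\Delta_v$ is a type 5 surface if and only if $V(M_f)$ is 4 real lines, two of them with multiplicity 2 and two with multiplicity 1. (iv) $\Delta_v$ is a type 6 surface if and only if $V(M_f)$ is 2 real lines of multiplicity 3 each. (v) $\Delta_v$ is a truncated cone if and only if $V(M_f)$ has a plane and a real line as the only real solutions and (possibly) some complex solutions. (vi) $\Delta_v$ is an ellipsoid if and only if $V(M_f)$ has a plane as the only real solution and (possibly) some complex solutions.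
   Context: Curvature locus. With $f$ in Monge form at the origin $p$, $T_pM^3_{\mathrm{reg}}\simeq\mathbb{R}^3$ with coordinates $(x,y,z)$ and $N_pM^3_{\mathrm{reg}}\simeq\mathbb{R}^3$. The second fundamental form is $II_p(v,w)=\pi_2(d^2f(v,w))$, $\pi_2$ being the projection onto the normal space. The curvature locus is $\Delta_v=\eta(\mathbb{S}^2)$, where $\eta:\mathbb{S}^2\subset T_pM^3_{\mathrm{reg}}\to N_pM^3_{\mathrm{reg}}$, $\eta(u)=II_p(u,u)$. It is called substantial if the linear space parallel to its affine hull has dimension 3. Matrix. Let $\rho(x,y,z)=x^2+y^2+z^2-1$, and let $j^2f_i$ be the 2-jet of $f_i$ at the origin. $M_f$ is the $4\times 3$ matrix whose first three rows are the gradients $\left(\frac{\partial j^2f_i}{\partial x},\frac{\partial j^2f_i}{\partial y},\frac{\partial j^2f_i}{\partial z}\right)$, $i=1,2,3$, and whose fourth row is $\left(\frac{\partial\rho}{\partial x},\frac{\partial\rho}{\partial y},\frac{\partial\rho}{\partial z}\right)$. Its four $3\times3$ minors are homogeneous polynomials of degree 3 in $x,y,z$, and $V(M_f)$ is their common zero set. Complex solutions are also considered; ''line'' and ''plane'' mean linear subspaces through the origin, and a line is real if it is spanned by a real vector, complex otherwise. The multiplicity of a line in $V(M_f)$ is the number of points, counted with multiplicity, in which the line meets a generic plane away from the origin, i.e. the complex dimension of the local algebra obtained from the ideal of the four minors by restricting to such a plane and localising at the point of intersection. Types of surfaces. By a known classification (Coffman et al.; Romero Fuster et al.), a substantial curvature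 locus is one of the following surfaces, which are determined by the number and type of the singularities of $\eta$. Singularities are of map germs $(\mathbb{R}^2,p)\to(\mathbb{R}^3,\eta(p))$ up to smooth changes of coordinates in source and target ($\mathcal{A}$-equivalence); antipodal points of $\mathbb{S}^2$ have the same image and are counted once. A $CC$-point (cross-cap) has the normal form $(x,y)\mapsto(x,y^2,xy)$. - Roman Steiner surface: 6 cross-caps joined in pairs by 3 transversal double point curves which meet at a triple point. - Cross-cap surface: 2 cross-caps joined by a transversal double point curve. - Type 5 surface: 2 cross-caps joined by a transversal double point curve; one of these cross-caps lies on a tangent double point curve where the tangency is non-degenerate (the tangent sheets have different curvature); the two end points of this curve are non-finitely determined singularities, called $TCC$-points. - Type 6 surface: no cross-caps; a tangent double point curve with degenerate tangency (the tangent sheets have the same curvature), whose two end points are non-finitely determined singularities, called $DTCC$-points. - Truncated cone: a compact cone with a curve of singular points corresponding to the base and a singular point corresponding to the vertex, none of them finitely determined. - Ellipsoid: an ellipsoid, with a curve of non-finitely determined singular points of the parametrisation. *)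

(* Defs.v *)
From HB Require Import structures.
From mathcomp Require Import all_boot all_order all_algebra.
From mathcomp Require Import all_classical all_reals all_analysis.
From mathcomp Require Import complex.
From mathcomp Require Import -(notations) mpoly.
Set Implicit Arguments.
Unset Strict Implicit.
Unset Printing Implicit Defensive.
Import Order.TTheory GRing.Theory Num.Theory.
Import numFieldNormedType.Exports.
Local Open Scope classical_set_scope.
Local Open Scope ring_scope.
Local Open Scope complex_scope.

Definition dot (K : comNzRingType) (n : nat) (u v : 'rV[K]_n) : K :=
  \sum_(i < n) u 0 i * v 0 i.

Definition vec3 (K : Type) (x y z : K) : 'rV[K]_3 :=
  \row_(i < 3) tnth [tuple x; y; z] i.

Section Germs.
Variable R : realType.

(* [U] is meant to be open. *)
Fixpoint Ck_on (V W : normedModType R) (k : nat) (U : set V) (f : V -> W)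
    : Prop :=
  match k with
  | 0%N => forall x, U x -> {for x, continuous f}
  | k'.+1 => (forall x, U x -> differentiable f x) /\
             (forall v, Ck_on k' U (fun x => 'D_v f x))
  end.

Definition smooth_on (V W : normedModType R) (U : set V) (f : V -> W) : Prop :=
  forall k, Ck_on k U f.

Definition smooth_near (V W : normedModType R) (p : V) (f : V -> W) : Prop :=
  exists2 U : set V, open_nbhs p U & smooth_on U f.

Definition local_diffeo (V : normedModType R) (p : V) (h : V -> V) : Prop :=
  smooth_near p h /\
  exists g : V -> V, [/\ smooth_near (h p) g,
    \forall x \near p, g (h x) = x & \forall y \near h p, h (g y) = y].

Definition A_equivalent (V W : normedModType R)
    (f : V -> W) (p : V) (g : V -> W) (q : V) : Prop :=
  exists (h : V -> V) (k : W -> W),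
    [/\ local_diffeo p h /\ h p = q,
        local_diffeo (f p) k /\ k (f p) = g q
      & \forall x \near p, k (f x) = g (h x)].

Definition iter_derive (V W : normedModType R) (s : seq V) (f : V -> W)
    : V -> W :=
  foldr (fun v (h : V -> W) x => 'D_v h x) f s.

Definition same_jet (V W : normedModType R) (k : nat) (p : V) (f g : V -> W)
    : Prop :=
  forall s : seq V, (size s <= k)%N -> iter_derive s f p = iter_derive s g p.

Definition finitely_determined (V W : normedModType R) (f : V -> W) (p : V)
    : Prop :=
  exists k : nat, forall g : V -> W,
    smooth_near p g -> same_jet k p f g -> A_equivalent g p f p.

Definition crosscap_form (u : 'rV[R]_2) : 'rV[R]_3 :=
  vec3 (u 0 0) (u 0 1 ^+ 2) (u 0 0 * u 0 1).

Definition S2 : set 'rV[R]_3 := [set a | dot a a = 1].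

(* A smooth immersion into the sphere is a local diffeomorphism onto an open
   subset of it, by equality of dimensions. *)
Definition sphere_param (a : 'rV[R]_3) (phi : 'rV[R]_2 -> 'rV[R]_3) : Prop :=
  [/\ phi 0 = a, smooth_near 0 phi, \forall x \near (0 : 'rV[R]_2), S2 (phi x)
    & forall v : 'rV[R]_2, v != 0 -> 'D_v phi 0 != 0].

Definition regular_closed_curve (C : set 'rV[R]_3) : Prop :=
  exists gamma : R -> 'rV[R]_3,
    [/\ smooth_on [set: R] gamma, forall t, 'D_1 gamma t != 0,
        forall t, gamma (t + 1) = gamma t & C = range gamma].

End Germs.

Arguments S2 : clear implicits.

Section CurvatureLocus.
Variable R : realType.

Notation V3 := ('rV[R]_3).

Definition monge (f : 'I_3 -> V3 -> R) (x : V3) : 'rV[R]_(3 + 3) :=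
  row_mx x (\row_(i < 3) f i x).

(* In Monge form the normal space at the origin is {0} x R^3, so that the
   projection onto it is [rsubmx]. *)
Definition second_form (f : 'I_3 -> V3 -> R) (v w : V3) : V3 :=
  rsubmx ('D_v (fun x => 'D_w (monge f) x) 0).

(* Defined on the whole tangent space; only its restriction to the sphere
   matters, and derivatives along the sphere are those in tangent directions. *)
Definition eta (f : 'I_3 -> V3 -> R) (u : V3) : V3 := second_form f u u.

Definition curvature_locus (f : 'I_3 -> V3 -> R) : set V3 := eta f @` S2 R.

Definition affine_hull (A : set V3) : set V3 :=
  [set y | exists (n : nat) (c : 'I_n -> R) (a : 'I_n -> V3),
     [/\ \sum_(i < n) c i = 1, forall i, A (a i)
       & y = \sum_(i < n) c i *: a i]].

Definition substantial (A : set V3) : Prop :=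
  exists2 U : {vspace V3}, \dim U = 3%N &
    [set` U] = [set x - y | x in affine_hull A & y in affine_hull A].

Section SphereMap.
Variable g : V3 -> V3.

Definition eqpm (a b : V3) : Prop := a = b \/ a = - b.

(* The tangent plane of the sphere at [a] is the orthogonal complement of [a]. *)
Definition singular_pt (a : V3) : Prop :=
  S2 R a /\ exists2 w : V3, w != 0 /\ dot a w = 0 & 'D_w g a = 0.

Definition crosscap_pt (a : V3) : Prop :=
  S2 R a /\ exists2 phi, sphere_param a phi &
    A_equivalent (g \o phi) 0 (@crosscap_form R) 0.

Definition non_fin_det_pt (a : V3) : Prop :=
  S2 R a /\ exists2 phi, sphere_param a phi &
    ~ finitely_determined (g \o phi) 0.

(* The singular points are exactly those listed in [s], each antipodal pair
   being listed once. *)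
Definition singular_points_are (s : seq V3) : Prop :=
  [/\ pairwise (fun a b => (a != b) && (a != - b)) s,
      forall c, c \in s -> S2 R c
    & forall a, singular_pt a <-> exists2 c, c \in s & eqpm a c].

(* Image of the tangent plane of the sphere under the differential of [g]. *)
Definition tangent_image (a : V3) : set V3 :=
  [set 'D_w g a | w in [set w | dot a w = 0]].

Definition transversal (a b : V3) : Prop :=
  [/\ ~ singular_pt a, ~ singular_pt b
    & forall y, exists2 v, tangent_image a v & tangent_image b (y - v)].

Definition tangent (a b : V3) : Prop :=
  [/\ ~ singular_pt a, ~ singular_pt b & tangent_image a = tangent_image b].

(* Second derivative at 0 of [g] along the great circle through [a] with
   velocity [w]. *)
Definition accel (a w : V3) : V3 :=
  'D_w (fun x => 'D_w g x) a - dot w w *: 'D_a g a.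

(* The two sheets, assumed tangent at their common point, have the same second
   fundamental form there.  (The Gaussian curvature would not do: it vanishes
   on both sheets along a segment with constant tangent plane.) *)
Definition same_curvature (a b : V3) : Prop :=
  forall nu w1 w2 : V3,
    (forall y, tangent_image a y -> dot nu y = 0) ->
    dot a w1 = 0 -> dot b w2 = 0 -> 'D_w1 g a = 'D_w2 g b ->
    dot nu (accel a w1) = dot nu (accel b w2).

(* An arc of double points of [g], given by its two lifts to the sphere; it
   joins the images of [p] and [q], where the lifts merge up to sign. *)
Definition double_curve (p q : V3) (l : (R -> V3) * (R -> V3)) : Prop :=
  [/\ {within `[0, 1], continuous l.1} /\ {within `[0, 1], continuous l.2},
      forall t, 0 <= t <= 1 ->
        [/\ S2 R (l.1 t), S2 R (l.2 t) & g (l.1 t) = g (l.2 t)],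
      forall t, 0 < t < 1 -> ~ eqpm (l.1 t) (l.2 t),
      {in `[0, 1] &, injective (g \o l.1)}
    & [/\ eqpm (l.1 0) p, eqpm (l.2 0) p, eqpm (l.1 1) q & eqpm (l.2 1) q]].

Definition arc (l : (R -> V3) * (R -> V3)) : set V3 := (g \o l.1) @` `[0, 1].

Definition double_points_are (P : (R -> V3) * (R -> V3) -> Prop) : Prop :=
  forall a b, S2 R a -> S2 R b -> ~ eqpm a b -> g a = g b ->
    exists2 l, P l & exists2 t, 0 < t < 1 &
      (eqpm a (l.1 t) /\ eqpm b (l.2 t)) \/ (eqpm a (l.2 t) /\ eqpm b (l.1 t)).

Definition transversal_along (l : (R -> V3) * (R -> V3)) : Prop :=
  forall t, 0 < t < 1 -> transversal (l.1 t) (l.2 t).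

(* A tangent double point curve may run through a singular point of one of the
   sheets; tangency is required where both sheets are immersed. *)
Definition tangent_along (degenerate : bool) (l : (R -> V3) * (R -> V3))
    : Prop :=
  forall t, 0 < t < 1 -> ~ singular_pt (l.1 t) -> ~ singular_pt (l.2 t) ->
    tangent (l.1 t) (l.2 t) /\
    (same_curvature (l.1 t) (l.2 t) <-> degenerate).

Definition triple_point (y : V3) : Prop :=
  exists a b c, [/\ ~ eqpm a b, ~ eqpm a c, ~ eqpm b c
    & forall u, (S2 R u /\ g u = y) <-> [\/ eqpm u a, eqpm u b | eqpm u c]].

Definition roman_steiner : Prop :=
  exists (c1 c2 c3 c4 c5 c6 : V3) (l1 l2 l3 : (R -> V3) * (R -> V3)) (y : V3),
    [/\ singular_points_are [:: c1; c2; c3; c4; c5; c6],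
        forall c, c \in [:: c1; c2; c3; c4; c5; c6] -> crosscap_pt c,
        [/\ double_curve c1 c2 l1, double_curve c3 c4 l2
          & double_curve c5 c6 l3],
        (forall l, [\/ l = l1, l = l2 | l = l3] -> transversal_along l) /\
        double_points_are (fun l => [\/ l = l1, l = l2 | l = l3])
      & triple_point y /\
        [/\ arc l1 `&` arc l2 = [set y], arc l1 `&` arc l3 = [set y]
          & arc l2 `&` arc l3 = [set y]]].

Definition crosscap_surface : Prop :=
  exists (c1 c2 : V3) (l : (R -> V3) * (R -> V3)),
    [/\ singular_points_are [:: c1; c2], crosscap_pt c1 /\ crosscap_pt c2,
        double_curve c1 c2 l, transversal_along l
      & double_points_are (eq l)].

Definition type5_surface : Prop :=
  exists (c1 c2 t1 t2 : V3) (l m : (R -> V3) * (R -> V3)),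
    [/\ singular_points_are [:: c1; c2; t1; t2],
        crosscap_pt c1 /\ crosscap_pt c2,
        non_fin_det_pt t1 /\ non_fin_det_pt t2,
        double_curve c1 c2 l /\ transversal_along l
      & [/\ double_curve t1 t2 m, tangent_along false m,
            double_points_are (fun k => k = l \/ k = m) & arc m (g c1)]].

Definition type6_surface : Prop :=
  exists (t1 t2 : V3) (m : (R -> V3) * (R -> V3)),
    [/\ singular_points_are [:: t1; t2], forall a, ~ crosscap_pt a,
        non_fin_det_pt t1 /\ non_fin_det_pt t2,
        double_curve t1 t2 m /\ tangent_along true m
      & double_points_are (eq m)].

Definition std_vertex : V3 := vec3 0 0 1.

Definition std_base : set V3 :=
  [set u | u 0 0 ^+ 2 + u 0 1 ^+ 2 = 1 /\ u 0 2%:R = 0].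

Definition std_cone : set V3 :=
  [set s *: std_vertex + (1 - s) *: b | s in [set s : R | 0 <= s <= 1]
                                      & b in std_base].

Definition truncated_cone : Prop :=
  exists (A : 'M[R]_3) (o : V3) (C : set V3) (a0 : V3),
    let h u := u *m A + o in
    [/\ A \in unitmx, g @` S2 R = h @` std_cone,
        regular_closed_curve C /\ g @` C = h @` std_base,
        forall a, (S2 R a /\ g a = h std_vertex) <-> eqpm a a0
      & (forall a, singular_pt a <-> (C a \/ eqpm a a0)) /\
        (forall a, singular_pt a -> non_fin_det_pt a)].

Definition ellipsoid : Prop :=
  exists (A : 'M[R]_3) (o : V3) (C : set V3),
    [/\ A \in unitmx, g @` S2 R = [set u *m A + o | u in S2 R],
        regular_closed_curve C, forall a, singular_pt a <-> C a
      & forall a, singular_pt a -> non_fin_det_pt a].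

End SphereMap.
End CurvatureLocus.

Section Matrix.
Variable R : realType.

Notation V3 := ('rV[R]_3).
Notation C := (R[i]).
Notation poly3 := (mpoly 3).

Definition mvar (K : nzRingType) (i : 'I_3) : poly3 K := mpolyX K (mnm1 i).

Definition evalp (K : comNzRingType) (p : poly3 K) (u : 'rV[K]_3) : K :=
  meval (fun i => u 0 i) p.

Definition pd (i : 'I_3) (h : V3 -> R) (x : V3) : R := 'D_(delta_mx 0 i) h x.

Definition jet2 (h : V3 -> R) : poly3 R :=
  mpolyC 3 (h 0) + \sum_(i < 3) pd i h 0 *: mvar R i
  + \sum_(i < 3) \sum_(j < 3)
      (pd i (pd j h) 0 / 2%:R) *: (mvar R i * mvar R j).

Definition rho : poly3 R := \sum_(i < 3) mvar R i ^+ 2 - 1.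

Definition Mf (f : 'I_3 -> V3 -> R) : 'M[poly3 R]_(3 + 1, 3) :=
  col_mx (\matrix_(i < 3, j < 3) mderiv j (jet2 (f i)))
         (\row_(j < 3) mderiv j rho).

Definition minor (f : 'I_3 -> V3 -> R) (k : 'I_(3 + 1)) : poly3 R :=
  \det (row' k (Mf f) : 'M[poly3 R]_3).

Definition minorC (f : 'I_3 -> V3 -> R) (k : 'I_(3 + 1)) : poly3 C :=
  map_mpoly (real_complex R) (minor f k).

Definition V_Mf (f : 'I_3 -> V3 -> R) : set 'rV[C]_3 :=
  [set u | forall k, evalp (minorC f k) u = 0].

Definition V_Mf_real (f : 'I_3 -> V3 -> R) : set V3 :=
  [set u | V_Mf f (map_mx (real_complex R) u)].

Definition local_ring (q : 'rV[C]_3) : set {fraction (poly3 C)} :=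
  [set x | exists n d : poly3 C, evalp d q != 0 /\ x = tofrac n / tofrac d].

Definition local_ideal (q : 'rV[C]_3) (gens : seq (poly3 C))
    : set {fraction (poly3 C)} :=
  [set x | exists2 c : nat -> {fraction (poly3 C)},
     forall i, local_ring q (c i) &
     x = \sum_(i < size gens) c i * tofrac (nth 0 gens i)].

(* The quotient of the local ring at q by the ideal generated by [gens] has
   dimension [n] over the complex numbers. *)
Definition local_algebra_dim (q : 'rV[C]_3) (gens : seq (poly3 C)) (n : nat)
    : Prop :=
  exists2 b : 'I_n -> {fraction (poly3 C)}, forall i, local_ring q (b i) &
    forall x, local_ring q x ->
      exists! c : 'rV[C]_n,
        local_ideal q gens (x - \sum_(i < n) tofrac (mpolyC 3 (c 0 i)) * b i).

(* Affine planes off the origin are written dot lam u = 1, and a property holds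
   for the generic one when it does outside the zero set of some nonzero
   polynomial in lam.  Restricting to the plane amounts to adding its equation
   to the generators. *)
Definition line_mult (f : 'I_3 -> V3 -> R) (L : {vspace 'rV[C]_3}) (n : nat)
    : Prop :=
  exists2 Phi : poly3 C, Phi != 0 &
    forall lam : 'rV[C]_3, evalp Phi lam != 0 ->
      exists2 q, q \in L /\ dot lam q = 1 &
        local_algebra_dim q
          ((\sum_(i < 3) lam 0 i *: mvar C i - 1)
             :: [seq minorC f k | k <- enum 'I_(3 + 1)]) n.

Definition real_line (L : {vspace 'rV[C]_3}) : Prop :=
  exists2 r : V3, r != 0 & L = <[map_mx (real_complex R) r]>%VS.

Definition V_is_lines (f : 'I_3 -> V3 -> R) (s : seq {vspace 'rV[C]_3})
    : Prop :=
  [/\ uniq s, forall L : {vspace 'rV[C]_3}, L \in s -> \dim L = 1%N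
    & forall u, V_Mf f u <->
        exists2 L : {vspace 'rV[C]_3}, L \in s & u \in L].

Definition V_six_real_lines (f : 'I_3 -> V3 -> R) : Prop :=
  exists s : seq {vspace 'rV[C]_3},
    [/\ size s = 6%N, V_is_lines f s
      & forall L, L \in s -> real_line L /\ line_mult f L 1].

Definition V_two_real_four_complex_lines (f : 'I_3 -> V3 -> R) : Prop :=
  exists s t : seq {vspace 'rV[C]_3},
    [/\ size s = 2%N /\ size t = 4%N, V_is_lines f (s ++ t),
        forall L, L \in s -> real_line L, forall L, L \in t -> ~ real_line L
      & forall L, L \in s ++ t -> line_mult f L 1].

Definition V_four_real_lines (f : 'I_3 -> V3 -> R) : Prop :=
  exists s t : seq {vspace 'rV[C]_3},
    [/\ size s = 2%N /\ size t = 2%N, V_is_lines f (s ++ t),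
        forall L, L \in s ++ t -> real_line L,
        forall L, L \in s -> line_mult f L 2
      & forall L, L \in t -> line_mult f L 1].

Definition V_two_real_lines (f : 'I_3 -> V3 -> R) : Prop :=
  exists s : seq {vspace 'rV[C]_3},
    [/\ size s = 2%N, V_is_lines f s
      & forall L, L \in s -> real_line L /\ line_mult f L 3].

Definition V_plane_and_line (f : 'I_3 -> V3 -> R) : Prop :=
  exists P L : {vspace V3},
    [/\ \dim P = 2%N, \dim L = 1%N, ~~ (L <= P)%VS
      & V_Mf_real f = [set` P] `|` [set` L]].

Definition V_plane (f : 'I_3 -> V3 -> R) : Prop :=
  exists2 P : {vspace V3}, \dim P = 2%N & V_Mf_real f = [set` P].

End Matrix.

(* Main.v *)
From HB Require Import structures.
Require Import Defs.
From mathcomp Require Import all_boot all_order all_algebra.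
From mathcomp Require Import all_classical all_reals all_analysis.
From mathcomp Require Import complex.
From mathcomp Require Import -(notations) mpoly.
From mathcomp Require Import ring lra.
Set Implicit Arguments.
Unset Strict Implicit.
Unset Printing Implicit Defensive.
Import Order.TTheory GRing.Theory Num.Theory.
Import numFieldNormedType.Exports.
Local Open Scope classical_set_scope.
Local Open Scope ring_scope.

(* The curvature map is u |-> B(u, u) for a symmetric bilinear map B on R^3.
   The traceless symmetric forms orthogonal to the components of B form a space
   of dimension at least 2, which contains a singular member e.f; this gives an
   orthonormal frame (e, f, n) with B(e, f) = 0.  According to which of
   B(f,f) - B(e,e), B(e,n), B(f,n), B(n,n) - B(e,e) are independent, B takes one
   of a few explicit normal forms.  In each of them the surface and the zero set
   of the minors can both be computed.  As the six types of surface exclude each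
   other, and so do the six types of zero set, the equivalences follow.

   Points a, b of the sphere have the same image when B(a - b, a + b) = 0, and u
   is singular in the tangent direction w when B(u, w) = 0; both conditions ask
   for a decomposable member of the space above.  A singular point is not
   finitely determined when nearby pairs of points with the same image always
   have tangent images in a common plane, since an arbitrarily flat perturbation
   destroys this property. *)

(** Both sides of each equivalence rest on one fact: the matrix at [u] kills [w] exactly when B(u,
    w) = 0 and [dot u w = 0]. So the minors vanish at the factors of the decomposable members of the
    complexified space of forms, and the real factors are, up to scale, the singular points on the
    sphere. Tracelessness makes the factors orthogonal: a nonzero traceless symmetric form with a
    kernel has eigenvalues r, 0, - r and splits into two orthogonal vectors. In a simple frame the
    other factors are proportional to (+/- a - p, +/- b - q, 1) with a^2 = 1 - [dl] + p^2 and b^2 =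
    [dl] + q^2. These squares have positive sum: both are positive, or they have opposite signs, or
    one is zero and another frame is taken. In a tangent frame, nonzero [b] gives type 5, b = 0 with
    nonzero [a] type 6, and a = b = 0 the cone. The local algebras are given by generators only;
    each is identified with C[X]/(X^n) through an explicit curve germ along which the minors vanish
    to order n, and this needs short lists of generators adapted to the frame. *)

(** * Smooth maps, local diffeomorphisms and an invariant of A-equivalence *)

Section SmoothCalculus.
Variable R : realType.
Implicit Types V W : normedModType R.

Lemma derive_eq_on V W (U : set V) (f g : V -> W) v x :
  open U -> U x -> (forall y, U y -> f y = g y) -> 'D_v f x = 'D_v g x.
Proof.
move=> oU Ux fg; have [->|v0] := eqVneq v 0; first by rewrite !derive0.
by apply: near_eq_derive => //; apply: filterS (open_nbhs_nbhs (conj oU Ux)).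
Qed.

Lemma differentiable_eq_on V W (U : set V) (f g : V -> W) x :
  open U -> U x -> (forall y, U y -> f y = g y) ->
  differentiable f x -> differentiable g x.
Proof.
move=> oU Ux fg df.
have fgx : \forall y \near x, f y = g y.
  by apply: filterS (open_nbhs_nbhs (conj oU Ux)).
have fg0 : \forall h \near (0 : V), f (h + x) = g (h + x).
  move: fgx; rewrite (near_shift 0) /=.
  by apply: filterS => h; rewrite /= subr0.
move/diff_locallyP : (df) => [cdf dfE].
have gE : g \o shift x = cst (g x) + 'd f x +o_ (0 : V) id.
  apply/eqaddoP => e e0.
  have /eqaddoP/(_ e e0) := dfE; apply: filter_app; near=> h.
  rewrite !fctE/= => H; rewrite -(near fg0 h)//.
  by rewrite -(fg _ Ux).
have dE := diff_unique cdf gE.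
apply/diff_locallyP; rewrite dE; split => //.
Unshelve. all: by end_near. Qed.

Lemma Ck_on_eq V W k (U : set V) (f g : V -> W) :
  open U -> (forall y, U y -> f y = g y) -> Ck_on k U f -> Ck_on k U g.
Proof.
move=> oU; elim: k f g => [|k IH] f g fg /=.
  move=> cf x Ux; rewrite /prop_for /continuous_at -(fg _ Ux).
  apply: cvg_trans (cf x Ux); apply: near_eq_cvg.
  by apply: filterS (open_nbhs_nbhs (conj oU Ux)) => y /fg.
move=> [df Df]; split=> [x Ux|v].
  exact: (differentiable_eq_on oU Ux fg (df _ Ux)).
by apply: IH (Df v) => y Uy; exact: (derive_eq_on v oU Uy fg).
Qed.

Lemma Ck_on_differentiable V W k (U : set V) (f : V -> W) x :
  Ck_on k.+1 U f -> U x -> differentiable f x.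
Proof. by move=> [+ _]; apply. Qed.

Lemma Ck_on_pred V W k (U : set V) (f : V -> W) : Ck_on k.+1 U f -> Ck_on k U f.
Proof.
elim: k f => [|k IH] f.
  by move=> [df _] x Ux; exact: differentiable_continuous (df _ Ux).
by move=> [df Df]; split => // v; apply: IH; exact: Df.
Qed.

Lemma Ck_on_sub V W k (U U' : set V) (f : V -> W) :
  U' `<=` U -> Ck_on k U f -> Ck_on k U' f.
Proof.
move=> sU; elim: k f => [|k IH] f /=; first by move=> cf x /sU /cf.
by move=> [df Df]; split=> [x /sU /df//|v]; exact: IH.
Qed.

Lemma Ck_on_cst V W k (U : set V) (w : W) : Ck_on k U (fun _ => w).
Proof.
elim: k w => [|k IH] w /=; first by move=> x _; exact: cst_continuous.
split=> [x _|v]; first exact: differentiable_cst.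
rewrite (_ : (fun _ => _) = fun _ : V => 0 : W); first exact: IH.
by apply: funext => x; exact: derive_cst.
Qed.

Lemma Ck_onD V W k (U : set V) (f g : V -> W) : open U ->
  Ck_on k U f -> Ck_on k U g -> Ck_on k U (fun x => f x + g x).
Proof.
move=> oU; elim: k f g => [|k IH] f g /=.
  by move=> cf cg x Ux; apply: cvgD; [exact: cf|exact: cg].
move=> [df Df] [dg Dg]; split=> [x Ux|v].
  by apply: differentiableD; [exact: df|exact: dg].
apply: Ck_on_eq (IH _ _ (Df v) (Dg v)) => // y Uy.
by rewrite -deriveD//; apply: diff_derivable; [exact: df|exact: dg].
Qed.

Lemma Ck_onZl V W k (U : set V) (f : V -> R) (w : W) : open U ->
  Ck_on k U f -> Ck_on k U (fun x => f x *: w).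
Proof.
move=> oU; elim: k f => [|k IH] f /=.
  by move=> cf x Ux; apply: cvgZr_tmp; exact: cf.
move=> [df Df]; split=> [x Ux|v].
  by apply: differentiableZl; exact: df.
apply: Ck_on_eq (IH _ (Df v)) => // y Uy.
rewrite [RHS]deriveE; last by apply: differentiableZl; exact: df.
by rewrite diffZl ?deriveE//; exact: df.
Qed.

Lemma Ck_onM V k (U : set V) (f g : V -> R) : open U ->
  Ck_on k U f -> Ck_on k U g -> Ck_on k U (fun x => f x * g x).
Proof.
move=> oU; elim: k f g => [|k IH] f g /=.
  by move=> cf cg x Ux; apply: cvgM; [exact: cf|exact: cg].
move=> Cf Cg; have [df Df] := Cf; have [dg Dg] := Cg; split=> [x Ux|v].
  by apply: differentiableM; [exact: df|exact: dg].
apply: (@Ck_on_eq _ _ _ _ (fun x => f x * 'D_v g x + g x * 'D_v f x)) => //.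
  move=> y Uy; rewrite deriveM//; first by apply: diff_derivable; exact: df.
  by apply: diff_derivable; exact: dg.
by apply: Ck_onD => //; apply: IH => //; exact: Ck_on_pred.
Qed.

Lemma Ck_onV V k (U : set V) (f : V -> R) : open U ->
  (forall x, U x -> f x != 0) -> Ck_on k U f -> Ck_on k U (fun x => (f x)^-1).
Proof.
move=> oU f0; elim: k f f0 => [|k IH] f f0 /=.
  by move=> cf x Ux; apply: cvgV; [exact: f0|exact: cf].
move=> Cf; have [df Df] := Cf; split=> [x Ux|v].
  by apply: differentiableV; [exact: df|exact: f0].
have CV := IH _ f0 (Ck_on_pred Cf).
apply: (@Ck_on_eq _ _ _ _ (fun x => -1 * ((f x)^-1 * (f x)^-1) * 'D_v f x)) => //.
  move=> y Uy; rewrite deriveV ?f0//; last by apply: diff_derivable; exact: df.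
  by rewrite -exprVn expr2 mulN1r.
by do !apply: Ck_onM => //; exact: Ck_on_cst.
Qed.

Lemma is_derive_sqrt_comp V (f : V -> R) x v : 0 < f x -> differentiable f x ->
  differentiable (fun y => Num.sqrt (f y)) x /\
  'D_v (fun y => Num.sqrt (f y)) x = (2 * Num.sqrt (f x))^-1 * 'D_v f x.
Proof.
move=> f0 df.
have ds := is_derive1_sqrt f0.
have dsq : differentiable (@Num.sqrt R) (f x).
  by apply/derivable1_diffP; case: ds.
have dc : differentiable (fun y => Num.sqrt (f y)) x.
  exact: (@differentiable_comp _ _ _ _ f (@Num.sqrt R)).
split=> //; rewrite [LHS]deriveE// (@diff_comp _ _ _ _ f (@Num.sqrt R))//=.
rewrite -(deriveE v df) diff1E// derive1E (@derive_val _ _ _ _ _ _ _ ds).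
exact: mulrC.
Qed.

Lemma Ck_on_sqrt V k (U : set V) (f : V -> R) : open U ->
  (forall x, U x -> 0 < f x) -> Ck_on k U f ->
  Ck_on k U (fun x => Num.sqrt (f x)).
Proof.
move=> oU f0; elim: k f f0 => [|k IH] f f0 /=.
  move=> cf x Ux; apply: continuous_comp; first exact: cf.
  exact: sqrt_continuous.
move=> Cf; have [df Df] := Cf; split=> [x Ux|v].
  by have [] := is_derive_sqrt_comp 0 (f0 _ Ux) (df _ Ux).
have CV := IH _ f0 (Ck_on_pred Cf).
apply: (@Ck_on_eq _ _ _ _ (fun x => (2 * Num.sqrt (f x))^-1 * 'D_v f x)) => //.
  by move=> y Uy; have [_ ->] := is_derive_sqrt_comp v (f0 _ Uy) (df _ Uy).
apply: Ck_onM => //; apply: Ck_onV => //.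
  by move=> x Ux; rewrite mulf_neq0// gt_eqF// ?sqrtr_gt0 ?f0.
by apply: Ck_onM => //; exact: Ck_on_cst.
Qed.

Lemma Ck_on_linear V W k (U : set V) (f : {linear V -> W}) :
  continuous f -> Ck_on k U f.
Proof.
move=> cf; case: k => [|k] /=; first by move=> x _; exact: cf.
split=> [x _|v]; first exact/linear_differentiable.
rewrite (_ : (fun x => 'D_v f x) = fun _ => f v); first exact: Ck_on_cst.
apply: funext => x; rewrite deriveE; last exact/linear_differentiable.
by rewrite diff_lin.
Qed.

Lemma Ck_on_trig k (U : set R) (c : R) : open U ->
  Ck_on k U (fun t => cos (c * t)) /\ Ck_on k U (fun t => sin (c * t)).
Proof.
move=> oU.
have dc t : is_derive t (1 : R) (fun t => cos (c * t)) (- c * sin (c * t)).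
  have -> : (fun t => cos (c * t)) = @cos R \o ( *%R c) by [].
  apply: is_derive_eq; rewrite /GRing.scale /=; ring.
have ds t : is_derive t (1 : R) (fun t => sin (c * t)) (c * cos (c * t)).
  have -> : (fun t => sin (c * t)) = @sin R \o ( *%R c) by [].
  apply: is_derive_eq; rewrite /GRing.scale /=; ring.
have dfc t : differentiable (fun t => cos (c * t)) t.
  by apply/derivable1_diffP; case: (dc t).
have dfs t : differentiable (fun t => sin (c * t)) t.
  by apply/derivable1_diffP; case: (ds t).
have DE (f : R -> R) t v : differentiable f t -> 'D_v f t = v * 'D_1 f t.
  move=> df; rewrite !deriveE// -[v in LHS]mulr1 -[v * 1]/(v *: (1 : R)).
  by rewrite linearZ.
elim: k => [|k [IHc IHs]] /=.
  by split=> x _; apply: differentiable_continuous.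
split; split=> // v.
- apply: (@Ck_on_eq _ _ _ _ (fun t => v * - c * sin (c * t))) => //.
    by move=> y _; rewrite DE// (@derive_val _ _ _ _ _ _ _ (dc y)) mulrA.
  by apply: Ck_onM => //; exact: Ck_on_cst.
- apply: (@Ck_on_eq _ _ _ _ (fun t => v * c * cos (c * t))) => //.
    by move=> y _; rewrite DE// (@derive_val _ _ _ _ _ _ _ (ds y)) mulrA.
  by apply: Ck_onM => //; exact: Ck_on_cst.
Qed.

Lemma smooth_near_differentiable V W p (f : V -> W) :
  smooth_near p f -> \forall x \near p, differentiable f x.
Proof.
move=> [U oU sU]; apply: filterS (open_nbhs_nbhs oU) => x Ux.
by have [+ _] := sU 1%N; apply.
Qed.

Lemma smooth_near_continuous V W p (f : V -> W) :
  smooth_near p f -> {for p, continuous f}.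
Proof.
by move/smooth_near_differentiable/nbhs_singleton/differentiable_continuous.
Qed.

Lemma local_diffeo_inv V p (h : V -> V) : local_diffeo p h ->
  exists g, [/\ local_diffeo (h p) g, g (h p) = p,
    \forall x \near p, g (h x) = x & \forall y \near h p, h (g y) = y].
Proof.
move=> [sh [g [sg gh hg]]]; have ghp := nbhs_singleton gh.
exists g; split=> //; split=> //; exists h.
by rewrite ghp; split.
Qed.

(** Differentiating [g \o h = id] and [h \o g = id] at each nearby point, not at [p] alone, gives
    bijectivity there; pairs of nearby points are compared later. *)
Lemma local_diffeo_d V p (h : V -> V) : local_diffeo p h ->
  \forall x \near p, differentiable h x /\
    (forall w, exists v, 'd h x v = w) /\ (forall v, 'd h x v = 0 -> v = 0).
Proof.
move=> dh; have [g [dg ghp gh hg]] := local_diffeo_inv dh.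
have ch := smooth_near_continuous dh.1.
have dfh := smooth_near_differentiable dh.1.
have dfg := ch _ (smooth_near_differentiable dg.1).
have hg' := ch _ (nbhs_interior hg).
have gh' := nbhs_interior gh.
near=> x.
have Dh : differentiable h x by near: x.
have Dg : differentiable g (h x) by near: x.
have ghx : \forall y \near x, g (h y) = y by near: x.
have hgx : \forall y \near h x, h (g y) = y by near: x.
have gx : g (h x) = x by apply: nbhs_singleton ghx.
split=> //; split=> [w|v hv].
  exists ('d g (h x) w).
  have Dh' : differentiable h (g (h x)) by rewrite gx.
  have /(congr1 (fun f => f w)) := @diff_comp _ _ _ _ g h (h x) Dg Dh'.
  rewrite /= gx => <-; rewrite -deriveE; last first.
    exact: (@differentiable_comp _ _ _ _ g h).
  rewrite (@near_eq_derive _ _ _ (h \o g) id)//; exact: derive_id.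
have := deriveE v (@differentiable_comp _ _ _ _ h g x Dh Dg).
rewrite (@near_eq_derive _ _ _ (g \o h) id)// derive_id => ->.
by rewrite (@diff_comp _ _ _ _ h g x Dh Dg) /comp hv linear0.
Unshelve. all: by end_near. Qed.

(** The conjugating maps are inverted; continuity of [F] at [p] brings the neighbourhood of [F p] on
    which the target inverse is valid back to the source. *)
Lemma A_equivalent_sym V W p q (F G : V -> W) :
  {for p, continuous F} -> A_equivalent F p G q -> A_equivalent G q F p.
Proof.
move=> cF [h [k [[dh hp] [dk kp] kF]]].
have [h' [dh' h'p h'h hh']] := local_diffeo_inv dh.
have [k' [dk' k'p k'k kk']] := local_diffeo_inv dk.
rewrite hp in dh' h'p hh'; rewrite kp in dk' k'p kk'.
exists h', k'; split=> //.
have ch' := smooth_near_continuous dh'.1; rewrite /prop_for/continuous_at h'p in ch'.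
have kF' := ch' _ kF.
have k'k' := ch' _ (cF _ k'k).
near=> y.
have hy : h (h' y) = y by near: y.
have <- : k' (k (F (h' y))) = F (h' y) by near: y.
by congr k'; rewrite -{1}hy; symmetry; near: y.
Unshelve. all: by end_near. Qed.

Definition ranges_span V W (F : V -> W) (p p' : V) : Prop :=
  forall z, exists v w, z = 'D_v F p + 'D_w F p'.

(** The invariant that refutes finite determinacy. Pairs with [x = y] are included; a differentiable
    map from a plane to space never spans at such a pair. *)
Definition nowhere_transversal V W (F : V -> W) (p : V) : Prop :=
  exists2 U, nbhs p U & forall x y, U x -> U y -> F x = F y ->
    ~ ranges_span F x y.

(** Near [p] the chain rule gives dk o dF = dG o dh, so a pair whose ranges span for [F] is sent by
    the surjective dk to such a pair for [G]. *)
Lemma A_equivalent_nowhere_transversal V W p q (F G : V -> W) :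
  smooth_near p F -> smooth_near q G -> A_equivalent F p G q ->
  nowhere_transversal G q -> nowhere_transversal F p.
Proof.
move=> sF sG [h [k [[dh hp] [dk kp] kF]]] [U qU NT].
have ch := smooth_near_continuous dh.1.
have cF := smooth_near_continuous sF.
have DF := smooth_near_differentiable sF.
have Dk := cF _ (local_diffeo_d dk).
have Dh := local_diffeo_d dh.
rewrite /prop_for/continuous_at hp in ch.
have DG := ch _ (smooth_near_differentiable sG).
have hU := ch _ qU.
have kF' := nbhs_interior kF.
pose good x := [/\ differentiable F x, differentiable k (F x) /\
   (forall w, exists v, 'd k (F x) v = w), differentiable h x,
   differentiable G (h x) & U (h x) /\ (\forall y \near x, k (F y) = G (h y))].
have chain x v : good x -> 'd k (F x) ('D_v F x) = 'D_('D_v h x) G (h x).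
  move=> [dFx [dkx _] dhx dGx [_ ex]].
  have [->|v0] := eqVneq v 0; first by rewrite !derive0 linear0.
  rewrite !(deriveE _ dFx) (deriveE _ dGx) (deriveE _ dhx).
  have /(congr1 (fun f => f v)) /= := @diff_comp _ _ _ _ F k x dFx dkx.
  have /(congr1 (fun f => f v)) /= := @diff_comp _ _ _ _ h G x dhx dGx.
  move=> <- <-; rewrite -!deriveE//.
  - exact: (@near_eq_derive _ _ _ (k \o F) (G \o h)).
  - exact: (@differentiable_comp _ _ _ _ h G).
  - exact: (@differentiable_comp _ _ _ _ F k).
exists good.
  near=> x; split; first by near: x.
  - suff: differentiable k (F x) /\ (forall w, exists v, 'd k (F x) v = w) /\
         (forall v, 'd k (F x) v = 0 -> v = 0) by move=> [? []].
    by near: x.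
  - suff: differentiable h x /\ (forall w, exists v, 'd h x v = w) /\
         (forall v, 'd h x v = 0 -> v = 0) by move=> [].
    by near: x.
  - by near: x.
  - by split; near: x.
move=> x y gx gy Fxy sp.
have [_ [_ sk] _ _ [Ux /nbhs_singleton ex]] := gx.
have [_ _ _ _ [Uy /nbhs_singleton ey]] := gy.
apply: (NT (h x) (h y)) => //; first by rewrite -ex -ey Fxy.
move=> z; have [z0 <-] := sk z; have [v [w ->]] := sp z0.
exists ('D_v h x), ('D_w h y); rewrite linearD; congr (_ + _).
  exact: chain.
by rewrite Fxy; exact: chain.
Unshelve. all: by end_near. Qed.

End SmoothCalculus.

(** * Vector-valued bilinear maps and the scalar product *)

Section BilinearMaps.
Variable K : comNzRingType.
Implicit Types (u v w : 'rV[K]_3) (B : 'I_3 -> 'M[K]_3).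

(** Locked, so that rewriting with [mxE] stops at a coordinate of [bil] and does not unfold the
    matrix products; [bilE] opens it. *)
Definition bil B u w : 'rV[K]_3 := locked (\row_i (u *m B i *m w^T) 0 0).

Let bil_coord B u w i : bil B u w 0 i = (u *m B i *m w^T) 0 0.
Proof. by rewrite /bil -lock mxE. Qed.

Lemma bilDl B u v w : bil B (u + v) w = bil B u w + bil B v w.
Proof. by apply/rowP => i; rewrite [RHS]mxE !bil_coord !mulmxDl [LHS]mxE. Qed.

Lemma bilDr B u v w : bil B u (v + w) = bil B u v + bil B u w.
Proof.
by apply/rowP => i; rewrite [RHS]mxE !bil_coord linearD /= mulmxDr [LHS]mxE.
Qed.

Lemma bilZl B a u w : bil B (a *: u) w = a *: bil B u w.
Proof. by apply/rowP => i; rewrite [RHS]mxE !bil_coord -!scalemxAl [LHS]mxE. Qed.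

Lemma bilZr B a u w : bil B u (a *: w) = a *: bil B u w.
Proof.
by apply/rowP => i; rewrite [RHS]mxE !bil_coord linearZ -!scalemxAr [LHS]mxE.
Qed.

Lemma bilC B u w : (forall i, (B i)^T = B i) -> bil B u w = bil B w u.
Proof.
move=> sB; apply/rowP => i; rewrite !bil_coord -[LHS](@mxE _ _ _ trmx_key (fun a b => (u *m B i *m w^T) b a)).
by rewrite -/(trmx _) !trmx_mul trmxK sB mulmxA.
Qed.

Lemma sum3 (V : nmodType) (F : 'I_3 -> V) : \sum_i F i = F 0 + F 1 + F 2%:R.
Proof.
rewrite !big_ord_recl big_ord0 addr0 addrA.
by congr (_ + F _ + F _); apply: val_inj.
Qed.

Lemma sum5 (V : nmodType) (F : 'I_5 -> V) :
  \sum_i F i = F 0 + F 1 + F 2%:R + F 3%:R + F 4%:R.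
Proof.
rewrite !big_ord_recl big_ord0 addr0 !addrA.
by congr (_ + F _ + F _ + F _ + F _); apply: val_inj.
Qed.

Lemma bilE B u w i :
  bil B u w 0 i = \sum_(a < 3) \sum_(b < 3) B i a b * (u 0 a * w 0 b).
Proof.
rewrite bil_coord !mxE exchange_big /=; apply: eq_bigr => b _.
rewrite !mxE mulr_suml; apply: eq_bigr => a _; ring.
Qed.

Lemma dotE u w : dot u w = u 0 0 * w 0 0 + u 0 1 * w 0 1 + u 0 2%:R * w 0 2%:R.
Proof.
exact: sum3.
Qed.

Lemma dotC u w : dot u w = dot w u.
Proof. by rewrite !dotE; ring. Qed.
Lemma dotDl u v w : dot (u + v) w = dot u w + dot v w.
Proof. by rewrite !dotE !mxE; ring. Qed.
Lemma dotDr u v w : dot u (v + w) = dot u v + dot u w.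
Proof. by rewrite !dotE !mxE; ring. Qed.
Lemma dotZl a u w : dot (a *: u) w = a * dot u w.
Proof. by rewrite !dotE !mxE; ring. Qed.
Lemma dotZr a u w : dot u (a *: w) = a * dot u w.
Proof. by rewrite !dotE !mxE; ring. Qed.
Lemma dot0l u : dot 0 u = 0.
Proof. by rewrite !dotE !mxE; ring. Qed.

End BilinearMaps.

(** * Smoothness of row-vector maps and derivatives of quadratic maps *)

Section SmoothRows.
Variable R : realType.
Implicit Types V W : normedModType R.

Lemma Ck_on_row V n k (U : set V) (F : V -> 'rV[R]_n.+1) : open U ->
  (forall i, Ck_on k U (fun x => F x 0 i)) -> Ck_on k U F.
Proof.
move=> oU CF.
have H m (mn : (m <= n.+1)%N) : Ck_on k U (fun x =>
    \sum_(i < n.+1 | (i < m)%N) F x 0 i *: delta_mx 0 i : 'rV[R]_n.+1).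
  elim: m mn => [|m IH] mn.
    apply: (@Ck_on_eq _ _ _ _ _ (fun=> 0)) => //; last exact: Ck_on_cst.
    by move=> y _; rewrite big_pred0.
  apply: (@Ck_on_eq _ _ _ _ _ (fun x => F x 0 (Ordinal mn) *: delta_mx 0 (Ordinal mn) +
     \sum_(i < n.+1 | (i < m)%N) F x 0 i *: delta_mx 0 i)) => //.
    move=> y _; rewrite [RHS](bigD1 (Ordinal mn))//=; congr (_ + _).
    by apply: eq_bigl => i; rewrite ltnS -val_eqE /= ltn_neqAle andbC.
  by apply: Ck_onD => //; [exact: Ck_onZl|apply: IH; exact: ltnW].
apply: Ck_on_eq (H n.+1 (leqnn _)) => // y _.
rewrite [RHS]row_sum_delta; apply: eq_bigl => i; exact: ltn_ord.
Qed.

Lemma Ck_onN V k (U : set V) (f : V -> R) : open U ->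
  Ck_on k U f -> Ck_on k U (fun x => - f x).
Proof.
move=> oU Cf; apply: (@Ck_on_eq _ _ _ _ _ (fun x => -1 * f x)) => //.
  by move=> y _; rewrite mulN1r.
by apply: Ck_onM => //; exact: Ck_on_cst.
Qed.

Lemma Ck_onX V k (U : set V) (f : V -> R) n : open U ->
  Ck_on k U f -> Ck_on k U (fun x => f x ^+ n).
Proof.
move=> oU Cf; elim: n => [|n IH].
  by apply: (@Ck_on_eq _ _ _ _ _ (fun _ => 1 : R)) => //; exact: Ck_on_cst.
apply: (@Ck_on_eq _ _ _ _ _ (fun x => f x * f x ^+ n)) => //.
  by move=> y _; rewrite exprS.
exact: Ck_onM.
Qed.

Lemma Ck_on_vec3 V k (U : set V) (f g h : V -> R) : open U ->
  Ck_on k U f -> Ck_on k U g -> Ck_on k U h ->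
  Ck_on k U (fun x => vec3 (f x) (g x) (h x)).
Proof.
move=> oU Cf Cg Ch; apply: Ck_on_row => // i.
have H (F : V -> R) : Ck_on k U F -> (forall x, F x = vec3 (f x) (g x) (h x) 0 i) ->
    Ck_on k U (fun x => vec3 (f x) (g x) (h x) 0 i).
  by move=> CF E; apply: Ck_on_eq CF.
case: i H => [[|[|[|//]]] Hi] H.
- by apply: H Cf _ => x; rewrite mxE.
- by apply: H Cg _ => x; rewrite mxE.
- by apply: H Ch _ => x; rewrite mxE.
Qed.

Lemma open_pos V (f : V -> R) : (forall x, {for x, continuous f}) ->
  open [set x | 0 < f x].
Proof.
move=> cf; apply: (@open_comp _ _ f [set y | 0 < y]); last exact: open_gt.
by move=> x _; exact: cf.
Qed.

Lemma Ck_on_open_pos V (f : V -> R) : Ck_on 0 setT f -> open [set x | 0 < f x].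
Proof. by move=> cf; apply: open_pos => x; exact: cf. Qed.

Lemma derive_row V n (F : V -> 'rV[R]_n.+1) x v i : differentiable F x ->
  'D_v F x 0 i = 'D_v (fun y => F y 0 i) x.
Proof. by move=> dF; rewrite derive_mx ?mxE//; exact: diff_derivable. Qed.

Lemma Ck_on_coord V n k (U : set V) (F : V -> 'rV[R]_n.+1) i : open U ->
  Ck_on k U F -> Ck_on k U (fun x => F x 0 i).
Proof.
move=> oU; elim: k F => [|k IH] F /=.
  move=> cF x Ux; apply: (@continuous_comp _ _ _ F (fun M => M 0 i)).
    exact: cF.
  exact: coord_continuous.
move=> [dF DF]; split=> [x Ux|v].
  apply: (@differentiable_comp _ _ _ _ F (fun M => M 0 i)); first exact: dF.
  exact: differentiable_coord.
apply: Ck_on_eq (IH _ (DF v)) => // y Uy.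
by rewrite derive_row//; exact: dF.
Qed.

Lemma Ck_on_coord_id n k (U : set 'rV[R]_n.+1) i : Ck_on k U (fun x => x 0 i).
Proof.
have @f : {linear 'rV[R]_n.+1 -> R}.
  by exists (fun N : 'rV[R]_n.+1 => N 0 i); do 2![eexists]; do ?[constructor];
     rewrite ?mxE// => ? *; rewrite ?mxE//; move=> ?; rewrite !mxE.
have cf : continuous f by exact: coord_continuous.
exact: (@Ck_on_linear _ _ _ k U f cf).
Qed.

Lemma Ck_on_bil V k (U : set V) (F : V -> 'rV[R]_3) (B : 'I_3 -> 'M[R]_3) :
  open U -> Ck_on k U F -> Ck_on k U (fun x => bil B (F x) (F x)).
Proof.
move=> oU CF; apply: Ck_on_row => // i.
have C a : Ck_on k U (fun x => F x 0 a) by exact: Ck_on_coord.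
apply: (@Ck_on_eq _ _ _ _ _ (fun x => \sum_(a < 3) \sum_(b < 3)
   B i a b * (F x 0 a * F x 0 b))) => //.
  by move=> y _; rewrite bilE.
have CS (G : 'I_3 -> V -> R) : (forall a, Ck_on k U (G a)) ->
    Ck_on k U (fun x => \sum_(a < 3) G a x).
  move=> CG; apply: (@Ck_on_eq _ _ _ _ _
    (fun x => G ord0 x + (G (lift ord0 ord0) x + G (lift ord0 (lift ord0 ord0)) x))) => //.
    by move=> y _; rewrite !big_ord_recl big_ord0 addr0.
  by do !apply: Ck_onD.
apply CS; move=> a; apply CS; move=> b.
by apply: Ck_onM => //; [exact: Ck_on_cst|exact: Ck_onM].
Qed.

Lemma Ck_on_id V k (U : set V) : Ck_on k U (@id V).
Proof.
case: k => [|k] /=; first by move=> x _; exact: cvg_id.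
split=> [x _|v]; first by apply: ex_diff.
rewrite (_ : (fun x => 'D_v id x) = fun _ => v); first exact: Ck_on_cst.
by apply: funext => x; rewrite derive_id.
Qed.

Lemma differentiable_bil (B : 'I_3 -> 'M[R]_3) a :
  differentiable (fun u => bil B u u) a.
Proof.
have /(_ 1%N) := Ck_on_bil B openT (@Ck_on_id _ _ _).
by move/Ck_on_differentiable; apply.
Qed.

Lemma derive_bil (B : 'I_3 -> 'M[R]_3) a w : (forall i, (B i)^T = B i) ->
  'D_w (fun u => bil B u u) a = 2 *: bil B a w.
Proof.
move=> sB; rewrite /derive.
(* The difference quotient of a quadratic map is exactly affine in [h], so the limit is read off. *)
have E : \forall h \near 0^', 2 *: bil B a w + h *: bil B w w =
    h^-1 *: (bil B (h *: w + a) (h *: w + a) - bil B a a).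
  near=> h.
  have h0 : h != 0 by near: h; exact: nbhs_dnbhs_neq.
  apply: (scalerI h0); rewrite [RHS]scalerA divff// scale1r.
  rewrite !(bilDl, bilDr, bilZl, bilZr) (bilC w a sB).
  apply/rowP => i; rewrite !mxE; ring.
apply: cvg_lim => //; apply: cvg_trans (near_eq_cvg E) _.
have H : 2 *: bil B a w + h *: bil B w w @[h --> (0 : R)^'] -->
    2 *: bil B a w + 0 *: bil B w w.
  apply: cvgD; first exact: cvg_cst.
  by apply: cvgZr_tmp; exact: (@cvg_within _ (nbhs (0 : R))).
by rewrite scale0r addr0 in H.
Unshelve. all: by end_near. Qed.

Lemma derive_bil_comp V (B : 'I_3 -> 'M[R]_3) (F : V -> 'rV[R]_3) x v :
  (forall i, (B i)^T = B i) -> differentiable F x ->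
  'D_v (fun y => bil B (F y) (F y)) x = 2 *: bil B (F x) ('D_v F x).
Proof.
move=> sB dF.
have dB := differentiable_bil B (F x).
rewrite deriveE; last first.
  exact: (@differentiable_comp _ _ _ _ F (fun u => bil B u u)).
rewrite (@diff_comp _ _ _ _ F (fun u => bil B u u))//=.
by rewrite -(deriveE v dF) -deriveE// derive_bil.
Qed.

End SmoothRows.

(** Follows the shape of a formula through the closure rules for C^k maps; positivity under square
    roots and nonvanishing under inverses are left as goals. *)
Ltac ck := repeat (first [ exact: Ck_on_cst | exact: Ck_on_coord_id | assumption
  | apply: Ck_onD | apply: Ck_onN | apply: Ck_onM | apply: Ck_onX | apply: Ck_onZl
  | apply: Ck_on_vec3 | apply: Ck_on_sqrt | apply: Ck_onV | exact: openT]).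

(** * The curvature map as a quadratic map *)

Section Eta.
Variable R : realType.
Implicit Types (f : 'I_3 -> 'rV[R]_3 -> R).

(** Averaging the matrix of second partials with its transpose makes symmetry immediate, without
    equality of mixed partials; the quadratic map [eta] and the gradient of [jet2] see this average
    only. *)
Definition hess f (i : 'I_3) : 'M[R]_3 :=
  let P := \matrix_(a, b) pd a (pd b (f i)) 0 in 2^-1 *: (P + P^T).

Lemma hess_sym f i : (hess f i)^T = hess f i.
Proof. by rewrite /hess; move: (\matrix_(a, b) _) => P; rewrite linearZ linearD /= trmxK addrC. Qed.

Lemma derive_pd (h : 'rV[R]_3 -> R) x v : differentiable h x ->
  'D_v h x = \sum_a v 0 a * pd a h x.
Proof.
move=> dh; rewrite deriveE// [v in LHS]row_sum_delta linear_sum /=.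
apply: eq_bigr => a _; rewrite linearZ /=; congr (_ * _).
by rewrite /pd deriveE.
Qed.

Lemma second_derive (h : 'rV[R]_3 -> R) u v : smooth_near 0 h ->
  'D_u (fun x => 'D_v h x) 0 = \sum_a \sum_b v 0 a * (u 0 b * pd b (pd a h) 0).
Proof.
move=> [U [oU U0] sU].
have [dU DU] := sU 2%N.
have dp a : differentiable (pd a h) 0 by have [+ _] := DU (delta_mx 0 a); apply.
rewrite (@derive_eq_on _ _ _ U _ (\sum_a (fun x => v 0 a * pd a h x)))//; last first.
  by move=> y Uy; rewrite derive_pd ?fct_sumE//; exact: dU.
rewrite derive_sum; last first.
  by move=> a; apply: derivableM; [exact: derivable_cst|exact: diff_derivable].
apply: eq_bigr => a _.
rewrite deriveMl; last exact: diff_derivable.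
by rewrite derive_pd// mulr_sumr.
Qed.

Lemma etaE f : (forall i, smooth_near 0 (f i)) ->
  eta f = fun u => bil (hess f) u u.
Proof.
move=> sf; apply: funext => u; apply/rowP => i.
have /choice[U UP] : forall j, exists U, open_nbhs 0 U /\ smooth_on U (f j).
  by move=> j; have [U] := sf j; exists U.
have oU j := (UP j).1; have sU j := (UP j).2; clear UP.
have near0 : \forall x \near (0 : 'rV[R]_3),
   'D_u (monge f) x = row_mx u (\row_(i < 3) 'D_u (f i) x).
  have : \forall x \near (0 : 'rV[R]_3), forall i, U i x.
    exact: (@filter_forall _ _ U _ (nbhs_filter 0) (fun j => open_nbhs_nbhs (oU j))).
  apply: filterS => x Ux.
  have dm : derivable (monge f) x u.
    apply/derivable_mxP => a b; rewrite /monge.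
    case: (split_ordP b) => j -> /=.
      under eq_fun do rewrite row_mxEl.
      by apply: diff_derivable; exact: differentiable_coord.
    under eq_fun do rewrite row_mxEr mxE.
    by apply: diff_derivable; have [+ _] := sU j 1%N; apply.
  rewrite derive_mx//; apply/rowP => b; rewrite mxE.
  case: (split_ordP b) => j -> /=.
    rewrite row_mxEl; under eq_fun do rewrite /monge row_mxEl.
    by rewrite -(derive_row u j (Ck_on_differentiable (@Ck_on_id _ _ 1 setT) I)) derive_id.
  by rewrite row_mxEr mxE; under eq_fun do rewrite /monge row_mxEr mxE.
rewrite /eta /second_form mxE.
rewrite (near_eq_derive _ near0) derive_mx; last first.
  apply/derivable_mxP => a b.
  case: (split_ordP b) => j -> /=.
    by under eq_fun do rewrite row_mxEl; exact: derivable_cst.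
  under eq_fun do rewrite row_mxEr mxE.
  apply: diff_derivable; have [_ D] := sU j 2%N.
  by have [+ _] := D u; apply; case: (oU j).
rewrite mxE; under eq_fun do rewrite row_mxEr mxE.
rewrite second_derive// bilE.
have [P PE] : exists P, forall a b, pd a (pd b (f i)) 0 = P a b.
  by exists (fun a b => pd a (pd b (f i)) 0).
have E a b : hess f i a b = (P a b + P b a) / 2.
  by rewrite /hess; do 4!rewrite mxE; rewrite mxE !PE mulrC.
under [RHS]eq_bigr => a _ do under eq_bigr => b _ do rewrite E.
under [LHS]eq_bigr => a _ do under eq_bigr => b _ do rewrite PE.
(* The two halves of the symmetrised sum agree after exchanging the order of summation, as both
   arguments are [u]. *)
transitivity (\sum_a \sum_b (2^-1 * (P a b * (u 0 a * u 0 b)) +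
    2^-1 * (P b a * (u 0 a * u 0 b)))); last first.
  by apply: eq_bigr => a _; apply: eq_bigr => b _; ring.
under [RHS]eq_bigr => a _ do rewrite big_split.
rewrite big_split /= [X in _ = X + _]exchange_big /= -big_split /=.
apply: eq_bigr => a _; rewrite -big_split /=; apply: eq_bigr => b _.
by field.
Qed.

End Eta.

(** * Linear independence and dual vectors in dimension three *)

Section Independence.
Variable K : fieldType.
Implicit Types x y z v : 'rV[K]_3.

Definition indep3 x y z : Prop :=
  forall a b c, a *: x + b *: y + c *: z = 0 -> [/\ a = 0, b = 0 & c = 0].

Definition rows3 x y z : 'M[K]_3 := \matrix_(i < 3) tnth [tuple x; y; z] i.

Lemma mul_rows3 (u : 'rV[K]_3) x y z :
  u *m rows3 x y z = u 0 0 *: x + u 0 1 *: y + u 0 2%:R *: z.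
Proof.
rewrite mulmx_sum_row !big_ord_recl big_ord0 addr0 addrA !rowK !(tnth_nth 0) /=.
by congr (_ *: _ + _ *: _ + _ *: _); congr (u 0 _); apply: val_inj.
Qed.

Lemma vec3E (F : Type) (a b c : F) :
  [/\ vec3 a b c 0 0 = a, vec3 a b c 0 1 = b & vec3 a b c 0 2%:R = c].
Proof. by split; rewrite mxE. Qed.

Lemma mul_vec3_rows3 a b c x y z :
  vec3 a b c *m rows3 x y z = a *: x + b *: y + c *: z.
Proof. by rewrite mul_rows3; have [-> -> ->] := vec3E a b c. Qed.

Lemma vec3_eta (u : 'rV[K]_3) : u = vec3 (u 0 0) (u 0 1) (u 0 2%:R).
Proof.
apply/rowP => i; rewrite mxE.
by case: i => [[|[|[|//]]] H] /=; congr (u 0 _); apply: val_inj.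
Qed.

Lemma indep3_unitmx x y z : indep3 x y z <-> rows3 x y z \in unitmx.
Proof.
split=> [xyz|U a b c].
  rewrite -row_free_unit -kermx_eq0; apply/eqP/row_matrixP => i.
  rewrite row0; set u := row i _.
  have : u *m rows3 x y z = 0 by rewrite /u -row_mul mulmx_ker row0.
  rewrite mul_rows3 => /xyz [a0 b0 c0]; rewrite [u]vec3_eta a0 b0 c0.
  by apply/rowP => j; rewrite !mxE; case: j => [[|[|[|//]]] H].
rewrite -mul_vec3_rows3 => /(congr1 (mulmx^~ (invmx (rows3 x y z)))).
rewrite mulmxK// mul0mx => E0; have [Ha Hb Hc] := vec3E a b c.
by move: Ha Hb Hc; rewrite E0 !mxE.
Qed.

Lemma indep3_span x y z : indep3 x y z ->
  forall v, exists a b c, v = a *: x + b *: y + c *: z.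
Proof.
move=> /indep3_unitmx U v; pose u := v *m invmx (rows3 x y z).
exists (u 0 0), (u 0 1), (u 0 2%:R).
by rewrite -mul_rows3 /u mulmxKV.
Qed.

(** Prescribing the products with a basis is an invertible linear system; the solutions serve as
    coordinate functionals and as conormals. *)
Lemma indep3_dual x y z : indep3 x y z -> forall a b c,
  exists v, [/\ dot v x = a, dot v y = b & dot v z = c].
Proof.
move=> /indep3_unitmx U a b c.
pose v : 'rV[K]_3 := (invmx (rows3 x y z) *m (vec3 a b c)^T)^T; exists v.
have H (u : 'rV[K]_3) : u *m rows3 x y z *m v^T = u *m (vec3 a b c)^T.
  by rewrite /v trmxK mulmxA -(mulmxA u) mulmxV// mulmx1.
have D p q : dot p q = (q *m p^T) 0 0.
  by rewrite !mxE; apply: eq_bigr => i _; rewrite !mxE mulrC.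
have [Ha Hb Hc] := vec3E a b c.
split; rewrite D.
- by have := H (vec3 1 0 0); rewrite mul_vec3_rows3 scale1r !scale0r !addr0 => ->;
    rewrite -D dotE; have [-> -> ->] := vec3E (1 : K) 0 0; rewrite Ha; ring.
- by have := H (vec3 0 1 0); rewrite mul_vec3_rows3 scale1r !scale0r add0r addr0 => ->;
    rewrite -D dotE; have [-> -> ->] := vec3E (0 : K) 1 0; rewrite Hb; ring.
- by have := H (vec3 0 0 1); rewrite mul_vec3_rows3 scale1r !scale0r !add0r => ->;
    rewrite -D dotE; have [-> -> ->] := vec3E (0 : K) 0 1; rewrite Hc; ring.
Qed.

Lemma not_indep3_dual x y z : ~ indep3 x y z ->
  exists2 v, v != 0 & [/\ dot v x = 0, dot v y = 0 & dot v z = 0].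
Proof.
move=> N; pose A := (rows3 x y z)^T.
have : ~~ row_free A by apply/negP; rewrite row_free_unit unitmx_tr => /indep3_unitmx.
rewrite -kermx_eq0 => /rowV0Pn[v /sub_kermxP vA v0]; exists v => //.
have D p q : dot p q = (q *m p^T) 0 0.
  by rewrite !mxE; apply: eq_bigr => i _; rewrite !mxE mulrC.
have H (u : 'rV[K]_3) : dot v (u *m rows3 x y z) = 0.
  rewrite dotC D -[rows3 x y z]trmxK -/A trmx_mul trmxK mulmxA vA mul0mx; exact: mxE.
split.
- by have := H (vec3 1 0 0); rewrite mul_vec3_rows3 scale1r !scale0r !addr0.
- by have := H (vec3 0 1 0); rewrite mul_vec3_rows3 scale1r !scale0r add0r addr0.
- by have := H (vec3 0 0 1); rewrite mul_vec3_rows3 scale1r !scale0r !add0r.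
Qed.

End Independence.

(** * Orthonormal frames *)

Section Frames.
Variable K : fieldType.
Implicit Types (u v w e f n : 'rV[K]_3) (B : 'I_3 -> 'M[K]_3).

Definition orthonormal e f n : Prop :=
  [/\ dot e e = 1, dot f f = 1, dot n n = 1 &
      [/\ dot e f = 0, dot e n = 0 & dot f n = 0]].

Lemma orthonormal_swap e f n : orthonormal e f n -> orthonormal f e n.
Proof. by move=> [? ? ? [? ? ?]]; split=> //; split=> //; rewrite dotC. Qed.

Lemma orthonormal_indep e f n : orthonormal e f n -> indep3 e f n.
Proof.
move=> [ee ff nn [ef en fn]] a b c E.
have H v : a * dot e v + b * dot f v + c * dot n v = 0.
  by rewrite -!dotZl -!dotDl E dot0l.
split.
- by have := H e; rewrite ee dotC ef (dotC n) en !mulr0 !addr0 mulr1.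
- by have := H f; rewrite ef ff (dotC n) fn !mulr0 add0r addr0 mulr1.
- by have := H n; rewrite en fn nn !mulr0 !add0r mulr1.
Qed.

Lemma orthonormal_expand e f n : orthonormal e f n ->
  forall u, u = dot u e *: e + dot u f *: f + dot u n *: n.
Proof.
move=> on u; have [ee ff nn [ef en fn]] := on.
have [a [b [c ->]]] := indep3_span (orthonormal_indep on) u.
rewrite !dotDl !dotZl ee ff nn ef (dotC f e) ef en (dotC n e) en fn (dotC n f) fn.
by rewrite !mulr0 !mulr1 !addr0 !add0r.
Qed.

Lemma dot_comb e f n a b c a' b' c' : orthonormal e f n ->
  dot (a *: e + b *: f + c *: n) (a' *: e + b' *: f + c' *: n) =
  a * a' + b * b' + c * c'.
Proof.
move=> [ee ff nn [ef en fn]].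
rewrite !dotDl !dotDr !dotZl !dotZr.
by rewrite ee ff nn ef (dotC f e) ef en (dotC n e) en fn (dotC n f) fn; ring.
Qed.

Lemma bil_comb B e f n a b c a' b' c' : (forall i, (B i)^T = B i) ->
  bil B (a *: e + b *: f + c *: n) (a' *: e + b' *: f + c' *: n) =
  (a * a') *: bil B e e + (b * b') *: bil B f f + (c * c') *: bil B n n +
  (a * b' + b * a') *: bil B e f + (a * c' + c * a') *: bil B e n +
  (b * c' + c * b') *: bil B f n.
Proof.
move=> sB; rewrite !(bilDl, bilDr, bilZl, bilZr).
rewrite (bilC f e sB) (bilC n e sB) (bilC n f sB).
move: (bil B e e) (bil B f f) (bil B n n) (bil B e f) (bil B e n) (bil B f n).
by move=> *; apply/rowP => i; rewrite !mxE; ring.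
Qed.

Lemma indep3_neq0 (x y z : 'rV[K]_3) : indep3 x y z -> [/\ x != 0, y != 0 & z != 0].
Proof.
move=> I; split; apply/eqP => E.
- by have [/eqP] := I 1 0 0 ltac:(by rewrite E scaler0 !scale0r !addr0); rewrite oner_eq0.
- by have [_ /eqP] := I 0 1 0 ltac:(by rewrite E scaler0 !scale0r !addr0); rewrite oner_eq0.
- by have [_ _ /eqP] := I 0 0 1 ltac:(by rewrite E scaler0 !scale0r !addr0); rewrite oner_eq0.
Qed.

End Frames.

(** * Singular points, double points and their arcs on the sphere *)

Section SphereGeometry.
Variables (R : realType) (B : 'I_3 -> 'M[R]_3).
Hypothesis sB : forall i, (B i)^T = B i.
Implicit Types (a b u v w e f n : 'rV[R]_3).
Notation g := (fun u => bil B u u).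

Lemma derive_g a w : 'D_w g a = 2 *: bil B a w.
Proof. exact: derive_bil. Qed.

Lemma dot_eq0 u : (dot u u == 0) = (u == 0).
Proof.
apply/eqP/eqP => [|->]; last by rewrite dot0l.
rewrite dotE => E.
have E0 : u 0 0 = 0 by nra.
have E1 : u 0 1 = 0 by nra.
have E2 : u 0 2%:R = 0 by nra.
rewrite [u]vec3_eta E0 E1 E2.
by apply/rowP => j; rewrite !mxE; case: j => [[|[|[|//]]] H].
Qed.

Lemma singular_ptE a : singular_pt g a <->
  S2 R a /\ exists w, [/\ w != 0, dot a w = 0 & bil B a w = 0].
Proof.
split=> [[Sa [w [w0 aw]]]|[Sa [w [w0 aw bw]]]].
  rewrite derive_g => /eqP; rewrite scaler_eq0 pnatr_eq0 /= => /eqP.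
  by split=> //; exists w.
by split=> //; exists w => //; rewrite derive_g bw scaler0.
Qed.

Lemma tangent_imageE a y : tangent_image g a y <->
  exists2 w, dot a w = 0 & y = bil B a w.
Proof.
split=> [[w /= aw <-]|[w aw ->]].
  by exists (2 *: w); rewrite ?dotZr ?aw ?mulr0// derive_g bilZr.
exists (2^-1 *: w); first by rewrite /= dotZr aw mulr0.
by rewrite derive_g bilZr scalerA divff ?scale1r// pnatr_eq0.
Qed.

Lemma double_pair a b : g a = g b -> dot a a = 1 -> dot b b = 1 ->
  bil B (a + b) (a - b) = 0 /\ dot (a + b) (a - b) = 0.
Proof.
move=> gab aa bb; split.
  rewrite bilDl -scaleN1r !bilDr !bilZr (bilC b a sB) gab.
  move: (bil B b b) (bil B a b) => *.
  by apply/rowP => i; rewrite !mxE; ring.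
rewrite dotDl -scaleN1r !dotDr !dotZr aa bb (dotC b a); ring.
Qed.

(** Cosine and sine are written as square roots of [1 - t] and [t] so that the common image moves
    affinely from [g e] to [g f]; injectivity on the arc is then immediate. *)
Definition arc_lift e f : (R -> 'rV[R]_3) * (R -> 'rV[R]_3) :=
  (fun t => Num.sqrt (1 - t) *: e + Num.sqrt t *: f,
   fun t => Num.sqrt (1 - t) *: e - Num.sqrt t *: f).

Lemma sqr_arc (t : R) : 0 <= t <= 1 ->
  Num.sqrt (1 - t) ^+ 2 = 1 - t /\ Num.sqrt t ^+ 2 = t.
Proof. by move=> /andP[t0 t1]; rewrite !sqr_sqrtr ?subr_ge0. Qed.

Lemma arc_lift_image e f t : bil B e f = 0 -> 0 <= t <= 1 ->
  g ((arc_lift e f).1 t) = (1 - t) *: g e + t *: g f /\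
  g ((arc_lift e f).2 t) = (1 - t) *: g e + t *: g f.
Proof.
move=> ef tI; have [H1 H2] := sqr_arc tI; rewrite /=.
move: (Num.sqrt (1 - t)) (Num.sqrt t) H1 H2 => c s <- H; rewrite -H.
split; rewrite ?scalerN -?scaleNr !(bilDl, bilDr, bilZl, bilZr) (bilC f e sB) ef.
  move: (bil B e e) (bil B f f) => *.
  by apply/rowP => i; rewrite !mxE; ring.
move: (bil B e e) (bil B f f) => *.
by apply/rowP => i; rewrite !mxE; ring.
Qed.

Section Arc.
Variables e f : 'rV[R]_3.
Hypotheses (ee : dot e e = 1) (ff : dot f f = 1) (ef : dot e f = 0).
Hypothesis bef : bil B e f = 0.

Lemma orthonormal_uniq2 c s c' s' :
  c *: e + s *: f = c' *: e + s' *: f -> c = c' /\ s = s'.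
Proof.
move=> E; have H v : c * dot e v + s * dot f v = c' * dot e v + s' * dot f v.
  by rewrite -!dotZl -!dotDl E.
have := H e; have := H f; rewrite ee ff ef (dotC f e) ef !mulr0 !mulr1 !add0r.
by rewrite !addr0.
Qed.

Lemma arc_lift_neq t : 0 < t < 1 -> ~ eqpm ((arc_lift e f).1 t) ((arc_lift e f).2 t).
Proof.
move=> /andP[t0 t1]; have s0 : 0 < Num.sqrt t by rewrite sqrtr_gt0.
have c0 : 0 < Num.sqrt (1 - t) by rewrite sqrtr_gt0 subr_gt0.
rewrite /eqpm /= opprB; move: (Num.sqrt t) (Num.sqrt (1 - t)) s0 c0 => s c s0 c0.
case=> E.
  have [_ /eqP] : c = c /\ s = - s by apply: orthonormal_uniq2; rewrite scaleNr.
  by rewrite -addr_eq0 => /eqP; lra.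
have [/eqP + _] : c = - c /\ s = s.
  by apply: orthonormal_uniq2; rewrite scaleNr [RHS]addrC.
by rewrite -addr_eq0 => /eqP; lra.
Qed.

Lemma double_curve_arc : g e != g f -> double_curve g e f (arc_lift e f).
Proof.
move=> gef.
have cs (c : R -> R) (w : 'rV[R]_3) : continuous c ->
    continuous (fun t => Num.sqrt (c t) *: w).
  move=> cc t; apply: cvgZr_tmp; apply: continuous_comp; first exact: cc.
  exact: sqrt_continuous.
have c1 : continuous (fun t : R => 1 - t).
  by move=> t; apply: cvgB; [exact: cvg_cst|exact: cvg_id].
have ci : continuous (fun t : R => t) by move=> t; exact: cvg_id.
split.
- split; apply: continuous_subspaceT => t.
    by apply: cvgD; [exact: (cs _ e c1 t)|exact: (cs _ f ci t)].
  by apply: cvgB; [exact: (cs _ e c1 t)|exact: (cs _ f ci t)].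
- move=> t tI; have [-> ->] := arc_lift_image bef tI.
  have [H1 H2] := sqr_arc tI.
  split=> //; rewrite /S2 /=.
    rewrite !(dotDl, dotDr, dotZl, dotZr) ee ff (dotC f e) ef.
    by rewrite !mulr0 addr0 add0r !mulr1 -!expr2 H1 H2 subrK.
  rewrite -scaleNr !(dotDl, dotDr, dotZl, dotZr) ee ff (dotC f e) ef.
  by rewrite !mulr0 addr0 add0r !mulr1 mulrNN -!expr2 H1 H2 subrK.
- exact: arc_lift_neq.
- move=> s t; rewrite !in_itv /= => sI tI E.
  have [E1 _] := arc_lift_image bef sI.
  have [E2 _] := arc_lift_image bef tI.
  have : (t - s) *: (g e - g f) = 0.
    move: E; rewrite E1 E2; move: (g e) (g f) => x y E.
    apply/rowP => i; move/rowP/(_ i): E; rewrite !mxE => E; lra.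
  by move=> /eqP; rewrite scaler_eq0 !subr_eq0 (negPf gef) orbF => /eqP.
- rewrite /arc_lift /= subr0 subrr sqrtr0 sqrtr1 !scale1r !scale0r subr0 addr0 sub0r add0r.
  by split; [left|left|left|right].
Qed.

Lemma eqpmN a b : eqpm a b -> eqpm (- a) b.
Proof. by case=> ->; [right|left; rewrite opprK]. Qed.

(** The parameter is the square of the f-coordinate. Up to antipodes, equal signs of [c] and [s]
    keep the two lifts in order and opposite signs exchange them. *)
Lemma arc_lift_pair c s : c ^+ 2 + s ^+ 2 = 1 -> c != 0 -> s != 0 ->
  let a := c *: e + s *: f in let b := c *: e - s *: f in
  exists2 t, 0 < t < 1 &
    (eqpm a ((arc_lift e f).1 t) /\ eqpm b ((arc_lift e f).2 t)) \/
    (eqpm a ((arc_lift e f).2 t) /\ eqpm b ((arc_lift e f).1 t)).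
Proof.
move=> cs c0 s0 /=; exists (s ^+ 2).
  have c2 : 0 < c ^+ 2 by rewrite exprn_even_gt0.
  have s2 : 0 < s ^+ 2 by rewrite exprn_even_gt0.
  by rewrite s2 /=; lra.
have -> : 1 - s ^+ 2 = c ^+ 2 by rewrite -cs addrK.
rewrite !sqrtr_sqr.
have [cp|cn] := ltP 0 c; have [sp|sn] := ltP 0 s;
  rewrite ?(gtr0_norm cp) ?(gtr0_norm sp) ?(ler0_norm cn) ?(ler0_norm sn).
- by left; split; left.
- by right; rewrite !scaleNr !opprK; split; left.
- by right; rewrite !scaleNr; split; right; rewrite ?opprB ?opprD ?opprK // addrC.
- by left; rewrite !scaleNr !opprK; split; right; rewrite ?opprD ?opprK// addrC.
Qed.

(** Half the sum and half the difference recover [a] and [b], up to sign, as c e + s f and c e - s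
    f; the unit length of [a] gives c^2 + s^2 = 1. *)
Lemma double_pair_on_arc a b mu ka : dot a a = 1 -> dot b b = 1 -> ~ eqpm a b ->
  (a + b = mu *: e /\ a - b = ka *: f) \/ (a + b = mu *: f /\ a - b = ka *: e) ->
  exists2 t, 0 < t < 1 &
    (eqpm a ((arc_lift e f).1 t) /\ eqpm b ((arc_lift e f).2 t)) \/
    (eqpm a ((arc_lift e f).2 t) /\ eqpm b ((arc_lift e f).1 t)).
Proof.
move=> aa bb nab H.
have aE : a = 2^-1 *: (a + b) + 2^-1 *: (a - b).
  by apply/rowP => i; rewrite !mxE; field.
have bE : b = 2^-1 *: (a + b) - 2^-1 *: (a - b).
  by apply/rowP => i; rewrite !mxE; field.
have mu0 : mu != 0.
  apply/eqP => m0; apply: nab; right; apply/eqP; rewrite -addr_eq0.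
  by case: H => [[-> _]|[-> _]]; rewrite m0 scale0r.
have ka0 : ka != 0.
  apply/eqP => m0; apply: nab; left; apply/eqP; rewrite -subr_eq0.
  by case: H => [[_ ->]|[_ ->]]; rewrite m0 scale0r.
have h0 x : x != 0 -> 2^-1 * x != 0 :> R by move=> ?; rewrite mulf_neq0// invr_eq0 pnatr_eq0.
case: H => [[E1 E2]|[E1 E2]].
  rewrite E1 E2 !scalerA in aE bE.
  have cs : (2^-1 * mu) ^+ 2 + (2^-1 * ka) ^+ 2 = 1.
    by rewrite -[RHS]aa aE !(dotDl, dotDr, dotZl, dotZr) ee ff (dotC f e) ef; ring.
  by rewrite aE bE; apply: arc_lift_pair; rewrite ?h0.
rewrite E1 E2 !scalerA in aE bE.
have cs : (2^-1 * ka) ^+ 2 + (2^-1 * mu) ^+ 2 = 1.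
  by rewrite -[RHS]aa aE !(dotDl, dotDr, dotZl, dotZr) ee ff (dotC f e) ef; ring.
have [t tI H] := arc_lift_pair cs (h0 _ ka0) (h0 _ mu0); exists t => //.
have -> : a = (2^-1 * ka) *: e + (2^-1 * mu) *: f by rewrite aE addrC.
have -> : b = - ((2^-1 * ka) *: e - (2^-1 * mu) *: f) by rewrite bE opprB.
by case: H => [[? ?]|[? ?]]; [left|right]; split=> //; exact: eqpmN.
Qed.

End Arc.
End SphereGeometry.

(** * Existence of an orthonormal frame with a vanishing mixed term *)

Section FrameExistence.
Variable R : realType.
Implicit Types (u v w e f n : 'rV[R]_3) (B : 'I_3 -> 'M[R]_3).

Definition normalize u : 'rV[R]_3 := (Num.sqrt (dot u u))^-1 *: u.

Lemma dot_gt0 u : u != 0 -> 0 < dot u u.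
Proof.
move=> u0; rewrite lt_def dot_eq0 u0 /= dotE.
by rewrite -!expr2 !addr_ge0// sqr_ge0.
Qed.

Lemma sqrt_dot_neq0 u : u != 0 -> (Num.sqrt (dot u u))^-1 != 0 :> R.
Proof. by move=> u0; rewrite invr_eq0 sqrtr_eq0 -ltNge dot_gt0. Qed.

Lemma dot_normalize u : u != 0 -> dot (normalize u) (normalize u) = 1.
Proof.
move=> u0; rewrite /normalize dotZl dotZr mulrA -invfM -expr2.
by rewrite sqr_sqrtr ?ltW ?dot_gt0// mulVf// gt_eqF// dot_gt0.
Qed.

Definition cross u w : 'rV[R]_3 :=
  vec3 (u 0 1 * w 0 2%:R - u 0 2%:R * w 0 1)
       (u 0 2%:R * w 0 0 - u 0 0 * w 0 2%:R)
       (u 0 0 * w 0 1 - u 0 1 * w 0 0).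

Lemma dot_vec3 (x y z : R) u : dot (vec3 x y z) u = x * u 0 0 + y * u 0 1 + z * u 0 2%:R.
Proof. by rewrite dotE; have [-> -> ->] := vec3E x y z. Qed.

Lemma orthonormal_cross e f : dot e e = 1 -> dot f f = 1 -> dot e f = 0 ->
  orthonormal e f (cross e f).
Proof.
move=> ee ff ef; split=> //; last first.
  by split=> //; rewrite dotC dot_vec3; ring.
move: ee ff ef; rewrite [dot (cross e f) _]dotE !dotE => ee ff ef.
rewrite /cross; have [-> -> ->] := vec3E (e 0 1 * f 0 2%:R - e 0 2%:R * f 0 1)
  (e 0 2%:R * f 0 0 - e 0 0 * f 0 2%:R) (e 0 0 * f 0 1 - e 0 1 * f 0 0).
move: (e 0 0) (e 0 1) (e 0 2%:R) (f 0 0) (f 0 1) (f 0 2%:R) ee ff ef.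
move=> a b c x y z H1 H2 H3.
(* Lagrange's identity: the squared length of a cross product is the Gram determinant. *)
have -> : (b * z - c * y) * (b * z - c * y) + (c * x - a * z) * (c * x - a * z) +
  (a * y - b * x) * (a * y - b * x) = (a * a + b * b + c * c) * (x * x + y * y + z * z)
   - (a * x + b * y + c * z) ^+ 2 by ring.
by rewrite H1 H2 H3; ring.
Qed.

Lemma exists_orthonormal n : dot n n = 1 -> exists e f, orthonormal e f n.
Proof.
move=> nn.
suff [e [ee en]] : exists e, dot e e = 1 /\ dot e n = 0.
  have [H1 H2 H3 [H4 H5 H6]] := orthonormal_cross ee nn en.
  exists e, (cross e n); split=> //; split=> //; exact: etrans (dotC _ _) H6.
suff [e [e0 en]] : exists e, e != 0 /\ dot e n = 0.
  by exists (normalize e); rewrite dot_normalize// /normalize dotZl en mulr0.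
have [n0|n0] := eqVneq (n 0 0) 0.
  exists (vec3 1 0 0); split; last by rewrite dot_vec3 n0; ring.
  by apply/eqP => /rowP/(_ 0); rewrite !mxE /= => /eqP; rewrite oner_eq0.
exists (vec3 (- n 0 1) (n 0 0) 0); split; last by rewrite dot_vec3; ring.
by apply/eqP => /rowP/(_ 1); rewrite !mxE /=; apply/eqP.
Qed.

Definition traceless (s : 'I_5 -> R) : 'M[R]_3 :=
  \matrix_(i < 3, j < 3)
   nth 0 (nth [::] [:: [:: s 0; s 2%:R; s 3%:R]; [:: s 2%:R; s 1; s 4%:R];
       [:: s 3%:R; s 4%:R; - s 0 - s 1]] i) j.

(** Written out as a polynomial in the entries so that the same expression can be formed over
    [{poly R}] along a path of matrices. *)
Definition det_traceless (s : 'I_5 -> R) : R :=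
  s 0 * (s 1 * (- s 0 - s 1) - s 4%:R ^+ 2)
  - s 2%:R * (s 2%:R * (- s 0 - s 1) - s 4%:R * s 3%:R)
  + s 3%:R * (s 2%:R * s 4%:R - s 1 * s 3%:R).

Lemma det3E (K : comNzRingType) (M : 'M[K]_3) : \det M =
  M 0 0 * (M 1 1 * M 2%:R 2%:R - M 1 2%:R * M 2%:R 1)
  - M 0 1 * (M 1 0 * M 2%:R 2%:R - M 1 2%:R * M 2%:R 0)
  + M 0 2%:R * (M 1 0 * M 2%:R 1 - M 1 1 * M 2%:R 0).
Proof.
rewrite (expand_det_row _ 0) !big_ord_recl big_ord0 addr0 /cofactor.
rewrite !(expand_det_row _ 0) !big_ord_recl !big_ord0 !addr0 /cofactor !det_mx11.
rewrite !mxE /=.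
pose F a b := M (inord a) (inord b).
have MF i j : M i j = F (val i) (val j) by rewrite /F !inord_val.
rewrite !MF /= /bump /=; move: F {MF} => F; ring.
Qed.

Lemma det_tracelessE s : \det (traceless s) = det_traceless s.
Proof. by rewrite det3E /det_traceless !mxE /=; ring. Qed.

(* Two independent members of the kernel are joined by a path from a member
   to its opposite that avoids 0; the determinant is odd, so it vanishes on
   the way. *)
Lemma exists_singular_traceless (A : 'M[R]_(5, 3)) :
  exists s : 'rV[R]_5, [/\ s != 0, s *m A = 0 & det_traceless (s 0) = 0].
Proof.
have rk : (2 <= \rank (kermx A))%N.
  rewrite mxrank_ker; have := rank_leq_col A; move: (\rank A) => r.
  by case: r => [|[|[|[|]]]].
pose b := row_base (kermx A).
pose i0 : 'I_(\rank (kermx A)) := Ordinal (leq_trans (isT : (0 < 2)%N) rk).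
pose i1 : 'I_(\rank (kermx A)) := Ordinal rk.
pose k1 := row i0 b; pose k2 := row i1 b.
have kA i : row i b *m A = 0.
  by apply/sub_kermxP; rewrite (submx_trans (row_sub _ _))// eq_row_base.
have free x y : x *: k1 + y *: k2 = 0 -> x = 0 /\ y = 0.
  have Fb := row_base_free (kermx A).
  rewrite /k1 /k2 !rowE !scalemxAl -mulmxDl => /eqP.
  rewrite mulmx_free_eq0// => /eqP/rowP E.
  have := E i0; have := E i1; rewrite !mxE !eqxx /= !mulr0 !mulr1 addr0 add0r.
  by move=> -> ->.
(* The coefficients vanish at 1/2 and at 0 and 1 respectively, hence never together; the ends of the
   path are [k1] and [- k1]. *)
pose s t := (1 - 2 * t) *: k1 + (t * (1 - t)) *: k2.
have sA t : s t *m A = 0 by rewrite mulmxDl -!scalemxAl !kA !scaler0 addr0.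
have s0 t : s t != 0.
  apply/eqP => /free[E1 /eqP]; rewrite mulf_eq0 => /orP[|] /eqP; lra.
suff [t dt] : exists t, det_traceless (s t 0) = 0 by exists (s t).
have [sp spE] : exists sp : 'I_5 -> {poly R}, forall i t, (sp i).[t] = s t 0 i.
  exists (fun i => (1 - 2 * 'X) * (k1 0 i)%:P + 'X * (1 - 'X) * (k2 0 i)%:P) => i t.
  by rewrite !hornerE !mxE; ring.
pose P : {poly R} := sp 0 * (sp 1 * (- sp 0 - sp 1) - sp 4%:R ^+ 2)
  - sp 2%:R * (sp 2%:R * (- sp 0 - sp 1) - sp 4%:R * sp 3%:R)
  + sp 3%:R * (sp 2%:R * sp 4%:R - sp 1 * sp 3%:R).
have PE t : P.[t] = det_traceless (s t 0).
  by rewrite /P /det_traceless !hornerE !spE.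
have odd : P.[1] = - P.[0].
  rewrite !PE /det_traceless !mxE; ring.
have [P0|P0] := leP P.[0] 0.
  have [|x _ /rootP Hx] := @poly_ivt _ P 0 1 ler01; last by exists x; rewrite -PE.
  by rewrite P0 odd oppr_ge0.
have [|x _ /rootP Hx] := @poly_ivt _ (- P) 0 1 ler01.
  by rewrite !hornerN odd opprK oppr_le0 ltW.
by exists x; rewrite -PE; apply/eqP; rewrite -oppr_eq0 -hornerN Hx.
Qed.

(** Rotation by an angle th with cos 2 th = t / rho and sin 2 th = - r / rho moves the traceless
    form with entries r, t, - r to the anti-diagonal; [c] and [d] come from the half-angle formulas,
    with N^2 = 2 rho (rho + t). *)
Lemma rotate_frame (b11 b22 b12 : 'rV[R]_3) r t : (r != 0) || (t != 0) ->
  r *: (b11 - b22) + (2 * t) *: b12 = 0 ->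
  exists c d : R, c ^+ 2 + d ^+ 2 = 1 /\
    (c * d) *: (b22 - b11) + (c ^+ 2 - d ^+ 2) *: b12 = 0.
Proof.
(* For r = 0 the form is already anti-diagonal, while [rho + t] could vanish. *)
have [->|r0 _] := eqVneq r 0.
  rewrite /= scale0r add0r => t0 /eqP; rewrite scaler_eq0 mulf_eq0 pnatr_eq0.
  rewrite (negPf t0) /= => /eqP ->; exists 1, 0; split; first by ring.
  by rewrite mulr0 scale0r scaler0 addr0.
move=> E; pose rho := Num.sqrt (r ^+ 2 + t ^+ 2).
have r2 : 0 < r ^+ 2 by rewrite exprn_even_gt0.
have t2 : 0 <= t ^+ 2 by exact: sqr_ge0.
have rhoE : rho ^+ 2 = r ^+ 2 + t ^+ 2 by rewrite sqr_sqrtr// addr_ge0// ltW.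
have rho0 : 0 < rho by rewrite sqrtr_gt0; lra.
have rt : 0 < rho + t by nra.
pose N := Num.sqrt (2 * rho * (rho + t)).
have N2 : N ^+ 2 = 2 * rho * (rho + t) by rewrite sqr_sqrtr// !mulr_ge0// ltW.
have N0 : N != 0 by rewrite gt_eqF// sqrtr_gt0 !mulr_gt0.
exists ((rho + t) / N), (- r / N); split.
  rewrite !expr_div_n N2 sqrrN.
  have -> : r ^+ 2 = rho ^+ 2 - t ^+ 2 by rewrite rhoE addrK.
  field; apply/andP; split; exact: lt0r_neq0.
have -> : (rho + t) / N * (- r / N) = - (r / (2 * rho)).
  transitivity (- ((rho + t) * r / N ^+ 2)); first by field.
  by rewrite N2; field; apply/andP; split; exact: lt0r_neq0.
have -> : ((rho + t) / N) ^+ 2 - (- r / N) ^+ 2 = t / rho.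
  rewrite !expr_div_n N2 sqrrN.
  have -> : r ^+ 2 = rho ^+ 2 - t ^+ 2 by rewrite rhoE addrK.
  field; apply/andP; split; exact: lt0r_neq0.
apply/rowP => i; move/rowP/(_ i): E; rewrite !mxE => E.
transitivity ((2 * rho)^-1 * (r * (b11 0 i - b22 0 i) + 2 * t * b12 0 i)).
  by field; exact: lt0r_neq0.
by rewrite E mulr0.
Qed.

Lemma exists_frame B : (forall i, (B i)^T = B i) ->
  exists e f n, orthonormal e f n /\ bil B e f = 0.
Proof.
move=> sB.
(* Column [i] lists the coefficients of the five coordinates of [s] in the trace of [B i] against
   [traceless s]. *)
pose A : 'M[R]_(5, 3) := \matrix_(k < 5, i < 3) nth 0
  [:: B i 0 0 - B i 2%:R 2%:R; B i 1 1 - B i 2%:R 2%:R; 2 * B i 0 1;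
      2 * B i 0 2%:R; 2 * B i 1 2%:R] k.
have [s [s0 sA ds]] := exists_singular_traceless A.
pose M := traceless (s 0).
have sM : M^T = M.
  by apply/matrixP => i j; rewrite !mxE;
    case: i => [[|[|[|//]]] Hi]; case: j => [[|[|[|//]]] Hj].
have M0 : M != 0.
  apply/eqP => E; move/eqP: s0; apply; apply/rowP => j; rewrite [RHS]mxE.
  have H i k : M i k = 0 by rewrite E mxE.
  have := H 0 0; have := H 0 1; have := H 0 2%:R; have := H 1 1; have := H 1 2%:R.
  rewrite !mxE /= => H1 H2 H3 H4 H5.
  case: j => [[|[|[|[|[|//]]]]] Hj].
  - by rewrite -[RHS]H5; congr (s 0 _); apply: val_inj.
  - by rewrite -[RHS]H2; congr (s 0 _); apply: val_inj.
  - by rewrite -[RHS]H4; congr (s 0 _); apply: val_inj.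
  - by rewrite -[RHS]H3; congr (s 0 _); apply: val_inj.
  - by rewrite -[RHS]H1; congr (s 0 _); apply: val_inj.
have trB i : \tr (B i *m M) = 0.
  have sBe a b : B i a b = B i b a by rewrite -[in LHS](sB i) mxE.
  have : (s *m A) 0 i = 0 by rewrite sA mxE.
  rewrite mxE sum5 !mxE /= /mxtrace sum3 !mxE !sum3 !mxE /=.
  rewrite (sBe 1 0) (sBe 2%:R 0) (sBe 2%:R 1) => E.
  rewrite -[RHS]E; ring.
have trM : \tr M = 0.
  by rewrite /mxtrace sum3 !mxE /=; ring.
(* The kernel vector becomes the normal [n]; on the orthogonal plane the form is a nonzero traceless
   2 by 2 block. *)
have /det0P[v v0 vM] : \det M == 0 by rewrite det_tracelessE ds.
have [x1 [x2 on]] := exists_orthonormal (dot_normalize v0).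
set n := normalize v in on.
have nM : n *m M = 0 by rewrite /n /normalize -scalemxAl vM scaler0.
pose E := rows3 x1 x2 n.
have rE i : row i E = tnth [tuple x1; x2; n] i by rewrite rowK.
have D (p q : 'rV[R]_3) : dot p q = (p *m q^T) 0 0.
  by rewrite !mxE; apply: eq_bigr => i _; rewrite !mxE.
have [h1 h2 h3 [h4 h5 h6]] := on.
have EE : E *m E^T = 1%:M.
  apply/matrixP => i j.
  have -> : (E *m E^T) i j = dot (row i E) (row j E).
    by rewrite /dot [LHS]mxE; apply: eq_bigr => k _; rewrite !mxE.
  rewrite !rE !(tnth_nth 0) mxE.
  by case: i => [[|[|[|//]]] Hi]; case: j => [[|[|[|//]]] Hj] /=; rewrite // dotC.
have EE' : E^T *m E = 1%:M by apply: mulmx1C.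
pose M' := E *m M *m E^T.
have rowE (N : 'M[R]_3) i j : (E *m N *m E^T) i j = (row i E *m N *m (row j E)^T) 0 0.
  have -> : row i E *m N *m (row j E)^T = row i (E *m N) *m col j E^T.
    by rewrite row_mul tr_row.
  by rewrite !mxE; apply: eq_bigr => k _; rewrite !mxE.
have rE0 : row 0 E = x1 by rewrite rE.
have rE1 : row 1 E = x2 by rewrite rE.
have rE2 : row 2%:R E = n by rewrite rE.
have M'E i : M' 2%:R i = 0 by rewrite rowE rE2 nM mul0mx mxE.
have sM' : M'^T = M' by rewrite /M' !trmx_mul sM trmxK mulmxA.
have sM'E i j : M' i j = M' j i by rewrite -[in LHS]sM' mxE.
have tM' : M' 1 1 = - M' 0 0.
  have : \tr M' = 0 by rewrite /M' mxtrace_mulC mulmxA EE' mul1mx.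
  by rewrite /mxtrace sum3 M'E addr0 => /eqP; rewrite addrC addr_eq0 => /eqP.
have rt : (M' 0 0 != 0) || (M' 0 1 != 0).
  rewrite -negb_and; apply/negP => /andP[/eqP r0 /eqP t0]; move/eqP: M0; apply.
  have -> : M = E^T *m M' *m E.
    by rewrite /M' !mulmxA EE' mul1mx -mulmxA EE' mulmx1.
  suff -> : M' = 0 by rewrite mulmx0 mul0mx.
  apply/matrixP => i j; rewrite [RHS]mxE.
  have c0 : forall i, M' i 2%:R = 0 by move=> k; rewrite sM'E.
  case: i => [[|[|[|//]]] Hi]; case: j => [[|[|[|//]]] Hj].
  - by rewrite -[RHS]r0; congr (M' _ _); apply: val_inj.
  - by rewrite -[RHS]t0; congr (M' _ _); apply: val_inj.
  - by rewrite -[RHS](c0 0); congr (M' _ _); apply: val_inj.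
  - by rewrite -[RHS]t0 sM'E; congr (M' _ _); apply: val_inj.
  - by rewrite -oppr0 -[in RHS]r0 -tM'; congr (M' _ _); apply: val_inj.
  - by rewrite -[RHS](c0 1); congr (M' _ _); apply: val_inj.
  - by rewrite -[RHS](M'E 0); congr (M' _ _); apply: val_inj.
  - by rewrite -[RHS](M'E 1); congr (M' _ _); apply: val_inj.
  - by rewrite -[RHS](M'E 2%:R); congr (M' _ _); apply: val_inj.
(* The orthogonality of [B k] to the form, read in the frame, involves that 2 by 2 block only. *)
have rel : M' 0 0 *: (bil B x1 x1 - bil B x2 x2) + (2 * M' 0 1) *: bil B x1 x2 = 0.
  apply/rowP => k; have := trB k.
  have -> : \tr (B k *m M) = \tr (E *m B k *m E^T *m M').
    rewrite /M' !mulmxA [RHS]mxtrace_mulC !mulmxA EE' mul1mx.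
    by rewrite -[in RHS](mulmxA (B k)) EE' mulmx1.
  have BE i j : bil B (row i E) (row j E) 0 k = (E *m B k *m E^T) i j.
    by rewrite rowE /bil -lock mxE.
  have ent (a b : R) (x y z : 'rV[R]_3) :
      (a *: (x - y) + b *: z) 0 k = a * (x 0 k - y 0 k) + b * z 0 k.
    by rewrite !mxE.
  move=> Ht; rewrite ent [RHS]mxE -rE0 -rE1 !BE; move: Ht.
  have sB' : (E *m B k *m E^T) 1 0 = (E *m B k *m E^T) 0 1.
    by rewrite -!BE bilC.
  move: (E *m B k *m E^T) sB' {BE} => B' sB'.
  move: (M') M'E sM'E tM' => N M'E sM'E tM'.
  rewrite /mxtrace sum3 !mxE !sum3 !M'E (sM'E 1 0) (sM'E 0 2%:R) (sM'E 1 2%:R) !M'E tM' sB'.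
  by move=> <-; ring.
have [c [d [cd E0]]] := rotate_frame rt rel.
exists (c *: x1 + d *: x2), (- d *: x1 + c *: x2), n; split.
  have Hc := fun a b a' b' => dot_comb a b 0 a' b' 0 on.
  split=> //; last split.
  - by have := Hc c d c d; rewrite !scale0r !addr0 => ->; rewrite -[RHS]cd; ring.
  - by have := Hc (- d) c (- d) c; rewrite !scale0r !addr0 => ->; rewrite -[RHS]cd; ring.
  - by have := Hc c d (- d) c; rewrite !scale0r !addr0 => ->; ring.
  - by rewrite dotDl !dotZl h5 h6; ring.
  - by rewrite dotDl !dotZl h5 h6; ring.
rewrite -[RHS]E0 !(bilDl, bilDr, bilZl, bilZr) (bilC x2 x1 sB).
move: (bil B x1 x1) (bil B x1 x2) (bil B x2 x2) => *.
by apply/rowP => i; rewrite !mxE; ring.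
Qed.

End FrameExistence.

(** * Normal forms of the bilinear map *)

Section Classification.
Variables (R : realType) (B : 'I_3 -> 'M[R]_3).
Hypothesis sB : forall i, (B i)^T = B i.
Implicit Types (u v w e f n : 'rV[R]_3).

Definition frame e f n : Prop := orthonormal e f n /\ bil B e f = 0.

(** The generic form. The scalars [dl], 2 p, 2 q are the coordinates of B(n, n) - B(e, e) in the
    basis of the second clause; the factor 2 lets the remaining decomposable members be found by
    completing squares. *)
Definition simple_frame e f n (dl p q : R) : Prop :=
  [/\ frame e f n,
      indep3 (bil B f f - bil B e e) (bil B e n) (bil B f n)
    & bil B n n = bil B e e + dl *: (bil B f f - bil B e e)
                  + (2 * p) *: bil B e n + (2 * q) *: bil B f n].

(** B(f, n) lies in the plane of the first two basis vectors, so all tangent images along the circle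
    through [e] and [f] lie in that plane. The scalar [b] controls the difference in curvature of
    the two sheets along the arc. *)
Definition tangent_frame e f n (a b : R) : Prop :=
  [/\ frame e f n,
      indep3 (bil B f f - bil B e e) (bil B e n) (bil B n n - bil B e e)
    & bil B f n = (a / 2) *: (bil B f f - bil B e e) - b *: bil B e n].

(** The circle through [e] and [f] is mapped to a single point. *)
Definition ellipsoid_frame e f n : Prop :=
  [/\ frame e f n, bil B f f = bil B e e
    & indep3 (bil B e n) (bil B f n) (bil B n n - bil B e e)].

Lemma frame_swap e f n : frame e f n -> frame f e n.
Proof. by move=> [on ef]; split; [exact: orthonormal_swap|rewrite bilC]. Qed.

Lemma frame_span e f n u : frame e f n -> exists a b c : R, u = a *: e + b *: f + c *: n.
Proof. by move=> [on _]; exact: indep3_span (orthonormal_indep on) u. Qed.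

Lemma simple_bil e f n dl p q a b c a' b' c' : simple_frame e f n dl p q ->
  bil B (a *: e + b *: f + c *: n) (a' *: e + b' *: f + c' *: n) =
  (a * a' + b * b' + c * c') *: bil B e e
  + (b * b' + dl * c * c') *: (bil B f f - bil B e e)
  + (a * c' + c * a' + 2 * p * c * c') *: bil B e n
  + (b * c' + c * b' + 2 * q * c * c') *: bil B f n.
Proof.
move=> [[on ef] _ nn]; rewrite bil_comb// ef nn.
move: (bil B e e) (bil B f f) (bil B e n) (bil B f n) => *.
by apply/rowP => i; rewrite !mxE; ring.
Qed.

Lemma tangent_bil e f n (al be : R) a b c a' b' c' : tangent_frame e f n al be ->
  bil B (a *: e + b *: f + c *: n) (a' *: e + b' *: f + c' *: n) =
  (a * a' + b * b' + c * c') *: bil B e e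
  + (b * b' + al / 2 * (b * c' + c * b')) *: (bil B f f - bil B e e)
  + (a * c' + c * a' - be * (b * c' + c * b')) *: bil B e n
  + (c * c') *: (bil B n n - bil B e e).
Proof.
move=> [[on ef] _ fn]; rewrite bil_comb// ef fn.
move: (bil B e e) (bil B f f) (bil B e n) (bil B n n) => *.
by apply/rowP => i; rewrite !mxE; ring.
Qed.

Lemma ellipsoid_bil e f n a b c a' b' c' : ellipsoid_frame e f n ->
  bil B (a *: e + b *: f + c *: n) (a' *: e + b' *: f + c' *: n) =
  (a * a' + b * b' + c * c') *: bil B e e
  + (a * c' + c * a') *: bil B e n + (b * c' + c * b') *: bil B f n
  + (c * c') *: (bil B n n - bil B e e).
Proof.
move=> [[on ef] ff _]; rewrite bil_comb// ef ff.
move: (bil B e e) (bil B f n) (bil B e n) (bil B n n) => *.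
by apply/rowP => i; rewrite !mxE; ring.
Qed.

Lemma simple_frame_swap e f n dl p q :
  simple_frame e f n dl p q -> simple_frame f e n (1 - dl) q p.
Proof.
move=> [fr I nn]; split; first exact: frame_swap.
  move=> x y z; move: I; rewrite /indep3.
  move: (bil B e e) (bil B f f) (bil B e n) (bil B f n) => E F X Y I E0.
  have [|/eqP H1 H2 H3] := I (- x) z y.
    by rewrite -[RHS]E0; apply/rowP => i; rewrite !mxE; ring.
  by split=> //; apply/eqP; rewrite -oppr_eq0.
rewrite nn; move: (bil B e e) (bil B f f) (bil B e n) (bil B f n) => *.
by apply/rowP => i; rewrite !mxE; ring.
Qed.

(* When [dl + q ^+ 2] or [1 - dl + p ^+ 2] vanishes, the determinant has a
   double root elsewhere in the pencil, and the two factors of that member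
   span the plane of a frame that is not simple. *)
Lemma simple_frame_degenerate e f n dl p q : simple_frame e f n dl p q ->
  1 - dl + p ^+ 2 = 0 -> exists e' f' n', frame e' f' n' /\
    ~ indep3 (bil B f' f' - bil B e' e') (bil B e' n') (bil B f' n').
Proof.
move=> sf al0; have [[on ef] I nn] := sf.
(* Here [dl = 1 + p ^+ 2], so the radicand is positive. The vectors [e1] and [f1] solve m1 + p m3 =
   0 and m2 + q m3 = b, the equations of factors when the first discriminant vanishes, with m3 = -1
   and m3 = 1. *)
pose b := Num.sqrt (dl + q ^+ 2).
have p2 := sqr_ge0 p; have q2 := sqr_ge0 q.
have b2 : b ^+ 2 = dl + q ^+ 2 by rewrite sqr_sqrtr; lra.
pose e1 := p *: e + (q + b) *: f + (- 1) *: n.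
pose f1 := (- p) *: e + (b - q) *: f + 1 *: n.
have e10 : e1 != 0.
  by rewrite -dot_eq0 /e1 (dot_comb _ _ _ _ _ _ on); apply/eqP; nra.
have f10 : f1 != 0.
  by rewrite -dot_eq0 /f1 (dot_comb _ _ _ _ _ _ on); apply/eqP; nra.
pose e' := normalize e1; pose f' := normalize f1.
have ef1 : dot e1 f1 = 0.
  rewrite /e1 /f1 (dot_comb _ _ _ _ _ _ on).
  transitivity (b ^+ 2 - p ^+ 2 - q ^+ 2 - 1); first by ring.
  by rewrite b2; lra.
have ef' : dot e' f' = 0 by rewrite /e' /f' /normalize dotZl dotZr ef1 !mulr0.
have on' := orthonormal_cross (dot_normalize e10) (dot_normalize f10) ef'.
exists e', f', (cross e' f'); split.
  split=> //; rewrite /e' /f' /normalize bilZl bilZr (simple_bil _ _ _ _ _ _ sf).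
  have -> : p * - p + (q + b) * (b - q) + -1 * 1 = 0.
    have -> : p * - p + (q + b) * (b - q) + -1 * 1 = b ^+ 2 - p ^+ 2 - q ^+ 2 - 1 by ring.
    by rewrite b2; lra.
  have -> : (q + b) * (b - q) + dl * -1 * 1 = 0.
    have -> : (q + b) * (b - q) + dl * -1 * 1 = b ^+ 2 - q ^+ 2 - dl by ring.
    by rewrite b2; lra.
  have -> : p * 1 + -1 * - p + 2 * p * -1 * 1 = 0 by ring.
  have -> : (q + b) * 1 + -1 * (b - q) + 2 * q * -1 * 1 = 0 by ring.
  by rewrite !scale0r !addr0 !scaler0.
(* The component of [B] along [nu] is a multiple of the metric plus the square of the linear form a
   + p c, which vanishes on [e1] and [f1]; hence [nu] annihilates the three vectors of the new
   frame. *)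
have [nu [nD nX nY]] := indep3_dual I (-1) p 0.
pose k := dot nu (bil B e e).
have nuE a1 b1 c1 a2 b2' c2 : dot nu (bil B (a1 *: e + b1 *: f + c1 *: n) (a2 *: e + b2' *: f + c2 *: n)) =
   (a1 + p * c1) * (a2 + p * c2) + (k - 1) * (a1 * a2 + b1 * b2' + c1 * c2).
  rewrite (simple_bil _ _ _ _ _ _ sf) !dotDr !dotZr nD nX nY -/k.
  have -> : dl = 1 + p ^+ 2 by lra.
  ring.
have fr' : frame e f n by [].
have lin u w : (exists a b0, u = a *: e1 + b0 *: f1) ->
    dot nu (bil B u w) = (k - 1) * dot u w.
  move=> [x [y ->]]; have [a2 [b2' [c2 ->]]] := frame_span w fr'.
  have -> : x *: e1 + y *: f1 = (x * p - y * p) *: e + (x * (q + b) + y * (b - q)) *: f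
      + (y - x) *: n.
    by apply/rowP => i; rewrite !mxE; ring.
  by rewrite nuE (dot_comb _ _ _ _ _ _ on); ring.
have le w : dot nu (bil B e' w) = (k - 1) * dot e' w.
  by apply: lin; exists (Num.sqrt (dot e1 e1))^-1, 0; rewrite scale0r addr0.
have lf w : dot nu (bil B f' w) = (k - 1) * dot f' w.
  by apply: lin; exists 0, (Num.sqrt (dot f1 f1))^-1; rewrite scale0r add0r.
move=> I'; have [h1 h2 _ [_ h5 h6]] := on'.
have vanish (u v w : 'rV[R]_3) : dot nu u = 0 -> dot nu v = 0 -> dot nu w = 0 ->
    (exists x y z, nu = x *: u + y *: v + z *: w) -> nu = 0.
  move=> u0 v0 w0 [x [y [z E]]]; apply/eqP.
  by rewrite -dot_eq0 {2}E !dotDr !dotZr u0 v0 w0 !mulr0 !addr0.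
have nu0 : nu = 0.
  apply: vanish (indep3_span I' nu).
  - by rewrite -scaleN1r dotDr dotZr le lf h1 h2 mulN1r subrr.
  - by rewrite le h5 mulr0.
  - by rewrite lf h6 mulr0.
by move: nD; rewrite nu0 dot0l => /eqP; rewrite eq_sym oppr_eq0 oner_eq0.
Qed.

(** By hypothesis the four vectors span. If the first three are dependent, a nonzero coefficient of
    [Y], of [X] or of [D] in a relation, tried in this order, gives the tangent form, the tangent
    form with [e] and [f] exchanged, or the ellipsoid form; [N] completes the basis each time. *)
Lemma frame_trichotomy e f n : frame e f n ->
  (forall v, dot v (bil B f f - bil B e e) = 0 -> dot v (bil B e n) = 0 ->
     dot v (bil B f n) = 0 -> dot v (bil B n n - bil B e e) = 0 -> v = 0) ->
  [\/ exists dl p q, simple_frame e f n dl p q,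
      exists a b, tangent_frame e f n a b \/ tangent_frame f e n a b
    | ellipsoid_frame e f n].
Proof.
move=> fr full; set D := bil B f f - bil B e e in full *.
set X := bil B e n in full *; set Y := bil B f n in full *.
set N := bil B n n - bil B e e in full *.
have [I|nI] := pselect (indep3 D X Y).
  constructor 1; have [dl [p [q E]]] := indep3_span I N.
  exists dl, (p / 2), (q / 2); split=> //.
  rewrite -/D -/X -/Y !(mulrC 2) !divfK ?pnatr_eq0//.
  transitivity (bil B e e + N); first by rewrite /N addrC subrK.
  by rewrite E !addrA.
have key x y : (forall v, dot v x = 0 -> dot v y = 0 ->
    [/\ dot v D = 0, dot v X = 0 & dot v Y = 0]) -> indep3 x y N.
  move=> H; apply: contrapT => /not_indep3_dual[v v0 [vx vy vN]].
  have [vD vX vY] := H v vx vy.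
  by move/eqP: v0; apply; exact: full.
have : exists x y z, [/\ x *: D + y *: X + z *: Y = 0 & [|| x != 0, y != 0 | z != 0]].
  apply: contrapT => H; apply: nI => x y z E.
  apply: contrapT => K; apply: H; exists x, y, z; split=> //.
  by apply/negPn; rewrite !negb_or !negbK; apply/negP => /and3P[/eqP ? /eqP ? /eqP ?]; apply: K.
move=> [x [y [z [E nz]]]].
have [z0|z0] := eqVneq z 0; last first.
  constructor 2; exists (- 2 * x / z), (y / z); left.
  have YE : Y = (- 2 * x / z / 2) *: D - (y / z) *: X.
    have : z *: Y = z *: ((- 2 * x / z / 2) *: D - (y / z) *: X).
      move: E; clear - z0; move: D X Y => d1 d2 d3 E.
      apply/rowP => i; move/rowP/(_ i): E; rewrite !mxE => E.
      transitivity (- (x * d1 0 i + y * d2 0 i)); first lra.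
      by field.
    by move/(scalerI z0).
  split=> //; apply: key => v vD vX; split=> //.
  by rewrite YE dotDr dotZr vD -scaleNr dotZr vX !mulr0 addr0.
have [y0|y0] := eqVneq y 0; last first.
  constructor 2; exists (2 * x / y), 0; right.
  have XE : X = (2 * x / y / 2) *: (- D).
    have : y *: X = y *: ((2 * x / y / 2) *: (- D)).
      move: E; rewrite z0; clear - y0; move: D X Y => d1 d2 d3 E.
      apply/rowP => i; move/rowP/(_ i): E; rewrite !mxE => E.
      transitivity (- (x * d1 0 i)); first lra.
      by field.
    by move/(scalerI y0).
  have DE : bil B e e - bil B f f = - D by rewrite opprB.
  split; first exact: frame_swap.
    rewrite DE -/Y.
    have I0 : indep3 D Y N.
      apply: key => v vD vY; split=> //.
      by rewrite XE scalerN -scaleNr dotZr vD mulr0.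
    rewrite (_ : bil B n n - bil B f f = N - D); last first.
      rewrite /N /D; move: (bil B n n) (bil B f f) (bil B e e) => *.
      by apply/rowP => i; rewrite !mxE; ring.
    move=> a b c F; have [|/eqP H1 H2 H3] := I0 (- a - c) b c.
      rewrite -[RHS]F; clear; move: D Y N => d1 d2 d3.
      by apply/rowP => i; rewrite !mxE; ring.
    by split=> //; move: H1; rewrite H3 subr0 oppr_eq0 => /eqP.
  by rewrite DE -/X scale0r subr0.
have x0 : x != 0 by move: nz; rewrite y0 z0 eqxx !orbF.
have D0 : D = 0.
  by move: E => /eqP; rewrite y0 z0 !scale0r !addr0 scaler_eq0 (negPf x0) => /eqP.
constructor 3; split=> //; first by apply/eqP; rewrite -subr_eq0 -/D D0.
by apply: key => v vX vY; split=> //; rewrite D0 dotC dot0l.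
Qed.

Definition roman_frame e f n dl p q :=
  simple_frame e f n dl p q /\ 0 < 1 - dl + p ^+ 2 /\ 0 < dl + q ^+ 2.

Definition crosscap_frame e f n dl p q :=
  simple_frame e f n dl p q /\ (1 - dl + p ^+ 2) * (dl + q ^+ 2) < 0.

(** A frame that is not simple is used as soon as one exists. Otherwise [simple_frame_degenerate],
    applied also to the exchanged frame, forbids a zero discriminant; the discriminants have
    positive sum, so the sign of their product decides. *)
Lemma frame_classification :
  (forall v (k : R), (forall u, S2 R u -> dot v (bil B u u) = k) -> v = 0) ->
  (exists e f n dl p q, roman_frame e f n dl p q) \/
  (exists e f n dl p q, crosscap_frame e f n dl p q) \/
  (exists e f n a b, tangent_frame e f n a b) \/
  (exists e f n, ellipsoid_frame e f n).
Proof.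
move=> sub.
have full e f n : frame e f n -> forall v, dot v (bil B f f - bil B e e) = 0 ->
    dot v (bil B e n) = 0 -> dot v (bil B f n) = 0 ->
    dot v (bil B n n - bil B e e) = 0 -> v = 0.
  move=> fr v vD vX vY vN; apply: (sub v (dot v (bil B e e))) => u.
  have [a [b [c ->]]] := frame_span u fr; have [on ef] := fr.
  rewrite /S2 /= (dot_comb _ _ _ _ _ _ on) bil_comb// ef => Su.
  have vff : dot v (bil B f f) = dot v (bil B e e).
    by move: vD; rewrite -scaleN1r dotDr dotZr; lra.
  have vnn : dot v (bil B n n) = dot v (bil B e e).
    by move: vN; rewrite -scaleN1r dotDr dotZr; lra.
  rewrite scaler0 addr0 !dotDr !dotZr vff vnn vX vY !mulr0 !addr0.
  by rewrite -!mulrDl Su mul1r.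
have [[e [f [n [fr nI]]]]|H] := pselect (exists e f n, frame e f n /\
    ~ indep3 (bil B f f - bil B e e) (bil B e n) (bil B f n)).
  right; right; case: (frame_trichotomy fr (full _ _ _ fr)).
  - by move=> [dl [p [q [_ I _]]]].
  - by move=> [a [b [tf|tf]]]; left; [exists e, f, n, a, b|exists f, e, n, a, b].
  - by move=> el; right; exists e, f, n.
have [e [f [n fr0]]] := exists_frame sB; have fr : frame e f n by [].
have I : indep3 (bil B f f - bil B e e) (bil B e n) (bil B f n).
  by apply: contrapT => nI; apply: H; exists e, f, n.
have [dl [p [q sf]]] : exists dl p q, simple_frame e f n dl p q.
  case: (frame_trichotomy fr (full _ _ _ fr)) => // [[a [b [tf|tf]]]|el].
  - have [_ _ E] := tf; have [] := I (- (a / 2)) b 1; last by move=> _ _ /eqP; rewrite oner_eq0.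
    rewrite E; move: (bil B f f - bil B e e) (bil B e n) => *.
    by apply/rowP => i; rewrite !mxE; ring.
  - have [_ _ E] := tf; have [] := I (a / 2) 1 b; last by move=> _ /eqP; rewrite oner_eq0.
    rewrite E; move: (bil B f f) (bil B e e) (bil B f n) => *.
    by apply/rowP => i; rewrite !mxE; ring.
  - have [_ E _] := el; have [] := indep3_neq0 I.
    by rewrite E subrr eqxx.
have al0 : 1 - dl + p ^+ 2 != 0.
  by apply/eqP => /(simple_frame_degenerate sf).
have dl0 : dl + q ^+ 2 != 0.
  apply/eqP => E; apply: H; apply: (simple_frame_degenerate (simple_frame_swap sf)).
  by rewrite -[RHS]E; ring.
have sum : 0 < (1 - dl + p ^+ 2) + (dl + q ^+ 2).
  have := sqr_ge0 p; have := sqr_ge0 q; lra.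
case: (ltrgtP ((1 - dl + p ^+ 2) * (dl + q ^+ 2)) 0) => [lt|gt|/eqP].
- by right; left; exists e, f, n, dl, p, q.
- left; exists e, f, n, dl, p, q; split=> //.
  by move: sum gt; move: (1 - dl + p ^+ 2) (dl + q ^+ 2) => x y s g; split; nra.
- by rewrite mulf_eq0 (negPf al0) (negPf dl0).
Qed.

(** A functional constant on the locus is constant on its affine hull and kills all differences
    there, that is, the whole space. Substantiality enters the classification in this form. *)
Lemma substantial_functional (h : 'rV[R]_3 -> 'rV[R]_3) :
  substantial (h @` S2 R) ->
  forall v (k : R), (forall u, S2 R u -> dot v (h u) = k) -> v = 0.
Proof.
move=> [U dU HU] v k vk.
have hull x : affine_hull (h @` S2 R) x -> dot v x = k.
  move=> [m [c [a [c1 ha ->]]]]; rewrite dotC.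
  have -> : dot (\sum_(i < m) c i *: a i) v = \sum_(i < m) c i * dot (a i) v.
    elim/big_ind2 : _ => [|x1 y1 x2 y2 <- <-|i _]; first by rewrite dot0l.
      by rewrite dotDl.
    by rewrite dotZl.
  transitivity (\sum_(i < m) c i * k); last by rewrite -mulr_suml c1 mul1r.
  apply: eq_bigr => i _; have [u Su <-] := ha i.
  by rewrite dotC vk.
have /eqP UT : U == fullv.
  by rewrite eqEdim subvf dU dimvf dim_matrix.
have : [set` U] v by rewrite UT /= memvf.
rewrite HU => -[x Hx [y Hy E]]; apply/eqP; rewrite -dot_eq0 -{2}E.
by rewrite -scaleN1r dotDr dotZr !hull// mulN1r subrr.
Qed.

End Classification.

(** * Central projection charts of the sphere *)

Section SphereChart.
Variable R : realType.
Implicit Types (u v : 'rV[R]_2) (e f n : 'rV[R]_3).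

Definition chart_scale u : R := (Num.sqrt (1 + u 0 0 ^+ 2 + u 0 1 ^+ 2))^-1.

Definition chart_dir e f n u : 'rV[R]_3 := e + u 0 1 *: f + u 0 0 *: n.

(** Central projection of the tangent plane at [e]. The coordinate [u 0 1] runs along [f], the
    kernel direction when [bil B e f = 0], to match the second variable of [crosscap_form]. *)
Definition chart e f n u : 'rV[R]_3 := chart_scale u *: chart_dir e f n u.

Lemma chart_scale_pos u : 0 < 1 + u 0 0 ^+ 2 + u 0 1 ^+ 2 :> R.
Proof. by have := sqr_ge0 (u 0 0); have := sqr_ge0 (u 0 1); lra. Qed.

Lemma sqr_chart_scale u : chart_scale u ^+ 2 = (1 + u 0 0 ^+ 2 + u 0 1 ^+ 2)^-1.
Proof. by rewrite /chart_scale exprVn sqr_sqrtr// ltW// chart_scale_pos. Qed.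

Lemma chart_scale_gt0 u : 0 < chart_scale u.
Proof. by rewrite invr_gt0 sqrtr_gt0 chart_scale_pos. Qed.

Lemma Ck_on_chart_scale k : Ck_on k setT chart_scale.
Proof.
rewrite /chart_scale; ck.
- by move=> x _; rewrite gt_eqF// sqrtr_gt0 chart_scale_pos.
- by move=> x _; exact: chart_scale_pos.
Qed.

Lemma chart_coord e f n u i :
  chart e f n u 0 i = chart_scale u * (e 0 i + u 0 1 * f 0 i + u 0 0 * n 0 i).
Proof. by rewrite !mxE. Qed.

Lemma Ck_on_chart e f n k : Ck_on k setT (chart e f n).
Proof.
apply: Ck_on_row => [|i]; first exact: openT.
under eq_fun do rewrite chart_coord.
have ? := @Ck_on_chart_scale k; ck.
Qed.

Lemma chart0 e f n : chart e f n 0 = e.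
Proof.
rewrite /chart /chart_scale /chart_dir !mxE expr0n /= !addr0 sqrtr1 invr1.
by rewrite !scale0r !addr0 scale1r.
Qed.

Lemma derive_coord m (x v : 'rV[R]_m.+1) j :
  is_derive x v (fun w : 'rV[R]_m.+1 => w 0 j) (v 0 j).
Proof.
have d := differentiable_coord x 0 j.
split; first exact: diff_derivable.
have di : differentiable (@id 'rV[R]_m.+1) x.
  exact: (Ck_on_differentiable (@Ck_on_id _ _ 1 setT) I).
by rewrite -(derive_row v j di) derive_id.
Qed.

Lemma derive_chart_scale u v :
  'D_v chart_scale u = - chart_scale u * (u 0 0 * v 0 0 + u 0 1 * v 0 1) /
     (1 + u 0 0 ^+ 2 + u 0 1 ^+ 2).
Proof.
have N0 : 1 + u 0 0 ^+ 2 + u 0 1 ^+ 2 != 0 by rewrite gt_eqF// chart_scale_pos.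
have d0 := derive_coord u v 0; have d1 := derive_coord u v 1.
have /derivableP ds : derivable chart_scale u v.
  by apply: diff_derivable; exact: Ck_on_differentiable (@Ck_on_chart_scale 1) I.
have dN := is_deriveD (is_deriveD (is_derive_cst (1 : R) u v) (is_deriveM d0 d0)) (is_deriveM d1 d1).
(* Differentiating the identity s^2 (1 + |u|^2) = 1 replaces a direct computation with the square
   root. *)
have := is_deriveM (is_deriveM ds ds) dN; set F := (X in is_derive _ _ X _) => dF.
have E : F = cst 1.
  apply: funext => w; rewrite /F !fctE -!expr2 sqr_chart_scale mulVf//.
  by rewrite gt_eqF// chart_scale_pos.
have := @derive_val _ _ _ _ _ _ _ dF.
rewrite E (derive_cst (1 : R) u v) !fctE /GRing.scale /= -!expr2.
have s0 : chart_scale u != 0 by rewrite gt_eqF// chart_scale_gt0.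
move: ('D_v _ _) (chart_scale u) s0 N0 => d s s0 N0 H.
have : s * (2 * d * (1 + u 0 0 ^+ 2 + u 0 1 ^+ 2) +
   s * (2 * (u 0 0 * v 0 0 + u 0 1 * v 0 1))) = 0 by rewrite [RHS]H; ring.
move/eqP; rewrite mulf_eq0 (negPf s0) /= => /eqP H'.
have -> : d = 2 * d * (1 + u 0 0 ^+ 2 + u 0 1 ^+ 2) / (2 * (1 + u 0 0 ^+ 2 + u 0 1 ^+ 2)).
  by field.
have -> : 2 * d * (1 + u 0 0 ^+ 2 + u 0 1 ^+ 2) =
   - (s * (2 * (u 0 0 * v 0 0 + u 0 1 * v 0 1))) by apply/eqP; rewrite -addr_eq0 H'.
by field.
Qed.

Lemma derive_chart e f n u v : 'D_v (chart e f n) u =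
  'D_v chart_scale u *: chart_dir e f n u + chart_scale u *: (v 0 1 *: f + v 0 0 *: n).
Proof.
apply/rowP => i.
rewrite derive_row; last exact: Ck_on_differentiable (@Ck_on_chart e f n 1) I.
have /derivableP ds : derivable chart_scale u v.
  by apply: diff_derivable; exact: Ck_on_differentiable (@Ck_on_chart_scale 1) I.
have dd := is_deriveD (is_deriveD (is_derive_cst (e 0 i) u v)
  (is_deriveZ (f 0 i) (derive_coord u v 1))) (is_deriveZ (n 0 i) (derive_coord u v 0)).
have := @derive_val _ _ _ _ _ _ _ (is_deriveM ds dd).
set F := (X in 'D_v X u = _ -> _); have -> : (fun w => chart e f n w 0 i) = F.
  by apply: funext => w; rewrite chart_coord /F !fctE /GRing.scale_fun /GRing.scale /=; ring.
by move=> ->; rewrite !fctE /GRing.scale_fun /GRing.scale /= !mxE; ring.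
Qed.

Lemma chart_sphere e f n u : orthonormal e f n -> S2 R (chart e f n u).
Proof.
move=> on; rewrite /S2 /= /chart dotZl dotZr mulrA -expr2 sqr_chart_scale.
have -> : chart_dir e f n u = 1 *: e + u 0 1 *: f + u 0 0 *: n by rewrite scale1r.
rewrite (dot_comb _ _ _ _ _ _ on).
have -> : 1 * 1 + u 0 1 * u 0 1 + u 0 0 * u 0 0 = 1 + u 0 0 ^+ 2 + u 0 1 ^+ 2 by ring.
by rewrite mulVf// gt_eqF// chart_scale_pos.
Qed.

Lemma sphere_param_chart e f n : orthonormal e f n -> sphere_param e (chart e f n).
Proof.
move=> on; split.
- exact: chart0.
- by exists setT; [split=> //; exact: openT|move=> k; exact: Ck_on_chart].
- by apply: (@filterE _ _ (nbhs_filter (0 : 'rV[R]_2))) => x; exact: chart_sphere.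
- move=> v; apply: contraNneq; rewrite derive_chart.
  have -> : chart_dir e f n 0 = e by rewrite /chart_dir !mxE !scale0r !addr0.
  have -> : chart_scale 0 = 1 by rewrite /chart_scale !mxE expr0n /= !addr0 sqrtr1 invr1.
  rewrite scale1r addrA => /(orthonormal_indep on)[_ v1 v0]; apply/eqP/rowP => i; rewrite [RHS]mxE.
  case: i => [[|[|//]] Hi].
  + by rewrite -[RHS]v0; congr (v 0 _); apply: val_inj.
  + by rewrite -[RHS]v1; congr (v 0 _); apply: val_inj.
Qed.

Lemma bil_chart (B : 'I_3 -> 'M[R]_3) e f n u :
  bil B (chart e f n u) (chart e f n u) =
  (1 + u 0 0 ^+ 2 + u 0 1 ^+ 2)^-1 *: bil B (chart_dir e f n u) (chart_dir e f n u).
Proof. by rewrite /chart bilZl bilZr scalerA -expr2 sqr_chart_scale. Qed.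

End SphereChart.

(** * Cross-caps at the ends of a simple double curve *)

Section CrossCap.
Variables (R : realType) (B : 'I_3 -> 'M[R]_3).
Hypothesis sB : forall i, (B i)^T = B i.
Notation g := (fun u => bil B u u).
Variables (e f n : 'rV[R]_3) (dl p q : R).
Hypothesis sf : simple_frame B e f n dl p q.

Let o := bil B e e.
Let D := bil B f f - bil B e e.
Let X := bil B e n.
Let Y := bil B f n.
Let al := 1 - dl.

Variables tD tX tY : 'rV[R]_3.
Hypothesis dual : forall b c d : R,
  [/\ dot tD (b *: D + c *: X + d *: Y) = b, dot tX (b *: D + c *: X + d *: Y) = c
    & dot tY (b *: D + c *: X + d *: Y) = d].
Hypothesis dual_span : forall w, w = dot tD w *: D + dot tX w *: X + dot tY w *: Y.

Let cb (w : 'rV[R]_3) : R := dot tD w - dot tD o.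
Let cc (w : 'rV[R]_3) : R := (dot tX w - dot tX o) / 2.
Let cd (w : 'rV[R]_3) : R := (dot tY w - dot tY o) / 2.
Let ca w := 1 - cb w.
Let qq w := ca w ^+ 2 + 4 * cc w * (p * ca w - al * cc w).
(** Root near 0 of (p a - al c) x^2 + a x - c = 0 with a = [ca w] and c = [cc w], in the form of the
    quadratic formula that stays smooth where the leading coefficient vanishes. *)
Let cx w := 2 * cc w / (ca w + Num.sqrt (qq w)).

Let kk (w : 'rV[R]_3) : 'rV[R]_3 :=
  vec3 (cx w) (cb w / ca w * (1 + al * cx w ^+ 2) - dl * cx w ^+ 2)
     (cd w / ca w * (1 + al * cx w ^+ 2) - q * cx w ^+ 2).

Let den (z : 'rV[R]_3) : R := 1 + z 0 0 ^+ 2 + z 0 1.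

(** On (x, y^2, x y) this is the image of the chart point with coordinates (x, y), because that
    image involves only x, y^2 and x y. The map [kk] is its local inverse. *)
Let hh (z : 'rV[R]_3) : 'rV[R]_3 :=
  o + ((z 0 1 + dl * z 0 0 ^+ 2) / den z) *: D
    + (2 * ((z 0 0 + p * z 0 0 ^+ 2) / den z)) *: X
    + (2 * ((z 0 2%:R + q * z 0 0 ^+ 2) / den z)) *: Y.

Let coordsE b c d : let w := o + b *: D + (2 * c) *: X + (2 * d) *: Y in
  [/\ cb w = b, cc w = c & cd w = d].
Proof.
move=> w; have [H1 H2 H3] := dual b (2 * c) (2 * d).
have E t : dot t w = dot t o + dot t (b *: D + (2 * c) *: X + (2 * d) *: Y).
  by rewrite -dotDr !addrA.
by rewrite /cb /cc /cd !E H1 H2 H3; split; field.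
Qed.

Let coords_span w : w = o + cb w *: D + (2 * cc w) *: X + (2 * cd w) *: Y.
Proof.
have E t : dot t (w - o) = dot t w - dot t o.
  by rewrite -scaleN1r dotDr dotZr mulN1r.
have E2 (t : R) : 2 * (t / 2) = t by field.
transitivity (o + (w - o)); first by rewrite addrC subrK.
by rewrite {1}(dual_span (w - o)) !E /cb /cc /cd !E2 !addrA.
Qed.

(* Since [(p - al * c) x^2 + x = c] with [c = (x + p x^2) / (1 + al x^2)], the
   discriminant [1 + 4 c (p - al * c)] is the square of [1 + 2 x (p - al * c)]. *)
Let kk_hh z : 0 < den z -> 0 < 1 + al * z 0 0 ^+ 2 ->
  0 < 1 + 2 * p * z 0 0 - al * z 0 0 ^+ 2 -> kk (hh z) = z.
Proof.
move=> dz az sz; rewrite [RHS]vec3_eta /kk.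
have [Eb Ec Ed] := coordsE ((z 0 1 + dl * z 0 0 ^+ 2) / den z)
  ((z 0 0 + p * z 0 0 ^+ 2) / den z) ((z 0 2%:R + q * z 0 0 ^+ 2) / den z).
have d0 : den z != 0 by exact: lt0r_neq0.
have Ea : ca (hh z) = (1 + al * z 0 0 ^+ 2) / den z.
  by rewrite /ca Eb /al; move: d0; rewrite /den => d0; field.
have sq : Num.sqrt (qq (hh z)) = (1 + 2 * p * z 0 0 - al * z 0 0 ^+ 2) / den z.
  have -> : qq (hh z) = ((1 + 2 * p * z 0 0 - al * z 0 0 ^+ 2) / den z) ^+ 2.
    by rewrite /qq Ea Ec; field.
  by rewrite sqrtr_sqr gtr0_norm// divr_gt0.
have a0 : 1 + al * z 0 0 ^+ 2 != 0 by exact: lt0r_neq0.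
have Ex : cx (hh z) = z 0 0.
  rewrite /cx sq Ea Ec.
  have s0 : 1 + p * z 0 0 != 0.
    by apply/eqP => H; have : (1 + al * z 0 0 ^+ 2) + (1 + 2 * p * z 0 0 - al * z 0 0 ^+ 2) = 0; lra.
  field; rewrite d0 /=.
  have -> : 1 + al * z 0 0 ^+ 2 + (1 + 2 * p * z 0 0 - al * z 0 0 ^+ 2) = 2 * (1 + p * z 0 0) by ring.
  by rewrite mulf_neq0// pnatr_eq0.
rewrite Ex Ea Eb Ed; congr vec3; field; exact/andP.
Qed.

Let hh_kk w : 0 < ca w -> 0 < qq w -> 0 < 1 + al * cx w ^+ 2 -> hh (kk w) = w.
Proof.
move=> aw qw xw.
have a0 : ca w != 0 by exact: lt0r_neq0.
have S0 : 0 < Num.sqrt (qq w) by rewrite sqrtr_gt0.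
have SE : Num.sqrt (qq w) ^+ 2 = qq w by rewrite sqr_sqrtr// ltW.
have s0 : ca w + Num.sqrt (qq w) != 0 by rewrite gt_eqF// addr_gt0.
have [E0 E1 E2] := vec3E (cx w) (cb w / ca w * (1 + al * cx w ^+ 2) - dl * cx w ^+ 2)
     (cd w / ca w * (1 + al * cx w ^+ 2) - q * cx w ^+ 2).
have EX : cx w + p * cx w ^+ 2 = cc w / ca w * (1 + al * cx w ^+ 2).
  apply/eqP; rewrite -subr_eq0; apply/eqP.
  (* Substituting the root formula leaves a multiple of [qq w] minus the square of its square
     root. *)
  transitivity (cc w / (ca w * (ca w + Num.sqrt (qq w)) ^+ 2) *
    (ca w ^+ 2 + 4 * cc w * (p * ca w - al * cc w) - Num.sqrt (qq w) ^+ 2)).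
    by rewrite /cx; field; rewrite a0 s0.
  by rewrite SE /qq subrr mulr0.
have A0 : 1 + al * cx w ^+ 2 != 0 by exact: lt0r_neq0.
have Ed : den (kk w) = (1 + al * cx w ^+ 2) / ca w.
  by rewrite /den /kk E0 E1 /al /ca; move: a0; rewrite /ca => a0; field.
rewrite [RHS]coords_span /hh Ed /kk E0 E1 E2 EX.
congr (_ + _ *: _ + _ *: _ + _ *: _).
- by rewrite -/al; field; rewrite a0 A0.
- by field; rewrite a0 A0.
- by field; rewrite a0 A0.
Qed.

Let Ck_dot t k : Ck_on k setT (fun w : 'rV[R]_3 => dot t w).
Proof.
apply: (@Ck_on_eq _ _ _ _ _ (fun w : 'rV[R]_3 => t 0 0 * w 0 0 + t 0 1 * w 0 1 + t 0 2%:R * w 0 2%:R)).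
- exact: openT.
- by move=> w _; rewrite dotE.
- ck.
Qed.

Let Ck_cb k : Ck_on k setT cb. Proof. by rewrite /cb; have ? := @Ck_dot tD k; ck. Qed.
Let Ck_cc k : Ck_on k setT cc. Proof. by rewrite /cc; have ? := @Ck_dot tX k; ck. Qed.
Let Ck_cd k : Ck_on k setT cd. Proof. by rewrite /cd; have ? := @Ck_dot tY k; ck. Qed.
Let Ck_ca k : Ck_on k setT ca. Proof. by rewrite /ca; have ? := @Ck_cb k; ck. Qed.
Let Ck_qq k : Ck_on k setT qq.
Proof. by rewrite /qq; have ? := @Ck_ca k; have ? := @Ck_cc k; ck. Qed.

Let U := [set w | 0 < ca w] `&` [set w | 0 < qq w].

Let open_U : open U.
Proof. by apply: openI; apply: Ck_on_open_pos; [exact: Ck_ca|exact: Ck_qq]. Qed.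

Let Ck_cx k : Ck_on k U cx.
Proof.
have sub (h : 'rV[R]_3 -> R) : Ck_on k setT h -> Ck_on k U h by apply: Ck_on_sub.
rewrite /cx.
have Ca := sub _ (@Ck_ca k); have Cc := sub _ (@Ck_cc k); have Cq := sub _ (@Ck_qq k).
ck => w [/= aw qw] //.
by rewrite gt_eqF// addr_gt0// sqrtr_gt0.
Qed.

Let Ck_kk k : Ck_on k U kk.
Proof.
have sub (h : 'rV[R]_3 -> R) : Ck_on k setT h -> Ck_on k U h by apply: Ck_on_sub.
rewrite /kk.
have Ca := sub _ (@Ck_ca k); have Cb := sub _ (@Ck_cb k); have Cd := sub _ (@Ck_cd k).
have Cx := @Ck_cx k.
by ck => w [/= aw qw]; rewrite gt_eqF.
Qed.

Let coords_o : [/\ ca o = 1, qq o = 1 & cx o = 0].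
Proof.
have Ea : ca o = 1 by rewrite /ca /cb subrr subr0.
have Ec : cc o = 0 by rewrite /cc subrr mul0r.
by rewrite /cx /qq Ea Ec; split=> //; ring.
Qed.

Let Uo : U o.
Proof. by have [Ea Eq _] := coords_o; split; rewrite /= ?Ea ?Eq ltr01. Qed.

Let kk_o : kk o = 0.
Proof.
have [_ _ Ex] := coords_o.
rewrite /kk Ex /cb /cd !subrr !mul0r expr0n /= !mulr0 !subr0.
by apply/rowP => i; rewrite !mxE; case: i => [[|[|[|//]]] Hi].
Qed.

Let Ck_den k : Ck_on k setT den. Proof. rewrite /den; ck. Qed.

Let Uh := [set z | 0 < den z].

Let Ck_hh k : Ck_on k Uh hh.
Proof.
have oU : open Uh by apply: Ck_on_open_pos; exact: Ck_den.
have Cd : Ck_on k Uh den by apply: Ck_on_sub (@Ck_den k).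
by rewrite /hh; ck => z /= dz; rewrite gt_eqF.
Qed.

Let den0 : den 0 = 1. Proof. by rewrite /den !mxE expr0n /= !addr0. Qed.

(** In the chart the map is literally [hh \o crosscap_form], so the source diffeomorphism is the
    identity and [kk] straightens the target. *)
Lemma crosscap_pt_dual : crosscap_pt g e.
Proof.
have [[on ef] _ _] := sf.
have [ee _ _ _] := on.
split=> //; exists (chart e f n); first exact: sphere_param_chart.
have sk : smooth_near o kk by exists U => // k; exact: Ck_kk.
have pos (h : 'rV[R]_3 -> R) (V : set 'rV[R]_3) x : open V -> V x -> Ck_on 0 V h ->
    0 < h x -> \forall y \near x, 0 < h y.
  move=> oV Vx ch hx.
  exact: (ch x Vx [set y | 0 < y] (open_nbhs_nbhs (conj (@open_gt _ 0) hx))).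
have ldk : local_diffeo o kk.
  split=> //; exists hh; rewrite kk_o; split.
  - exists Uh; last by move=> k; exact: Ck_hh.
    split; last by rewrite /Uh /= den0 ltr01.
    by apply: Ck_on_open_pos; exact: Ck_den.
  - have [Ea Eq Ex] := coords_o; near=> w; apply: hh_kk; near: w.
    + by apply: (pos ca setT o openT I (@Ck_ca 0)); rewrite Ea; exact: ltr01.
    + by apply: (pos qq setT o openT I (@Ck_qq 0)); rewrite Eq; exact: ltr01.
    + apply: (pos (fun w => 1 + al * cx w ^+ 2) U) => //.
        by have ? := @Ck_cx 0; ck.
      by rewrite Ex expr0n /= mulr0 addr0 ltr01.
  - near=> z; apply: kk_hh; near: z.
    + by apply: (pos den setT 0 openT I (@Ck_den 0)); rewrite den0; exact: ltr01.
    + apply: (pos (fun z : 'rV[R]_3 => 1 + al * z 0 0 ^+ 2) setT 0 openT I).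
        by ck.
      by rewrite mxE expr0n /= mulr0 addr0 ltr01.
    + apply: (pos (fun z : 'rV[R]_3 => 1 + 2 * p * z 0 0 - al * z 0 0 ^+ 2) setT 0 openT I).
        by ck.
      by rewrite mxE expr0n /= !mulr0 addr0 subr0 ltr01.
have ldi : local_diffeo (0 : 'rV[R]_2) id.
  have si : smooth_near (0 : 'rV[R]_2) id.
    by exists setT; [split=> //; exact: openT|move=> k; exact: Ck_on_id].
  by split=> //; exists id; split=> //; exact: (@filterE _ _ (nbhs_filter (0 : 'rV[R]_2))).
have gE u : g (chart e f n u) = hh (crosscap_form u).
  have dE : den (crosscap_form u) = 1 + u 0 0 ^+ 2 + u 0 1 ^+ 2.
    by rewrite /den; have [-> -> _] := vec3E (u 0 0) (u 0 1 ^+ 2) (u 0 0 * u 0 1).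
  have d0 : 1 + u 0 0 ^+ 2 + u 0 1 ^+ 2 != 0 by rewrite gt_eqF// chart_scale_pos.
  rewrite bil_chart /hh dE; have [-> -> ->] := vec3E (u 0 0) (u 0 1 ^+ 2) (u 0 0 * u 0 1).
  have -> : chart_dir e f n u = 1 *: e + u 0 1 *: f + u 0 0 *: n by rewrite scale1r.
  rewrite (simple_bil sB _ _ _ _ _ _ sf) -/o -/D -/X -/Y.
  move: o D X Y => d1 d2 d3 d4; apply/rowP => i; rewrite !mxE; field.
  by [].
exists id, kk; split; first by split.
  rewrite /comp chart0 -/o; split=> //; rewrite kk_o.
  by apply/rowP => i; rewrite !mxE; case: i => [[|[|[|//]]] Hi] /=; rewrite ?expr0n ?mul0r.
have pos2 (h : 'rV[R]_2 -> R) : Ck_on 0 setT h -> 0 < h 0 ->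
    \forall y \near (0 : 'rV[R]_2), 0 < h y.
  move=> ch hx.
  exact: (ch 0 I [set y | 0 < y] (open_nbhs_nbhs (conj (@open_gt _ 0) hx))).
near=> u; rewrite (gE u : (g \o chart e f n) u = _); have [E0 E1 E2] := vec3E (u 0 0) (u 0 1 ^+ 2) (u 0 0 * u 0 1).
apply: kk_hh; rewrite ?/den E0 ?E1; first exact: chart_scale_pos.
- near: u; apply: pos2; first by ck.
  by rewrite mxE expr0n /= mulr0 addr0 ltr01.
- near: u; apply: pos2; first by ck.
  by rewrite mxE expr0n /= !mulr0 addr0 subr0 ltr01.
Unshelve. all: by end_near. Qed.

End CrossCap.

Lemma crosscap_pt_simple (R : realType) (B : 'I_3 -> 'M[R]_3) e f n dl p q :
  (forall i, (B i)^T = B i) -> simple_frame B e f n dl p q ->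
  crosscap_pt (fun u => bil B u u) e.
Proof.
move=> sB sf; have [_ I _] := sf.
have [tD [d1 d2 d3]] := indep3_dual I 1 0 0.
have [tX [x1 x2 x3]] := indep3_dual I 0 1 0.
have [tY [y1 y2 y3]] := indep3_dual I 0 0 1.
have dual (b c d : R) : let w := b *: (bil B f f - bil B e e) + c *: bil B e n + d *: bil B f n in
    [/\ dot tD w = b, dot tX w = c & dot tY w = d].
  by rewrite /= !dotDr !dotZr d1 d2 d3 x1 x2 x3 y1 y2 y3; split; ring.
apply: (crosscap_pt_dual sB sf dual) => w.
have [b [c [d ->]]] := indep3_span I w.
by have [-> -> ->] := dual b c d.
Qed.

(** * Flat perturbations and jets *)

Section Jets.
Variable R : realType.
Implicit Types V W : normedModType R.

Lemma smooth_iter_derive V W (F : V -> W) s :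
  smooth_on setT F -> smooth_on setT (iter_derive s F).
Proof. by move=> sF; elim: s => [//|v s IH] k; have [_] := IH k.+1; apply. Qed.

Lemma iter_deriveD V W (F H : V -> W) s : smooth_on setT F -> smooth_on setT H ->
  iter_derive s (fun x => F x + H x) = fun x => iter_derive s F x + iter_derive s H x.
Proof.
move=> sF sH; elim: s => [//|v s IH] /=; apply: funext => x; rewrite IH.
have dF := smooth_iter_derive s sF; have dH := smooth_iter_derive s sH.
have d (G : V -> W) : smooth_on setT G -> derivable G x v.
  by move=> sG; apply: diff_derivable; have [+ _] := sG 1%N; apply.
by rewrite (@deriveD _ _ _ (iter_derive s F) (iter_derive s H)) //; exact: d.
Qed.

Lemma iter_deriveZl V W (h : V -> R) (w : W) s : smooth_on setT h ->
  iter_derive s (fun x => h x *: w) = fun x => iter_derive s h x *: w.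
Proof.
move=> sh; elim: s => [//|v s IH] /=; apply: funext => x; rewrite IH.
have dh : differentiable (iter_derive s h) x.
  by have [+ _] := smooth_iter_derive s sh 1%N; apply.
rewrite deriveE; last exact: differentiableZl.
by rewrite diffZl// deriveE.
Qed.

(** Each differentiation lowers the power of the coordinate by at most one, and the cofactor stays
    smooth. *)
Lemma iter_derive_flat n (r : 'rV[R]_n.+1 -> R) j m s : smooth_on setT r ->
  (size s <= m)%N ->
  exists2 r' : 'rV[R]_n.+1 -> R, smooth_on setT r' &
    iter_derive s (fun u : 'rV[R]_n.+1 => u 0 j ^+ m * r u) =
      fun u => u 0 j ^+ (m - size s) * r' u.
Proof.
move=> sr; elim: s => [|v s IH] /= sm; first by exists r; rewrite ?subn0.
have [r' sr' ->] := IH (ltnW sm).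
have -> : (m - size s = (m - (size s).+1).+1)%N by rewrite subnSK.
move: (m - (size s).+1)%N => i.
exists (fun u => (i.+1%:R * v 0 j) * r' u + u 0 j * 'D_v r' u).
  move=> k; have := sr' k; have [_ /(_ v)] := sr' k.+1 => Dr Cr.
  by ck.
apply: funext => u.
have dr : derivable r' u v.
  by apply: diff_derivable; have [+ _] := sr' 1%N; apply.
have dj := derive_coord u v j.
have /derivableP dr' := dr.
have -> : (fun u : 'rV[R]_n.+1 => u 0 j ^+ i.+1 * r' u) =
   (fun u : 'rV[R]_n.+1 => u 0 j) ^+ i.+1 * r' by rewrite funeqE => w /=; rewrite !fctE.
rewrite derive_val /= !fctE /GRing.scale /= exprS; ring.
Qed.

Lemma same_jet_flat n (W : normedModType R) (F : 'rV[R]_n.+1 -> W) (r : 'rV[R]_n.+1 -> R) (w : W) j k m :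
  smooth_on setT F -> smooth_on setT r -> (k < m)%N ->
  same_jet k 0 F (fun u => F u + (u 0 j ^+ m * r u) *: w).
Proof.
move=> sF sr km s sk.
have sh : smooth_on setT (fun u : 'rV[R]_n.+1 => u 0 j ^+ m * r u).
  by move=> i; have := sr i => ?; ck.
have sm : (size s < m)%N := leq_ltn_trans sk km.
have [r' sr' E] := iter_derive_flat j sr (ltnW sm).
rewrite iter_deriveD//; last by move=> i; apply: Ck_onZl => //; exact: openT.
by rewrite iter_deriveZl// E mxE expr0n subn_eq0 leqNgt sm mul0r scale0r addr0.
Qed.

End Jets.

(** * Failure of finite determinacy where the sheets are tangent *)

Section Transversality.
Variables (R : realType) (B : 'I_3 -> 'M[R]_3).
Hypothesis sB : forall i, (B i)^T = B i.
Notation g := (fun u => bil B u u).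
Implicit Types (u v w e f n : 'rV[R]_3).

(** Viewing the scalar product as the bilinear map of constant identity matrices makes the
    derivative rules for [bil] available to it. *)
Lemma dot_bil u w : dot u w = bil (fun _ => 1%:M) u w 0 0.
Proof.
rewrite /bil -lock mxE mulmx1 /dot mxE.
by apply: eq_bigr => i _; rewrite mxE.
Qed.

Lemma derive_sphere (V : normedModType R) (phi : V -> 'rV[R]_3) (x v : V) :
  (\forall y \near x, S2 R (phi y)) -> differentiable phi x ->
  dot (phi x) ('D_v phi x) = 0.
Proof.
move=> sph dphi.
have H : 'D_v (fun y => bil (fun _ => 1%:M) (phi y) (phi y)) x =
    2 *: bil (fun _ => 1%:M) (phi x) ('D_v phi x).
  by apply: derive_bil_comp => // i; rewrite trmx1.
have E : 'D_v (fun y => bil (fun _ => 1%:M) (phi y) (phi y)) x 0 0 = 0.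
  rewrite derive_row; last first.
    apply: (@differentiable_comp _ _ _ _ phi (fun u => bil (fun _ => 1%:M) u u)) => //.
    exact: differentiable_bil.
  rewrite (@near_eq_derive _ _ _ _ (cst (1 : R) : V -> R)) ?derive_cst//.
  by apply: filterS sph => y; rewrite /S2 /= -dot_bil.
move: E; rewrite H dot_bil.
move: (bil _ _ _) => z; rewrite mxE => /eqP; rewrite mulf_eq0 pnatr_eq0 /= => /eqP //.
Qed.

(** The sphere version of [nowhere_transversal]: both tangent images are normal to one vector [nu].
    It does not depend on a parametrisation, so it excludes a cross-cap in every one. *)
Definition tangent_pairs_near e : Prop := exists2 U, nbhs e U &
  forall u u', U u -> U u' -> S2 R u -> S2 R u' -> g u = g u' ->
  exists2 nu, nu != 0 & forall w,
    (dot u w = 0 -> dot nu (bil B u w) = 0) /\ (dot u' w = 0 -> dot nu (bil B u' w) = 0).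

Lemma sphere_param_smooth e phi : sphere_param e phi -> smooth_near 0 (g \o phi).
Proof.
move=> [_ [U oU sU] _ _]; exists U => // k; apply: Ck_on_bil (sU k).
by case: oU.
Qed.

(** Spanning ranges would express [nu] itself as a sum of two vectors orthogonal to [nu]. *)
Lemma nowhere_transversal_sphere e phi : tangent_pairs_near e ->
  sphere_param e phi -> nowhere_transversal (g \o phi) 0.
Proof.
move=> [U eU H] [p0 sphi Sphi _].
have cphi := smooth_near_continuous sphi.
rewrite /prop_for /continuous_at p0 in cphi.
pose good x := [/\ U (phi x), differentiable phi x & \forall y \near x, S2 R (phi y)].
exists good.
  have h1 := cphi _ eU; have h2 := smooth_near_differentiable sphi.
  have h3 := nbhs_interior Sphi.
  near=> x; split; near: x => //.
move=> x y [Ux dx Sx] [Uy dy Sy] E sp.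
have [nu nu0 Hnu] := H _ _ Ux Uy (nbhs_singleton Sx) (nbhs_singleton Sy) E.
have [v [w]] := sp nu; rewrite !derive_bil_comp// => nuE.
have [/(_ (derive_sphere v Sx dx)) H1 _] := Hnu ('D_v phi x).
have [_ /(_ (derive_sphere w Sy dy)) H2] := Hnu ('D_w phi y).
have E1 : dot nu (2 *: bil B (phi x) ('D_v phi x)) = 0 by rewrite dotZr H1 mulr0.
have E2 : dot nu (2 *: bil B (phi y) ('D_w phi y)) = 0 by rewrite dotZr H2 mulr0.
have : dot nu nu = 0.
  apply: (etrans (congr1 (dot nu) nuE)); apply: (etrans (dotDr _ _ _)).
  by rewrite -[RHS]addr0; exact: (congr2 +%R E1 E2).
by move/eqP; rewrite dot_eq0 (negPf nu0).
Unshelve. all: by end_near. Qed.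

Lemma derive_crosscap_form (u v : 'rV[R]_2) : 'D_v (@crosscap_form R) u =
  vec3 (v 0 0) (2 * u 0 1 * v 0 1) (u 0 0 * v 0 1 + u 0 1 * v 0 0).
Proof.
have d0 := derive_coord u v 0; have d1 := derive_coord u v 1.
have C : Ck_on 1 setT (@crosscap_form R) by rewrite /crosscap_form; ck.
apply/rowP => i; rewrite derive_row; last exact: Ck_on_differentiable C I.
case: i => [[|[|[|//]]] Hi]; rewrite [RHS]mxE (tnth_nth 0) /=.
- by under eq_fun do rewrite mxE /=; rewrite derive_val.
- under eq_fun do rewrite mxE /=.
  have -> : (fun x : 'rV[R]_2 => x 0 1 ^+ 2) = (fun x : 'rV[R]_2 => x 0 1) ^+ 2.
    by rewrite funeqE => w; rewrite !fctE.
  by rewrite derive_val /GRing.scale /=; ring.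
- under eq_fun do rewrite mxE /=.
  have -> : (fun x : 'rV[R]_2 => x 0 0 * x 0 1) = (fun x : 'rV[R]_2 => x 0 0) * (fun x => x 0 1) by [].
  by rewrite derive_val /GRing.scale /=.
Qed.

Definition vec2 (x y : R) : 'rV[R]_2 := \row_(i < 2) tnth [tuple x; y] i.

Lemma vec2E x y : vec2 x y 0 0 = x /\ vec2 x y 0 1 = y.
Proof. by split; rewrite mxE. Qed.

Lemma nbhs_vertical_pair (U : set 'rV[R]_2) : nbhs (0 : 'rV[R]_2) U ->
  exists2 y : R, 0 < y & U (vec2 0 y) /\ U (vec2 0 (- y)).
Proof.
move=> U0.
have c0 : Ck_on 0 setT (fun y : R => vec2 0 y).
  have E : (fun y : R => y *: vec2 0 1) = fun y : R => vec2 0 y.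
    apply: funext => y; apply/rowP => i; rewrite !mxE.
    by case: i => [[|[|//]] Hi] /=; rewrite ?mulr0 ?mulr1.
  rewrite -E; apply: Ck_onZl; [exact: openT|exact: Ck_on_id].
have v0 : vec2 0 0 = 0.
  by apply/rowP => i; rewrite !mxE; case: i => [[|[|//]] Hi].
have N1 : \forall y \near (0 : R), U (vec2 0 y).
  by have := c0 0 I; rewrite /prop_for /continuous_at v0; apply.
have N2 : \forall y \near (0 : R), U (vec2 0 (- y)).
  have : {for (0 : R), continuous (fun y : R => - y)} by exact: opp_continuous.
  by rewrite /prop_for /continuous_at oppr0 => cN; exact: cN N1.
have [eps /= eps0 H] := (nbhs_ballP (0 : R) _).1 (filterI N1 N2).
exists (eps / 2); first by rewrite divr_gt0.
by apply: H; rewrite /ball /= sub0r normrN gtr0_norm ?divr_gt0// ltr_pdivrMr// mulr2n mulrDr mulr1 ltrDl.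
Qed.

(** The test pairs are (0, y) and (0, - y), which in a chart are the two lifts of a double point and
    occur in every neighbourhood of 0. *)
Lemma not_nowhere_transversal_pairs (W : normedModType R) (F : 'rV[R]_2 -> W) :
  (forall y, 0 < y -> F (vec2 0 y) = F (vec2 0 (- y)) /\
     ranges_span F (vec2 0 y) (vec2 0 (- y))) -> ~ nowhere_transversal F 0.
Proof.
move=> H [U /nbhs_vertical_pair[y y0 [U1 U2]] NT].
by have [E sp] := H y y0; exact: NT E sp.
Qed.

Lemma crosscap_form_transversal : ~ nowhere_transversal (@crosscap_form R) 0.
Proof.
apply: not_nowhere_transversal_pairs => y y0.
have [E0 E1] := vec2E 0 y; have [E2 E3] := vec2E 0 (- y).
split; first by rewrite /crosscap_form E0 E1 E2 E3 sqrrN !mul0r.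
have y0' : y != 0 by exact: lt0r_neq0.
(* Solves v0 + w0 = z0, 2 y v1 = z1 and y (v0 - w0) = z2. *)
move=> z; exists (vec2 ((z 0 0 + z 0 2%:R / y) / 2) (z 0 1 / (2 * y))).
exists (vec2 ((z 0 0 - z 0 2%:R / y) / 2) 0).
rewrite !derive_crosscap_form E0 E1 E2 E3.
have [-> ->] := vec2E ((z 0 0 + z 0 2%:R / y) / 2) (z 0 1 / (2 * y)).
have [-> ->] := vec2E ((z 0 0 - z 0 2%:R / y) / 2) 0.
rewrite {1}[z]vec3_eta; apply/rowP => i; rewrite !mxE !(tnth_nth 0) /=.
by case: i => [[|[|[|//]]] Hi] /=; field.
Qed.

Lemma crosscap_smooth : smooth_near 0 (@crosscap_form R).
Proof.
by exists setT; [split=> //; exact: openT|move=> k; rewrite /crosscap_form; ck].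
Qed.

Lemma tangent_pairs_not_crosscap e : tangent_pairs_near e -> ~ crosscap_pt g e.
Proof.
move=> H [_ [phi sp A]].
have sF := sphere_param_smooth sp.
apply: crosscap_form_transversal.
apply: (A_equivalent_nowhere_transversal crosscap_smooth sF).
  exact: A_equivalent_sym (smooth_near_continuous sF) A.
exact: nowhere_transversal_sphere H sp.
Qed.

Section Perturbation.
Variables e f n : 'rV[R]_3.
Hypotheses (on : orthonormal e f n) (ef : bil B e f = 0) (tp : tangent_pairs_near e).
Let D := bil B f f - bil B e e.
Let X := bil B e n.
Let Y := bil B f n.
Let phi := chart e f n.

(** Were the germ determined by its k-jet, the perturbation with m > k would be A-equivalent to it
    and inherit [nowhere_transversal] from the tangent pairs. *)
Lemma non_fin_det_perturb (P : 'rV[R]_3) (r : nat -> 'rV[R]_2 -> R) :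
  (forall m, smooth_on setT (r m)) ->
  (forall k, exists2 m, (k < m)%N & ~ nowhere_transversal
     (fun u : 'rV[R]_2 => (g \o phi) u + (u 0 1 ^+ m * r m u) *: P) 0) ->
  non_fin_det_pt g e.
Proof.
move=> sr H; have [ee _ _ _] := on; split=> //.
exists phi; first exact: sphere_param_chart.
move=> [k fd]; have [m km] := H k; apply.
have sF : smooth_on setT (g \o phi).
  by move=> i; apply: Ck_on_bil; [exact: openT|exact: Ck_on_chart].
have sG : smooth_near 0 (fun u : 'rV[R]_2 => (g \o phi) u + (u 0 1 ^+ m * r m u) *: P).
  exists setT; first by split=> //; exact: openT.
  move=> i; apply: Ck_onD; [exact: openT|exact: sF|apply: Ck_onZl; first exact: openT].
  by have ? := sr m i; ck.
have sp := sphere_param_chart on.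
apply: (A_equivalent_nowhere_transversal sG (sphere_param_smooth sp)).
  by apply: fd => //; exact: same_jet_flat.
exact: nowhere_transversal_sphere tp sp.
Qed.

Lemma derive_chart_vertical (y : R) (v : 'rV[R]_2) :
  'D_v (g \o phi) (vec2 0 y) = (2 / (1 + y ^+ 2)) *:
    ((v 0 1 * y / (1 + y ^+ 2)) *: D + v 0 0 *: (X + y *: Y)).
Proof.
rewrite derive_bil_comp//; last first.
  exact: Ck_on_differentiable (@Ck_on_chart R e f n 1) I.
rewrite derive_chart derive_chart_scale /phi /chart bilZl.
have [E0 E1] := vec2E 0 y; have := sqr_chart_scale (vec2 0 y).
rewrite /chart_dir E0 E1 scale0r addr0 expr0n /= addr0 mul0r add0r.
have N0 : 1 + y ^+ 2 != 0 by rewrite gt_eqF//; have := sqr_ge0 y; lra.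
move: (chart_scale _) => s s2.
rewrite !(bilDl, bilDr, bilZl, bilZr) (bilC f e sB) ef -/X -/Y /D.
move: (bil B e e) (bil B f f) X Y => d1 d2 d3 d4.
have -> : 2 / (1 + y ^+ 2) = 2 * s ^+ 2 by rewrite s2.
by apply/rowP => i; rewrite !mxE; field.
Qed.

Lemma g_chart_vertical y : g (phi (vec2 0 y)) = (1 + y ^+ 2)^-1 *: (bil B e e + y ^+ 2 *: bil B f f).
Proof.
rewrite /= /phi bil_chart /chart_dir; have [-> ->] := vec2E 0 y.
rewrite scale0r addr0 expr0n /= addr0 !(bilDl, bilDr, bilZl, bilZr) (bilC f e sB) ef.
by rewrite !scaler0 addr0 add0r scalerA expr2.
Qed.

Lemma derive_perturb (P : 'rV[R]_3) (h : 'rV[R]_2 -> R) (u v : 'rV[R]_2) : smooth_on setT h ->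
  'D_v (fun u : 'rV[R]_2 => (g \o phi) u + h u *: P) u = 'D_v (g \o phi) u + 'D_v h u *: P.
Proof.
move=> sh; have dh : differentiable h u by have [+ _] := sh 1%N; apply.
have dF : differentiable (g \o phi) u.
  have C : Ck_on 1 setT (g \o phi).
    by apply: Ck_on_bil; [exact: openT|exact: Ck_on_chart].
  exact: Ck_on_differentiable C I.
have dZ : differentiable (fun u : 'rV[R]_2 => h u *: P) u by exact: differentiableZl.
rewrite (@deriveD _ _ _ (g \o phi) (fun u : 'rV[R]_2 => h u *: P)); try exact: diff_derivable.
by rewrite [X in _ + X = _]deriveE// diffZl// -deriveE.
Qed.

Lemma sum_vertical (y : R) (v w : 'rV[R]_2) (P : 'rV[R]_3) (s t : R) : 0 < y ->
  'D_v (g \o phi) (vec2 0 y) + s *: P + ('D_w (g \o phi) (vec2 0 (- y)) + t *: P) =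
  (2 / (1 + y ^+ 2)) *: (((v 0 1 - w 0 1) * y / (1 + y ^+ 2)) *: D
   + (v 0 0 + w 0 0) *: X + (y * (v 0 0 - w 0 0)) *: Y) + (s + t) *: P.
Proof.
move=> y0; rewrite !derive_chart_vertical sqrrN.
move: D X Y => d1 d2 d3; apply/rowP => i; rewrite !mxE; ring.
Qed.

Lemma smooth_coord m j : smooth_on setT (fun u : 'rV[R]_m.+1 => u 0 j).
Proof. by move=> k; exact: Ck_on_coord_id. Qed.

Lemma smooth_flat m (r : 'rV[R]_2 -> R) : smooth_on setT r ->
  smooth_on setT (fun u : 'rV[R]_2 => u 0 1 ^+ m * r u).
Proof. by move=> sr k; have ? := sr k; ck. Qed.

(** At (0, y) and (0, - y) the ranges span [D] and [X] only. The perturbation u0 u1^m P with odd [m]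
    contributes y^m (v0 - w0) P to the sum of derivatives, leaving v0 + w0 free for [X]. *)
Lemma non_fin_det_odd P a b : indep3 D X P -> Y = a *: D + b *: X -> non_fin_det_pt g e.
Proof.
move=> I YE; apply (@non_fin_det_perturb P (fun _ (u : 'rV[R]_2) => u 0 0)).
  by move=> _; exact: smooth_coord.
move=> k; exists (k.*2.+1); first by rewrite ltnS -addnn leq_addr.
set m := k.*2.+1; apply: not_nowhere_transversal_pairs => y y0.
have [E0 E1] := vec2E 0 y; have [E2 E3] := vec2E 0 (- y).
split; first by rewrite /= !g_chart_vertical E0 E2 sqrrN !mulr0.
have y0' : y != 0 by exact: lt0r_neq0.
have N0 : 1 + y ^+ 2 != 0 by rewrite gt_eqF//; have := sqr_ge0 y; lra.
have sh := smooth_flat m (@smooth_coord 1 0).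
have Dh (t : R) (v : 'rV[R]_2) : 'D_v (fun u : 'rV[R]_2 => u 0 1 ^+ m * u 0 0) (vec2 0 t) = t ^+ m * v 0 0.
  have d0 := derive_coord (vec2 0 t) v 0; have d1 := derive_coord (vec2 0 t) v 1.
  have -> : (fun u : 'rV[R]_2 => u 0 1 ^+ m * u 0 0) = (fun u : 'rV[R]_2 => u 0 1) ^+ m * (fun u : 'rV[R]_2 => u 0 0).
    by rewrite funeqE => w; rewrite !fctE.
  by rewrite derive_val !fctE; have [-> ->] := vec2E 0 t; rewrite scale0r addr0.
move=> z; have [x1 [x2 [x3 ->]]] := indep3_span I z.
(* [sg] and [dl] are the sum and the difference of the first coordinates of the two tangent vectors,
   solved from the coefficients of [X] and [P]; [ta] then adjusts that of [D]. *)
pose dl := x3 / y ^+ m; pose sg := x2 * (1 + y ^+ 2) / 2 - y * b * dl.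
pose ta := (x1 * (1 + y ^+ 2) / 2 - y * a * dl) * (1 + y ^+ 2) / y.
exists (vec2 ((sg + dl) / 2) ta), (vec2 ((sg - dl) / 2) 0).
rewrite !derive_perturb// !Dh sum_vertical//.
have [-> ->] := vec2E ((sg + dl) / 2) ta; have [-> ->] := vec2E ((sg - dl) / 2) 0.
have -> : (- y) ^+ m = - y ^+ m.
  by rewrite exprNn -signr_odd /m /= odd_double expr1 mulN1r.
have ym : y ^+ m != 0 by rewrite expf_neq0.
rewrite YE /ta /sg /dl; move: (y ^+ m) ym D X => ym ym0 d1 d2.
by apply/rowP => i; rewrite !mxE; field; rewrite y0' N0 ym0.
Qed.

(** The mirror case: [X] is the redundant direction, [Y] comes from the difference v0 - w0, and an
    even [m] puts [P] on the sum v0 + w0. *)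
Lemma non_fin_det_even P a b : indep3 D Y P -> X = a *: D + b *: Y -> non_fin_det_pt g e.
Proof.
move=> I XE; apply (@non_fin_det_perturb P (fun _ (u : 'rV[R]_2) => u 0 0)).
  by move=> _; exact: smooth_coord.
move=> k; exists (k.+1.*2); first by rewrite -addnn addSn ltnS leq_addr.
set m := k.+1.*2; apply: not_nowhere_transversal_pairs => y y0.
have [E0 E1] := vec2E 0 y; have [E2 E3] := vec2E 0 (- y).
split; first by rewrite /= !g_chart_vertical E0 E2 sqrrN !mulr0.
have y0' : y != 0 by exact: lt0r_neq0.
have N0 : 1 + y ^+ 2 != 0 by rewrite gt_eqF//; have := sqr_ge0 y; lra.
have sh := smooth_flat m (@smooth_coord 1 0).
have Dh (t : R) (v : 'rV[R]_2) : 'D_v (fun u : 'rV[R]_2 => u 0 1 ^+ m * u 0 0) (vec2 0 t) = t ^+ m * v 0 0.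
  have d0 := derive_coord (vec2 0 t) v 0; have d1 := derive_coord (vec2 0 t) v 1.
  have -> : (fun u : 'rV[R]_2 => u 0 1 ^+ m * u 0 0) = (fun u : 'rV[R]_2 => u 0 1) ^+ m * (fun u : 'rV[R]_2 => u 0 0).
    by rewrite funeqE => w; rewrite !fctE.
  by rewrite derive_val !fctE; have [-> ->] := vec2E 0 t; rewrite scale0r addr0.
move=> z; have [x1 [x2 [x3 ->]]] := indep3_span I z.
pose sg := x3 / y ^+ m; pose dl := (x2 * (1 + y ^+ 2) / 2 - b * sg) / y.
pose ta := (x1 * (1 + y ^+ 2) / 2 - a * sg) * (1 + y ^+ 2) / y.
exists (vec2 ((sg + dl) / 2) ta), (vec2 ((sg - dl) / 2) 0).
rewrite !derive_perturb// !Dh sum_vertical//.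
have [-> ->] := vec2E ((sg + dl) / 2) ta; have [-> ->] := vec2E ((sg - dl) / 2) 0.
have -> : (- y) ^+ m = y ^+ m.
  by rewrite exprNn -signr_odd /m odd_double expr0 mul1r.
have ym : y ^+ m != 0 by rewrite expf_neq0.
rewrite XE /ta /dl /sg; move: (y ^+ m) ym D Y => ym ym0 d1 d2.
by apply/rowP => i; rewrite !mxE; field; rewrite y0' N0 ym0.
Qed.

(** The circle through [e] and [f] is collapsed, so its direction contributes nothing; the
    perturbation u1^m P restores a third direction. An even [m] keeps (0, y) and (0, - y) at the
    same image. *)
Lemma non_fin_det_collapsed P : D = 0 -> indep3 X Y P -> non_fin_det_pt g e.
Proof.
move=> D0 I; apply: (@non_fin_det_perturb P (fun _ _ => 1)).
  by move=> _ k; exact: Ck_on_cst.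
move=> k; exists (k.+1.*2); first by rewrite -addnn addSn ltnS leq_addr.
set m := k.+1.*2; apply: not_nowhere_transversal_pairs => y y0.
have [E0 E1] := vec2E 0 y; have [E2 E3] := vec2E 0 (- y).
have yN : (- y) ^+ m = y ^+ m.
  by rewrite exprNn -signr_odd /m odd_double expr0 mul1r.
have yN' : (- y) ^+ m.-1 = - y ^+ m.-1.
  by rewrite exprNn -signr_odd /m doubleS /= odd_double expr1 mulN1r.
split; first by rewrite /= !g_chart_vertical E1 E3 sqrrN yN.
have y0' : y != 0 by exact: lt0r_neq0.
have N0 : 1 + y ^+ 2 != 0 by rewrite gt_eqF//; have := sqr_ge0 y; lra.
have sh := @smooth_flat m (fun _ => 1) (fun k => Ck_on_cst _ _ _).
have Dh (t : R) (v : 'rV[R]_2) : 'D_v (fun u : 'rV[R]_2 => u 0 1 ^+ m * 1) (vec2 0 t) = m%:R * t ^+ m.-1 * v 0 1.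
  have d1 := derive_coord (vec2 0 t) v 1.
  have -> : (fun u : 'rV[R]_2 => u 0 1 ^+ m * 1) = (fun u : 'rV[R]_2 => u 0 1) ^+ m.
    by rewrite funeqE => w; rewrite !fctE mulr1.
  by rewrite derive_val; have [_ ->] := vec2E 0 t; rewrite /GRing.scale /= mulr_natl.
move=> z; have [x1 [x2 [x3 ->]]] := indep3_span I z.
pose sg := x1 * (1 + y ^+ 2) / 2; pose dl := x2 * (1 + y ^+ 2) / (2 * y).
pose ta := x3 / (m%:R * y ^+ m.-1).
exists (vec2 ((sg + dl) / 2) ta), (vec2 ((sg - dl) / 2) 0).
rewrite !derive_perturb// !Dh sum_vertical// D0 yN'.
have [-> ->] := vec2E ((sg + dl) / 2) ta; have [-> ->] := vec2E ((sg - dl) / 2) 0.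
have ym : m%:R * y ^+ m.-1 != 0 by rewrite mulf_neq0 ?pnatr_eq0// expf_neq0.
rewrite /ta /dl /sg.
have -> : m%:R * y ^+ m.-1 * (x3 / (m%:R * y ^+ m.-1)) = x3 by rewrite mulrC divfK.
rewrite !mulr0 addr0.
move: X Y => d1 d2.
apply/rowP => i; rewrite !mxE; field.
by rewrite y0' N0 expf_neq0 ?pnatr_eq0.
Qed.

End Perturbation.
End Transversality.

(** * Singular and double points read off from decomposable forms *)

Section FactorPairs.
Variables (R : realType) (B : 'I_3 -> 'M[R]_3).
Hypothesis sB : forall i, (B i)^T = B i.
Notation g := (fun u => bil B u u).
Notation V3 := ('rV[R]_3).
Implicit Types (u v w e f n m d : V3).

Lemma dotNr u w : dot u (- w) = - dot u w.
Proof. by rewrite -scaleN1r dotZr mulN1r. Qed.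

Lemma comb_neq0 e f n (a b c : R) : a *: e + b *: f + c *: n != 0 ->
  [|| a != 0, b != 0 | c != 0].
Proof.
apply: contraNT; rewrite !negb_or !negbK => /and3P[/eqP -> /eqP -> /eqP ->].
by rewrite !scale0r !addr0.
Qed.

Lemma dot_unit_scale e (mu : R) : dot e e = 1 -> dot (mu *: e) (mu *: e) = 1 ->
  eqpm (mu *: e) e.
Proof.
rewrite dotZl dotZr => -> /eqP; rewrite mulr1 -expr2 sqrf_eq1 => /orP[]/eqP ->.
  by left; rewrite scale1r.
by right; rewrite scaleN1r.
Qed.

Definition factors_into m d e f : Prop :=
  exists mu ka : R, (m = mu *: e /\ d = ka *: f) \/ (m = mu *: f /\ d = ka *: e).

Lemma factors_into_sym m d e f : factors_into m d e f -> factors_into d m e f.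
Proof. by move=> [mu [ka [[-> ->]|[-> ->]]]]; exists ka, mu; [right|left]. Qed.

(* The rank 2 members of the pencil are the symmetric products e f with
   (e, f) in [s]. *)
Definition factor_pairs (s : seq (V3 * V3)) : Prop :=
  (forall e f, (e, f) \in s ->
     [/\ dot e e = 1, dot f f = 1, dot e f = 0 & bil B e f = 0]) /\
  (forall m d, m != 0 -> d != 0 -> dot m d = 0 -> bil B m d = 0 ->
     exists e f, (e, f) \in s /\ factors_into m d e f).

Definition pair_points (s : seq (V3 * V3)) : seq V3 :=
  flatten [seq [:: p.1; p.2] | p <- s].

Lemma pair_pointsP s a : reflect (exists e f, (e, f) \in s /\ (a = e \/ a = f))
  (a \in pair_points s).
Proof.
apply: (iffP flatten_mapP) => [[[e f] ef]|[e [f [ef H]]]].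
  by rewrite !inE => /orP[]/eqP ->; exists e, f; split=> //; [left|right].
by exists (e, f) => //; rewrite !inE; case: H => ->; rewrite eqxx ?orbT.
Qed.

(** A singular point and its kernel direction are the two factors of a member; conversely each
    factor of a pair has the other as kernel direction. *)
Lemma factor_pairs_singular s a : factor_pairs s ->
  singular_pt g a <-> exists2 c, c \in pair_points s & eqpm a c.
Proof.
move=> [H1 H2]; split.
  move/(singular_ptE sB) => [Sa [w [w0 aw bw]]].
  have a0 : a != 0 by rewrite -dot_eq0 (Sa : dot a a = 1) oner_eq0.
  have [e [f [ef [mu [ka [[aE _]|[aE _]]]]]]] := H2 _ _ a0 w0 aw bw;
    have [ee ff _ _] := H1 _ _ ef.
  - exists e; first by apply/pair_pointsP; exists e, f; split=> //; left.
    by rewrite aE; apply: dot_unit_scale; rewrite // -aE.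
  - exists f; first by apply/pair_pointsP; exists e, f; split=> //; right.
    by rewrite aE; apply: dot_unit_scale; rewrite // -aE.
move=> [c /pair_pointsP[e [f [ef cE]]] ac].
have [ee ff ef0 bef] := H1 _ _ ef.
have nz u : dot u u = 1 -> u != 0 by rewrite -dot_eq0 => ->; rewrite oner_eq0.
have sing u w : dot u u = 1 -> dot w w = 1 -> dot u w = 0 -> bil B u w = 0 ->
    singular_pt g u.
  by move=> uu ww uw buw; apply/(singular_ptE sB); split=> //; exists w; rewrite nz.
have NN u : dot (- u) (- u) = dot u u by rewrite -scaleN1r dotZl dotZr; ring.
have Nl u w : dot (- u) w = - dot u w by rewrite -scaleN1r dotZl mulN1r.
have bN u w : bil B (- u) w = - bil B u w by rewrite -scaleN1r bilZl scaleN1r.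
case: cE ac => -> [] ->.
- exact: (sing e f).
- by apply: (sing (- e) f); rewrite ?NN ?Nl ?bN ?ef0 ?bef ?oppr0.
- by apply: (sing f e) => //; [rewrite dotC|rewrite bilC].
- by apply: (sing (- f) e); rewrite ?NN ?Nl ?bN // ?(dotC f) ?(bilC f e sB) ?ef0 ?bef ?oppr0.
Qed.

Lemma factor_pairs_double s : factor_pairs s ->
  double_points_are g (fun l => exists e f, (e, f) \in s /\ l = arc_lift e f).
Proof.
move=> [H1 H2] a b Sa Sb nab gab.
have [bE dE] := double_pair sB gab Sa Sb.
have m0 : a + b != 0.
  by apply/eqP => E; apply: nab; right; apply/eqP; rewrite -addr_eq0 E.
have d0 : a - b != 0.
  by apply/eqP => E; apply: nab; left; apply/eqP; rewrite -subr_eq0 E.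
have [e [f [ef [mu [ka H]]]]] := H2 _ _ m0 d0 dE bE.
have [ee ff ef0 _] := H1 _ _ ef.
exists (arc_lift e f); first by exists e, f.
exact: (double_pair_on_arc ee ff ef0 Sa Sb nab H).
Qed.

Lemma singular_points_are_pairs s : factor_pairs s ->
  pairwise (fun a b => (a != b) && (a != - b)) (pair_points s) ->
  singular_points_are g (pair_points s).
Proof.
move=> fp pw; split=> //; last by move=> a; exact: factor_pairs_singular.
move=> c /pair_pointsP[e [f [ef cE]]]; have [ee ff _ _] := fp.1 _ _ ef.
by case: cE => ->.
Qed.

Lemma not_eqpm_neq u w : ~ eqpm u w -> (u != w) && (u != - w).
Proof.
by move=> H; apply/andP; split; apply/eqP => E; apply: H; [left|right].
Qed.

Lemma not_eqpm_orthogonal u w : dot u u = 1 -> dot u w = 0 -> ~ eqpm u w.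
Proof.
have NN v : dot v (- v) = - dot v v by rewrite -scaleN1r dotZr mulN1r.
move=> uu uw [E|E]; move: uw.
  by rewrite -E uu => /eqP; rewrite oner_eq0.
by rewrite -[w]opprK -E NN uu => /eqP; rewrite oppr_eq0 oner_eq0.
Qed.

Section Arcs.
Variables e f n : V3.
Hypothesis fr : frame B e f n.
Let D := bil B f f - bil B e e.
Let X := bil B e n.
Let Y := bil B f n.

(** Orthogonality gives c a = - s b, which removes B(e, e) by itself and leaves a multiple of [D]
    and the mixed terms with [n]. *)
Lemma bil_arc (c s a b k : R) : c * a + s * b = 0 ->
  bil B (c *: e + s *: f) (a *: e + b *: f + k *: n) = (s * b) *: D + k *: (c *: X + s *: Y).
Proof.
move=> E; have [on ef] := fr.
have -> : c *: e + s *: f = c *: e + s *: f + 0 *: n by rewrite scale0r addr0.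
rewrite bil_comb// ef; have -> : c * a = - (s * b) by apply/eqP; rewrite -addr_eq0 E.
rewrite /D /X /Y; move: (bil B e e) (bil B f f) (bil B n n) (bil B e n) (bil B f n) => *.
by apply/rowP => i; rewrite !mxE; ring.
Qed.

Lemma dot_arc (c s a b k : R) :
  dot (c *: e + s *: f) (a *: e + b *: f + k *: n) = c * a + s * b.
Proof.
have [on _] := fr.
have -> : c *: e + s *: f = c *: e + s *: f + 0 *: n by rewrite scale0r addr0.
by rewrite (dot_comb _ _ _ _ _ _ on) mul0r addr0.
Qed.

Lemma tangent_image_arc (c s : R) y : c != 0 ->
  tangent_image g (c *: e + s *: f) y <->
  exists b k : R, y = (s * b) *: D + k *: (c *: X + s *: Y).
Proof.
move=> c0; rewrite (tangent_imageE sB); split.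
  move=> [w]; have [a [b [k ->]]] := frame_span w fr.
  by rewrite dot_arc => E ->; rewrite bil_arc//; exists b, k.
move=> [b [k ->]]; exists ((- (s * b) / c) *: e + b *: f + k *: n).
  by rewrite dot_arc; field.
by rewrite bil_arc//; field.
Qed.

Lemma not_singular_arc (c s : R) : c != 0 -> s != 0 ->
  (forall x y : R, x *: D + y *: (c *: X + s *: Y) = 0 -> x = 0 /\ y = 0) ->
  ~ singular_pt g (c *: e + s *: f).
Proof.
move=> c0 s0 I /(singular_ptE sB)[_ [w [w0]]].
have [a [b [k wE]]] := frame_span w fr; rewrite wE dot_arc => E.
rewrite bil_arc// => /I[/eqP sb k0].
move: sb; rewrite mulf_eq0 (negPf s0) /= => /eqP b0.
move: E; rewrite b0 mulr0 addr0 => /eqP; rewrite mulf_eq0 (negPf c0) /= => /eqP a0.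
by move/eqP: w0; apply; rewrite wE a0 b0 k0 !scale0r !addr0.
Qed.

(** The tangent images contain [D] and, respectively, c X + s Y and c X - s Y; the sum and
    difference of the latter are multiples of [X] and [Y]. *)
Lemma transversal_arc : indep3 D X Y -> transversal_along g (arc_lift e f).
Proof.
move=> I t /andP[t0 t1]; rewrite /arc_lift /=.
have s0 : Num.sqrt t != 0 by rewrite gt_eqF// sqrtr_gt0.
have c0 : Num.sqrt (1 - t) != 0 by rewrite gt_eqF// sqrtr_gt0 subr_gt0.
move: (Num.sqrt t) (Num.sqrt (1 - t)) s0 c0 => s c s0 c0.
rewrite -scaleNr; have s0' : - s != 0 by rewrite oppr_eq0.
have ind (s' : R) (x y : R) : x *: D + y *: (c *: X + s' *: Y) = 0 -> x = 0 /\ y = 0.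
  move=> E; have [|-> /eqP + _] := I x (y * c) (y * s').
    by rewrite -[RHS]E; apply/rowP => i; rewrite !mxE; ring.
  by rewrite mulf_eq0 (negPf c0) orbF => /eqP.
split; [exact: not_singular_arc (ind s)|exact: not_singular_arc (ind (- s))|].
move=> y; have [a [b [k ->]]] := indep3_span I y.
pose k1 := (b / c + k / s) / 2; pose k2 := (b / c - k / s) / 2.
exists ((s * (a / s)) *: D + k1 *: (c *: X + s *: Y)).
  by apply/tangent_image_arc => //; exists (a / s), k1.
apply/tangent_image_arc => //; exists 0, k2.
rewrite /k1 /k2; move: D X Y => d1 d2 d3.
by apply/rowP => i; rewrite !mxE; field; rewrite s0 c0.
Qed.

End Arcs.

Lemma simple_frame_crosscaps e f n dl p q : simple_frame B e f n dl p q ->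
  [/\ crosscap_pt g e, crosscap_pt g f, double_curve g e f (arc_lift e f)
    & transversal_along g (arc_lift e f)].
Proof.
move=> sf; have [fr I _] := sf; have [[ee ff _ [ef0 _ _]] ef] := fr.
split.
- exact: crosscap_pt_simple sf.
- exact: crosscap_pt_simple (simple_frame_swap sB sf).
- apply: double_curve_arc => //; have [D0 _ _] := indep3_neq0 I.
  by rewrite eq_sym -subr_eq0.
- exact: transversal_arc fr I.
Qed.

Lemma frame_simple e f n : frame B e f n ->
  indep3 (bil B f f - bil B e e) (bil B e n) (bil B f n) ->
  exists dl p q, simple_frame B e f n dl p q.
Proof.
move=> fr I; have [dl [p [q E]]] := indep3_span I (bil B n n - bil B e e).
exists dl, (p / 2), (q / 2); split=> //.
rewrite !(mulrC 2) !divfK ?pnatr_eq0//.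
transitivity (bil B e e + (bil B n n - bil B e e)); first by rewrite addrC subrK.
by rewrite E !addrA.
Qed.

(** * Cross-cap surfaces *)

(** With m3 nonzero, eliminating [d] from the three coordinate equations and [dot m d = 0] completes
    two squares whose right-hand sides are the discriminants. With m3 = 0 the equations force d3 = 0
    and then the pair (e, f). *)
Lemma simple_frame_factor e f n dl p q (m1 m2 m3 d1 d2 d3 : R) :
  simple_frame B e f n dl p q ->
  let m := m1 *: e + m2 *: f + m3 *: n in let d := d1 *: e + d2 *: f + d3 *: n in
  m != 0 -> d != 0 -> dot m d = 0 -> bil B m d = 0 ->
  factors_into m d e f \/
  [/\ m3 != 0, (m1 + p * m3) ^+ 2 = (1 - dl + p ^+ 2) * m3 ^+ 2
    & (m2 + q * m3) ^+ 2 = (dl + q ^+ 2) * m3 ^+ 2].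
Proof.
move=> sf m d m0 d0; have [[on _] I _] := sf.
rewrite /m /d (dot_comb _ _ _ _ _ _ on) (simple_bil sB _ _ _ _ _ _ sf) => dt.
rewrite dt scale0r add0r => /I[E1 E2 E3].
have [m30|m30] := eqVneq m3 0.
  left; have {}m0 := comb_neq0 m0; move: m0 E1 E2 E3 dt.
  rewrite m30 eqxx orbF !mul0r !mulr0 !mul0r !addr0 => m0 E1 E2 E3 E4.
  have d30 : d3 = 0.
    case/orP: m0 => m0.
      by move/eqP: E2; rewrite mulf_eq0 (negPf m0) => /eqP.
    by move/eqP: E3; rewrite mulf_eq0 (negPf m0) => /eqP.
  move: E4; rewrite E1 addr0 => E4; rewrite d30 !scale0r !addr0.
  have [m10|m10] := eqVneq m1 0.
    move: m0; rewrite m10 eqxx /= => m20.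
    move/eqP: E1; rewrite mulf_eq0 (negPf m20) /= => /eqP ->.
    by exists m2, d1; right; rewrite !scale0r add0r addr0.
  move/eqP: E4; rewrite mulf_eq0 (negPf m10) /= => /eqP d10.
  move: (comb_neq0 d0); rewrite d10 d30 eqxx orbF /= => d20.
  move/eqP: E1; rewrite mulf_eq0 (negPf d20) orbF => /eqP ->.
  by exists m1, d2; left; rewrite !scale0r add0r addr0.
right.
have d30 : d3 != 0.
  apply/eqP => d30; move: (comb_neq0 d0); rewrite d30 eqxx orbF.
  move: E2 E3; rewrite d30 !mulr0 !add0r !addr0 => /eqP + /eqP.
  by rewrite !mulf_eq0 (negPf m30) /= => /eqP -> /eqP ->; rewrite eqxx.
split=> //; apply: (mulfI d30).
- have -> : d3 * (m1 + p * m3) ^+ 2 = m1 * (m1 * d3 + m3 * d1 + 2 * p * m3 * d3)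
     - m3 * (m1 * d1 + m2 * d2 + m3 * d3) + m3 * (m2 * d2 + dl * m3 * d3)
     + d3 * ((1 - dl + p ^+ 2) * m3 ^+ 2) by ring.
  by rewrite E1 E2 dt; ring.
- have -> : d3 * (m2 + q * m3) ^+ 2 = m2 * (m2 * d3 + m3 * d2 + 2 * q * m3 * d3)
     - m3 * (m2 * d2 + dl * m3 * d3) + d3 * ((dl + q ^+ 2) * m3 ^+ 2) by ring.
  by rewrite E1 E3; ring.
Qed.

(** A further pair would make both discriminants nonnegative, against the sign of their product. *)
Lemma crosscap_frame_pairs e f n dl p q : crosscap_frame B e f n dl p q ->
  factor_pairs [:: (e, f)].
Proof.
move=> [sf neg]; have [fr _ _] := sf; have [[ee ff _ [ef0 _ _]] bef] := fr.
split=> [e' f'|m d m0 d0 md bmd].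
  by rewrite inE => /eqP[-> ->].
exists e, f; split; first by rewrite inE.
have [m1 [m2 [m3 mE]]] := frame_span m fr; have [d1 [d2 [d3 dE]]] := frame_span d fr.
rewrite mE dE in m0 d0 md bmd *.
have [//|[m30 E1 E2]] := simple_frame_factor sf m0 d0 md bmd.
have m2p : 0 < m3 ^+ 2 by rewrite exprn_even_gt0.
have := sqr_ge0 (m1 + p * m3); have := sqr_ge0 (m2 + q * m3); rewrite E1 E2.
rewrite !pmulr_lge0// => h1 h2.
by have := mulr_ge0 h2 h1; rewrite leNgt neg.
Qed.

Lemma crosscap_frame_surface e f n dl p q :
  crosscap_frame B e f n dl p q -> crosscap_surface g.
Proof.
move=> cf; have fp := crosscap_frame_pairs cf; have [sf _] := cf.
have [c1 c2 dc tr] := simple_frame_crosscaps sf.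
have [[[ee ff _ [ef0 _ _]] _] _ _] := sf.
exists e, f, (arc_lift e f); split=> //.
- apply: (singular_points_are_pairs fp) => /=; rewrite !andbT.
  by apply: not_eqpm_neq; exact: not_eqpm_orthogonal.
- move=> a b Sa Sb nab gab; have [l [e' [f' [ef ->]]] H] := factor_pairs_double fp Sa Sb nab gab.
  by move: H; rewrite inE in ef; case/eqP: ef => -> -> H; exists (arc_lift e f).
Qed.

(** * Surfaces with a tangent double point curve *)

(** The tangent image is spanned by the images of two vectors, so it has a normal. *)
Lemma nu_exists u : dot u u = 1 -> exists2 nu : V3, nu != 0 &
  forall w, dot u w = 0 -> dot nu (bil B u w) = 0.
Proof.
move=> uu; have [x [y on]] := exists_orthonormal uu.
have [|nu nu0 [H1 H2 _]] := @not_indep3_dual _ (bil B u x) (bil B u y) (bil B u x).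
  move=> I; have [|/eqP] := I 1 0 (-1).
    by rewrite scale1r scale0r addr0 scaleN1r subrr.
  by rewrite oner_eq0.
exists nu => // w; have [a [b [c ->]]] := indep3_span (orthonormal_indep on) w.
have [h1 h2 h3 [h4 h5 h6]] := on.
rewrite !dotDr !dotZr (dotC u x) h5 (dotC u y) h6 uu !mulr0 !add0r mulr1 => ->.
by rewrite scale0r addr0 bilDr !bilZr dotDr !dotZr H1 H2 !mulr0 addr0.
Qed.

Lemma tangent_pairs_eqpm u u' : dot u u = 1 -> u' = u \/ u' = - u ->
  exists2 nu : V3, nu != 0 & forall w,
    (dot u w = 0 -> dot nu (bil B u w) = 0) /\ (dot u' w = 0 -> dot nu (bil B u' w) = 0).
Proof.
move=> uu H; have [nu nu0 Hn] := nu_exists uu; exists nu => // w; split; first exact: Hn.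
case: H => ->; first exact: Hn.
rewrite -scaleN1r dotZl bilZl dotZr => /eqP; rewrite mulf_eq0 oppr_eq0 oner_eq0 /=.
by move=> /eqP /Hn ->; rewrite mulr0.
Qed.

Lemma accelE a w : accel g a w = 2 *: (bil B w w - dot w w *: bil B a a).
Proof.
rewrite /accel (_ : (fun x => 'D_w g x) = fun x => 2 *: bil B x w); last first.
  by apply: funext => x; exact: derive_g.
rewrite (derive_g sB) (_ : 'D_w _ a = 2 *: bil B w w); last first.
  have E : \forall h \near 0^', 2 *: bil B w w =
      h^-1 *: (2 *: bil B (h *: w + a) w - 2 *: bil B a w).
    near=> h.
    have h0 : h != 0 by near: h; exact: nbhs_dnbhs_neq.
    rewrite bilDl bilZl; move: (bil B w w) (bil B a w) => *.
    by apply/rowP => i; rewrite !mxE; field.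
  apply: cvg_lim => //; apply: cvg_trans (near_eq_cvg E) _.
  exact: cvg_cst.
move: (bil B w w) (bil B a a) (dot w w) => *.
by apply/rowP => i; rewrite !mxE; ring.
Unshelve. all: by end_near. Qed.

Lemma two_neq0 : (2 : R) != 0. Proof. by rewrite pnatr_eq0. Qed.

Section TangentFrame.
Variables (e f n : V3) (a b : R).
Hypothesis tf : tangent_frame B e f n a b.
Let D := bil B f f - bil B e e.
Let X := bil B e n.
Let N := bil B n n - bil B e e.

(** A normal of the plane of [D] and [X] works at every point of the circle through [e] and [f],
    since B(f, n) lies in that plane. *)
Lemma tangent_frame_nu : exists2 nu : V3, nu != 0 & forall x1 x2 y1 y2 y3 : R,
  dot (x1 *: e + x2 *: f) (y1 *: e + y2 *: f + y3 *: n) = 0 ->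
  dot nu (bil B (x1 *: e + x2 *: f) (y1 *: e + y2 *: f + y3 *: n)) = 0.
Proof.
have [fr I Y] := tf; have [nu [nD nX nN]] := indep3_dual I 0 0 1.
exists nu.
  by apply/eqP => E; move: nN; rewrite E dot0l => /eqP; rewrite eq_sym oner_eq0.
move=> x1 x2 y1 y2 y3; rewrite (dot_arc fr) => E.
rewrite (bil_arc fr)// Y -scaleNr.
move: (bil B f f - bil B e e) (bil B e n) nD nX => d1 d2 nD nX.
by rewrite !(dotDr, dotZr) nD nX; ring.
Qed.

(** If d3 is nonzero, the [X] equation makes m proportional to b e + f; the [D] equation then fixes
    d2, and orthogonality gives b d1 + d2 = 0. If d3 = 0 only the pair (e, f) is left. *)
Lemma tangent_frame_factor (m1 m2 m3 d1 d2 d3 : R) :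
  let m := m1 *: e + m2 *: f + m3 *: n in let d := d1 *: e + d2 *: f + d3 *: n in
  m3 = 0 -> m != 0 -> d != 0 -> dot m d = 0 -> bil B m d = 0 ->
  factors_into m d e f \/
  [/\ m1 = b * m2, d2 = - (a / 2) * d3, b * d1 + d2 = 0, m2 != 0 & d3 != 0].
Proof.
move=> m d; rewrite /m /d => -> m0 d0; have [[on _] I _] := tf.
rewrite (dot_comb _ _ _ _ _ _ on) (tangent_bil sB _ _ _ _ _ _ tf) => dt.
rewrite dt scale0r add0r => /I[]; rewrite !mul0r !addr0 => E1 E2 _.
rewrite mul0r addr0 in dt.
have {}m0 : (m1 != 0) || (m2 != 0) by have := comb_neq0 m0; rewrite eqxx orbF.
have [d30|d30] := eqVneq d3 0.
  left; rewrite d30 !scale0r !addr0.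
  move: E1; rewrite d30 mulr0 mulr0 addr0 => E1.
  move: dt; rewrite E1 addr0 => E4.
  have [m10|m10] := eqVneq m1 0.
    move: m0; rewrite m10 eqxx /= => m20.
    move/eqP: E1; rewrite mulf_eq0 (negPf m20) /= => /eqP ->.
    by exists m2, d1; right; rewrite !scale0r add0r addr0.
  move/eqP: E4; rewrite mulf_eq0 (negPf m10) /= => /eqP d10.
  move: (comb_neq0 d0); rewrite d10 d30 eqxx orbF /= => d20.
  move/eqP: E1; rewrite mulf_eq0 (negPf d20) orbF => /eqP ->.
  by exists m1, d2; left; rewrite !scale0r add0r addr0.
right.
have m1E : m1 = b * m2.
  by apply: (mulIf d30); apply/eqP; rewrite -subr_eq0 -mulrA; apply/eqP.
have m20 : m2 != 0.
  by apply/eqP => m20; move: m0; rewrite m1E m20 mulr0 eqxx.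
have d2E : d2 = - (a / 2) * d3.
  by apply: (mulfI m20); apply/eqP; rewrite -subr_eq0; apply/eqP; rewrite -[RHS]E1; ring.
split=> //; apply: (mulfI m20); rewrite mulr0 -[RHS]dt m1E; ring.
Qed.

(** At c e + x f, with x = s or x = - s, the tangent image is the plane of [D] and [X] unless c = x
    b, the singular case. A tangent vector with n-coordinate k has X-component proportional to k (c
    - x b) and normal acceleration proportional to k^2, so the curvatures agree exactly when (c - s
    b)^2 = (c + s b)^2, that is, b = 0. *)
Lemma tangent_arc t : 0 < t < 1 ->
  let u := (arc_lift e f).1 t in let u' := (arc_lift e f).2 t in
  ~ singular_pt g u -> ~ singular_pt g u' ->
  tangent g u u' /\ (same_curvature g u u' <-> b = 0).
Proof.
move=> /andP[t0 t1]; rewrite /arc_lift /=.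
have s0 : Num.sqrt t != 0 by rewrite gt_eqF// sqrtr_gt0.
have c0 : Num.sqrt (1 - t) != 0 by rewrite gt_eqF// sqrtr_gt0 subr_gt0.
have cs : Num.sqrt (1 - t) ^+ 2 + Num.sqrt t ^+ 2 = 1.
  by rewrite !sqr_sqrtr ?subrK// ltW// subr_gt0.
move: (Num.sqrt t) (Num.sqrt (1 - t)) s0 c0 cs => s c s0 c0 cs.
rewrite -scaleNr; have s0' : - s != 0 by rewrite oppr_eq0.
have [fr I YE] := tf; have [on ef] := fr; have [ee ff nn [ef0 en fn]] := on.
have unit (x : R) : c ^+ 2 + x ^+ 2 = 1 -> S2 R (c *: e + x *: f).
  move=> E; rewrite /S2 /= -[f]addr0 -(scale0r n) -[x *: _]addr0.
  have := dot_arc fr c x c x 0; rewrite scale0r !addr0 => ->.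
  by rewrite -!expr2.
have nonsing (x : R) : x != 0 -> c ^+ 2 + x ^+ 2 = 1 ->
    ~ singular_pt g (c *: e + x *: f) -> c - x * b != 0.
  move=> x0 cx ns; apply/eqP => E; apply: ns; apply/(singular_ptE sB).
  split; first exact: unit.
  (* The kernel direction when c = x b: its e- and f-coordinates cancel the [D] term coming from
     B(f, n). *)
  exists ((x * a / (2 * c)) *: e + (- a / 2) *: f + 1 *: n).
  have dt : c * (x * a / (2 * c)) + x * (- a / 2) = 0 by field.
  rewrite (dot_arc fr) dt; split=> //.
    apply/eqP => E0; have [_ _ /eqP] := orthonormal_indep on E0.
    by rewrite oner_eq0.
  rewrite (bil_arc fr)// YE.
  have -> : c = x * b by apply/eqP; rewrite -subr_eq0 E.
  move: (bil B f f) (bil B e e) (bil B e n) => *.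
  by apply/rowP => i; rewrite !mxE; field.
have im (x : R) y : x != 0 -> c - x * b != 0 ->
    tangent_image g (c *: e + x *: f) y <-> exists al be : R, y = al *: D + be *: X.
  move=> x0 cx; rewrite (tangent_image_arc fr)// YE -/D -/X; split.
    move=> [b' [k ->]]; exists (x * b' + k * x * a / 2), (k * (c - x * b)).
    by clear; move: D X => *; apply/rowP => i; rewrite !mxE; field.
  move=> [al [be ->]]; pose k := be / (c - x * b).
  exists ((al - k * x * a / 2) / x), k; rewrite /k; clear - x0 cx; move: D X => *.
  by apply/rowP => i; rewrite !mxE; field; rewrite x0 cx.
have cs' : c ^+ 2 + (- s) ^+ 2 = 1 by rewrite sqrrN.
move=> ns ns'; have h1 := nonsing _ s0 cs ns; have h2 := nonsing _ s0' cs' ns'.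
split.
  split; [exact: ns|exact: ns'|]; apply/seteqP; split=> y.
    by move/(im _ _ s0 h1) => H; apply/im.
  by move/(im _ _ s0' h2) => H; apply/im.
have biluw (x a' b' k : R) : c * a' + x * b' = 0 ->
    bil B (c *: e + x *: f) (a' *: e + b' *: f + k *: n) =
    (x * b' + k * x * a / 2) *: D + (k * (c - x * b)) *: X.
  move=> E; rewrite (bil_arc fr)// YE -/D -/X; clear; move: D X => *.
  by apply/rowP => i; rewrite !mxE; field.
have acc (x a' b' k : R) nu : x != 0 -> c ^+ 2 + x ^+ 2 = 1 -> dot nu D = 0 -> dot nu X = 0 ->
    dot nu (accel g (c *: e + x *: f) (a' *: e + b' *: f + k *: n)) = 2 * k ^+ 2 * dot nu N.
  move=> x0 cx nD nX; rewrite accelE.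
  have -> : c *: e + x *: f = c *: e + x *: f + 0 *: n by rewrite scale0r addr0.
  rewrite !(tangent_bil sB _ _ _ _ _ _ tf) (dot_comb _ _ _ _ _ _ on) -/D -/X -/N.
  have E : c * c + x * x + 0 * 0 = 1 by rewrite -cx; ring.
  rewrite E; clear - nD nX; move: D X N (bil B e e) nD nX => d1 d2 d3 d4 nD nX.
  by rewrite !(dotDr, dotZr, dotNr) nD nX; ring.
split.
  move=> sc; have [nu [nD nX nN]] := indep3_dual I 0 0 1.
  have H : (c + s * b) ^+ 2 = (c - s * b) ^+ 2.
    have e1 : c * (s * a) + s * (- c * a) = 0 by ring.
    have e2 : c * 0 + - s * 0 = 0 by ring.
    (* Velocities with the same image: the n-coordinates c + s b and c - s b equalise the [X]
       components, the remaining ones the [D] components. *)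
    set w1 := (s * a) *: e + (- c * a) *: f + (c + s * b) *: n.
    set w2 := 0 *: e + 0 *: f + (c - s * b) *: n.
    have k1 y : tangent_image g (c *: e + s *: f) y -> dot nu y = 0.
      by move=> /(im _ _ s0 h1)[al [be ->]]; rewrite dotDr !dotZr nD nX !mulr0 addr0.
    have k2 : dot (c *: e + s *: f) w1 = 0 by rewrite (dot_arc fr).
    have k3 : dot (c *: e + (- s) *: f) w2 = 0 by rewrite (dot_arc fr).
    have k4 : bil B (c *: e + s *: f) w1 = bil B (c *: e + (- s) *: f) w2.
      by rewrite !biluw//; congr (_ *: _ + _ *: _); [field|ring].
    have k5 : 'D_w1 g (c *: e + s *: f) = 'D_w2 g (c *: e + (- s) *: f).
      by rewrite (derive_g sB) k4 -(derive_g sB).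
    have := sc nu w1 w2 k1 k2 k3 k5.
    move: (acc s (s * a) (- c * a) (c + s * b) nu s0 cs nD nX).
    move: (acc (- s) 0 0 (c - s * b) nu s0' cs' nD nX).
    rewrite -/w1 -/w2 => A2 A1 A12.
    have := etrans (esym A1) (etrans A12 A2); rewrite nN !mulr1 => /mulfI; apply.
    by rewrite pnatr_eq0.
  have : s * c * b = 0.
    have : 4 * (s * c * b) = (c + s * b) ^+ 2 - (c - s * b) ^+ 2 by ring.
    by rewrite H subrr => /eqP; rewrite mulf_eq0 pnatr_eq0 /= => /eqP.
  by move/eqP; rewrite !mulf_eq0 (negPf s0) (negPf c0) /= => /eqP.
move=> b0 nu w1 w2 Hnu.
have nD : dot nu D = 0.
  by apply: Hnu; apply/im => //; exists 1, 0; rewrite scale1r scale0r addr0.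
have nX : dot nu X = 0.
  by apply: Hnu; apply/im => //; exists 0, 1; rewrite scale1r scale0r add0r.
have [a1 [b1 [k1 ->]]] := frame_span w1 fr; have [a2 [b2 [k2 ->]]] := frame_span w2 fr.
rewrite !(dot_arc fr) => e1 e2 E0.
have {E0} E : bil B (c *: e + s *: f) (a1 *: e + b1 *: f + k1 *: n) =
    bil B (c *: e + (- s) *: f) (a2 *: e + b2 *: f + k2 *: n).
  by apply: (scalerI two_neq0); rewrite -!(derive_g sB).
have {}E := etrans (esym (biluw s a1 b1 k1 e1)) (etrans E (biluw (- s) a2 b2 k2 e2)).
apply: (etrans (acc s a1 b1 k1 nu s0 cs nD nX)).
apply: esym; apply: (etrans (acc (- s) a2 b2 k2 nu s0' cs' nD nX)).
suff -> : k1 = k2 by [].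
have E3 : (s * b1 + k1 * s * a / 2 - (- s * b2 + k2 * - s * a / 2)) *: D +
    (k1 * (c - s * b) - k2 * (c - - s * b)) *: X + 0 *: N = 0.
  move/eqP: E; rewrite -subr_eq0 => /eqP <-.
  by clear; move: D X N => *; apply/rowP => i; rewrite !mxE; ring.
have [_ /eqP + _] := I _ _ _ E3.
rewrite b0 !mulr0 !subr0 -mulrBl mulf_eq0 (negPf c0) orbF subr_eq0 => /eqP //.
Qed.

Lemma tangent_frame_D_neq0 : bil B e e != bil B f f.
Proof.
have [_ I _] := tf; have [D0 _ _] := indep3_neq0 I.
by rewrite eq_sym -subr_eq0.
Qed.

(** If every pair of distinct, non-antipodal double points near [x] lies on the circle through [e]
    and [f], the normal of [tangent_frame_nu] serves them all. *)
Lemma tangent_pairs_near_frame x U : nbhs x U ->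
  (forall u u', U u -> U u' -> u + u' != 0 -> u - u' != 0 ->
     dot (u + u') (u - u') = 0 -> bil B (u + u') (u - u') = 0 ->
     factors_into (u + u') (u - u') e f) -> tangent_pairs_near B x.
Proof.
move=> xU H; exists U => // u u' Uu Uu' Su Su' E.
have [bE dE] := double_pair sB E Su Su'.
have [d0|d0] := eqVneq (u - u') 0.
  by apply: (tangent_pairs_eqpm Su); left; apply/eqP; rewrite eq_sym -subr_eq0 d0.
have [m0|m0] := eqVneq (u + u') 0.
  by apply: (tangent_pairs_eqpm Su); right; apply/eqP; rewrite -addr_eq0 addrC m0.
have [mu [ka F]] := H _ _ Uu Uu' m0 d0 dE bE.
have uE : u = 2^-1 *: ((u + u') + (u - u')).
  by apply/rowP => i; rewrite !mxE; field.
have u'E : u' = 2^-1 *: ((u + u') - (u - u')).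
  by apply/rowP => i; rewrite !mxE; field.
have [nu nu0 Hnu] := tangent_frame_nu; have [fr _ _] := tf.
have pl (w : V3) : (exists y1 y2 : R, w = y1 *: e + y2 *: f) ->
    forall z, dot w z = 0 -> dot nu (bil B w z) = 0.
  move=> [y1 [y2 ->]] z; have [z1 [z2 [z3 ->]]] := frame_span z fr; exact: Hnu.
exists nu => // w; split; apply: pl.
  case: F => [[E1 E2]|[E1 E2]]; rewrite uE E1 E2.
    by exists (2^-1 * mu), (2^-1 * ka); rewrite scalerDr !scalerA.
  by exists (2^-1 * ka), (2^-1 * mu); rewrite scalerDr !scalerA addrC.
case: F => [[E1 E2]|[E1 E2]]; rewrite u'E E1 E2.
  by exists (2^-1 * mu), (- (2^-1 * ka)); rewrite scaleNr scalerBr !scalerA.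
by exists (- (2^-1 * ka)), (2^-1 * mu); rewrite scaleNr scalerBr !scalerA addrC.
Qed.

Lemma non_fin_det_tangent : tangent_pairs_near B e -> non_fin_det_pt g e.
Proof.
move=> tp; have [[on ef] I YE] := tf.
by apply: (non_fin_det_odd sB on ef tp I (a := a / 2) (b := - b)); rewrite scaleNr.
Qed.

Lemma non_fin_det_tangent_end : tangent_pairs_near B f -> non_fin_det_pt g f.
Proof.
move=> tp; have [fr I YE] := tf; have [on fe] := frame_swap sB fr.
apply: (non_fin_det_even sB on fe tp (P := N) (a := - (a / 2)) (b := - b)).
  move=> x y z; rewrite -/X -[bil B e e - _]opprB -/D scalerN -scaleNr.
  by move=> /I[/eqP + -> ->]; rewrite oppr_eq0 => /eqP.
rewrite YE -[bil B e e - _]opprB scalerN !scaleNr opprK //.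
Qed.

End TangentFrame.

(** The basis vector B(n, n) - B(e, e) occurs with coefficient m3 d3. *)
Lemma tangent_frame_third e f n a b (m1 m2 m3 d1 d2 d3 : R) :
  tangent_frame B e f n a b ->
  let m := m1 *: e + m2 *: f + m3 *: n in let d := d1 *: e + d2 *: f + d3 *: n in
  dot m d = 0 -> bil B m d = 0 -> m3 * d3 = 0.
Proof.
move=> tf m d; have [[on _] I _] := tf.
rewrite /m /d (dot_comb _ _ _ _ _ _ on) (tangent_bil sB _ _ _ _ _ _ tf) => ->.
by rewrite scale0r add0r => /I[_ _].
Qed.

(** By [tangent_frame_third] one factor has no n-coordinate, so in a member other than e f it is
    proportional to b e + f. For b nonzero its partner is a multiple of (a / (2 b), - a / 2, 1),
    cleared of denominators by 2 b; for b = 0 such a member needs a = 0. *)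
Lemma tangent_frame_factors e f n a b m d : tangent_frame B e f n a b ->
  m != 0 -> d != 0 -> dot m d = 0 -> bil B m d = 0 ->
  [\/ factors_into m d e f, a = 0 /\ b = 0 |
     b != 0 /\ exists la mu : R, la != 0 /\ mu != 0 /\
      (m = la *: (b *: e + f) /\ d = mu *: (a *: e - (a * b) *: f + (2 * b) *: n) \/
       d = la *: (b *: e + f) /\ m = mu *: (a *: e - (a * b) *: f + (2 * b) *: n))].
Proof.
move=> tf m0 d0 md bmd; have [fr _ _] := tf.
have key (m1 m2 m3 d1 d2 d3 : R) : let m := m1 *: e + m2 *: f + m3 *: n in
   let d := d1 *: e + d2 *: f + d3 *: n in
   m3 = 0 -> m != 0 -> d != 0 -> dot m d = 0 -> bil B m d = 0 ->
   [\/ factors_into m d e f, a = 0 /\ b = 0 |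
     b != 0 /\ exists la mu : R, la != 0 /\ mu != 0 /\
      (m = la *: (b *: e + f) /\ d = mu *: (a *: e - (a * b) *: f + (2 * b) *: n))].
  move=> m' d' m3z m'0 d'0 md' bmd'.
  case: (tangent_frame_factor tf m3z m'0 d'0 md' bmd') => [?|[m1E d2E bE m20 d30]].
    by constructor 1.
  have [b0|b0] := eqVneq b 0.
    constructor 2; split=> //; move: bE; rewrite b0 mul0r add0r d2E => /eqP.
    by rewrite mulf_eq0 (negPf d30) orbF oppr_eq0 mulf_eq0 invr_eq0 pnatr_eq0 orbF => /eqP.
  constructor 3; split=> //; exists m2, (d3 / (2 * b)); split=> //; split.
    by rewrite mulf_neq0// invr_eq0 mulf_neq0// pnatr_eq0.
  have d1E : d1 = (a / (2 * b)) * d3.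
    apply: (mulfI b0); transitivity (- d2); first by apply/eqP; rewrite -addr_eq0 bE.
    by rewrite d2E; field.
  rewrite /m' /d' m1E m3z d1E d2E; split; apply/rowP => i; rewrite !mxE; first by ring.
  by field.
have [m1 [m2 [m3 mE]]] := frame_span m fr; have [d1 [d2 [d3 dE]]] := frame_span d fr.
rewrite mE dE in m0 d0 md bmd *.
have /eqP := tangent_frame_third tf md bmd; rewrite mulf_eq0 => /orP[]/eqP z0.
  case: (key _ _ _ _ _ _ z0 m0 d0 md bmd) => [?|?|[b0 [la [mu [la0 [mu0 H]]]]]].
  - by constructor 1.
  - by constructor 2.
  - by constructor 3; split=> //; exists la, mu; do 2 split=> //; left.
rewrite dotC in md; rewrite bilC// in bmd.
case: (key _ _ _ _ _ _ z0 d0 m0 md bmd) => [?|?|[b0 [la [mu [la0 [mu0 H]]]]]].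
- by constructor 1; exact: factors_into_sym.
- by constructor 2.
- by constructor 3; split=> //; exists la, mu; do 2 split=> //; right.
Qed.

Lemma type6_factors e f n a m d : tangent_frame B e f n a 0 -> a != 0 ->
  m != 0 -> d != 0 -> dot m d = 0 -> bil B m d = 0 -> factors_into m d e f.
Proof.
move=> tf a0 m0 d0 md bmd.
case: (tangent_frame_factors tf m0 d0 md bmd) => [//|[/eqP]|[/eqP//]].
by rewrite (negPf a0).
Qed.

Lemma type6_frame e f n a : tangent_frame B e f n a 0 -> a != 0 -> type6_surface g.
Proof.
move=> tf a0; have [fr I YE] := tf; have [[ee ff _ [ef0 _ _]] bef] := fr.
have fp : factor_pairs [:: (e, f)].
  split=> [e' f'|m d m0 d0 md bmd]; first by rewrite inE => /eqP[-> ->].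
  by exists e, f; split; [rewrite inE|exact: type6_factors tf a0 m0 d0 md bmd].
have tp x : tangent_pairs_near B x.
  apply: (tangent_pairs_near_frame tf (@filterT _ (nbhs x) _)) => u u' _ _ m0 d0 md bmd.
  exact: type6_factors tf a0 m0 d0 md bmd.
exists e, f, (arc_lift e f); split.
- apply: (singular_points_are_pairs fp) => /=; rewrite !andbT.
  by apply: not_eqpm_neq; exact: not_eqpm_orthogonal.
- by move=> x; exact: tangent_pairs_not_crosscap.
- by split; [exact: non_fin_det_tangent tf _|exact: non_fin_det_tangent_end tf _].
- split; first by apply: double_curve_arc => //; exact: tangent_frame_D_neq0 tf.
  move=> t tI n1 n2; have [? H] := tangent_arc tf tI n1 n2.
  by split; [assumption|split=> _; [|exact: H.2]].
- move=> x y Sa Sb nab gab; have [l [e' [f' [ef ->]]] H] := factor_pairs_double fp Sa Sb nab gab.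
  by move: H; rewrite inE in ef; case/eqP: ef => -> -> H; exists (arc_lift e f).
Qed.

End FactorPairs.

(** * Type 5 surfaces *)

Section Type5.
Variables (R : realType) (B : 'I_3 -> 'M[R]_3).
Hypothesis sB : forall i, (B i)^T = B i.
Notation g := (fun u => bil B u u).
Notation V3 := ('rV[R]_3).
Variables (e f n : V3) (a b : R).
Hypotheses (tf : tangent_frame B e f n a b) (b0 : b != 0).
Let D := bil B f f - bil B e e.
Let X := bil B e n.
Let N := bil B n n - bil B e e.

Let eh : V3 := b *: e + f.
Let fh : V3 := a *: e - (a * b) *: f + (2 * b) *: n.
(** The cross product of [eh] and [fh], computed in the coordinates of the frame. *)
Let nh : V3 := (2 * b) *: e - (2 * b ^+ 2) *: f - (a * (1 + b ^+ 2)) *: n.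

Let ehE : eh = b *: e + 1 *: f + 0 *: n.
Proof. by rewrite scale1r scale0r addr0. Qed.
Let fhE : fh = a *: e + (- (a * b)) *: f + (2 * b) *: n.
Proof. by rewrite scaleNr. Qed.
Let nhE : nh = (2 * b) *: e + (- (2 * b ^+ 2)) *: f + (- (a * (1 + b ^+ 2))) *: n.
Proof. by rewrite !scaleNr. Qed.

Let b2 : 0 < b ^+ 2. Proof. by rewrite exprn_even_gt0. Qed.
Let b21 : 0 < 1 + b ^+ 2. Proof. by rewrite addr_gt0. Qed.
Let on : orthonormal e f n. Proof. by case: tf => [[]]. Qed.

Let eh0 : eh != 0.
Proof.
apply/eqP; rewrite ehE => E; have [_ /eqP + _] := orthonormal_indep on E.
by rewrite oner_eq0.
Qed.
Let fh0 : fh != 0.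
Proof.
apply/eqP; rewrite fhE => E; have [_ _ /eqP] := orthonormal_indep on E.
by rewrite mulf_eq0 pnatr_eq0 (negPf b0).
Qed.
Let nh0 : nh != 0.
Proof.
apply/eqP; rewrite nhE => E; have [/eqP + _ _] := orthonormal_indep on E.
by rewrite mulf_eq0 pnatr_eq0 (negPf b0).
Qed.

Let e1 := normalize eh.
Let f1 := normalize fh.
Let n1 := normalize nh.

Let dot_norm (x y : V3) : dot x y = 0 -> dot (normalize x) (normalize y) = 0.
Proof. by move=> E; rewrite /normalize dotZl dotZr E !mulr0. Qed.

Let on1 : orthonormal e1 f1 n1.
Proof.
split; try exact: dot_normalize; split; apply: dot_norm.
- by rewrite ehE fhE (dot_comb _ _ _ _ _ _ on); ring.
- by rewrite ehE nhE (dot_comb _ _ _ _ _ _ on); ring.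
- by rewrite fhE nhE (dot_comb _ _ _ _ _ _ on); ring.
Qed.

Let bef1 : bil B e1 f1 = 0.
Proof.
rewrite /e1 /f1 /normalize bilZl bilZr ehE fhE (tangent_bil sB _ _ _ _ _ _ tf).
have -> : b * a + 1 * - (a * b) + 0 * (2 * b) = 0 by ring.
have -> : 1 * - (a * b) + a / 2 * (1 * (2 * b) + 0 * - (a * b)) = 0 by field.
have -> : b * (2 * b) + 0 * a - b * (1 * (2 * b) + 0 * - (a * b)) = 0 by ring.
have -> : 0 * (2 * b) = 0 :> R by ring.
by rewrite !scale0r !addr0 !scaler0.
Qed.

Let fr1 : frame B e1 f1 n1. Proof. by []. Qed.

(** Expanded in the basis of the tangent frame, x3 times the second relation minus x2 times the
    third isolates [z] with a nonvanishing factor; [x] and [y] follow. So the second pair carries a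
    transversal double curve ending in cross-caps. *)
Let indep1 : indep3 (bil B f1 f1 - bil B e1 e1) (bil B e1 n1) (bil B f1 n1).
Proof.
have [h1 h2 h3 [h4 h5 h6]] := on1; have [_ I _] := tf.
rewrite /e1 /f1 /n1 /normalize in h1 h2 h3 h5 h6 *.
have l0 := sqrt_dot_neq0 eh0; have k0 := sqrt_dot_neq0 fh0; have m0 := sqrt_dot_neq0 nh0.
move: ((Num.sqrt (dot eh eh))^-1) ((Num.sqrt (dot fh fh))^-1) ((Num.sqrt (dot nh nh))^-1)
  l0 k0 m0 h1 h2 h3 h5 h6 => la mu nu la0 mu0 nu0 h1 h2 h3 h5 h6.
rewrite !(dotZl, dotZr) in h1 h2.
have S (x y : R) (u w : V3) : bil B (x *: u) (y *: w) = (x * y) *: bil B u w.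
  by rewrite bilZl bilZr scalerA.
have d1 : la * (la * (1 + b ^+ 2)) = 1.
  by rewrite -[RHS]h1 ehE (dot_comb _ _ _ _ _ _ on); ring.
have d2 : mu * (mu * (a ^+ 2 * (1 + b ^+ 2) + 4 * b ^+ 2)) = 1.
  by rewrite -[RHS]h2 fhE (dot_comb _ _ _ _ _ _ on); ring.
pose x1 := mu ^+ 2 * (a ^+ 2 * b ^+ 2 + a / 2 * (2 * - (a * b) * (2 * b))) - la ^+ 2.
pose x2 := 4 * a * b * mu ^+ 2 * (1 + b ^+ 2).
pose x3 := mu ^+ 2 * (4 * b ^+ 2).
pose ka := - (2 * b ^+ 2) - a ^+ 2 / 2 * (1 + b ^+ 2).
pose y1 := 2 * a * b ^+ 3 + a / 2 * (a ^+ 2 * b * (1 + b ^+ 2) - 4 * b ^+ 3).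
pose y2 := (1 + b ^+ 2) * (4 * b ^+ 2 - a ^+ 2 * (1 + b ^+ 2)).
pose y3 := - (2 * a * b * (1 + b ^+ 2)).
have E1 : bil B (mu *: fh) (mu *: fh) - bil B (la *: eh) (la *: eh) = x1 *: D + x2 *: X + x3 *: N.
  rewrite !S fhE ehE !(tangent_bil sB _ _ _ _ _ _ tf) -/D -/X -/N /x1 /x2 /x3.
  move: D X N (bil B e e) => p q r s.
  apply/rowP => i; rewrite !mxE; apply/eqP; rewrite -subr_eq0; apply/eqP.
  transitivity ((mu * (mu * (a ^+ 2 * (1 + b ^+ 2) + 4 * b ^+ 2))
    - la * (la * (1 + b ^+ 2))) * s 0 i); first by field.
  by rewrite d1 d2 subrr mul0r.
have E2 : bil B (la *: eh) (nu *: nh) = (la * nu * ka) *: D.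
  rewrite S ehE nhE (tangent_bil sB _ _ _ _ _ _ tf) -/D -/X -/N /ka.
  move: D X N (bil B e e) => p q r s.
  by apply/rowP => i; rewrite !mxE; field.
have E3 : bil B (mu *: fh) (nu *: nh) = (mu * nu) *: (y1 *: D + y2 *: X + y3 *: N).
  rewrite S fhE nhE (tangent_bil sB _ _ _ _ _ _ tf) -/D -/X -/N /y1 /y2 /y3.
  move: D X N (bil B e e) => p q r s.
  by apply/rowP => i; rewrite !mxE; field.
move=> x y z; rewrite E1 E2 E3 => E.
have [|_ F2 F3] := I (x * x1 + y * (la * nu * ka) + z * (mu * nu * y1))
  (x * x2 + z * (mu * nu * y2)) (x * x3 + z * (mu * nu * y3)).
  rewrite -[RHS]E -/D -/X -/N; move: D X N => p q r.
  by apply/rowP => i; rewrite !mxE; ring.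
have ka0 : ka != 0.
  have := mulr_ge0 (sqr_ge0 a) (ltW b21) => H.
  have -> : ka = - ((4 * b ^+ 2 + a ^+ 2 * (1 + b ^+ 2)) / 2) by rewrite /ka; field.
  have k0 : 0 < 4 * b ^+ 2 + a ^+ 2 * (1 + b ^+ 2).
    by apply: ltr_wpDr => //; rewrite mulr_gt0.
  by rewrite oppr_eq0 gt_eqF// divr_gt0.
have z0 : z = 0.
  have H : z * (mu ^+ 3 * nu * b ^+ 2 * (1 + b ^+ 2) * (a ^+ 2 * (1 + b ^+ 2) + 4 * b ^+ 2)) = 0.
    have -> : z * (mu ^+ 3 * nu * b ^+ 2 * (1 + b ^+ 2) * (a ^+ 2 * (1 + b ^+ 2) + 4 * b ^+ 2)) =
      (x3 * (x * x2 + z * (mu * nu * y2)) - x2 * (x * x3 + z * (mu * nu * y3))) / 4.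
      by rewrite /x2 /x3 /y2 /y3; field.
    by rewrite F2 F3 !mulr0 subrr mul0r.
  have k0 : a ^+ 2 * (1 + b ^+ 2) + 4 * b ^+ 2 != 0.
    by apply/eqP => K; move: d2; rewrite K !mulr0 => /eqP; rewrite eq_sym oner_eq0.
  move/eqP: H; rewrite mulf_eq0 => /orP[/eqP //|].
  have b20 : 1 + b ^+ 2 != 0 by rewrite gt_eqF.
  by apply: contraTeq => _; do 4![apply: mulf_neq0 => //]; exact: expf_neq0.
have x0 : x = 0.
  move/eqP: F3; rewrite z0 mul0r addr0 mulf_eq0 => /orP[/eqP //|].
  apply: contraTeq => _; apply: mulf_neq0; first exact: expf_neq0.
  by rewrite mulf_neq0 ?expf_neq0 ?pnatr_eq0.
split=> //; move: E; rewrite x0 z0 !scale0r add0r addr0 => /eqP.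
rewrite scalerA scaler_eq0 !mulf_eq0 (negPf la0) (negPf nu0) (negPf ka0) !orbF.
by have [D0 _ _] := indep3_neq0 I; rewrite (negPf D0) orbF => /eqP.
Qed.

Let fp : factor_pairs B [:: (e1, f1); (e, f)].
Proof.
have [ee ff _ [ef0 _ _]] := on; have [h1 h2 _ [h4 _ _]] := on1; have [[_ bef] _ _] := tf.
split=> [e' f'|m d m0 d0 md bmd]; first by rewrite !inE => /orP[]/eqP[-> ->].
case: (tangent_frame_factors sB tf m0 d0 md bmd) => [H|[_ /eqP]|[_ [la [mu [la0 [mu0 H]]]]]].
- by exists e, f; rewrite !inE eqxx orbT.
- by rewrite (negPf b0).
exists e1, f1; split; first by rewrite !inE eqxx.
have U (x : V3) : x != 0 -> x = Num.sqrt (dot x x) *: normalize x.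
  by move=> x0; rewrite /normalize scalerA divff ?scale1r// sqrtr_eq0 -ltNge dot_gt0.
case: H => [[mE dE]|[dE mE]]; last exists (mu * Num.sqrt (dot fh fh)), (la * Num.sqrt (dot eh eh)).
  exists (la * Num.sqrt (dot eh eh)), (mu * Num.sqrt (dot fh fh)).
  by left; split; [rewrite mE -[RHS]scalerA -(U _ eh0)|rewrite dE -[RHS]scalerA -(U _ fh0)].
by right; split; [rewrite mE -[RHS]scalerA -(U _ fh0)|rewrite dE -[RHS]scalerA -(U _ eh0)].
Qed.

(** Linear forms positive near [e] and vanishing on [eh], respectively [fh], keep u + u' off the
    factors of the second pair, so close double pairs come from the tangent curve. *)
Let tpe : tangent_pairs_near B e.
Proof.
pose L1 (u : V3) := dot (e - b *: f) u; pose L2 (u : V3) := dot (b ^+ 2 *: e + b *: f) u.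
have [ee ff _ [ef0 _ _]] := on.
have cL (t : V3) : Ck_on 0 setT (fun u : V3 => dot t u).
  apply: (@Ck_on_eq _ _ _ _ _ (fun w : V3 => t 0 0 * w 0 0 + t 0 1 * w 0 1 + t 0 2%:R * w 0 2%:R)).
  - exact: openT.
  - by move=> w _; rewrite dotE.
  - ck.
have U1 : nbhs e [set u | 0 < L1 u].
  apply: open_nbhs_nbhs; split; first exact: Ck_on_open_pos (cL _).
  by rewrite /L1 /= dotDl -scaleN1r !dotZl ee (dotC f) ef0 !mulr0 addr0 ltr01.
have U2 : nbhs e [set u | 0 < L2 u].
  apply: open_nbhs_nbhs; split; first exact: Ck_on_open_pos (cL _).
  by rewrite /L2 /= dotDl !dotZl ee (dotC f) ef0 mulr0 addr0 mulr1.
apply: (tangent_pairs_near_frame sB tf (filterI U1 U2)) => u u' [u1 u2] [u1' u2'] m0 d0 md bmd.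
have m1 : L1 (u + u') != 0 by rewrite gt_eqF// /L1 dotDr addr_gt0.
have m2 : L2 (u + u') != 0 by rewrite gt_eqF// /L2 dotDr addr_gt0.
case: (tangent_frame_factors sB tf m0 d0 md bmd) => [//|[_ /eqP]|[_ [la [mu [la0 [mu0 H]]]]]].
  by rewrite (negPf b0).
exfalso; case: H => [[mE _]|[_ mE]].
  move/eqP: m1; apply; rewrite mE /L1.
  have -> : e - b *: f = 1 *: e + (- b) *: f + 0 *: n by rewrite scale1r scaleNr scale0r addr0.
  by rewrite -/eh ehE dotZr (dot_comb _ _ _ _ _ _ on); ring.
move/eqP: m2; apply; rewrite mE /L2.
have -> : b ^+ 2 *: e + b *: f = b ^+ 2 *: e + b *: f + 0 *: n by rewrite scale0r addr0.
by rewrite -/fh fhE dotZr (dot_comb _ _ _ _ _ _ on); ring.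
Qed.

Let tpf : tangent_pairs_near B f.
Proof.
pose L1 (u : V3) := dot (b ^+ 2 *: f - b *: e) u; pose L2 (u : V3) := dot (b *: e + f) u.
have [ee ff _ [ef0 _ _]] := on.
have cL (t : V3) : Ck_on 0 setT (fun u : V3 => dot t u).
  apply: (@Ck_on_eq _ _ _ _ _ (fun w : V3 => t 0 0 * w 0 0 + t 0 1 * w 0 1 + t 0 2%:R * w 0 2%:R)).
  - exact: openT.
  - by move=> w _; rewrite dotE.
  - ck.
have U1 : nbhs f [set u | 0 < L1 u].
  apply: open_nbhs_nbhs; split; first exact: Ck_on_open_pos (cL _).
  by rewrite /L1 /= dotDl -scaleN1r !dotZl ff ef0 !mulr0 addr0 mulr1.
have U2 : nbhs f [set u | 0 < L2 u].
  apply: open_nbhs_nbhs; split; first exact: Ck_on_open_pos (cL _).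
  by rewrite /L2 /= dotDl !dotZl ff ef0 mulr0 add0r ltr01.
apply: (tangent_pairs_near_frame sB tf (filterI U1 U2)) => u u' [u1 u2] [u1' u2'] m0 d0 md bmd.
have m1 : L1 (u + u') != 0 by rewrite gt_eqF// /L1 dotDr addr_gt0.
have m2 : L2 (u + u') != 0 by rewrite gt_eqF// /L2 dotDr addr_gt0.
case: (tangent_frame_factors sB tf m0 d0 md bmd) => [//|[_ /eqP]|[_ [la [mu [la0 [mu0 H]]]]]].
  by rewrite (negPf b0).
exfalso; case: H => [[mE _]|[_ mE]].
  move/eqP: m1; apply; rewrite mE /L1.
  have -> : b ^+ 2 *: f - b *: e = (- b) *: e + b ^+ 2 *: f + 0 *: n.
    by rewrite scaleNr scale0r addr0 addrC.
  by rewrite -/eh ehE dotZr (dot_comb _ _ _ _ _ _ on); ring.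
move/eqP: m2; apply; rewrite mE /L2.
have -> : b *: e + f = b *: e + 1 *: f + 0 *: n by rewrite scale1r scale0r addr0.
by rewrite -/fh fhE dotZr (dot_comb _ _ _ _ _ _ on); ring.
Qed.

Lemma type5_frame : type5_surface g.
Proof.
have [dl [p [q sf]]] := frame_simple fr1 indep1.
have [c1 c2 dc tr] := simple_frame_crosscaps sB sf.
have [ee ff _ [ef0 _ _]] := on; have [h1 h2 _ [h4 _ _]] := on1; have [fr _ _] := tf.
have bef := fr.2.
have NE (u w : V3) : dot u u = 1 -> (exists t, dot t u = 0 /\ dot t w != 0) -> ~ eqpm u w.
  by move=> uu [t [tu tw]] [E|E]; move/eqP: tw; apply;
    rewrite -?E // -[w]opprK -E -scaleN1r dotZr tu mulr0.
have le0 := sqrt_dot_neq0 eh0; have lf0 := sqrt_dot_neq0 fh0.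
exists e1, f1, e, f, (arc_lift e1 f1), (arc_lift e f); split.
- apply: (singular_points_are_pairs sB fp) => /=; rewrite !andbT.
  have ort (x y : V3) : dot x x = 1 -> dot x y = 0 -> (x != y) && (x != - y).
    by move=> xx xy; apply: not_eqpm_neq; exact: not_eqpm_orthogonal.
  have flip (x y : V3) : (y != x) && (y != - x) -> (x != y) && (x != - y).
    by rewrite !(eq_sym y) => /andP[-> H]; apply: contra H => /eqP ->; rewrite opprK.
  have [_ _ nn [_ en fn]] := on.
  have fe1 : dot f eh = 1 by rewrite /eh dotDr dotZr (dotC f e) ef0 ff mulr0 add0r.
  have ee1 : dot e eh = b by rewrite /eh dotDr dotZr ee ef0 mulr1 addr0.
  have nf1 : dot n fh = 2 * b.
    by rewrite fhE !dotDr !dotZr (dotC n e) en (dotC n f) fn nn !mulr0 !add0r mulr1.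
  rewrite (ort _ _ h1 h4) (ort _ _ ee ef0) andbT /=; apply/andP; split; apply/andP; split;
    apply: flip; apply: not_eqpm_neq; apply: NE => //.
  + by exists f; rewrite dotC ef0 dotZr fe1 mulr1.
  + by exists e; rewrite ef0 dotZr ee1 mulf_neq0.
  + by exists n; rewrite dotC en dotZr nf1 !mulf_neq0// pnatr_eq0.
  + by exists n; rewrite dotC fn dotZr nf1 !mulf_neq0// pnatr_eq0.
- by [].
- by split; [exact: (non_fin_det_tangent sB tf tpe)|exact: (non_fin_det_tangent_end sB tf tpf)].
- by [].
- split.
  + by apply: (double_curve_arc sB) => //; exact: tangent_frame_D_neq0 tf.
  + move=> t tI n2 n3; have [H1 H2] := tangent_arc sB tf tI n2 n3.
    split; first exact: H1.
    split=> [/H2.1 E|E]; first by move/eqP: b0; case.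
    by case: (elimF idP (erefl false) E).
  + move=> x y Sa Sb nab gab; have [l [e' [f' [ef ->]]] H] := factor_pairs_double sB fp Sa Sb nab gab.
    move: H; rewrite !inE in ef; case/orP: ef => /eqP[-> ->] H.
      by exists (arc_lift e1 f1) => //; left.
    by exists (arc_lift e f) => //; right.
  (* The unit vector [e1] lies on the circle through [e] and [f], and the square of its
     f-coordinate, 1 / (1 + b^2), is its parameter on the arc. *)
  + pose t := (Num.sqrt (dot eh eh))^-1 ^+ 2.
    have d1 : dot eh eh = 1 + b ^+ 2.
      by rewrite ehE (dot_comb _ _ _ _ _ _ on); ring.
    have tE : t = (1 + b ^+ 2)^-1 by rewrite /t exprVn sqr_sqrtr d1// ltW.
    have tI : 0 <= t <= 1.
      by rewrite tE invr_ge0 ltW//= invf_le1// lerDl ltW.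
    exists t; first by rewrite /= in_itv.
    rewrite /comp; have [-> _] := arc_lift_image sB bef tI.
    rewrite /e1 /normalize bilZl bilZr scalerA -expr2 -/t /eh !(bilDl, bilDr, bilZl, bilZr).
    rewrite (bilC f e sB) bef !scaler0 addr0 add0r scalerDr.
    congr (_ + _); rewrite !scalerA; congr (_ *: _).
    by rewrite tE; field; rewrite gt_eqF.
Qed.

End Type5.

(** * Roman Steiner surfaces *)

Lemma pairwise6 (T : Type) (r : T -> T -> bool) (a b c d e f : T) :
  [/\ r a b, r c d & r e f] /\
  [/\ r a c /\ r a d, r b c /\ r b d, r a e /\ r a f, r b e /\ r b f
    & (r c e /\ r c f) /\ (r d e /\ r d f)] ->
  pairwise r [:: a; b; c; d; e; f].
Proof.
move=> [[ab cd ef] [[ac ad] [bc bd] [ae af] [be bf] [[ce cf] [de df]]]].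
by rewrite /= ab ac ad ae af bc bd be bf cd ce cf de df ef.
Qed.

Section SteinerBasis.
Variables (R : realType) (B : 'I_3 -> 'M[R]_3).
Hypothesis sB : forall i, (B i)^T = B i.
Notation g := (fun u => bil B u u).
Notation V3 := ('rV[R]_3).
Implicit Types (u w m d : V3).

Definition cross_term (y u w : V3) : V3 := bil B u w - dot u w *: y.

(* In the basis [p1], [p2], [p3] the quadratic map becomes
   [|u|^2 y + 2 (u1 u2 z12 + u1 u3 z13 + u2 u3 z23)]. *)
Definition steiner_basis (y p1 p2 p3 : V3) : Prop :=
  [/\ [/\ dot p1 p1 = 1, dot p2 p2 = 1 & dot p3 p3 = 1], indep3 p1 p2 p3,
      [/\ bil B p1 p1 = y, bil B p2 p2 = y & bil B p3 p3 = y]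
    & indep3 (cross_term y p1 p2) (cross_term y p1 p3) (cross_term y p2 p3)].

Lemma cross_termC y u w : cross_term y u w = cross_term y w u.
Proof. by rewrite /cross_term dotC bilC. Qed.

Lemma indep3_rot (x y z : V3) : indep3 x y z -> indep3 y z x.
Proof.
by move=> I a b c E; have [|-> -> ->] := I c a b; first by rewrite -[RHS]E -addrA addrC.
Qed.

Lemma indep3_swap (x y z : V3) : indep3 x y z -> indep3 y x z.
Proof.
by move=> I a b c E; have [|-> -> ->] := I b a c; first by rewrite (addrC (b *: _)).
Qed.

Lemma steiner_basis_rot y p1 p2 p3 : steiner_basis y p1 p2 p3 -> steiner_basis y p2 p3 p1.
Proof.
move=> [[h1 h2 h3] I [g1 g2 g3] Z]; split=> //; first exact: indep3_rot.
rewrite (cross_termC y p2 p1) (cross_termC y p3 p1); exact: indep3_rot (indep3_rot Z).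
Qed.

Lemma steiner_basis_swap y p1 p2 p3 : steiner_basis y p1 p2 p3 -> steiner_basis y p2 p1 p3.
Proof.
move=> [[h1 h2 h3] I [g1 g2 g3] Z]; split=> //; first exact: indep3_swap.
rewrite (cross_termC y p2 p1); exact: (indep3_rot (indep3_rot (indep3_swap (indep3_rot Z)))).
Qed.

Section Basis.
Variables (y p1 p2 p3 : V3).
Hypothesis st : steiner_basis y p1 p2 p3.
Let z12 := cross_term y p1 p2.
Let z13 := cross_term y p1 p3.
Let z23 := cross_term y p2 p3.

Lemma steiner_bil (a b c a' b' c' : R) :
  let u := a *: p1 + b *: p2 + c *: p3 in let w := a' *: p1 + b' *: p2 + c' *: p3 in
  bil B u w = dot u w *: y + (a * b' + b * a') *: z12 + (a * c' + c * a') *: z13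
     + (b * c' + c * b') *: z23.
Proof.
have [[h1 h2 h3] _ [g1 g2 g3] _] := st.
move=> u w; rewrite bil_comb// g1 g2 g3 /u /w !(dotDl, dotDr, dotZl, dotZr) h1 h2 h3.
rewrite (dotC p2 p1) (dotC p3 p1) (dotC p3 p2) /z12 /z13 /z23 /cross_term.
move: (dot p1 p2) (dot p1 p3) (dot p2 p3) (bil B p1 p2) (bil B p1 p3) (bil B p2 p3) => *.
by apply/rowP => i; rewrite !mxE; ring.
Qed.

(** Unit vectors with the same image have orthogonal sum and difference, on which the mixed term
    vanishes; these give the ends of the double curve whose lifts pass through [p] and [p'] up to
    sign. *)
Definition edge_pair (p p' : V3) : V3 * V3 := (normalize (p + p'), normalize (p - p')).

Lemma edge_neq0 : p1 + p2 != 0 /\ p1 - p2 != 0.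
Proof.
have [_ I _ _] := st; split; apply/eqP => E.
  have [|/eqP] := I 1 1 0; first by rewrite !scale1r scale0r addr0.
  by rewrite oner_eq0.
have [|/eqP] := I 1 (-1) 0; first by rewrite scale1r scaleN1r scale0r addr0.
by rewrite oner_eq0.
Qed.

Lemma edge_dot : dot (p1 + p2) (p1 - p2) = 0.
Proof.
have [[h1 h2 _] _ _ _] := st.
by rewrite dotDl !dotDr !dotNr h1 h2 (dotC p2 p1); ring.
Qed.

Lemma edge_coef (p : V3) (k : R) : k *: (p1 + p2) = k *: p1 + k *: p2 + 0 *: p3 /\
  k *: (p1 - p2) = k *: p1 + (- k) *: p2 + 0 *: p3.
Proof. by rewrite scale0r !addr0 scalerDr scalerBr scaleNr. Qed.

Lemma edge_frame : exists n : V3,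
  frame B (edge_pair p1 p2).1 (edge_pair p1 p2).2 n /\
  indep3 (g (edge_pair p1 p2).2 - g (edge_pair p1 p2).1)
    (bil B (edge_pair p1 p2).1 n) (bil B (edge_pair p1 p2).2 n).
Proof.
have [P0 M0] := edge_neq0; have [_ I _ Z] := st.
have ee := dot_normalize P0; have ff := dot_normalize M0.
have ef : dot (normalize (p1 + p2)) (normalize (p1 - p2)) = 0.
  by rewrite /normalize dotZl dotZr edge_dot !mulr0.
have := orthonormal_cross ee ff ef; move: (cross _ _) => n on; exists n => /=.
have := sqrt_dot_neq0 P0; have := sqrt_dot_neq0 M0.
have [_ _ _ [_ en fn]] := on.
rewrite /normalize in ee ff ef en fn on *.
move: ((Num.sqrt _)^-1) ((Num.sqrt _)^-1) ee ff ef en fn on => mu la ee ff ef en fn on mu0 la0.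
have [[c1 _] [_ c2]] := (edge_coef n la, edge_coef n mu); rewrite c1 c2 in ee ff ef en fn on *.
have [n1 [n2 [n3 nE]]] := indep3_span I n.
(* Otherwise [n] would lie in the plane of [p1] and [p2], which the two edge vectors span. *)
have n30 : n3 != 0.
  apply/eqP => n30; have /(_ ((n1 + n2) / (2 * la)) ((n1 - n2) / (2 * mu)) (-1)) := orthonormal_indep on.
  case; last by move=> _ _ /eqP; rewrite oppr_eq0 oner_eq0.
  by rewrite nE n30; apply/rowP => i; rewrite !mxE; field; rewrite mu0 la0.
have beE (x x' x'' w w' w'' : R) := steiner_bil x x' x'' w w' w''.
rewrite nE in en fn *; split; first split=> //.
  by rewrite -nE.
  rewrite beE ef scale0r add0r; apply/rowP => i; rewrite !mxE; ring.
rewrite !beE ee ff en fn !scale1r !scale0r !add0r.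
move=> x y' z E; have [|E1 E2 E3] := Z (x * (- 2 * (mu ^+ 2 + la ^+ 2)) + y' * (la * (n1 + n2)) + z * (mu * (n2 - n1)))
   (n3 * (y' * la + z * mu)) (n3 * (y' * la - z * mu)).
  by rewrite -[RHS]E -/z12 -/z13 -/z23; move: z12 z13 z23 => *; apply/rowP => i; rewrite !mxE; ring.
have y0 : y' = 0.
  have : y' * (2 * la * n3) = n3 * (y' * la + z * mu) + n3 * (y' * la - z * mu) by ring.
  by rewrite E2 E3 addr0 => /eqP; rewrite !mulf_eq0 pnatr_eq0 (negPf la0) (negPf n30) !orbF => /eqP.
have z0 : z = 0.
  have : z * (2 * mu * n3) = n3 * (y' * la + z * mu) - n3 * (y' * la - z * mu) by ring.
  by rewrite E2 E3 subr0 => /eqP; rewrite !mulf_eq0 pnatr_eq0 (negPf mu0) (negPf n30) !orbF => /eqP.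
split=> //; move/eqP: E1; rewrite y0 z0 !mul0r !addr0 mulf_eq0 => /orP[/eqP //|].
rewrite mulf_eq0 oppr_eq0 pnatr_eq0 /= => /eqP H.
by have := sqr_ge0 mu; have : 0 < la ^+ 2 by [rewrite exprn_even_gt0]; lra.
Qed.

Lemma edge_simple : exists n dl p q,
  simple_frame B (edge_pair p1 p2).1 (edge_pair p1 p2).2 n dl p q.
Proof. by have [n [fr I]] := edge_frame; exists n; exact: frame_simple. Qed.

Lemma edge_arc x : Defs.arc g (arc_lift (edge_pair p1 p2).1 (edge_pair p1 p2).2) x ->
  exists t, x = y + t *: z12.
Proof.
have [P0 M0] := edge_neq0; have [n [[[ee ff _ _] ef] _]] := edge_frame.
move=> [t /=]; rewrite in_itv /= => tI <-; rewrite /comp.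
have [-> _] := arc_lift_image sB ef tI.
rewrite /edge_pair /normalize /= in ee ff *.
move: ((Num.sqrt _)^-1) ((Num.sqrt _)^-1) ee ff => mu la ee ff.
have [[c1 _] [_ c2]] := (edge_coef 0 la, edge_coef 0 mu); rewrite c1 c2 in ee ff *.
rewrite !steiner_bil ee ff; exists ((1 - t) * (2 * la ^+ 2) - t * (2 * mu ^+ 2)).
by move: z12 z13 z23 => *; apply/rowP => i; rewrite !mxE; ring.
Qed.

Lemma edge_arc_center : Defs.arc g (arc_lift (edge_pair p1 p2).1 (edge_pair p1 p2).2) y.
Proof.
have [P0 M0] := edge_neq0; have [n [[[ee ff _ _] ef] _]] := edge_frame.
have la2 : 0 < (Num.sqrt (dot (p1 + p2) (p1 + p2)))^-1 ^+ 2.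
  by rewrite exprn_even_gt0 //=; exact: sqrt_dot_neq0.
have mu2 : 0 < (Num.sqrt (dot (p1 - p2) (p1 - p2)))^-1 ^+ 2.
  by rewrite exprn_even_gt0 //=; exact: sqrt_dot_neq0.
rewrite /edge_pair /= in ee ff ef *; rewrite {1 2}/normalize in ef.
have aE := arc_lift_image sB (ef : bil B (normalize (p1 + p2)) (normalize (p1 - p2)) = 0).
rewrite /normalize in ee ff aE *.
move: ((Num.sqrt _)^-1) ((Num.sqrt _)^-1) ee ff aE la2 mu2 => mu la ee ff aE la2 mu2.
have tI : 0 <= la ^+ 2 / (la ^+ 2 + mu ^+ 2) <= 1.
  apply/andP; split; first by rewrite ltW// divr_gt0// addr_gt0.
  by rewrite ler_pdivrMr ?addr_gt0// mul1r lerDl ltW.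
(* The parameter at which the coefficient (1 - t) la^2 - t mu^2 of [z12] vanishes. *)
exists (la ^+ 2 / (la ^+ 2 + mu ^+ 2)); first by rewrite /= in_itv.
rewrite /comp; have [-> _] := aE _ tI.
have [[c1 _] [_ c2]] := (edge_coef 0 la, edge_coef 0 mu); rewrite c1 c2 in ee ff *.
rewrite !steiner_bil ee ff.
have S0 : la ^+ 2 + mu ^+ 2 != 0 by rewrite gt_eqF// addr_gt0.
by move: z12 z13 z23 => *; apply/rowP => i; rewrite !mxE; field.
Qed.

(** Together with a b' + b a' = 0, orthogonality gives a a' + b b' = 0; hence (b^2 - a^2)(a'^2 +
    b'^2) = 0 and b = a or b = - a. *)
Lemma edge_factor (a b a' b' : R) :
  let m := a *: p1 + b *: p2 in let d := a' *: p1 + b' *: p2 in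
  m != 0 -> d != 0 -> dot m d = 0 -> a * b' + b * a' = 0 ->
  factors_into m d (edge_pair p1 p2).1 (edge_pair p1 p2).2.
Proof.
have [P0 M0] := edge_neq0; have [[h1 h2 _] I _ _] := st.
have U (x : V3) : x != 0 -> x = Num.sqrt (dot x x) *: normalize x.
  by move=> x0; rewrite /normalize scalerA divff ?scale1r// sqrtr_eq0 -ltNge dot_gt0.
move=> m d m0 d0 md E.
have E2 : a * a' + b * b' = 0.
  transitivity (dot m d - (a * b' + b * a') * dot p1 p2); last by rewrite md E; ring.
  by rewrite /m /d dotDl !dotDr !dotZl !dotZr h1 h2 (dotC p2 p1); ring.
have a0 : a != 0.
  apply/eqP => z; move: E E2; rewrite z !mul0r !add0r => /eqP + /eqP.
  rewrite !mulf_eq0; have [z2|] := eqVneq b 0.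
    by move/eqP: m0; rewrite /m z z2 !scale0r addr0.
  by move=> _ /= /eqP z1 /eqP z2; move/eqP: d0; rewrite /d z1 z2 !scale0r addr0.
have key : (b - a) * (b + a) * (a' ^+ 2 + b' ^+ 2) = 0.
  transitivity ((b * b' + a * a') * (b * b' - a * a') + (a * b' + b * a') * (b * a' - a * b')).
    by ring.
  by rewrite E (addrC (b * b')) E2 !mul0r addr0.
have nz : a' ^+ 2 + b' ^+ 2 != 0.
  apply/eqP => z; have z1 : a' = 0 by nra.
  have z2 : b' = 0 by nra.
  by move/eqP: d0; rewrite /d z1 z2 !scale0r addr0.
move/eqP: key; rewrite mulf_eq0 (negPf nz) orbF mulf_eq0 subr_eq0 addr_eq0 => /orP[]/eqP bE.
  have b'E : b' = - a'.
    by apply: (mulfI a0); apply/eqP; rewrite mulrN -addr_eq0 -[X in _ == X]E bE.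
  exists (a * Num.sqrt (dot (p1 + p2) (p1 + p2))), (a' * Num.sqrt (dot (p1 - p2) (p1 - p2))).
  left; rewrite -!scalerA /edge_pair /= -(U _ P0) -(U _ M0) /m /d bE b'E.
  by rewrite !scalerDr !scalerN !scaleNr.
have b'E : b' = a'.
  by apply: (mulfI a0); apply/eqP; rewrite -subr_eq0 -[X in _ == X]E bE mulNr.
exists (a * Num.sqrt (dot (p1 - p2) (p1 - p2))), (a' * Num.sqrt (dot (p1 + p2) (p1 + p2))).
right; rewrite -!scalerA /edge_pair /= -(U _ P0) -(U _ M0) /m /d bE b'E.
by rewrite !scalerDr !scalerN !scaleNr.
Qed.

End Basis.

Section Roman.
Variables (y p1 p2 p3 : V3).
Hypothesis st : steiner_basis y p1 p2 p3.
Let st2 : steiner_basis y p2 p3 p1 := steiner_basis_rot st.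
Let st3 : steiner_basis y p1 p3 p2 := steiner_basis_swap (steiner_basis_rot (steiner_basis_rot st)).
Let prs := [:: edge_pair p1 p2; edge_pair p1 p3; edge_pair p2 p3].

(** With a, b, c all nonzero, the equations multiplied by c, b and - a add up to 2 b c a' = 0, and
    the second vector would vanish; so the two vectors share a coordinate plane. *)
Let coord_cases (a b c a' b' c' : R) :
  a * b' + b * a' = 0 -> a * c' + c * a' = 0 -> b * c' + c * b' = 0 ->
  [|| a != 0, b != 0 | c != 0] -> [|| a' != 0, b' != 0 | c' != 0] ->
  [\/ c = 0 /\ c' = 0, b = 0 /\ b' = 0 | a = 0 /\ a' = 0].
Proof.
move=> E1 E2 E3 nz nz'.
have [a0|a0] := eqVneq a 0.
  have [a'0|a'0] := eqVneq a' 0; first by constructor 3.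
  move: E1 E2 nz; rewrite a0 !mul0r !add0r => /eqP + /eqP.
  by rewrite !mulf_eq0 (negPf a'0) !orbF => -> ->; rewrite eqxx.
have [b0|b0] := eqVneq b 0.
  have [b'0|b'0] := eqVneq b' 0; first by constructor 2.
  by move: E1; rewrite b0 mul0r addr0 => /eqP; rewrite mulf_eq0 (negPf a0) (negPf b'0).
have [c0|c0] := eqVneq c 0.
  have [c'0|c'0] := eqVneq c' 0; first by constructor 1.
  by move: E2; rewrite c0 mul0r addr0 => /eqP; rewrite mulf_eq0 (negPf a0) (negPf c'0).
have abc0 : 2 * b * c != 0 by rewrite !mulf_neq0// pnatr_eq0.
have a'0 : a' = 0.
  apply: (mulfI abc0); rewrite mulr0.
  transitivity (c * (a * b' + b * a') + b * (a * c' + c * a') - a * (b * c' + c * b')); first ring.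
  by rewrite E1 E2 E3 !mulr0 addr0 subr0.
move: E1 E2 nz'; rewrite a'0 !mulr0 !addr0 => /eqP + /eqP.
by rewrite !mulf_eq0 (negPf a0) /= => -> ->; rewrite eqxx.
Qed.

Let fp : factor_pairs B prs.
Proof.
have [[h1 h2 h3] I _ Z] := st.
split=> [e' f'|m d m0 d0 md bmd].
  have H (x : V3 * V3) : (exists n, frame B x.1 x.2 n) ->
      [/\ dot x.1 x.1 = 1, dot x.2 x.2 = 1, dot x.1 x.2 = 0 & bil B x.1 x.2 = 0].
    by move=> [n [[? ? _ [? _ _]] ?]].
  rewrite !inE => /or3P[]/eqP E; rewrite -[e']/((e', f').1) -[f']/((e', f').2) E; apply: H.
  - by have [n [fr _]] := edge_frame st; exists n.
  - by have [n [fr _]] := edge_frame st3; exists n.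
  - by have [n [fr _]] := edge_frame st2; exists n.
have [a [b [c mE]]] := indep3_span I m; have [a' [b' [c' dE]]] := indep3_span I d.
rewrite mE dE in m0 d0 md bmd *.
move: bmd; rewrite (steiner_bil st) md scale0r add0r => /Z[E1 E2 E3].
case: (coord_cases E1 E2 E3 (comb_neq0 m0) (comb_neq0 d0)) => -[z1 z2];
  move: m0 d0 md E1 E2 E3; rewrite z1 z2 !scale0r !(add0r, addr0) => m0 d0 md E1 E2 E3.
- exists (edge_pair p1 p2).1, (edge_pair p1 p2).2; split; first by rewrite !inE eqxx.
  exact (edge_factor st m0 d0 md E1).
- exists (edge_pair p1 p3).1, (edge_pair p1 p3).2; split; first by rewrite !inE eqxx orbT.
  exact (edge_factor st3 m0 d0 md E2).
- exists (edge_pair p2 p3).1, (edge_pair p2 p3).2; split; first by rewrite !inE eqxx !orbT.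
  exact (edge_factor st2 m0 d0 md E3).
Qed.

Let separated (u w : V3) : (exists t, dot t u = 0 /\ dot t w != 0) ->
  (normalize u != normalize w) && (normalize u != - normalize w).
Proof.
move=> [t [tu tw]]; apply: not_eqpm_neq.
have w0 : w != 0 by apply: contra tw => /eqP ->; rewrite dotC dot0l.
have nw : dot t (normalize w) != 0 by rewrite dotZr mulf_neq0// sqrt_dot_neq0.
have nu : dot t (normalize u) = 0 by rewrite dotZr tu mulr0.
by case=> E; move/eqP: nw; apply; rewrite -?E // -[normalize w]opprK -E dotNr nu oppr0.
Qed.

(** A functional vanishing on the first edge and on exactly one basis vector of the second separates
    their end points. *)
Let edges_separated (t a b c d : V3) : dot t a = 0 -> dot t b = 0 ->
  (dot t c = 0 /\ dot t d = 1) \/ (dot t c = 1 /\ dot t d = 0) ->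
  let u := edge_pair a b in let w := edge_pair c d in
  let D (x y : V3) := (x != y) && (x != - y) in
  (D u.1 w.1 /\ D u.1 w.2) /\ (D u.2 w.1 /\ D u.2 w.2).
Proof.
move=> ta tb tcd /=.
have [P M] : dot t (c + d) != 0 /\ dot t (c - d) != 0.
  rewrite !dotDr dotNr; case: tcd => -[-> ->].
    by rewrite !add0r oppr_eq0 oner_neq0.
  by rewrite oppr0 !addr0 oner_neq0.
have zP : dot t (a + b) = 0 by rewrite dotDr ta tb addr0.
have zM : dot t (a - b) = 0 by rewrite dotDr dotNr ta tb subr0.
by split; split; apply: separated; exists t.
Qed.

Let crossing (z z' x : V3) : (forall a b : R, a *: z + b *: z' = 0 -> a = 0) ->
  (exists t : R, x = y + t *: z) -> (exists t : R, x = y + t *: z') -> x = y.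
Proof.
move=> H [t ->] [t' /addrI E]; have -> : t = 0; last by rewrite scale0r addr0.
by apply: (H t (- t')); rewrite scaleNr E subrr.
Qed.

Lemma steiner_basis_roman : roman_steiner g.
Proof.
have [[h1 h2 h3] I [g1 g2 g3] Z] := st.
have [n [dl [p [q sf]]]] := edge_simple st.
have [n2 [dl2 [q1 [q2 sf2]]]] := edge_simple st2.
have [n3 [dl3 [q3 [q4 sf3]]]] := edge_simple st3.
have [k1 k2 dc1 tr1] := simple_frame_crosscaps sB sf.
have [k3 k4 dc2 tr2] := simple_frame_crosscaps sB sf3.
have [k5 k6 dc3 tr3] := simple_frame_crosscaps sB sf2.
pose l (x : V3 * V3) := arc_lift x.1 x.2.
exists (edge_pair p1 p2).1, (edge_pair p1 p2).2, (edge_pair p1 p3).1, (edge_pair p1 p3).2,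
  (edge_pair p2 p3).1, (edge_pair p2 p3).2.
exists (l (edge_pair p1 p2)), (l (edge_pair p1 p3)), (l (edge_pair p2 p3)), y.
have [t1 [a1 a2 a3]] := indep3_dual I 1 0 0.
have [t2 [b1 b2 b3]] := indep3_dual I 0 1 0.
have [t3 [c1 c2 c3]] := indep3_dual I 0 0 1.
split.
- apply: (singular_points_are_pairs sB fp); apply: pairwise6.
  have ort (u w : V3) : dot u u = 1 -> dot u w = 0 -> (u != w) && (u != - w).
    by move=> uu uw; apply: not_eqpm_neq; exact: not_eqpm_orthogonal.
  have [[[h11 _ _ [h12 _ _]] _] _ _] := sf; have [[[h13 _ _ [h14 _ _]] _] _ _] := sf2.
  have [[[h15 _ _ [h16 _ _]] _] _ _] := sf3.
  have [d12 d21] := edges_separated c1 c2 (or_introl (conj c1 c3)).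
  have [d13 d31] := edges_separated c1 c2 (or_introl (conj c2 c3)).
  have [d23 d32] := edges_separated b1 b3 (or_intror (conj b2 b3)).
  split; first by split; [exact: ort h11 h12|exact: ort h15 h16|exact: ort h13 h14].
  by split; [exact: d12|exact: d21|exact: d13|exact: d31|split; [exact: d23|exact: d32]].
- move=> c; rewrite !inE => /or3P[/eqP->|/eqP->|/or4P[]/eqP->];
    [exact: k1|exact: k2|exact: k3|exact: k4|exact: k5|exact: k6].
- exact: And3 dc1 dc2 dc3.
- split; first by move=> ? [] ->; [exact: tr1|exact: tr2|exact: tr3].
  move=> a b Sa Sb nab gab; have [l' [e' [f' [ef ->]]] H] := factor_pairs_double sB fp Sa Sb nab gab.
  exists (l (e', f')) => //; move: ef; rewrite !inE => /or3P[]/eqP ->.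
  + by constructor 1.
  + by constructor 2.
  + by constructor 3.
- split.
    exists p1, p2, p3.
    have sep (t u w : V3) : dot t u = 1 -> dot t w = 0 -> ~ eqpm u w.
      by move=> tu tw [] E; move: tu; rewrite E ?dotNr tw ?oppr0 => /eqP; rewrite eq_sym oner_eq0.
    split; [exact: (sep t1)|exact: (sep t1)|exact: (sep t2)|].
    move=> u; split; last first.
      have gN (w : V3) : bil B (- w) (- w) = bil B w w.
        by rewrite -scaleN1r bilZl bilZr scalerA mulN1r opprK scale1r.
      have dN (w : V3) : dot (- w) (- w) = dot w w.
        by rewrite -scaleN1r dotZl dotZr; ring.
      by case=> [] [] ->; rewrite /S2 /= ?gN ?dN.
    (* In the basis, the equation g u = y on the sphere says that all products of two distinct
       coordinates vanish. *)
    move=> [Su gu]; have [a [b [c uE]]] := indep3_span I u.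
    rewrite uE in Su gu *; move: gu; rewrite (steiner_bil st) (Su : dot _ _ = 1) scale1r.
    rewrite -!addrA => /eqP; rewrite addrC -subr_eq0 addrK !addrA => /eqP /Z[].
    have two (x z : R) : x * z + z * x = 0 -> (x == 0) || (z == 0).
      by move=> E; rewrite -mulf_eq0; apply/eqP; lra.
    move=> /two E1 /two E2 /two E3.
    have D (k : R) (w : V3) : dot w w = 1 -> dot (k *: w) (k *: w) = 1 -> eqpm (k *: w) w.
      by move=> ww; exact: dot_unit_scale.
    case/orP: E1 Su => /eqP z1; [case/orP: E3 => /eqP z2|case/orP: E2 => /eqP z2];
      rewrite /S2 /= z1 z2 !scale0r ?(add0r, addr0) => S.
    + by constructor 3; apply: D.
    + by constructor 2; apply: D.
    + by constructor 3; apply: D.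
    + by constructor 1; apply: D.
have A1 := edge_arc_center st; have A2 := edge_arc_center st3; have A3 := edge_arc_center st2.
have e1 := edge_arc st; have e2 := edge_arc st3; have e3 := edge_arc st2.
have cap (A A' : set V3) : (forall x, A x -> A' x -> x = y) -> A y -> A' y -> A `&` A' = [set y].
  by move=> H Ay A'y; apply/seteqP; split=> [x [/H]|x ->] //; apply.
split.
- apply: cap A1 A2 => x /e1 H1 /e2 H2; apply: crossing H1 H2 => a b E.
  by have [|] := Z a b 0; first by rewrite scale0r addr0.
- apply: cap A1 A3 => x /e1 H1 /e3 H2; apply: crossing H1 H2 => a b E.
  by have [|] := Z a 0 b; first by rewrite scale0r addr0.
- apply: cap A2 A3 => x /e2 H1 /e3 H2; apply: crossing H1 H2 => a b E.
  by have [|] := Z 0 a b; first by rewrite scale0r add0r.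
Qed.

End Roman.

Lemma roman_frame_surface e f n dl p q : roman_frame B e f n dl p q -> roman_steiner g.
Proof.
move=> [sf [al0 dl0]]; have [[on ef] I nn] := sf.
pose a := Num.sqrt (1 - dl + p ^+ 2); pose b := Num.sqrt (dl + q ^+ 2).
have a2 : a ^+ 2 = 1 - dl + p ^+ 2 by rewrite sqr_sqrtr// ltW.
have b2 : b ^+ 2 = dl + q ^+ 2 by rewrite sqr_sqrtr// ltW.
have a0 : a != 0 by rewrite gt_eqF// sqrtr_gt0.
have b0 : b != 0 by rewrite gt_eqF// sqrtr_gt0.
pose s := (Num.sqrt (1 + p ^+ 2 + q ^+ 2))^-1.
have S0 : 0 < 1 + p ^+ 2 + q ^+ 2 by have := sqr_ge0 p; have := sqr_ge0 q; lra.
have s2 : s ^+ 2 * (1 + p ^+ 2 + q ^+ 2) = 1.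
  by rewrite /s exprVn sqr_sqrtr ?mulVf// ?gt_eqF// ltW.
have s0 : s != 0 by rewrite invr_eq0 sqrtr_eq0 -ltNge.
have dlE : dl = b ^+ 2 - q ^+ 2 by rewrite b2 addrK.
have p2 : p ^+ 2 = a ^+ 2 + b ^+ 2 - q ^+ 2 - 1 by rewrite a2 b2; ring.
have sab : s ^+ 2 * (a ^+ 2 + b ^+ 2) = 1 by rewrite -[RHS]s2 a2 b2; ring.
(* Preimages of the triple point. They are chosen so that the sum and difference of [q1] and [q2]
   are multiples of [e] and [f], while p1 +/- q1 and p1 +/- q2 are multiples of the other factors
   (+/- a - p, +/- b - q, 1). They have unit length because a^2 + b^2 = 1 + p^2 + q^2. *)
pose p1 := (- s * p) *: e + (- s * q) *: f + s *: n.
pose q1 := (s * a) *: e + (s * b) *: f + 0 *: n.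
pose q2 := (s * a) *: e + (- s * b) *: f + 0 *: n.
have d12 : dot p1 q1 = s ^+ 2 * (- p * a - q * b).
  by rewrite (dot_comb _ _ _ _ _ _ on); ring.
have d13 : dot p1 q2 = s ^+ 2 * (- p * a + q * b).
  by rewrite (dot_comb _ _ _ _ _ _ on); ring.
have d23 : dot q1 q2 = s ^+ 2 * (a ^+ 2 - b ^+ 2).
  by rewrite (dot_comb _ _ _ _ _ _ on); ring.
pose D := bil B f f - bil B e e; pose y := bil B e e + (s ^+ 2 * b ^+ 2) *: D.
apply: (@steiner_basis_roman y p1 q1 q2); split.
- split; rewrite (dot_comb _ _ _ _ _ _ on).
  + by rewrite -[RHS]s2; ring.
  + by rewrite -[RHS]sab; ring.
  + by rewrite -[RHS]sab; ring.
- move=> x1 x2 x3 E.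
  have J := orthonormal_indep on.
  have [|E1 E2 E3] := J (- s * p * x1 + s * a * (x2 + x3))
    (- s * q * x1 + s * b * (x2 - x3)) (s * x1).
    by rewrite -[RHS]E; apply/rowP => i; rewrite !mxE; ring.
  have z1 : x1 = 0 by move/eqP: E3; rewrite mulf_eq0 (negPf s0) => /eqP.
  move: E1 E2; rewrite z1 !mulr0 !add0r => /eqP + /eqP.
  rewrite !mulf_eq0 (negPf s0) (negPf a0) (negPf b0) /= => /eqP E1 /eqP E2.
  by split=> //; lra.
- rewrite /y /D; split; rewrite (simple_bil sB _ _ _ _ _ _ sf).
  + have -> : - s * p * (- s * p) + - s * q * (- s * q) + s * s = 1.
      by rewrite -[RHS]s2; ring.
    rewrite scale1r -!addrA; congr (_ + _); rewrite -[RHS]addr0; congr (_ *: _ + _).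
      by rewrite dlE; ring.
    by apply/rowP => i; rewrite !mxE; ring.
  + have -> : s * a * (s * a) + s * b * (s * b) + 0 * 0 = 1 by rewrite -[RHS]sab; ring.
    rewrite !(mulr0, mul0r) !addr0 !scale0r !addr0 scale1r; congr (_ + _ *: _); ring.
  + have -> : s * a * (s * a) + - s * b * (- s * b) + 0 * 0 = 1 by rewrite -[RHS]sab; ring.
    rewrite !(mulr0, mul0r) !addr0 !scale0r !addr0 scale1r; congr (_ + _ *: _); ring.
- move=> x1 x2 x3; rewrite /cross_term d12 d13 d23 !(simple_bil sB _ _ _ _ _ _ sf) => E.
  pose k1 := s ^+ 2 * (- q * b - (- p * a - q * b) * (s ^+ 2 * b ^+ 2)).
  pose k2 := s ^+ 2 * (q * b - (- p * a + q * b) * (s ^+ 2 * b ^+ 2)).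
  pose k3 := - (s ^+ 2 * b ^+ 2 * (1 + s ^+ 2 * (a ^+ 2 - b ^+ 2))).
  have [|E1 E2 E3] := I (x1 * k1 + x2 * k2 + x3 * k3) (s ^+ 2 * a * (x1 + x2)) (s ^+ 2 * b * (x1 - x2)).
    rewrite -[RHS]E /k1 /k2 /k3 /y /D; move: (bil B f f) (bil B e n) (bil B f n) (bil B e e) => *.
    by apply/rowP => i; rewrite !mxE; ring.
  move/eqP: E2; move/eqP: E3; rewrite !mulf_eq0 (negPf s0) (negPf a0) (negPf b0) /=.
  move=> /eqP E3 /eqP E2; have z1 : x1 = 0 by lra.
  have z2 : x2 = 0 by lra.
  split=> //; move: E1; rewrite z1 z2 !mul0r !add0r => /eqP.
  have -> : k3 = - (2 * (s ^+ 2 * a * (s ^+ 2 * b) * (a * b))).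
    by rewrite /k3 -[X in X + s ^+ 2 * _]sab; ring.
  rewrite mulf_eq0 => /orP[/eqP //|].
  by rewrite oppr_eq0 !mulf_eq0 pnatr_eq0 (negPf s0) (negPf a0) (negPf b0).
Qed.

End SteinerBasis.

(** * Truncated cones and ellipsoids *)

Lemma is_derive_trig (R : realType) (c t : R) :
  is_derive t (1 : R) (fun t => cos (c * t)) (- c * sin (c * t)) /\
  is_derive t (1 : R) (fun t => sin (c * t)) (c * cos (c * t)).
Proof.
split.
  have -> : (fun t => cos (c * t)) = @cos R \o ( *%R c) by [].
  apply: is_derive_eq; rewrite /GRing.scale /=; ring.
have -> : (fun t => sin (c * t)) = @sin R \o ( *%R c) by [].
apply: is_derive_eq; rewrite /GRing.scale /=; ring.
Qed.

(** * Great circles as regular closed curves *)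

Section GreatCircle.
Variable R : realType.
Notation V3 := ('rV[R]_3).

Lemma circle_param (x z : R) : x ^+ 2 + z ^+ 2 = 1 ->
  exists t : R, x = cos (2 * pi * t) /\ z = sin (2 * pi * t).
Proof.
move=> E; have x1 : -1 <= x <= 1.
  by have := sqr_ge0 z => z2; apply/andP; split; nra.
have xI : x \in `[-1, 1]%R by rewrite in_itv /=.
have k0 : (2 * pi : R) != 0 by rewrite mulf_neq0 ?pnatr_eq0// gt_eqF// pi_gt0.
have s : sin (acos x) = `|z|.
  rewrite sin_acos// -sqrtr_sqr; congr Num.sqrt.
  by rewrite -E addrC addKr.
have [z0|z0] := leP 0 z.
  exists (acos x / (2 * pi)); rewrite mulrC divfK// acosK//; split=> //.
  by rewrite s ger0_norm.
exists (- acos x / (2 * pi)); rewrite mulrC divfK// cosN acosK//; split=> //.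
by rewrite sinN s ltr0_norm ?opprK.
Qed.

(** A square root x + i z of the unit complex number b1 + i b2; at b1 = -1 the root i is taken, as
    the general formula divides by x. *)
Lemma half_angle (b1 b2 : R) : b1 ^+ 2 + b2 ^+ 2 = 1 ->
  exists x z : R, [/\ x ^+ 2 + z ^+ 2 = 1, x ^+ 2 - z ^+ 2 = b1 & 2 * x * z = b2].
Proof.
move=> E; have b1I : -1 <= b1.
  by have := sqr_ge0 b2 => z2; nra.
have [b10|b10] := eqVneq b1 (-1).
  exists 0, 1; rewrite b10 in E *; split; try ring.
  by apply/eqP; rewrite mulr0 mul0r eq_sym -sqrf_eq0; apply/eqP; nra.
have p : 0 < (1 + b1) / 2 by rewrite divr_gt0//; move: b1I; rewrite le_eqVlt eq_sym (negPf b10) /=; lra.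
pose x := Num.sqrt ((1 + b1) / 2).
have x0 : x != 0 by rewrite gt_eqF// sqrtr_gt0.
have x2 : x ^+ 2 = (1 + b1) / 2 by rewrite sqr_sqrtr// ltW.
have z2 : (b2 / (2 * x)) ^+ 2 = (1 - b1) / 2.
  rewrite expr_div_n exprMn x2.
  have -> : b2 ^+ 2 = (1 - b1) * (1 + b1) by rewrite -[b2 ^+ 2](addKr (b1 ^+ 2)) E; ring.
  by field; lra.
exists x, (b2 / (2 * x)); rewrite x2 z2; split; [by field|by field|by field].
Qed.

Variables e f n : V3.
Hypothesis on : orthonormal e f n.

Lemma great_circle_param (a : V3) : (S2 R a /\ dot a n = 0) <->
  exists x z : R, x ^+ 2 + z ^+ 2 = 1 /\ a = x *: e + z *: f.
Proof.
have [ee ff nn [ef en fn]] := on; split.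
  move=> [Sa an]; exists (dot a e), (dot a f).
  have aE := orthonormal_expand on a; rewrite an scale0r addr0 in aE; split=> //.
  move: Sa; rewrite /S2 /= {1 2}aE; move: (dot a e) (dot a f) => x z <-.
  by rewrite !(dotDl, dotDr, dotZl, dotZr) ee ff (dotC f e) ef; ring.
move=> [x [z [xz ->]]]; rewrite /S2 /= !(dotDl, dotDr, dotZl, dotZr) ee ff ef (dotC f e) ef en fn.
by split; [rewrite -[RHS]xz|]; ring.
Qed.

Lemma regular_great_circle : regular_closed_curve [set a : V3 | S2 R a /\ dot a n = 0].
Proof.
pose gamma (t : R) : V3 := cos (2 * pi * t) *: e + sin (2 * pi * t) *: f.
have [ee ff nn [ef en fn]] := on.
exists gamma; split.
- move=> k; have [Cc Cs] := @Ck_on_trig R k setT (2 * pi) openT.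
  by apply: Ck_onD; [exact: openT|apply: Ck_onZl => //; exact: openT
    |apply: Ck_onZl => //; exact: openT].
- move=> t; have [dc ds] := is_derive_trig (2 * pi) t.
  have Fc : differentiable (fun t : R => cos (2 * pi * t)) t.
    by apply/derivable1_diffP; case: dc.
  have Fs : differentiable (fun t : R => sin (2 * pi * t)) t.
    by apply/derivable1_diffP; case: ds.
  have DZ (h : R -> R) (w : V3) : differentiable h t -> 'D_1 (fun t => h t *: w) t = 'D_1 h t *: w.
    move=> dh; rewrite [LHS]deriveE; last by apply: differentiableZl.
    by rewrite diffZl ?deriveE.
  have -> : 'D_1 gamma t = (- (2 * pi) * sin (2 * pi * t)) *: e + (2 * pi * cos (2 * pi * t)) *: f.
    rewrite deriveD; first by rewrite !DZ// !derive_val.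
      by apply: diff_derivable; exact: differentiableZl.
    by apply: diff_derivable; exact: differentiableZl.
  apply/eqP => E; have := congr1 (fun w => dot w w) E.
  rewrite dot0l !(dotDl, dotDr, dotZl, dotZr) ee ff ef (dotC f e) ef.
  have := cos2Dsin2 (2 * pi * t); move: (cos _) (sin _) => c s cs E0.
  have : (2 * pi) ^+ 2 * (c ^+ 2 + s ^+ 2) = 0 :> R by rewrite -[RHS]E0; ring.
  rewrite cs mulr1 => /eqP; rewrite sqrf_eq0 mulf_eq0 pnatr_eq0 /=.
  by apply/negP; rewrite gt_eqF// pi_gt0.
- move=> t; have E : 2 * pi * (t + 1) = 2 * pi * t + pi *+ 2 by rewrite -mulr_natl; ring.
  rewrite /gamma E.
  by rewrite (cosD (2 * pi * t)) (sinD (2 * pi * t)) cos2pi sin2pi !mulr1 !mulr0 subr0 addr0.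
- apply/seteqP; split=> a.
    move/great_circle_param => [x [z [xz ->]]].
    by have [t [-> ->]] := circle_param xz; exists t.
  move=> [t _ <-]; apply/great_circle_param.
  by exists (cos (2 * pi * t)), (sin (2 * pi * t)); rewrite cos2Dsin2.
Qed.

End GreatCircle.

Section Cone.
Variables (R : realType) (B : 'I_3 -> 'M[R]_3).
Hypothesis sB : forall i, (B i)^T = B i.
Notation g := (fun u => bil B u u).
Notation V3 := ('rV[R]_3).

Lemma eqpm_unit (f u : V3) (k : R) : k ^+ 2 = 1 -> u = k *: f -> eqpm u f.
Proof.
move=> /eqP; rewrite sqrf_eq1 => /orP[]/eqP -> ->; first by left; rewrite scale1r.
by right; rewrite scaleN1r.
Qed.

Lemma cone_bil e f n (a b c a' b' c' : R) : tangent_frame B e f n 0 0 ->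
  bil B (a *: e + b *: f + c *: n) (a' *: e + b' *: f + c' *: n) =
  (a * a' + b * b' + c * c') *: bil B e e + (b * b') *: (bil B f f - bil B e e)
  + (a * c' + c * a') *: bil B e n + (c * c') *: (bil B n n - bil B e e).
Proof.
by move=> tf; rewrite (tangent_bil sB _ _ _ _ _ _ tf) !mul0r addr0 subr0.
Qed.

(** The normal form is invariant under rotations of the plane of [e] and [n], so any point of the
    singular circle may take the place of [e]. *)
Lemma cone_rotate e f n (x z k : R) : x ^+ 2 + z ^+ 2 = 1 -> k ^+ 2 = 1 ->
  tangent_frame B e f n 0 0 ->
  tangent_frame B (x *: e + z *: n) (k *: f) ((- z) *: e + x *: n) 0 0.
Proof.
move=> xz kk tf; have [[on ef] I _] := tf; have [ee ff nn [ef0 en fn]] := on.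
have h1 : x *: e + z *: n = x *: e + 0 *: f + z *: n by rewrite scale0r addr0.
have h2 : k *: f = 0 *: e + k *: f + 0 *: n by rewrite !scale0r addr0 add0r.
have h3 : (- z) *: e + x *: n = (- z) *: e + 0 *: f + x *: n by rewrite scale0r addr0.
rewrite h1 h2 h3; split.
- split; last first.
    rewrite (cone_bil _ _ _ _ _ _ tf) !(mul0r, mulr0) !addr0 !scale0r !addr0 //.
  split; rewrite ?(dot_comb _ _ _ _ _ _ on).
  + by rewrite -[RHS]xz; ring.
  + by rewrite -[RHS]kk; ring.
  + by rewrite -[RHS]xz; ring.
  + by split; ring.
- move=> a b c; rewrite !(cone_bil _ _ _ _ _ _ tf) => E.
  have [|E1 E2 E3] := I a (a * (- (2 * x * z)) + b * (x ^+ 2 - z ^+ 2) - 4 * c * x * z)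
     (a * (- z ^+ 2) + b * x * z + c * (x ^+ 2 - z ^+ 2)).
    rewrite -[RHS]E; have kE : k * k = 1 by rewrite -expr2.
    have zE : z * z = 1 - x * x by rewrite -!expr2 -xz addrC addKr.
    rewrite -!expr2 in kE zE *.
    move: (bil B f f) (bil B e n) (bil B n n) (bil B e e) => *.
    apply/rowP => i; rewrite !mxE; apply/eqP; rewrite -subr_eq0; apply/eqP; ring: kE zE.
  rewrite E1 !mul0r !add0r in E2 E3.
  (* [E2] and [E3] are a linear system in [b] and [c] with determinant (x^2 + z^2)^2 = 1. *)
  have b0 : b = 0.
    transitivity (b * (x ^+ 2 + z ^+ 2) ^+ 2); first by rewrite xz expr1n mulr1.
    transitivity ((x ^+ 2 - z ^+ 2) * (b * (x ^+ 2 - z ^+ 2) - 4 * c * x * z)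
       + 4 * x * z * (b * x * z + c * (x ^+ 2 - z ^+ 2))); first by ring.
    by rewrite E2 E3 !mulr0 addr0.
  have c0 : c = 0.
    transitivity (c * (x ^+ 2 + z ^+ 2) ^+ 2); first by rewrite xz expr1n mulr1.
    transitivity ((x ^+ 2 - z ^+ 2) * (b * x * z + c * (x ^+ 2 - z ^+ 2))
       - x * z * (b * (x ^+ 2 - z ^+ 2) - 4 * c * x * z)); first by ring.
    by rewrite E2 E3 !mulr0 subr0.
  by [].
- rewrite [RHS](_ : _ = 0); last by rewrite mul0r !scale0r subr0.
  by rewrite (cone_bil _ _ _ _ _ _ tf) !(mul0r, mulr0) !addr0 !scale0r !addr0.
Qed.

(** The complex number c1 + i c3 is squared: at height c2^2 the image has distance 1 - c2^2 from the
    axis, which is the standard cone. *)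
Lemma cone_image e f n (c1 c2 c3 : R) : tangent_frame B e f n 0 0 ->
  c1 ^+ 2 + c2 ^+ 2 + c3 ^+ 2 = 1 ->
  let o := bil B e e + 2^-1 *: (bil B n n - bil B e e) in
  let A := rows3 ((- 2^-1) *: (bil B n n - bil B e e)) (bil B e n)
     (bil B f f - bil B e e - 2^-1 *: (bil B n n - bil B e e)) in
  g (c1 *: e + c2 *: f + c3 *: n) = vec3 (c1 ^+ 2 - c3 ^+ 2) (2 * c1 * c3) (c2 ^+ 2) *m A + o.
Proof.
move=> tf E o A; rewrite /A /o mul_vec3_rows3 (cone_bil _ _ _ _ _ _ tf) -!expr2 E.
have -> : c1 ^+ 2 = 1 - c2 ^+ 2 - c3 ^+ 2 by rewrite -E; ring.
move: (bil B f f) (bil B e n) (bil B n n) (bil B e e) => *.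
by apply/rowP => i; rewrite !mxE; field.
Qed.

Lemma cone_tangent_pairs e f n x : tangent_frame B e f n 0 0 -> tangent_pairs_near B x.
Proof.
move=> tf; exists setT => [|u u' _ _]; first exact: filterT.
have [fr I _] := tf; have [on _] := fr.
have [c1 [c2 [c3 ->]]] := frame_span u fr; have [d1 [d2 [d3 ->]]] := frame_span u' fr.
rewrite /S2 /= !(dot_comb _ _ _ _ _ _ on) => Su Su'.
rewrite !(cone_bil _ _ _ _ _ _ tf) Su Su' !scale1r => E.
have [|E1 E2 E3] := I (c2 * c2 - d2 * d2) (2 * (c1 * c3 - d1 * d3)) (c3 * c3 - d3 * d3).
  move/eqP: E; rewrite -subr_eq0 => /eqP <-.
  move: (bil B f f) (bil B e n) (bil B n n) (bil B e e) => *.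
  by apply/rowP => i; rewrite !mxE; ring.
have E13 : c1 * c3 = d1 * d3 by lra.
have E33 : c3 * c3 = d3 * d3 by lra.
have E11 : c1 * c1 = d1 * d1 by lra.
have [c0|c0] := boolP ((c1 == 0) && (c3 == 0)).
  move: c0 E11 E33 => /andP[/eqP c10 /eqP c30]; rewrite c10 c30 !mulr0.
  move=> /esym/eqP; rewrite mulf_eq0 orbb => /eqP d10 /esym/eqP; rewrite mulf_eq0 orbb => /eqP d30.
  rewrite d10 d30 !scale0r !addr0 !add0r; apply: tangent_pairs_eqpm.
    by have [_ ff _ _] := on; rewrite dotZl dotZr ff mulr1 -[RHS]Su c10 c30; ring.
  have : d2 ^+ 2 == c2 ^+ 2 by rewrite !expr2; apply/eqP; lra.
  by rewrite eqf_sqr => /orP[]/eqP ->; [left|right; rewrite scaleNr].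
have [nu [nD nX nN]] := indep3_dual I (c3 ^+ 2) (c1 * c3) (c3 ^+ 2 - c1 ^+ 2).
have key (a b c : R) : a * a = c1 * c1 -> c * c = c3 * c3 -> a * c = c1 * c3 ->
    forall w, dot (a *: e + b *: f + c *: n) w = 0 -> dot nu (bil B (a *: e + b *: f + c *: n) w) = 0.
  move=> aa cc ac w; have [w1 [w2 [w3 ->]]] := frame_span w fr.
  rewrite (dot_comb _ _ _ _ _ _ on) (cone_bil _ _ _ _ _ _ tf) => dt.
  rewrite dt scale0r add0r !dotDr !dotZr nD nX nN.
  have -> : b * w2 = - (a * w1 + c * w3) by rewrite -[LHS]subr0 -dt; ring.
  rewrite -ac !expr2 -cc -aa; ring.
exists nu; last by move=> w; split; apply: key.
apply: contraNneq c0 => nu0; move: nD nN; rewrite nu0 !dot0l => /esym/eqP.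
rewrite sqrf_eq0 => /eqP ->; rewrite expr0n /= sub0r => /esym/eqP.
by rewrite oppr_eq0 sqrf_eq0 => ->; rewrite eqxx.
Qed.

Lemma cone_singular e f n a : tangent_frame B e f n 0 0 ->
  singular_pt g a <-> (S2 R a /\ dot a f = 0) \/ eqpm a f.
Proof.
move=> tf; have [fr I _] := tf; have [on bef] := fr; have [ee ff nn [ef en fn]] := on.
have on' : orthonormal e n f by split=> //; split=> //; rewrite dotC.
have [c1 [c2 [c3 aE]]] := frame_span a fr; split.
  move=> /(singular_ptE sB)[Sa [w [w0]]]; have [w1 [w2 [w3 wE]]] := frame_span w fr.
  rewrite aE wE in Sa w0 *.
  rewrite (dot_comb _ _ _ _ _ _ on) => dt; rewrite (cone_bil _ _ _ _ _ _ tf) dt scale0r add0r.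
  move=> /I[E1 E2 E3]; have {}w0 := comb_neq0 w0.
  have Su : c1 ^+ 2 + c2 ^+ 2 + c3 ^+ 2 = 1.
    by move: Sa; rewrite /S2 /= (dot_comb _ _ _ _ _ _ on) -!expr2.
  have [c20|c20] := eqVneq c2 0.
    left; split=> //; rewrite !(dotDl, dotZl) ef (dotC n f) fn c20.
    by ring.
  move/eqP: E1; rewrite mulf_eq0 (negPf c20) /= => /eqP w20; move: w0 dt E2 E3.
  rewrite w20 eqxx mulr0 addr0 /= => w0 dt E2 E3.
  have [c10 c30] : c1 = 0 /\ c3 = 0.
    have k1 : c1 * w1 = 0 by lra.
    case/orP: w0 => w0.
      have c10 : c1 = 0 by move/eqP: k1; rewrite mulf_eq0 (negPf w0) orbF => /eqP.
      split=> //; move: E2; rewrite c10 mul0r add0r => /eqP; rewrite mulf_eq0 (negPf w0) orbF => /eqP //.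
    have c30 : c3 = 0 by move/eqP: E3; rewrite mulf_eq0 (negPf w0) orbF => /eqP.
    split=> //; move: E2; rewrite c30 mul0r addr0 => /eqP; rewrite mulf_eq0 (negPf w0) orbF => /eqP //.
  right; apply: (@eqpm_unit _ _ c2); first by rewrite -[RHS]Su c10 c30; ring.
  by rewrite c10 c30 !scale0r add0r addr0.
move=> H; apply/(singular_ptE sB).
case: H => [/(great_circle_param on')[x [z [xz ->]]]|af].
  split.
    by have [//] := (great_circle_param on' (x *: e + z *: n)).2 (ex_intro _ x (ex_intro _ z (conj xz erefl))).
  exists f; have fE : f = 0 *: e + 1 *: f + 0 *: n by rewrite !scale0r scale1r add0r addr0.
  have -> : x *: e + z *: n = x *: e + 0 *: f + z *: n by rewrite scale0r addr0.
  split; first by rewrite -dot_eq0 ff oner_eq0.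
    by rewrite [X in dot _ X]fE (dot_comb _ _ _ _ _ _ on); ring.
  by rewrite [X in bil B _ X]fE (cone_bil _ _ _ _ _ _ tf) !(mul0r, mulr0) !addr0 !scale0r !addr0.
have e0 : e != 0 by rewrite -dot_eq0 ee oner_eq0.
case: af => af; rewrite af; split; try (exists e; split=> //).
+ by [].
+ by rewrite dotC.
+ by rewrite bilC.
+ by rewrite /S2 /= -scaleN1r dotZl dotZr ff; ring.
+ by rewrite -scaleN1r dotZl dotC ef mulr0.
+ by rewrite -scaleN1r bilZl bilC// bef scaler0.
Qed.

Lemma cone_frame_surface e f n : tangent_frame B e f n 0 0 -> truncated_cone g.
Proof.
move=> tf; have [fr I _] := tf; have [on bef] := fr; have [ee ff nn [ef en fn]] := on.
have on' : orthonormal e n f by split=> //; split=> //; rewrite dotC.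
pose N := bil B n n - bil B e e.
exists (rows3 ((- 2^-1) *: N) (bil B e n) (bil B f f - bil B e e - 2^-1 *: N)).
exists (bil B e e + 2^-1 *: N), [set a : V3 | S2 R a /\ dot a f = 0], f.
have gE := cone_image tf _; rewrite /= -/N in gE.
have U : rows3 ((- 2^-1) *: N) (bil B e n) (bil B f f - bil B e e - 2^-1 *: N) \in unitmx.
  apply/indep3_unitmx => a b c E.
  have [|c0 b0 a0] := I c b (- a / 2 - c / 2).
    rewrite -[RHS]E /N; move: (bil B n n) (bil B f f) (bil B e n) (bil B e e) => *.
    by apply/rowP => i; rewrite !mxE; field.
  by split=> //; move: a0; rewrite c0; lra.
have hE (u w : V3) (A : 'M[R]_3) (o : V3) : A \in unitmx -> u *m A + o = w *m A + o -> u = w.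
  by move=> AU /addIr; exact: (can_inj (mulmxK AU)).
have baseE (x z : R) : x ^+ 2 + z ^+ 2 = 1 -> std_base (vec3 x z 0 : V3).
  by move=> E; rewrite /std_base /=; have [-> -> ->] := vec3E x z 0.
have stdE (s x z : R) : s *: std_vertex R + (1 - s) *: vec3 x z 0 =
    vec3 ((1 - s) * x) ((1 - s) * z) s.
  transitivity (vec3 (s * 0 + (1 - s) * x) (s * 0 + (1 - s) * z) (s * 1 + (1 - s) * 0)).
    by rewrite [LHS]vec3_eta !mxE.
  by rewrite !mulr0 mulr1 !add0r addr0.
split=> //.
- apply/seteqP; split=> y.
    move=> [u + <-]; have [c1 [c2 [c3 ->]]] := frame_span u fr.
    rewrite /S2 /= (dot_comb _ _ _ _ _ _ on) -!expr2 => Su; rewrite gE//.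
    eexists; last by [].
    (* At the vertex any base point will do; elsewhere the base point is obtained on dividing by 1 -
       c2^2. *)
    have [s1|s1] := eqVneq (c2 ^+ 2) 1.
      exists 1; first by rewrite /= ler01 lexx.
      exists (vec3 1 0 0); first by apply: baseE; rewrite expr1n expr0n addr0.
      rewrite stdE subrr !mul0r s1; congr vec3; have z1 := sqr_ge0 c1; have z3 := sqr_ge0 c3; nra.
    exists (c2 ^+ 2); first by rewrite /= sqr_ge0 /=; have := sqr_ge0 c1; have := sqr_ge0 c3; lra.
    have s0 : 1 - c2 ^+ 2 != 0 by rewrite subr_eq0 eq_sym.
    exists (vec3 ((c1 ^+ 2 - c3 ^+ 2) / (1 - c2 ^+ 2)) (2 * c1 * c3 / (1 - c2 ^+ 2)) 0).
      apply: baseE; rewrite !expr_div_n -mulrDl.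
      have -> : 1 - c2 ^+ 2 = c1 ^+ 2 + c3 ^+ 2 by rewrite -Su; ring.
      have k0 : (c1 ^+ 2 + c3 ^+ 2) ^+ 2 != 0.
        by rewrite sqrf_eq0; move: s0; rewrite -Su (_ : _ - _ = c1 ^+ 2 + c3 ^+ 2)//; ring.
      by rewrite -[RHS](divff k0); congr (_ / _); ring.
    by rewrite stdE !(mulrC (1 - c2 ^+ 2)) !divfK.
  move=> [_ [s /andP[s0 s1] [b [b1 b3] <-]] <-].
  have [x [z [xz x1 x2]]] := half_angle b1.
  have [h1 h2] : Num.sqrt (1 - s) ^+ 2 = 1 - s /\ Num.sqrt s ^+ 2 = s.
    by rewrite !sqr_sqrtr ?subr_ge0.
  pose k := Num.sqrt (1 - s).
  have Su : (k * x) ^+ 2 + Num.sqrt s ^+ 2 + (k * z) ^+ 2 = 1.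
    rewrite !exprMn h1 h2; transitivity ((1 - s) * (x ^+ 2 + z ^+ 2) + s); first by ring.
    by rewrite xz mulr1 subrK.
  exists ((k * x) *: e + Num.sqrt s *: f + (k * z) *: n).
    by rewrite /S2 /= (dot_comb _ _ _ _ _ _ on) -!expr2.
  rewrite gE// h2; congr (_ *m _ + _).
  rewrite (vec3_eta b) b3 stdE -x1 -x2; congr vec3; rewrite -h1 -/k; ring.
- split; first exact: (regular_great_circle on').
  apply/seteqP; split=> y.
    move=> [u /(great_circle_param on')[x [z [xz ->]]] <-].
    exists (vec3 (x ^+ 2 - z ^+ 2) (2 * x * z) 0).
      apply: baseE; transitivity ((x ^+ 2 + z ^+ 2) ^+ 2); first by ring.
      by rewrite xz expr1n.
    have -> : x *: e + z *: n = x *: e + 0 *: f + z *: n by rewrite scale0r addr0.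
    by rewrite gE ?expr0n ?addr0.
  move=> [b [b1 b3] <-]; have [x [z [xz x1 x2]]] := half_angle b1.
  exists (x *: e + z *: n); first by apply/(great_circle_param on'); exists x, z.
  have -> : x *: e + z *: n = x *: e + 0 *: f + z *: n by rewrite scale0r addr0.
  rewrite gE ?expr0n ?addr0//; congr (_ *m _ + _).
  by rewrite [RHS]vec3_eta b3 -x1 -x2.
- move=> a; have [c1 [c2 [c3 aE]]] := frame_span a fr; split.
    rewrite aE /S2 /= (dot_comb _ _ _ _ _ _ on) -!expr2 => -[Su]; rewrite gE// => /(hE _ _ _ _ U) E.
    have := congr1 (fun w : V3 => w 0 2%:R) E; rewrite /std_vertex /= !mxE /= => E2'.
    have E2 : c2 ^+ 2 = 1 := E2'.
    have z1 := sqr_ge0 c1; have z3 := sqr_ge0 c3.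
    have c10 : c1 = 0 by apply/eqP; rewrite -sqrf_eq0; apply/eqP; lra.
    have c30 : c3 = 0 by apply/eqP; rewrite -sqrf_eq0; apply/eqP; lra.
    by apply: (eqpm_unit E2); rewrite c10 c30 !scale0r add0r addr0.
  have fE : f = 0 *: e + 1 *: f + 0 *: n by rewrite !scale0r scale1r add0r addr0.
  have gf : g f = std_vertex R *m rows3 ((- 2^-1) *: N) (bil B e n) (bil B f f - bil B e e - 2^-1 *: N) + (bil B e e + 2^-1 *: N).
    rewrite {1 2}fE gE; last by rewrite expr1n expr0n addr0 add0r.
    by rewrite expr0n subr0 mulr0 expr1n.
  case=> -> //; rewrite /S2 /= -scaleN1r dotZl dotZr bilZl bilZr ff; split; first by ring.
  by rewrite scalerA mulrNN mulr1 scale1r.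
- split.
    by move=> a; apply: (cone_singular a tf).
  move=> a sa.
  have H : [set a : V3 | S2 R a /\ dot a f = 0] a \/ eqpm a f.
    by apply/(cone_singular a tf).
  case: H => [/(great_circle_param on')[x [z [xz ->]]]|af].
    have tf' := cone_rotate xz (expr1n R 2) tf.
    exact: (non_fin_det_tangent sB tf' (cone_tangent_pairs _ tf')).
  have [k kk ->] : exists2 k : R, k ^+ 2 = 1 & a = k *: f.
    by case: af => ->; [exists 1|exists (-1)]; rewrite ?expr1n ?sqrrN ?expr1n ?scale1r ?scaleN1r.
  have xz : (1 : R) ^+ 2 + 0 ^+ 2 = 1 by rewrite expr1n expr0n addr0.
  have tf' := cone_rotate xz kk tf.
  exact: (non_fin_det_tangent_end sB tf' (cone_tangent_pairs _ tf')).
Qed.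

(** The collapsed circle has no distinguished point: rotations of the plane of [e] and [f] preserve
    the normal form. *)
Lemma ellipsoid_rotate e f n (x z : R) : x ^+ 2 + z ^+ 2 = 1 -> ellipsoid_frame B e f n ->
  ellipsoid_frame B (x *: e + z *: f) ((- z) *: e + x *: f) n.
Proof.
move=> xz el; have [[on ef] D0 I] := el; have [ee ff nn [ef0 en fn]] := on.
have h1 : x *: e + z *: f = x *: e + z *: f + 0 *: n by rewrite scale0r addr0.
have h3 : (- z) *: e + x *: f = (- z) *: e + x *: f + 0 *: n by rewrite scale0r addr0.
have h2 : bil B (x *: e + z *: f) n = x *: bil B e n + z *: bil B f n.
  by rewrite bilDl !bilZl.
have h4 : bil B (- z *: e + x *: f) n = - z *: bil B e n + x *: bil B f n.
  by rewrite bilDl !bilZl.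
have h5 : g (x *: e + z *: f) = bil B e e.
  rewrite h1 (ellipsoid_bil sB _ _ _ _ _ _ el) !(mul0r, mulr0) !addr0 !scale0r !addr0.
  by rewrite -!expr2 xz scale1r.
split.
- split; first split.
  + by rewrite h1 (dot_comb _ _ _ _ _ _ on) -[RHS]xz; ring.
  + by rewrite h3 (dot_comb _ _ _ _ _ _ on) -[RHS]xz; ring.
  + by [].
  + split; first by rewrite h1 h3 (dot_comb _ _ _ _ _ _ on); ring.
      by rewrite dotDl !dotZl en fn !mulr0 addr0.
    by rewrite dotDl !dotZl en fn !mulr0 addr0.
  + rewrite h1 h3 (ellipsoid_bil sB _ _ _ _ _ _ el) !(mul0r, mulr0) !addr0 !scale0r !addr0.
    by rewrite mulrN (mulrC z) addNr scale0r.
- rewrite h5 h3 (ellipsoid_bil sB _ _ _ _ _ _ el) !(mul0r, mulr0) !addr0 !scale0r !addr0.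
  by rewrite mulrNN -!expr2 addrC xz scale1r.
- move=> a b c; rewrite h2 h4 h5 => E.
  have [|E1 E2 E3] := I (a * x - b * z) (a * z + b * x) c.
    rewrite -[RHS]E; move: (bil B e n) (bil B f n) (bil B n n) (bil B e e) => *.
    by apply/rowP => i; rewrite !mxE; ring.
  split=> //.
    transitivity (a * (x ^+ 2 + z ^+ 2)); first by rewrite xz mulr1.
    by transitivity (x * (a * x - b * z) + z * (a * z + b * x)); [ring|rewrite E1 E2 !mulr0 addr0].
  transitivity (b * (x ^+ 2 + z ^+ 2)); first by rewrite xz mulr1.
  by transitivity (x * (a * z + b * x) - z * (a * x - b * z)); [ring|rewrite E1 E2 !mulr0 subr0].
Qed.

(* The three coordinates determine [2 n3 c - n], hence the conormal of the
   image at [c]. *)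
Lemma ellipsoid_tangent_pairs e f n x : ellipsoid_frame B e f n -> tangent_pairs_near B x.
Proof.
move=> el; exists setT => [|u u' _ _]; first exact: filterT.
have [fr _ I] := el; have [on _] := fr.
have [c1 [c2 [c3 ->]]] := frame_span u fr; have [d1 [d2 [d3 ->]]] := frame_span u' fr.
rewrite /S2 /= !(dot_comb _ _ _ _ _ _ on) => Su Su'.
rewrite !(ellipsoid_bil sB _ _ _ _ _ _ el) Su Su' !scale1r => E.
have [|E1 E2 E3] := I (2 * (c1 * c3 - d1 * d3)) (2 * (c2 * c3 - d2 * d3)) (c3 * c3 - d3 * d3).
  move/eqP: E; rewrite -subr_eq0 => /eqP <-.
  move: (bil B f n) (bil B e n) (bil B n n) (bil B e e) => *.
  by apply/rowP => i; rewrite !mxE; ring.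
have [nu [nX nY nN]] := indep3_dual I (c1 * c3) (c2 * c3) (2 * (c3 * c3) - 1).
have key (a b c : R) : a * c = c1 * c3 -> b * c = c2 * c3 -> c * c = c3 * c3 ->
    a * a + b * b + c * c = 1 ->
    forall w, dot (a *: e + b *: f + c *: n) w = 0 -> dot nu (bil B (a *: e + b *: f + c *: n) w) = 0.
  move=> ac bc cc S w; have [w1 [w2 [w3 ->]]] := frame_span w fr.
  rewrite (dot_comb _ _ _ _ _ _ on) (ellipsoid_bil sB _ _ _ _ _ _ el) => dt.
  rewrite dt scale0r add0r !dotDr !dotZr nX nY nN -ac -bc -cc.
  transitivity (c * c * (a * w1 + b * w2 + c * w3) + c * w3 * (a * a + b * b + c * c - 1)).
    by ring.
  by rewrite dt S subrr !mulr0 addr0.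
exists nu; last by move=> w; split; apply: key; lra.
apply/eqP => nu0; move: nX nY nN; rewrite nu0 !dot0l => /esym/eqP + /esym/eqP.
rewrite !mulf_eq0; have [c30|_] := eqVneq c3 0.
  by rewrite c30 => _ _; lra.
by rewrite !orbF => /eqP c10 /eqP c20; rewrite c10 c20 in Su *; lra.
Qed.

(** The angle from [n] is doubled: c is sent to 2 c3 c - n, a point of the unit sphere in the new
    coordinates. *)
Lemma ellipsoid_image e f n (c1 c2 c3 : R) : ellipsoid_frame B e f n ->
  c1 ^+ 2 + c2 ^+ 2 + c3 ^+ 2 = 1 ->
  let N := 2^-1 *: (bil B n n - bil B e e) in
  g (c1 *: e + c2 *: f + c3 *: n) =
    vec3 (2 * c1 * c3) (2 * c2 * c3) (2 * c3 ^+ 2 - 1) *m rows3 (bil B e n) (bil B f n) N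
    + (bil B e e + N).
Proof.
move=> el E N; rewrite mul_vec3_rows3 (ellipsoid_bil sB _ _ _ _ _ _ el) -!expr2 E /N.
move: (bil B f n) (bil B e n) (bil B n n) (bil B e e) => *.
by apply/rowP => i; rewrite !mxE; field.
Qed.

Lemma ellipsoid_singular e f n a : ellipsoid_frame B e f n ->
  singular_pt g a <-> (S2 R a /\ dot a n = 0).
Proof.
move=> el; have [fr D0 I] := el; have [on bef] := fr; have [ee ff nn [ef en fn]] := on.
split.
  move=> /(singular_ptE sB)[Sa [w [w0 dt bw]]]; split=> //.
  move: dt bw; have [c1 [c2 [c3 aE]]] := frame_span a fr; have [w1 [w2 [w3 wE]]] := frame_span w fr.
  rewrite aE wE in Sa w0 *.
  rewrite (dot_comb _ _ _ _ _ _ on) => dt; rewrite (ellipsoid_bil sB _ _ _ _ _ _ el) dt scale0r add0r.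
  move=> /I[E1 E2 /eqP]; rewrite mulf_eq0 => /orP[]/eqP z.
    by rewrite !(dotDl, dotZl) en fn z; ring.
  move: E1 E2 (comb_neq0 w0); rewrite z !mulr0 !add0r eqxx orbF => /eqP + /eqP.
  rewrite !mulf_eq0; have [c30 _ _|_ /= /eqP -> /eqP ->] := eqVneq c3 0; last by rewrite eqxx.
  by rewrite !(dotDl, dotZl) en fn c30 => _; ring.
move=> H; have [x [z [xz aE]]] := (great_circle_param on a).1 H.
apply/(singular_ptE sB); split; first by case: H.
exists ((- z) *: e + x *: f); have h1 : a = x *: e + z *: f + 0 *: n by rewrite scale0r addr0.
have h3 : (- z) *: e + x *: f = (- z) *: e + x *: f + 0 *: n by rewrite scale0r addr0.
have el' := ellipsoid_rotate xz el; have [[[h _ _ [h4 _ _]] h5] _ _] := el'.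
have [[[_ h6 _ _] _] _ _] := el'.
by rewrite -dot_eq0 h6 oner_eq0 aE.
Qed.

Lemma ellipsoid_frame_surface e f n : ellipsoid_frame B e f n -> ellipsoid g.
Proof.
move=> el; have [fr D0 I] := el; have [on bef] := fr; have [ee ff nn [ef en fn]] := on.
pose N := 2^-1 *: (bil B n n - bil B e e).
have gE := ellipsoid_image el _; rewrite /= -/N in gE.
exists (rows3 (bil B e n) (bil B f n) N), (bil B e e + N), [set a : V3 | S2 R a /\ dot a n = 0].
split.
- apply/indep3_unitmx => a b c E; have [|-> ->] := I a b (c / 2).
    rewrite -[RHS]E /N; move: (bil B n n) (bil B f n) (bil B e n) (bil B e e) => *.
    by apply/rowP => i; rewrite !mxE; field.
  by move=> c0; split=> //; lra.
- apply/seteqP; split=> y.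
    move=> [u + <-]; have [c1 [c2 [c3 ->]]] := frame_span u fr.
    rewrite /S2 /= (dot_comb _ _ _ _ _ _ on) -!expr2 => Su; rewrite gE//.
    eexists; last by [].
    rewrite dotE; have [-> -> ->] := vec3E (2 * c1 * c3) (2 * c2 * c3) (2 * c3 ^+ 2 - 1).
    transitivity (4 * c3 ^+ 2 * (c1 ^+ 2 + c2 ^+ 2 + c3 ^+ 2 - 1) + 1); first by ring.
    by rewrite Su subrr mulr0 add0r.
  move=> [u Su <-]; rewrite /S2 /= dotE -!expr2 in Su.
  (* The pole - n is the image of the whole circle c3 = 0, of which [e] is a point; otherwise c3 is
     recovered by the half-angle formula. *)
  have [u3|u3] := eqVneq (u 0 2%:R) (-1).
    exists e => //; have eE : e = 1 *: e + 0 *: f + 0 *: n by rewrite !scale0r scale1r !addr0.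
    rewrite {1 2}eE gE; last by rewrite expr1n expr0n !addr0.
    congr (_ *m _ + _); have z1 := sqr_ge0 (u 0 0); have z2 := sqr_ge0 (u 0 1).
    have u1 : u 0 0 = 0 by apply/eqP; rewrite -sqrf_eq0; apply/eqP; nra.
    have u2 : u 0 1 = 0 by apply/eqP; rewrite -sqrf_eq0; apply/eqP; nra.
    by rewrite [RHS]vec3_eta u1 u2 u3; congr vec3; ring.
  pose c3 := Num.sqrt ((1 + u 0 2%:R) / 2).
  have z1 := sqr_ge0 (u 0 0); have z2 := sqr_ge0 (u 0 1).
  have p : 0 < (1 + u 0 2%:R) / 2.
    have : -1 <= u 0 2%:R by nra.
    by rewrite le_eqVlt eq_sym (negPf u3) /=; lra.
  have c30 : c3 != 0 by rewrite gt_eqF// sqrtr_gt0.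
  have c32 : c3 ^+ 2 = (1 + u 0 2%:R) / 2 by rewrite sqr_sqrtr// ltW.
  have Sc : (u 0 0 / (2 * c3)) ^+ 2 + (u 0 1 / (2 * c3)) ^+ 2 + c3 ^+ 2 = 1.
    rewrite !expr_div_n -mulrDl !exprMn c32.
    have -> : u 0 0 ^+ 2 + u 0 1 ^+ 2 = (1 - u 0 2%:R) * (1 + u 0 2%:R).
      by rewrite -[LHS](addrK (u 0 2%:R ^+ 2)) Su; ring.
    have q : 1 + u 0 2%:R != 0 by apply: contraTneq p => ->; rewrite mul0r ltxx.
    by move: (u 0 2%:R) q => x q; field.
  exists ((u 0 0 / (2 * c3)) *: e + (u 0 1 / (2 * c3)) *: f + c3 *: n).
    by rewrite /S2 /= (dot_comb _ _ _ _ _ _ on) -!expr2.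
  rewrite gE//; congr (_ *m _ + _); rewrite [RHS]vec3_eta c32; congr vec3; by field.
- exact: (regular_great_circle on).
- by move=> a; apply: (ellipsoid_singular a el).
- move=> a /(ellipsoid_singular a el)/(great_circle_param on)[x [z [xz ->]]].
  have el' := ellipsoid_rotate xz el; have [[on' ef'] D' I'] := el'.
  by apply: (non_fin_det_collapsed sB on' ef' (ellipsoid_tangent_pairs _ el') _ I'); rewrite D' subrr.
Qed.

End Cone.

(** * Multiplicity of a line *)

Section LocalAlgebra.
Variable R : realType.
Local Notation C := (R[i]).
Local Notation poly3 := (mpoly 3).
Implicit Types (h s d : poly3 C) (p r : {poly C}).

Lemma poly3_ind (K : comNzRingType) (Q : poly3 K -> Prop) :
  (forall c, Q (mpolyC 3 c)) -> (forall i, Q (mvar K i)) ->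
  (forall x y, Q x -> Q y -> Q (x + y)) -> (forall x y, Q x -> Q y -> Q (x * y)) ->
  forall x, Q x.
Proof.
move=> QC QX QD QM x; rewrite (mpolyE x).
apply: (big_ind Q) => //; first by rewrite -mpolyC0.
move=> m _; rewrite -mul_mpolyC; apply: (QM) => //; rewrite mpolyXE_id.
have Q1 : Q 1 by rewrite -mpolyC1.
apply: (big_ind Q Q1 QM) => i _; elim: (m i) => [|k IH]; first by rewrite expr0.
by rewrite exprS; apply: (QM) => //; exact: QX.
Qed.

Lemma frac_clear (F : fieldType) (b D d m x : F) : b != 0 ->
  b * D * d * (m / b * x) = d * m * D * x.
Proof. by move=> b0; field. Qed.

Lemma frac_scale (F : fieldType) (x y z : F) : x != 0 -> y / z = (x * y) / (x * z).
Proof. by move=> x0; rewrite -mulf_div divff// mul1r. Qed.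

Section Evaluation.
Variables (K : comNzRingType) (u : 'rV[K]_3).
Lemma evalpM (p p' : poly3 K) : evalp (p * p') u = evalp p u * evalp p' u.
Proof. exact: mevalM. Qed.
Lemma evalpD (p p' : poly3 K) : evalp (p + p') u = evalp p u + evalp p' u.
Proof. exact: mevalD. Qed.
Lemma evalpN (p : poly3 K) : evalp (- p) u = - evalp p u.
Proof. exact: mevalN. Qed.
Lemma evalpC c : evalp (mpolyC 3 c) u = c.
Proof. exact: mevalC. Qed.
Lemma evalp1 : evalp 1 u = 1.
Proof. exact: meval1. Qed.
Lemma evalp_var i : evalp (mvar K i) u = u 0 i.
Proof. exact: mevalXU. Qed.
Lemma evalpX (p : poly3 K) k : evalp (p ^+ k) u = evalp p u ^+ k.
Proof. by elim: k => [|k IH]; rewrite ?expr0 ?evalp1// !exprS evalpM IH. Qed.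
Lemma evalp0 : evalp 0 u = 0. Proof. exact: meval0. Qed.
End Evaluation.

Variables (q : 'rV[C]_3) (gens : seq (poly3 C)).

(** Membership in the local ideal with denominators cleared, [s] being a unit at [q]; the
    computations below stay among polynomials. *)
Definition loc_mem h : Prop := exists s (c : nat -> poly3 C),
  evalp s q != 0 /\ s * h = \sum_(i < size gens) c i * gens`_i.

Lemma loc_memM s h : loc_mem h -> loc_mem (s * h).
Proof.
move=> [t [c [t0 E]]]; exists t, (fun i => s * c i); split=> //.
by rewrite mulrCA E mulr_sumr; apply: eq_bigr => i _; rewrite mulrA.
Qed.

Lemma loc_memD h h' : loc_mem h -> loc_mem h' -> loc_mem (h + h').
Proof.
move=> [t [c [t0 E]]] [t' [c' [t'0 E']]].
exists (t * t'), (fun i => t' * c i + t * c' i); split.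
  by rewrite evalpM mulf_neq0.
under [RHS]eq_bigr => i _ do rewrite mulrDl -!mulrA.
rewrite big_split /= -!mulr_sumr -E -E'; ring.
Qed.

Lemma loc_memN h : loc_mem h -> loc_mem (- h).
Proof. by move=> H; rewrite -mulN1r; exact: loc_memM. Qed.

Lemma loc_memB h h' : loc_mem h -> loc_mem h' -> loc_mem (h - h').
Proof. by move=> H H'; apply: loc_memD => //; exact: loc_memN. Qed.

Lemma loc_mem0 : loc_mem 0.
Proof.
exists 1, (fun=> 0); rewrite evalp1 oner_neq0 mulr0; split=> //.
by rewrite big1// => i _; rewrite mul0r.
Qed.

Lemma loc_mem_gen h : h \in gens -> loc_mem h.
Proof.
move=> /(nthP 0)[k kn <-]; exists 1, (fun i => (i == k)%:R); split.
  by rewrite evalp1 oner_neq0.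
rewrite mul1r (bigD1 (Ordinal kn))//= eqxx mul1r big1 ?addr0// => i ik.
by rewrite (_ : (nat_of_ord i == k) = false) ?mul0r//; apply/negbTE.
Qed.

Lemma loc_mem_cancel s h : evalp s q != 0 -> loc_mem (s * h) -> loc_mem h.
Proof.
move=> s0 [t [c [t0 E]]]; exists (t * s), c; rewrite evalpM mulf_neq0//.
by rewrite -mulrA.
Qed.

Lemma local_idealP h d : evalp d q != 0 ->
  local_ideal q gens (tofrac h / tofrac d) <-> loc_mem h.
Proof.
have tf0 (s : poly3 C) : evalp s q != 0 -> tofrac s != 0.
  by move=> s0; rewrite tofrac_eq0; apply: contraNneq s0 => ->; rewrite evalp0.
move=> d0; split.
  move=> [c Hc E]; have /choice[nd ndP] : forall i, exists nd : poly3 C * poly3 C,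
      evalp nd.2 q != 0 /\ c i = tofrac nd.1 / tofrac nd.2.
    by move=> i; have [a [b H]] := Hc i; exists (a, b).
  pose D := \prod_(i < size gens) (nd i).2.
  exists D, (fun k => d * (nd k).1 * \prod_(j < size gens | nat_of_ord j != k) (nd j).2).
  split.
    rewrite /D; apply: (big_ind (fun s => evalp s q != 0)).
    - by rewrite evalp1 oner_neq0.
    - by move=> s s' ? ?; rewrite evalpM mulf_neq0.
    - by move=> i _; case: (ndP i).
  apply/eqP; rewrite -tofrac_eq rmorphM rmorph_sum /=; apply/eqP.
  transitivity (tofrac D * tofrac d * (tofrac h / tofrac d)).
    by rewrite -mulrA (mulrC (tofrac d)) divfK//; exact: tf0.
  rewrite E mulr_sumr; apply: eq_bigr => i _.
  rewrite /D (bigD1 i)//= (ndP i).2 !rmorphM /=; have n0 := tf0 _ (ndP i).1.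
  rewrite (eq_bigl (fun j : 'I_(size gens) => nat_of_ord j != i))//.
  by apply: frac_clear.
move=> [s [c [s0 E]]]; exists (fun k => tofrac (c k) / tofrac (s * d)).
  by move=> i; exists (c i), (s * d); rewrite evalpM mulf_neq0.
have [s0' d0'] := (tf0 _ s0, tf0 _ d0).
transitivity (tofrac (s * h) / tofrac (s * d)).
  rewrite (tofracM s h) (tofracM s d); exact: frac_scale s0'.
rewrite E rmorph_sum /= mulr_suml; apply: eq_bigr => i _.
by rewrite !rmorphM /= mulrAC.
Qed.

Section Curve.
Variables (n : nat) (P : 'I_3 -> {poly C}) (tau : poly3 C).

(* Restriction of a polynomial to the curve [P], and the polynomial functions
   of the parameter [tau]. *)
Definition on_curve h : {poly C} := mmap polyC P h.
Definition in_tau p : poly3 C := (map_poly (mpolyC 3 (R := C)) p).[tau].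

Lemma on_curveM h s : on_curve (h * s) = on_curve h * on_curve s.
Proof. exact: rmorphM. Qed.
Lemma on_curveD h s : on_curve (h + s) = on_curve h + on_curve s.
Proof. exact: rmorphD. Qed.
Lemma on_curveB h s : on_curve (h - s) = on_curve h - on_curve s.
Proof. exact: rmorphB. Qed.
Lemma on_curveC c : on_curve (mpolyC 3 c) = c%:P.
Proof. exact: mmapC. Qed.
Lemma on_curve_var i : on_curve (mvar C i) = P i.
Proof. by rewrite /on_curve /mvar mmapX mmap1U. Qed.
Lemma in_tauM p r : in_tau (p * r) = in_tau p * in_tau r.
Proof. by rewrite /in_tau rmorphM hornerM. Qed.
Lemma in_tauD p r : in_tau (p + r) = in_tau p + in_tau r.
Proof. by rewrite /in_tau rmorphD hornerD. Qed.
Lemma in_tauB p r : in_tau (p - r) = in_tau p - in_tau r.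
Proof. by rewrite /in_tau rmorphB hornerD hornerN. Qed.
Lemma in_tauC c : in_tau c%:P = mpolyC 3 c.
Proof. by rewrite /in_tau map_polyC hornerC. Qed.
Lemma in_tauX k : in_tau 'X^k = tau ^+ k.
Proof. by rewrite /in_tau map_polyXn hornerXn. Qed.

Lemma in_tau_coef p m : (size p <= m)%N ->
  in_tau p = \sum_(i < m) mpolyC 3 p`_i * tau ^+ i.
Proof.
move=> pm; rewrite /in_tau (horner_coef_wide (n := m)); last first.
  exact: leq_trans (size_poly _ _) pm.
by apply: eq_bigr => i _; rewrite coef_map.
Qed.

Hypothesis P0 : forall i, (P i).[0] = q 0 i.

Lemma on_curve0 h : (on_curve h).[0] = evalp h q.
Proof.
elim/poly3_ind: h => [c|i|p r IH1 IH2|p r IH1 IH2].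
- by rewrite on_curveC hornerC evalpC.
- by rewrite on_curve_var evalp_var.
- by rewrite on_curveD evalpD hornerD IH1 IH2.
- by rewrite on_curveM evalpM hornerM IH1 IH2.
Qed.

(** The curve passes through [q] at parameter 0, so a unit at [q] restricts to a polynomial with
    nonzero constant term. *)
Lemma on_curve_coprime h : evalp h q != 0 -> coprimep ('X^n) (on_curve h).
Proof.
move=> h0; apply: coprimep_expl; rewrite coprimep_sym -['X]subr0 -(polyC0 C) coprimep_XsubC.
by rewrite /root on_curve0.
Qed.

Hypothesis P_mem : forall i, loc_mem (mvar C i - in_tau (P i)).

(** True for the variables by hypothesis; restricting to the curve and substituting [tau] respects
    sums and products. *)
Lemma loc_mem_curve h : loc_mem (h - in_tau (on_curve h)).
Proof.
elim/poly3_ind: h => [c|i|p r IH1 IH2|p r IH1 IH2].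
- by rewrite on_curveC in_tauC subrr; exact: loc_mem0.
- by rewrite on_curve_var.
- by rewrite on_curveD in_tauD opprD addrACA; exact: loc_memD.
- rewrite on_curveM in_tauM.
  have -> : p * r - in_tau (on_curve p) * in_tau (on_curve r) =
    p * (r - in_tau (on_curve r)) + in_tau (on_curve r) * (p - in_tau (on_curve p)) by ring.
  by apply: loc_memD; exact: loc_memM.
Qed.

Hypothesis tau_mem : loc_mem (tau ^+ n).
Hypothesis gens_dvd : forall g, g \in gens -> 'X^n %| on_curve g.
Hypothesis tau_curve : 'X^n %| on_curve tau - 'X.

Lemma loc_mem_dvd h : loc_mem h -> 'X^n %| on_curve h.
Proof.
move=> [s [c [s0 E]]]; rewrite -(Gauss_dvdpr _ (on_curve_coprime s0)) -on_curveM E.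
rewrite /on_curve rmorph_sum /=; apply: (big_ind (fun p => 'X^n %| p)).
- exact: dvdp0.
- by move=> p r; exact: dvdp_add.
- move=> i _; rewrite rmorphM /=; apply: dvdp_mull; apply: gens_dvd.
  exact: mem_nth.
Qed.

Lemma on_curve_in_tau p : 'X^n %| on_curve (in_tau p) - p.
Proof.
elim/poly_ind: p => [|p c IH].
  by rewrite -[0]/(0%:P) in_tauC on_curveC subrr dvdp0.
rewrite in_tauD in_tauM in_tauC on_curveD on_curveM on_curveC -['X]expr1 in_tauX !expr1.
have -> : on_curve (in_tau p) * on_curve tau + c%:P - (p * 'X + c%:P) =
  (on_curve (in_tau p) - p) * on_curve tau + p * (on_curve tau - 'X) by ring.
by apply: dvdp_add; [exact: dvdp_mulr|exact: dvdp_mull].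
Qed.

(** Restriction to the curve and substitution of [tau] are inverse to each other modulo X^n and the
    local ideal, which identifies the local algebra with C[X]/(X^n); the powers of [tau] form the
    basis. *)
Lemma local_algebra_dim_curve : local_algebra_dim q gens n.
Proof.
have e1 : evalp 1 q != 0 :> C by rewrite evalp1 oner_neq0.
exists (fun i => tofrac (tau ^+ i)).
  by move=> i; exists (tau ^+ i), 1; rewrite e1 rmorph1 divr1.
have combE p : (size p <= n)%N ->
    \sum_(i < n) tofrac (mpolyC 3 ((\row_(i < n) p`_i) 0 i)) * tofrac (tau ^+ i) = tofrac (in_tau p).
  move=> pn; rewrite (in_tau_coef pn) rmorph_sum /=; apply: eq_bigr => i _.
  by rewrite mxE rmorphM.
move=> x [m [d [d0 ->]]].
have tf0 : tofrac d != 0 by rewrite tofrac_eq0; apply: contraNneq d0 => ->; rewrite evalp0.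
have [[u v] /= uv] : exists u, u.1 * 'X^n + u.2 * on_curve d = 1.
  by have /Bezout_eq1_coprimepP := on_curve_coprime d0.
(* The class of m / d: the restriction of [d] is invertible modulo X^n, with inverse [v] from the
   Bezout relation. *)
pose r := (v * on_curve m) %% 'X^n.
have rn : (size r <= n)%N.
  by rewrite -ltnS -(size_polyXn C n) ltn_modp monic_neq0// monicXn.
have rdvd : 'X^n %| on_curve m - r * on_curve d.
  have rE : r = v * on_curve m - (v * on_curve m) %/ 'X^n * 'X^n.
    by rewrite [X in X - _](divp_eq (v * on_curve m) 'X^n) addrAC subrr add0r.
  have -> : on_curve m - r * on_curve d =
      (u * on_curve m + (v * on_curve m) %/ 'X^n * on_curve d) * 'X^n.
    rewrite -[on_curve m in LHS]mul1r -uv rE; move: (_ %/ _) => k; ring.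
  exact: dvdp_mulIr.
have quotE p : tofrac m / tofrac d - tofrac (in_tau p) = tofrac (m - in_tau p * d) / tofrac d.
  by rewrite rmorphB rmorphM /= mulrBl mulfK.
have r_mem : loc_mem (m - in_tau r * d).
  have /dvdpP[k kE] := rdvd.
  have -> : m - in_tau r * d = (m - in_tau (on_curve m)) - in_tau r * (d - in_tau (on_curve d))
     + in_tau k * tau ^+ n.
    by rewrite -in_tauX -in_tauM -kE in_tauB in_tauM; ring.
  apply: loc_memD; last exact: loc_memM.
  by apply: loc_memB; [exact: loc_mem_curve|apply: loc_memM; exact: loc_mem_curve].
exists (\row_(i < n) r`_i); split.
  by rewrite combE// quotE; apply/local_idealP.
move=> c; have cE : c = \row_(i < n) (rVpoly c)`_i.
  by apply/rowP => i; rewrite mxE coef_rVpoly_ord.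
have pn : (size (rVpoly c) <= n)%N by exact: size_poly.
rewrite {1}cE combE// quotE => /(local_idealP _ d0) p_mem.
have : loc_mem (in_tau (r - rVpoly c)).
  apply: (loc_mem_cancel d0).
  have -> : d * in_tau (r - rVpoly c) = (m - in_tau (rVpoly c) * d) - (m - in_tau r * d).
    by rewrite in_tauB; ring.
  exact: loc_memB.
move=> /loc_mem_dvd H; have := dvdp_sub H (on_curve_in_tau (r - rVpoly c)).
rewrite opprB addrC subrK => D.
have E : r - rVpoly c = 0.
  apply/eqP; apply: contraLR D => nz; apply/negP => /(dvdp_leq nz).
  rewrite size_polyXn leqNgt ltnS; apply/negP; rewrite negbK.
  by apply: leq_trans (size_polyD _ _) _; rewrite size_polyN geq_max rn.
by rewrite cE -(subr0_eq E).
Qed.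

End Curve.

End LocalAlgebra.

(** * The ideal of minors *)

Section Minors.
Variable K : idomainType.

Definition generated (s : seq K) (y : K) : Prop :=
  exists c : nat -> K, y = \sum_(i < size s) c i * s`_i.

Lemma generatedZ s x y : generated s y -> generated s (x * y).
Proof.
move=> [c ->]; exists (fun i => x * c i); rewrite mulr_sumr.
by apply: eq_bigr => i _; rewrite mulrA.
Qed.

Lemma generatedD s x y : generated s x -> generated s y -> generated s (x + y).
Proof.
move=> [c ->] [d ->]; exists (fun i => c i + d i); rewrite -big_split /=.
by apply: eq_bigr => i _; rewrite mulrDl.
Qed.

Lemma generated_mem s y : y \in s -> generated s y.
Proof.
move=> /(nthP 0)[k kn <-]; exists (fun i => (i == k)%:R).
rewrite (bigD1 (Ordinal kn))//= eqxx mul1r big1 ?addr0// => i ik.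
by rewrite (_ : (nat_of_ord i == k) = false) ?mul0r//; apply/negbTE.
Qed.

Lemma generated_trans s s' y : (forall x, x \in s -> generated s' x) ->
  generated s y -> generated s' y.
Proof.
move=> H [c ->]; apply: (big_ind (generated s')).
- by exists (fun=> 0); rewrite big1// => i _; rewrite mul0r.
- exact: generatedD.
- by move=> i _; apply: generatedZ; apply: H; exact: mem_nth.
Qed.

Lemma row'_mul m (A : 'M[K]_(m.+1, 3)) (E : 'M[K]_3) k : row' k (A *m E) = row' k A *m E.
Proof. by apply/matrixP => i j; rewrite !mxE; apply: eq_bigr => l _; rewrite mxE. Qed.

Lemma generated_sum m (F : 'I_m -> K) (c : 'I_m -> K) :
  generated [seq F i | i <- enum 'I_m] (\sum_i c i * F i).
Proof.
exists (fun k => if insub k is Some i then c i else 0).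
rewrite size_map -cardE card_ord; apply: eq_bigr => i _.
by rewrite valK (nth_map i) ?nth_ord_enum // size_enum_ord.
Qed.

Lemma columns_combination (V g : 'M[K]_3) (v1 v2 v3 o c : 'rV[K]_3) i k :
  (forall l, V l i = tnth [tuple v1; v2; v3] l 0 i) ->
  (g 0 k *: v1 + g 1 k *: v2 + g 2%:R k *: v3 + c 0 k *: o) 0 i = (V^T *m g + o^T *m c) i k.
Proof.
move=> VE; rewrite [RHS]mxE [X in _ = X + _]mxE [X in _ = _ + X]mxE big_ord1 sum3.
do 4!rewrite [(_^T) _ _]mxE; rewrite !VE !(tnth_nth 0) /= !mxE.
rewrite (_ : ord0 = 0); last exact: val_inj.
ring.
Qed.

(** Bordering by a column gathers all minors of a 4 by 3 matrix into one determinant, linear in the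
    column; multiplicativity of the determinant then does the work of the Cauchy-Binet formula. *)
Lemma det_row_mx_minors (A : 'M[K]_(3 + 1, 3)) (v : 'cV[K]_(3 + 1)) :
  \det (row_mx A v) = \sum_(k < 3 + 1) ((-1) ^+ (k + 3) * v k 0) * \det (row' k A : 'M[K]_3).
Proof.
rewrite (expand_det_col _ (rshift 3 (0 : 'I_1))); apply: eq_bigr => k _.
rewrite row_mxEr /cofactor mulrCA mulrA; congr (_ * _ * \det _).
apply/matrixP => i j; rewrite !mxE.
have -> : lift (rshift 3 (0 : 'I_1)) j = lshift 1 j.
  by apply: val_inj; rewrite /= /bump leqNgt ltn_ord.
by have := row_mxEl A v (lift k i) j; rewrite mxE.
Qed.

Lemma det_row_mx_delta (A : 'M[K]_(3 + 1, 3)) (k : 'I_(3 + 1)) :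
  \det (row_mx A ((-1) ^+ (k + 3) *: delta_mx k 0)) = \det (row' k A : 'M[K]_3).
Proof.
rewrite det_row_mx_minors (bigD1 k)//= big1 => [|i ik]; last first.
  by rewrite !mxE (negPf ik) !mulr0 mul0r.
rewrite !mxE !eqxx mulr1 -exprD addnn -muln2 mulnC exprM sqrrN expr1n expr1n mul1r.
by rewrite addr0.
Qed.

Lemma minors_mul (N : 'M[K]_(3 + 1)) (G : 'M[K]_(3 + 1, 3)) (v : 'cV[K]_(3 + 1)) :
  \det (row_mx (N *m G) (N *m v)) = \det N * \det (row_mx G v).
Proof. by rewrite -mul_mx_row det_mulmx. Qed.

Lemma minors_mul_generated (N : 'M[K]_(3 + 1)) (G : 'M[K]_(3 + 1, 3)) k :
  generated [seq \det (row' i (N *m G) : 'M[K]_3) | i <- enum 'I_(3 + 1)]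
    (\det N * \det (row' k G : 'M[K]_3)).
Proof.
rewrite -det_row_mx_delta -minors_mul det_row_mx_minors.
exact: (generated_sum (fun i => \det (row' i (N *m G) : 'M[K]_3))).
Qed.

(** The bordering column is pulled back through the adjugate of [N]; the extra factor det N cancels
    in an integral domain. *)
Lemma minors_mul_generated' (N : 'M[K]_(3 + 1)) (G : 'M[K]_(3 + 1, 3)) k :
  \det N != 0 ->
  generated [seq \det (row' i G : 'M[K]_3) | i <- enum 'I_(3 + 1)]
    (\det (row' k (N *m G) : 'M[K]_3)).
Proof.
move=> N0; pose v := \adj N *m ((-1) ^+ (k + 3) *: delta_mx k 0 : 'cV[K]_(3 + 1)).
have E : \det (row' k (N *m G) : 'M[K]_3) = \det (row_mx G v).
  apply: (mulfI N0); rewrite -minors_mul /v mulmxA mul_mx_adj mul_scalar_mx.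
  rewrite scalerA -det_row_mx_delta !det_row_mx_minors mulr_sumr.
  by apply: eq_bigr => i _; rewrite !mxE; ring.
rewrite E det_row_mx_minors.
exact: (generated_sum (fun i => \det (row' i G : 'M[K]_3))).
Qed.

End Minors.

(** * The matrix in the coordinates of a frame *)

Section ComplexMinors.
Variable R : realType.
Local Notation C := (R[i]).
Local Notation poly3 := (mpoly 3).
Local Notation V3 := ('rV[R]_3).
Variable f : 'I_3 -> V3 -> R.
Hypothesis f_const : forall i, f i 0 = 0.
Hypothesis f_linear : forall i (v : V3), 'D_v (f i) 0 = 0.

Definition cst3 : R -> poly3 C := @mpolyC 3 C \o real_complex R.

HB.instance Definition _ := GRing.RMorphism.on cst3.

Definition var3 : 'rV[poly3 C]_3 := \row_k mvar C k.

Lemma mderiv_var (K : comNzRingType) i j : mderiv j (mvar K i) = (i == j)%:R.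
Proof.
rewrite /mvar mderivX mnm1E; case: eqP => [->|_]; last by rewrite scale0r.
by rewrite scale1r -mpolyX0; congr mpolyX; apply/mnmP => k; rewrite mnmBE mnm0E subnn.
Qed.

(** Each second partial enters [jet2] with factor 1/2 and is differentiated in either of its two
    variables, which reproduces the averaging in [hess]. *)
Lemma mderiv_jet2 i j : mderiv j (jet2 (f i)) = \sum_k hess f i j k *: mvar R k.
Proof.
rewrite /jet2 f_const mpolyC0 add0r big1 => [|k _]; last by rewrite /pd f_linear scale0r.
rewrite add0r raddf_sum /=.
have [P PE] : exists P, forall a b, pd a (pd b (f i)) 0 = P a b.
  by exists (fun a b => pd a (pd b (f i)) 0).
have E a b : hess f i a b = (P a b + P b a) / 2.
  by rewrite /hess; do 4!rewrite mxE; rewrite mxE !PE mulrC.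
under eq_bigr => a _.
  rewrite raddf_sum /=.
  under eq_bigr => b _ do rewrite PE mderivZ mderivM !mderiv_var scalerDr.
  rewrite big_split /=; over.
rewrite big_split /=.
under [RHS]eq_bigr => k _ do rewrite E mulrDl scalerDl.
rewrite [RHS]big_split /=; congr (_ + _).
  rewrite (bigD1 j)//= [X in _ + X]big1 => [|a ak].
    by rewrite addr0; apply: eq_bigr => b _; rewrite eqxx mul1r.
  by apply: big1 => b _; rewrite (negPf ak) mul0r scaler0.
apply: eq_bigr => a _; rewrite (bigD1 j)//= big1 => [|b bk].
  by rewrite addr0 eqxx mulr1.
by rewrite (negPf bk) mulr0 scaler0.
Qed.

Lemma mderiv_rho j : mderiv j (rho R) = 2 *: mvar R j.
Proof.
rewrite /rho raddfB /= raddf_sum /= -mpolyC1 mderivC subr0 (bigD1 j)//= big1 => [|k kj].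
  by rewrite addr0 expr2 mderivM mderiv_var eqxx mul1r mulr1 scaler_nat mulr2n.
by rewrite expr2 mderivM mderiv_var (negPf kj) mul0r mulr0 addr0.
Qed.

Definition MfC : 'M[poly3 C]_(3 + 1, 3) := map_mx (map_mpoly (real_complex R)) (Mf f).

Lemma minorCE k : minorC f k = \det (row' k MfC : 'M[poly3 C]_3).
Proof.
rewrite /minorC /minor -det_map_mx; congr (\det _).
by apply/matrixP => i j; rewrite !mxE.
Qed.

Lemma map_varZ (c : R) k : map_mpoly (real_complex R) (c *: mvar R k) = cst3 c * mvar C k.
Proof. by rewrite map_mpolyZ map_mpolyX -mul_mpolyC. Qed.

Lemma bil_map (K L : comNzRingType) (phi : {rmorphism K -> L}) (B : 'I_3 -> 'M[K]_3) u w :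
  bil (fun i => map_mx phi (B i)) (map_mx phi u) (map_mx phi w) = map_mx phi (bil B u w).
Proof.
apply/rowP => i; rewrite bilE mxE bilE rmorph_sum /=; apply: eq_bigr => a _.
by rewrite rmorph_sum /=; apply: eq_bigr => b _; rewrite !mxE !rmorphM.
Qed.

Notation "u ^k" := (map_mx cst3 u) (at level 2, format "u ^k").

Lemma MfC_mul (E : 'M[R]_3) : MfC *m (map_mx cst3 E)^T =
  col_mx (\matrix_(i < 3, k < 3) bil (fun i => map_mx cst3 (hess f i)) var3 (row k E)^k 0 i)
    (\row_(k < 3) (cst3 2 * dot var3 (row k E)^k)).
Proof.
rewrite /MfC /Mf map_col_mx mul_col_mx; congr col_mx; apply/matrixP => i k.
  rewrite !mxE bilE exchange_big /=; apply: eq_bigr => j _.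
  rewrite !mxE mderiv_jet2 rmorph_sum /= mulr_suml; apply: eq_bigr => l _.
  have hs : hess f i j l = hess f i l j by rewrite -[in LHS](hess_sym f i) [LHS]mxE.
  have -> : (hess f i)^k l j = cst3 (hess f i l j) by exact: mxE.
  have -> : var3 0 l = mvar C l by exact: mxE.
  by rewrite map_varZ hs; ring.
rewrite !mxE /dot mulr_sumr; apply: eq_bigr => j _.
by rewrite !mxE mderiv_rho map_varZ mulrA.
Qed.

Section FrameMinors.
Variables (e1 e2 e3 o v1 v2 v3 : V3) (g : 'M[poly3 C]_3).
Hypotheses (on : orthonormal e1 e2 e3) (I : indep3 v1 v2 v3).
Let c : 'rV[poly3 C]_3 := \row_k dot var3 (row k (rows3 e1 e2 e3))^k.
Hypothesis gE : forall k, bil (fun i => map_mx cst3 (hess f i)) var3 (row k (rows3 e1 e2 e3))^k =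
  g 0 k *: v1^k + g 1 k *: v2^k + g 2%:R k *: v3^k + c 0 k *: o^k.
Let G : 'M[poly3 C]_(3 + 1, 3) := col_mx g c.
Let E := rows3 e1 e2 e3.
Let N : 'M[poly3 C]_(3 + 1) :=
  block_mx (map_mx cst3 (rows3 v1 v2 v3))^T (o^k)^T 0 (cst3 2)%:M.

Let NG : MfC *m (map_mx cst3 E)^T = N *m G.
Proof.
rewrite MfC_mul mul_block_col mul0mx add0r mul_scalar_mx; congr col_mx; last first.
  by apply/matrixP => i k; rewrite !mxE.
clearbody c; apply/matrixP => i k; rewrite [LHS]mxE gE.
apply: columns_combination => l; rewrite 2!mxE !(tnth_nth 0).
by case: l => [[|[|[|//]]] H] /=; rewrite mxE.
Qed.

Let detE : \det (map_mx cst3 E)^T != 0.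
Proof.
have : E \in unitmx by apply/indep3_unitmx; exact: orthonormal_indep.
by rewrite det_tr det_map_mx unitmxE unitfE fmorph_eq0.
Qed.

Let detN : \det N != 0.
Proof.
have : rows3 v1 v2 v3 \in unitmx by apply/indep3_unitmx.
rewrite /N det_ublock det_tr det_map_mx det_scalar1 unitmxE unitfE.
rewrite -rmorphM fmorph_eq0 mulf_eq0 pnatr_eq0 orbF //.
Qed.

(** Multiplied by the frame on the right, the matrix factors as [N *m G]. Both constant matrices
    have nonzero determinant, so each list of minors generates the other up to nonzero constants. *)
Lemma frame_minors :
  (forall k, exists2 x : R, x != 0 & generated [seq minorC f k | k <- enum 'I_(3 + 1)]
     (cst3 x * \det (row' k G : 'M[poly3 C]_3))) /\
  (forall k, exists2 x : R, x != 0 &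
     generated [seq \det (row' k G : 'M[poly3 C]_3) | k <- enum 'I_(3 + 1)] (cst3 x * minorC f k)).
Proof.
have dE : \det (map_mx cst3 E)^T = cst3 (\det E) by rewrite det_tr det_map_mx.
have dN : \det N = cst3 (\det (rows3 v1 v2 v3) * 2).
  by rewrite /N det_ublock det_tr det_map_mx det_scalar1 rmorphM.
have NGE k : \det (row' k (N *m G) : 'M[poly3 C]_3) = cst3 (\det E) * minorC f k.
  rewrite -NG row'_mul det_mulmx -minorCE dE mulrC //.
split=> k.
  exists (\det (rows3 v1 v2 v3) * 2).
    by move: detN; rewrite dN fmorph_eq0.
  rewrite -dN; apply: generated_trans (minors_mul_generated N G k) => x.
  move=> /mapP[i _ ->]; rewrite NGE; apply: generatedZ; apply: generated_mem.
  by apply/mapP; exists i; rewrite ?mem_enum.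
exists (\det E); first by move: detE; rewrite dE fmorph_eq0.
by rewrite -NGE; exact: minors_mul_generated'.
Qed.

End FrameMinors.
End ComplexMinors.

(** * Multiplicity computed in frame coordinates *)

Section Lines.
Variable R : realType.
Local Notation C := (R[i]).
Local Notation poly3 := (mpoly 3).
Local Notation V3 := ('rV[R]_3).
Variable f : 'I_3 -> V3 -> R.

(** Lets short explicit lists replace the minors: zero set and local algebras depend on the
    generated ideal only. *)
Definition same_minors (ms : seq (poly3 C)) : Prop :=
  (forall y, y \in ms -> generated [seq minorC f k | k <- enum 'I_(3 + 1)] y) /\
  (forall k, generated ms (minorC f k)).

Lemma same_minors_trans ms ms' : same_minors ms ->
  (forall y, y \in ms -> generated ms' y) -> (forall y, y \in ms' -> generated ms y) ->
  same_minors ms'.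
Proof.
move=> [H1 H2] H3 H4; split=> [y /H4|k]; first exact: generated_trans.
by apply: generated_trans H3 _.
Qed.

Lemma same_minors_V ms u : same_minors ms ->
  V_Mf f u <-> forall y, y \in ms -> evalp y u = 0.
Proof.
have ev s y : generated s y -> (forall x, x \in s -> evalp x u = 0) -> evalp y u = 0.
  move=> [c ->] H; apply: (big_ind (fun y => evalp y u = 0)).
  - exact: evalp0.
  - by move=> x z Hx Hz; rewrite evalpD Hx Hz addr0.
  - by move=> i _; rewrite evalpM (H (_`_i)) ?mulr0// mem_nth.
move=> [H1 H2]; split=> [V y /H1|V k].
  by move=> /ev; apply => x /mapP[k _ ->]; exact: V.
exact: ev (H2 k) V.
Qed.

Variable E : 'M[R]_3.
Hypothesis EE : E *m E^T = 1%:M.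
Let EC : 'M[C]_3 := map_mx (real_complex R) E.

Definition coord (k : 'I_3) : poly3 C := dot (var3 R) (map_mx (@cst3 R) (row k E)).
Definition coord_at (u : 'rV[C]_3) (k : 'I_3) : C := (u *m EC^T) 0 k.

Let ECT : EC^T = map_mx (real_complex R) E^T.
Proof. by apply/matrixP => i j; rewrite !mxE. Qed.

Let ECE : EC^T *m EC = 1%:M.
Proof. by apply: mulmx1C; rewrite ECT -map_mxM EE map_mx1. Qed.

Lemma coord_at_inj u w : coord_at u =1 coord_at w -> u = w.
Proof.
move=> H; rewrite -[u]mulmx1 -[w]mulmx1 -ECE !mulmxA; congr (_ *m _).
by apply/rowP.
Qed.

Lemma coord_at_mul (x : 'rV[C]_3) k : coord_at (x *m EC) k = x 0 k.
Proof. by rewrite /coord_at -mulmxA ECT -map_mxM EE map_mx1 mulmx1. Qed.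

Lemma coord_atZ a u k : coord_at (a *: u) k = a * coord_at u k.
Proof. by rewrite /coord_at -scalemxAl mxE. Qed.

Lemma coord_at_expand u : u = \row_k coord_at u k *m EC.
Proof. by apply: coord_at_inj => k; rewrite coord_at_mul mxE. Qed.

Lemma evalp_coord u k : evalp (coord k) u = coord_at u k.
Proof.
rewrite /coord /coord_at /dot mxE /evalp raddf_sum /=; apply: eq_bigr => j _.
by rewrite !mxE mevalM mevalC mevalXU.
Qed.

Lemma var_coord j : mvar C j = \sum_k cst3 (E k j) * coord k.
Proof.
have -> : \sum_k cst3 (E k j) * coord k = \sum_i mvar C i * cst3 ((E^T *m E) i j).
  under eq_bigr => k _ do rewrite /coord /dot mulr_sumr.
  rewrite exchange_big /=; apply: eq_bigr => i _; rewrite [in RHS]mxE rmorph_sum mulr_sumr.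
  by apply: eq_bigr => k _; rewrite rmorphM !mxE; ring.
rewrite (mulmx1C EE) (bigD1 j)//= big1 => [|i ij]; last first.
  by rewrite mxE (negPf ij) rmorph0 mulr0.
by rewrite mxE eqxx rmorph1 mulr1 addr0.
Qed.

(** The polynomial in [lam] required to be nonzero is the pairing with the direction of the line, so
    a generic plane is one not parallel to it and meets it at the direction divided by [d]. The
    hypothesis asks for the curve germ and parameter of [local_algebra_dim_curve], in frame
    coordinates. *)
Lemma line_mult_coord ms (x : 'rV[C]_3) n : same_minors ms -> x != 0 ->
  (forall l : 'rV[C]_3, let d := \sum_k l 0 k * x 0 k in d != 0 ->
    let plane := \sum_k mpolyC 3 (l 0 k) * coord k - 1 in
    exists (Q : 'I_3 -> {poly C}) (tau : poly3 C),
    [/\ forall k, (Q k).[0] = x 0 k / d,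
        forall q gens, (forall k, evalp (coord k) q = x 0 k / d) ->
          (forall h, h \in plane :: ms -> loc_mem q gens h) ->
          (forall k, loc_mem q gens (coord k - in_tau tau (Q k))) /\ loc_mem q gens (tau ^+ n)
      & forall P : 'I_3 -> {poly C}, (forall k, on_curve P (coord k) = Q k) ->
          'X^n %| on_curve P tau - 'X /\ (forall g, g \in plane :: ms -> 'X^n %| on_curve P g)]) ->
  line_mult f <[x *m EC]>%VS n.
Proof.
move=> [sm1 sm2] x0 H; set v := x *m EC.
have v0 : v != 0.
  apply: contra x0 => /eqP v0; apply/eqP/rowP => k.
  by rewrite -coord_at_mul -/v v0 /coord_at mul0mx !mxE.
exists (\sum_(i < 3) mpolyC 3 (v 0 i) * mvar C i).
  apply: contra v0 => /eqP E0; apply/eqP/rowP => i; rewrite [RHS]mxE.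
  have := congr1 (fun p => evalp p (delta_mx 0 i)) E0; rewrite evalp0 => <-.
  rewrite /evalp raddf_sum /= (bigD1 i)//= big1 => [|j ji].
    by rewrite mevalM mevalC mevalXU [delta_mx _ _ _ _]mxE !eqxx mulr1 addr0.
  by rewrite mevalM mevalC mevalXU [delta_mx _ _ _ _]mxE (negPf ji) andbF mulr0.
move=> lam; rewrite /evalp raddf_sum /=.
under eq_bigr => i _ do rewrite mevalM mevalC mevalXU.
move=> lv0.
pose l : 'rV[C]_3 := \row_k coord_at lam k.
have lamE : lam = l *m EC by exact: coord_at_expand.
have dE : \sum_k l 0 k * x 0 k = \sum_i v 0 i * lam 0 i.
  have -> : \sum_k l 0 k * x 0 k = (x *m l^T) 0 0.
    by rewrite mxE; apply: eq_bigr => k _; rewrite !mxE mulrC.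
  have -> : \sum_i v 0 i * lam 0 i = (v *m lam^T) 0 0.
    by rewrite mxE; apply: eq_bigr => k _; rewrite [lam^T _ _]mxE.
  rewrite lamE trmx_mul mulmxA -(mulmxA x) (_ : EC *m EC^T = 1%:M) ?mulmx1//.
  exact: mulmx1C ECE.
have d0 : \sum_k l 0 k * x 0 k != 0 by rewrite dE.
have [Q [tau [Q0 Jm Dv]]] := H l d0.
set d := \sum_k l 0 k * x 0 k in d0 dE Q0 Jm Dv *; set plane := \sum_k _ - 1 in Jm Dv *.
pose q := d^-1 *: v.
have planeE : \sum_(i < 3) lam 0 i *: mvar C i - 1 = plane.
  congr (_ - 1); under eq_bigr => i _ do rewrite var_coord -mul_mpolyC mulr_sumr.
  rewrite exchange_big /=; apply: eq_bigr => k _.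
  rewrite mxE /coord_at mxE rmorph_sum mulr_suml; apply: eq_bigr => i _.
  by rewrite rmorphM /= mulrA; congr (_ * _ * _); rewrite !mxE.
exists q.
  split; first by rewrite memvZ ?memv_line.
  rewrite /dot -[RHS](mulVf d0) dE mulr_sumr; apply: eq_bigr => i _.
  by rewrite /q mxE -dE; ring.
rewrite planeE; set gens := _ :: _.
have qE k : evalp (coord k) q = x 0 k / d.
  by rewrite evalp_coord /q coord_atZ coord_at_mul mulrC.
have [] := Jm q gens qE.
  move=> h; rewrite inE => /orP[/eqP ->|/sm1 [c ->]].
    by apply: loc_mem_gen; rewrite inE eqxx.
  apply: (big_ind (loc_mem q gens)).
  - exact: loc_mem0.
  - exact: loc_memD.
  - move=> i _; apply: loc_memM; apply: loc_mem_gen; rewrite inE; apply/orP; right.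
    exact: mem_nth.
move=> J1 J2.
pose P i : {poly C} := \sum_k (real_complex R (E k i))%:P * Q k.
have PQ k : on_curve P (coord k) = Q k.
  rewrite /coord /dot /on_curve rmorph_sum /=.
  have -> : Q k = \sum_j (real_complex R ((E *m E^T) k j))%:P * Q j.
    have F j : E *m E^T = 1%:M -> (real_complex R ((E *m E^T) k j))%:P = (k == j)%:R :> {poly C}.
      by move=> ->; rewrite mxE; case: eqP => _; rewrite ?rmorph1 ?rmorph0.
    under eq_bigr => j _ do rewrite (F j EE).
    by rewrite (bigD1 k)//= eqxx mul1r big1 ?addr0// => j /negPf; rewrite eq_sym => ->; rewrite mul0r.
  under [RHS]eq_bigr => j _ do rewrite mxE !rmorph_sum mulr_suml.
  rewrite [RHS]exchange_big /=; apply: eq_bigr => i _.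
  rewrite rmorphM /= !mxE -/(on_curve P (mvar C i)) on_curve_var /P mulr_suml.
  rewrite -/(on_curve P (cst3 (E k i))) on_curveC; apply: eq_bigr => j _.
  by rewrite mxE !rmorphM /=; ring.
have [D1 D2] := Dv P PQ.
apply: (@local_algebra_dim_curve R q gens n P tau).
- move=> i; rewrite /P horner_sum.
  have -> : q 0 i = \sum_k real_complex R (E k i) * (x 0 k / d).
    rewrite /q mxE /v mxE mulr_sumr; apply: eq_bigr => k _; rewrite mxE; ring.
  by apply: eq_bigr => k _; rewrite hornerM hornerC Q0.
- move=> i; rewrite var_coord /P.
  have -> : in_tau tau (\sum_k (real_complex R (E k i))%:P * Q k) = \sum_k cst3 (E k i) * in_tau tau (Q k).
    rewrite /in_tau rmorph_sum horner_sum; apply: eq_bigr => k _.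
    by apply: etrans (in_tauM _ _ _) _; rewrite in_tauC.
  rewrite -sumrB; apply: (big_ind (loc_mem q gens)).
  - exact: loc_mem0.
  - exact: loc_memD.
  - by move=> k _; rewrite -mulrBr; apply: loc_memM; exact: J1.
- exact: J2.
- move=> g; rewrite inE => /orP[/eqP ->|/mapP[k _ ->]].
    by apply: D2; rewrite inE eqxx.
  have [c ->] := sm2 k; rewrite /on_curve rmorph_sum /=.
  apply: (big_ind (fun p => 'X^n %| p)); first exact: dvdp0.
    exact: dvdp_add.
  move=> i _; rewrite rmorphM /=; apply: dvdp_mull; apply: D2.
  by rewrite inE mem_nth ?orbT.
- exact: D1.
Qed.

End Lines.

(** * Explicit generators of the ideal of minors *)

Section Recombination.
Variable K : idomainType.

Lemma generated4E (a1 a2 a3 a4 x y z t w : K) :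
  w = a1 * x + a2 * y + a3 * z + a4 * t -> generated [:: x; y; z; t] w.
Proof.
move=> ->; exists (fun i => nth 0 [:: a1; a2; a3; a4] i).
by rewrite /= !big_ord_recl big_ord0 /= addr0 !addrA.
Qed.

Definition same_span (s t : seq K) : Prop :=
  (forall y, y \in s -> generated t y) /\ (forall y, y \in t -> generated s y).

Lemma simple_recombination (x y z p q : K) :
  same_span [:: - (z * (p + q)); x * q; y * p; - (z * q)] [:: z * p; z * q; y * p; x * q].
Proof.
split=> w; rewrite !inE => /or4P[]/eqP ->.
- by apply: (generated4E (a1 := -1) (a2 := -1) (a3 := 0) (a4 := 0)); ring.
- by apply: (generated4E (a1 := 0) (a2 := 0) (a3 := 0) (a4 := 1)); ring.
- by apply: (generated4E (a1 := 0) (a2 := 0) (a3 := 1) (a4 := 0)); ring.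
- by apply: (generated4E (a1 := 0) (a2 := -1) (a3 := 0) (a4 := 0)); ring.
- by apply: (generated4E (a1 := -1) (a2 := 0) (a3 := 0) (a4 := 1)); ring.
- by apply: (generated4E (a1 := 0) (a2 := 0) (a3 := 0) (a4 := -1)); ring.
- by apply: (generated4E (a1 := 0) (a2 := 0) (a3 := 1) (a4 := 0)); ring.
- by apply: (generated4E (a1 := 0) (a2 := 1) (a3 := 0) (a4 := 0)); ring.
Qed.

Lemma tangent_recombination (x y z t : K) :
  same_span [:: - y; z; t - x; - x] [:: x; y; z; t].
Proof.
split=> w; rewrite !inE => /or4P[]/eqP ->.
- by apply: (generated4E (a1 := 0) (a2 := -1) (a3 := 0) (a4 := 0)); ring.
- by apply: (generated4E (a1 := 0) (a2 := 0) (a3 := 1) (a4 := 0)); ring.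
- by apply: (generated4E (a1 := -1) (a2 := 0) (a3 := 0) (a4 := 1)); ring.
- by apply: (generated4E (a1 := -1) (a2 := 0) (a3 := 0) (a4 := 0)); ring.
- by apply: (generated4E (a1 := 0) (a2 := 0) (a3 := 0) (a4 := -1)); ring.
- by apply: (generated4E (a1 := -1) (a2 := 0) (a3 := 0) (a4 := 0)); ring.
- by apply: (generated4E (a1 := 0) (a2 := 1) (a3 := 0) (a4 := 0)); ring.
- by apply: (generated4E (a1 := 0) (a2 := 0) (a3 := 1) (a4 := -1)); ring.
Qed.

Lemma ellipsoid_recombination (x y z t : K) :
  same_span [:: y; - z; x - t; x] [:: x; y; z; t].
Proof.
split=> w; rewrite !inE => /or4P[]/eqP ->.
- by apply: (generated4E (a1 := 0) (a2 := 1) (a3 := 0) (a4 := 0)); ring.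
- by apply: (generated4E (a1 := 0) (a2 := 0) (a3 := -1) (a4 := 0)); ring.
- by apply: (generated4E (a1 := 1) (a2 := 0) (a3 := 0) (a4 := -1)); ring.
- by apply: (generated4E (a1 := 1) (a2 := 0) (a3 := 0) (a4 := 0)); ring.
- by apply: (generated4E (a1 := 0) (a2 := 0) (a3 := 0) (a4 := 1)); ring.
- by apply: (generated4E (a1 := 1) (a2 := 0) (a3 := 0) (a4 := 0)); ring.
- by apply: (generated4E (a1 := 0) (a2 := -1) (a3 := 0) (a4 := 0)); ring.
- by apply: (generated4E (a1 := 0) (a2 := 0) (a3 := -1) (a4 := 1)); ring.
Qed.

End Recombination.

Section FrameMinorLists.
Variable R : realType.
Local Notation C := (R[i]).
Local Notation poly3 := (mpoly 3).
Local Notation V3 := ('rV[R]_3).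
Variable f : 'I_3 -> V3 -> R.
Hypothesis f_const : forall i, f i 0 = 0.
Hypothesis f_linear : forall i (v : V3), 'D_v (f i) 0 = 0.
Notation B := (hess f).

Definition det_rows (K : comNzRingType) (x y z : 'I_3 -> K) : K :=
  x 0 * (y 1 * z 2%:R - y 2%:R * z 1) - x 1 * (y 0 * z 2%:R - y 2%:R * z 0)
  + x 2%:R * (y 0 * z 1 - y 1 * z 0).

Lemma minors_col_mx (K : comNzRingType) (g : 'M[K]_3) (c : 'rV[K]_3) :
  [seq \det (row' k (col_mx g c) : 'M[K]_3) | k <- enum 'I_(3 + 1)] =
  [:: det_rows (g 1) (g 2%:R) (c 0); det_rows (g 0) (g 2%:R) (c 0);
      det_rows (g 0) (g 1) (c 0); det_rows (g 0) (g 1) (g 2%:R)].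
Proof.
have lo (i : 'I_4) (j : 'I_3) (l : 'I_3) : val i = l -> (col_mx g c : 'M[K]_(3 + 1, 3)) i j = g l j.
  move=> il; have -> : i = lshift 1 l by exact: val_inj.
  exact: col_mxEu.
have hi (i : 'I_4) (j : 'I_3) : val i = 3 -> (col_mx g c : 'M[K]_(3 + 1, 3)) i j = c 0 j.
  move=> il; have -> : i = rshift 3 (0 : 'I_1) by exact: val_inj.
  exact: col_mxEd.
have dE (A : 'M[K]_(3 + 1, 3)) k (x y z : 'I_3 -> K) :
    (forall j, row' k A 0 j = x j) -> (forall j, row' k A 1 j = y j) ->
    (forall j, row' k A 2%:R j = z j) -> \det (row' k A : 'M[K]_3) = det_rows x y z.
  by move=> Hx Hy Hz; rewrite det3E /det_rows !Hx !Hy !Hz.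
rewrite (enum_ordSl) /= !enum_ordSl /= enum_ord0 /=.
congr [:: _; _; _; _]; apply: dE => j; rewrite mxE.
all: by first [apply: lo|apply: hi].
Qed.

Lemma ord3P (i : 'I_3) : [\/ i = 0, i = 1 | i = 2%:R].
Proof.
by case: i => [[|[|[|//]]] H]; [constructor 1|constructor 2|constructor 3]; apply: val_inj.
Qed.

Lemma rows3_row (K : fieldType) (x y z : 'rV[K]_3) :
  [/\ row 0 (rows3 x y z) = x, row 1 (rows3 x y z) = y & row 2%:R (rows3 x y z) = z].
Proof. by split; rewrite rowK (tnth_nth 0). Qed.

Lemma orthonormal_mul_tr (e1 e2 e3 : V3) : orthonormal e1 e2 e3 ->
  rows3 e1 e2 e3 *m (rows3 e1 e2 e3)^T = 1%:M.
Proof.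
move=> [h1 h2 h3 [h4 h5 h6]]; set E := rows3 e1 e2 e3.
have H i j : (E *m E^T) i j = dot (row i E) (row j E).
  by rewrite mxE; apply: eq_bigr => k _; rewrite !mxE.
have [r0 r1 r2] := rows3_row e1 e2 e3.
apply/matrixP => i j; rewrite H mxE.
case: (ord3P i) => ->; case: (ord3P j) => ->; rewrite ?r0 ?r1 ?r2 /=.
- exact: h1.
- exact: h4.
- exact: h5.
- by rewrite dotC.
- exact: h2.
- exact: h6.
- by rewrite dotC.
- by rewrite dotC.
- exact: h3.
Qed.

Lemma bil_suml (K : comNzRingType) (A : 'I_3 -> 'M[K]_3) (c : 'I_3 -> K) (u : 'I_3 -> 'rV[K]_3) w :
  bil A (\sum_l c l *: u l) w = \sum_l c l *: bil A (u l) w.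
Proof. by rewrite !sum3 !bilDl !bilZl. Qed.

Lemma sum_combination (K : comNzRingType) (c t0 t1 t2 t3 : 'I_3 -> K) (v1 v2 v3 o : 'rV[K]_3) :
  \sum_l c l *: (t0 l *: v1 + t1 l *: v2 + t2 l *: v3 + t3 l *: o) =
  (\sum_l t0 l * c l) *: v1 + (\sum_l t1 l * c l) *: v2 + (\sum_l t2 l * c l) *: v3
  + (\sum_l t3 l * c l) *: o.
Proof. by rewrite !sum3; apply/rowP => i; rewrite !mxE; ring. Qed.

Lemma frame_same_minors (e1 e2 e3 o v1 v2 v3 : V3) (T : 'I_3 -> 'M[R]_3) (g : 'M[poly3 C]_3) :
  orthonormal e1 e2 e3 -> indep3 v1 v2 v3 ->
  let E := rows3 e1 e2 e3 in
  (forall l k, bil B (row l E) (row k E) =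
     T 0 l k *: v1 + T 1 l k *: v2 + T 2%:R l k *: v3 + (l == k)%:R *: o) ->
  (forall j k, g j k = \sum_l cst3 (T j l k) * coord E l) ->
  same_minors f [:: det_rows (g 1) (g 2%:R) (coord E); det_rows (g 0) (g 2%:R) (coord E);
      det_rows (g 0) (g 1) (coord E); det_rows (g 0) (g 1) (g 2%:R)].
Proof.
move=> on I E TE gE.
have EE := orthonormal_mul_tr on.
pose c : 'rV[poly3 C]_3 := \row_k dot (var3 R) (map_mx (@cst3 R) (row k E)).
have cE : c 0 =1 coord E by move=> k; rewrite mxE.
have varE : var3 R = \sum_l coord E l *: map_mx (@cst3 R) (row l E).
  apply/rowP => j; rewrite mxE (var_coord EE) summxE; apply: eq_bigr => l _.
  by rewrite !mxE mulrC.
have bE k : bil (fun i => map_mx (@cst3 R) (B i)) (var3 R) (map_mx (@cst3 R) (row k E)) =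
   g 0 k *: map_mx (@cst3 R) v1 + g 1 k *: map_mx (@cst3 R) v2 + g 2%:R k *: map_mx (@cst3 R) v3
   + c 0 k *: map_mx (@cst3 R) o.
  have ->: c 0 k = \sum_l cst3 (l == k)%:R * coord E l.
    rewrite cE (bigD1 k)//= big1 => [|l lk]; first by rewrite eqxx rmorph1 mul1r addr0.
    by rewrite (negPf lk) rmorph0 mul0r.
  rewrite !gE varE bil_suml -sum_combination; apply: eq_bigr => l _.
  rewrite bil_map TE !map_mxD !map_mxZ //.
have [H1 H2] := frame_minors f_const f_linear on I bE.
have := minors_col_mx g c.
have -> : det_rows (g 1) (g 2%:R) (c 0) = det_rows (g 1) (g 2%:R) (coord E).
  by rewrite /det_rows !cE.
have -> : det_rows (g 0) (g 2%:R) (c 0) = det_rows (g 0) (g 2%:R) (coord E).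
  by rewrite /det_rows !cE.
have -> : det_rows (g 0) (g 1) (c 0) = det_rows (g 0) (g 1) (coord E).
  by rewrite /det_rows !cE.
move=> <-.
have inv (x : R) (y : poly3 C) s : x != 0 -> generated s (cst3 x * y) -> generated s y.
  move=> x0 /(generatedZ (cst3 x^-1)); rewrite mulrA -rmorphM mulVf// rmorph1 mul1r //.
split=> [y /mapP[k _ ->]|k].
  by have [x x0 Hx] := H1 k; exact: inv Hx.
by have [x x0 Hx] := H2 k; exact: inv Hx.
Qed.

(** Structure constants of the bilinear map, by component, row and column; nested lists leave
    literal entries for [ring] after simplification. *)
Definition coef3 (s : seq (seq (seq R))) (j l k : 'I_3) : R := nth 0 (nth [::] (nth [::] s j) l) k.

Lemma frame_minor_list (e1 e2 e3 o v1 v2 v3 : V3) (s : seq (seq (seq R))) :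
  orthonormal e1 e2 e3 -> indep3 v1 v2 v3 ->
  (forall l k, bil B (row l (rows3 e1 e2 e3)) (row k (rows3 e1 e2 e3)) =
     coef3 s 0 l k *: v1 + coef3 s 1 l k *: v2 + coef3 s 2%:R l k *: v3 + (l == k)%:R *: o) ->
  let c := coord (rows3 e1 e2 e3) in
  let g j k := cst3 (coef3 s j 0 k) * c 0 + cst3 (coef3 s j 1 k) * c 1 + cst3 (coef3 s j 2%:R k) * c 2%:R in
  forall d1 d2 d3 d4 : poly3 C,
    det_rows (g 1) (g 2%:R) c = d1 -> det_rows (g 0) (g 2%:R) c = d2 ->
    det_rows (g 0) (g 1) c = d3 -> det_rows (g 0) (g 1) (g 2%:R) = d4 ->
  same_minors f [:: d1; d2; d3; d4].
Proof.
move=> on I TE c g d1 d2 d3 d4 <- <- <- <-.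
have := @frame_same_minors e1 e2 e3 o v1 v2 v3 (fun j => \matrix_(l, k) coef3 s j l k)
  (\matrix_(j, k) g j k) on I.
have gE : (\matrix_(j, k) g j k : 'M[poly3 C]_3) =2 g by move=> j k; rewrite mxE.
rewrite /det_rows !gE; apply.
  by move=> l k; rewrite TE !mxE.
by move=> j k; rewrite gE sum3 !mxE.
Qed.

Section Lists.
Variables (e1 e2 e3 : V3).
Let c := coord (rows3 e1 e2 e3).

(** Off c2 = 0 the zeros are those of [Q1] and [Q2], each a product of two linear forms over C; on
    c2 = 0 only the lines of [e1] and [e2] remain. *)
Definition simple_minors (p q al be : R) : seq (poly3 C) :=
  let Q1 := (c 0 + cst3 p * c 2%:R) ^+ 2 - cst3 al * c 2%:R ^+ 2 in
  let Q2 := (c 1 + cst3 q * c 2%:R) ^+ 2 - cst3 be * c 2%:R ^+ 2 in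
  [:: c 2%:R * Q1; c 2%:R * Q2; c 1 * Q1; c 0 * Q2].

(** On c2 = 0 the last generator is c0 c1 (c0 - b c1); off c2 = 0 the zeros satisfy L = 0 and b c0 +
    c1 = 0. *)
Definition tangent_minors (a b : R) : seq (poly3 C) :=
  let h := cst3 (a / 2) in let b' := cst3 b in
  let L := c 1 + h * c 2%:R in
  [:: c 2%:R ^+ 2 * L; c 2%:R ^+ 2 * (b' * c 0 + c 1); c 0 * c 2%:R * L;
      c 0 * L * (c 0 - b' * c 1) + h * c 1 * c 2%:R * (b' * c 0 + c 1)].

Definition ellipsoid_minors : seq (poly3 C) :=
  [:: c 2%:R ^+ 3; c 2%:R ^+ 2 * c 0; c 2%:R ^+ 2 * c 1; c 2%:R * (c 0 ^+ 2 + c 1 ^+ 2)].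

Let cst01 : cst3 0 = 0 :> poly3 C /\ cst3 1 = 1 :> poly3 C.
Proof. by rewrite rmorph0 rmorph1. Qed.

Lemma simple_same_minors dl p q : simple_frame B e1 e2 e3 dl p q ->
  same_minors f (simple_minors p q (1 - dl + p ^+ 2) (dl + q ^+ 2)).
Proof.
move=> [[on ef] I nn]; have [r0 r1 r2] := rows3_row e1 e2 e3.
have sB := hess_sym f.
pose s := [:: [:: [:: 0; 0; 0]; [:: 0; 1; 0]; [:: 0; 0; dl]];
  [:: [:: 0; 0; 1]; [:: 0; 0; 0]; [:: 1; 0; 2 * p]];
  [:: [:: 0; 0; 0]; [:: 0; 0; 1]; [:: 0; 1; 2 * q]]].
have TE l k : bil B (row l (rows3 e1 e2 e3)) (row k (rows3 e1 e2 e3)) =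
     coef3 s 0 l k *: (bil B e2 e2 - bil B e1 e1) + coef3 s 1 l k *: bil B e1 e3
     + coef3 s 2%:R l k *: bil B e2 e3 + (l == k)%:R *: bil B e1 e1.
  case: (ord3P l) => ->; case: (ord3P k) => ->; rewrite ?r0 ?r1 ?r2 /=;
  rewrite ?(bilC _ e1 sB) ?(bilC e3 e2 sB) ?ef ?nn /coef3 /= ?scale0r ?scale1r ?add0r ?addr0 //.
    by rewrite subrK.
  by rewrite -!addrA addrC !addrA.
have [c0 c1] := cst01.
have [pE qE] : cst3 (2 * p) = 2 * cst3 p :> poly3 C /\ cst3 (2 * q) = 2 * cst3 q :> poly3 C.
  by rewrite !rmorphM !rmorph_nat.
have aE : cst3 (1 - dl + p ^+ 2) = 1 - cst3 dl + cst3 p ^+ 2 :> poly3 C.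
  by rewrite rmorphD rmorphB rmorphXn rmorph1.
have bE : cst3 (dl + q ^+ 2) = cst3 dl + cst3 q ^+ 2 :> poly3 C by rewrite rmorphD rmorphXn.
have [S1 S2] := simple_recombination (c 0) (c 1) (c 2%:R)
  ((c 0 + cst3 p * c 2%:R) ^+ 2 - cst3 (1 - dl + p ^+ 2) * c 2%:R ^+ 2)
  ((c 1 + cst3 q * c 2%:R) ^+ 2 - cst3 (dl + q ^+ 2) * c 2%:R ^+ 2).
apply: (same_minors_trans _ S1 S2); rewrite aE bE.
apply: (frame_minor_list on I TE); rewrite /det_rows /coef3 /= -/c c0 c1 ?pE ?qE;
  move: (cst3 dl) (cst3 p) (cst3 q) (c 0) (c 1) (c 2%:R); clear; move=> *; ring.
Qed.

Lemma tangent_same_minors a b : tangent_frame B e1 e2 e3 a b ->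
  same_minors f (tangent_minors a b).
Proof.
move=> [[on ef] I fn]; have [r0 r1 r2] := rows3_row e1 e2 e3.
have sB := hess_sym f.
pose s := [:: [:: [:: 0; 0; 0]; [:: 0; 1; a / 2]; [:: 0; a / 2; 0]];
  [:: [:: 0; 0; 1]; [:: 0; 0; - b]; [:: 1; - b; 0]];
  [:: [:: 0; 0; 0]; [:: 0; 0; 0]; [:: 0; 0; 1]]].
have TE l k : bil B (row l (rows3 e1 e2 e3)) (row k (rows3 e1 e2 e3)) =
     coef3 s 0 l k *: (bil B e2 e2 - bil B e1 e1) + coef3 s 1 l k *: bil B e1 e3
     + coef3 s 2%:R l k *: (bil B e3 e3 - bil B e1 e1) + (l == k)%:R *: bil B e1 e1.
  by case: (ord3P l) => ->; case: (ord3P k) => ->; rewrite ?r0 ?r1 ?r2 /=;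
  rewrite ?(bilC _ e1 sB) ?(bilC e3 e2 sB) ?ef ?fn /coef3 /= ?scale0r ?scale1r ?add0r ?addr0
    ?scaleNr ?subrK //.
have [c0 c1] := cst01.
have bE : cst3 (- b) = - cst3 b :> poly3 C by rewrite rmorphN.
have [S1 S2] := tangent_recombination (c 2%:R ^+ 2 * (c 1 + cst3 (a / 2) * c 2%:R))
  (c 2%:R ^+ 2 * (cst3 b * c 0 + c 1)) (c 0 * c 2%:R * (c 1 + cst3 (a / 2) * c 2%:R))
  (c 0 * (c 1 + cst3 (a / 2) * c 2%:R) * (c 0 - cst3 b * c 1)
   + cst3 (a / 2) * c 1 * c 2%:R * (cst3 b * c 0 + c 1)).
apply: (same_minors_trans _ S1 S2).
apply: (frame_minor_list on I TE); rewrite /det_rows /coef3 /= -/c c0 c1 ?bE;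
  move: (cst3 (a / 2)) (cst3 b) (c 0) (c 1) (c 2%:R); clear; move=> *; ring.
Qed.

Lemma ellipsoid_same_minors : ellipsoid_frame B e1 e2 e3 -> same_minors f ellipsoid_minors.
Proof.
move=> [[on ef] ff I]; have [r0 r1 r2] := rows3_row e1 e2 e3.
have sB := hess_sym f.
pose s : seq (seq (seq R)) := [:: [:: [:: 0; 0; 1]; [:: 0; 0; 0]; [:: 1; 0; 0]];
  [:: [:: 0; 0; 0]; [:: 0; 0; 1]; [:: 0; 1; 0]];
  [:: [:: 0; 0; 0]; [:: 0; 0; 0]; [:: 0; 0; 1]]].
have TE l k : bil B (row l (rows3 e1 e2 e3)) (row k (rows3 e1 e2 e3)) =
     coef3 s 0 l k *: bil B e1 e3 + coef3 s 1 l k *: bil B e2 e3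
     + coef3 s 2%:R l k *: (bil B e3 e3 - bil B e1 e1) + (l == k)%:R *: bil B e1 e1.
  by case: (ord3P l) => ->; case: (ord3P k) => ->; rewrite ?r0 ?r1 ?r2 /=;
  rewrite ?(bilC _ e1 sB) ?(bilC e3 e2 sB) ?ef ?ff /coef3 /= ?scale0r ?scale1r ?add0r ?addr0
    ?subrK //.
have [c0 c1] := cst01.
have [S1 S2] := ellipsoid_recombination (c 2%:R ^+ 3) (c 2%:R ^+ 2 * c 0) (c 2%:R ^+ 2 * c 1)
  (c 2%:R * (c 0 ^+ 2 + c 1 ^+ 2)).
apply: (same_minors_trans _ S1 S2).
apply: (frame_minor_list on I TE); rewrite /det_rows /coef3 /= -/c c0 c1;
  move: (c 0) (c 1) (c 2%:R); clear; move=> *; ring.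
Qed.

End Lists.

End FrameMinorLists.

Lemma plane_reduced (K : comNzRingType) (l x c : 'I_3 -> K) y :
  (\sum_k l k * x k) * y - 1 = (\sum_k l k * c k - 1) - \sum_k l k * (c k - x k * y).
Proof. by rewrite !sum3; ring. Qed.

Lemma plane_graph (K : comNzRingType) (l t c : 'I_3 -> K) j li : l j * li = 1 ->
  (\sum_k l k * c k - 1) - \sum_(k | k != j) l k * (c k - t k) =
  l j * (c j - li * (1 - \sum_(k | k != j) l k * t k)).
Proof.
move=> lj; rewrite mulrBr mulrA lj mul1r (bigD1 j)//=.
under [\sum_(k | _) l k * (_ - _)]eq_bigr => i _ do rewrite mulrBr.
by rewrite sumrB; move: (\sum_(k | _) _) (\sum_(k | _) _) => A A'; ring.
Qed.

Lemma reduced_coord (K : comNzRingType) (ck cj x d y : K) : y * d = x ->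
  ck - y = 1 * (ck - x * cj) + y * (d * cj - 1).
Proof. by move=> <-; ring. Qed.

(** * Two criteria for the multiplicity of a line *)

Section LineLists.
Variable R : realType.
Local Notation C := (R[i]).
Local Notation poly3 := (mpoly 3).
Local Notation V3 := ('rV[R]_3).
Variable f : 'I_3 -> V3 -> R.
Variables e1 e2 e3 : V3.
Hypothesis on : orthonormal e1 e2 e3.
Let E := rows3 e1 e2 e3.
Let EE : E *m E^T = 1%:M := orthonormal_mul_tr on.
Let EC : 'M[C]_3 := map_mx (real_complex R) E.
Let c := coord E.
Local Notation rc := (real_complex R).

Definition frame_line (x : 'rV[C]_3) : {vspace 'rV[C]_3} := <[x *m EC]>%VS.

Lemma evalp_cst r (u : 'rV[C]_3) : evalp (cst3 r) u = rc r.
Proof. exact: evalpC. Qed.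
Lemma on_curve_cst (P : 'I_3 -> {poly C}) r : on_curve P (cst3 r) = (rc r)%:P.
Proof. exact: on_curveC. Qed.
Lemma on_curveX (P : 'I_3 -> {poly C}) h k : on_curve P (h ^+ k) = on_curve P h ^+ k.
Proof. exact: rmorphXn. Qed.
Lemma on_curve_plane (P : 'I_3 -> {poly C}) (l : 'I_3 -> C) (h : 'I_3 -> poly3 C) :
  on_curve P (\sum_k mpolyC 3 (l k) * h k - 1) = \sum_k (l k)%:P * on_curve P (h k) - 1.
Proof.
rewrite on_curveB; congr (_ - _); last by rewrite -(mpolyC1 3 C) on_curveC.
apply: etrans (rmorph_sum _ _ _ _) _; apply: eq_bigr => k _.
by apply: etrans (on_curveM _ _ _) _; rewrite on_curveC.
Qed.

Lemma loc_mem_comb q gens (s t h1 h2 h : poly3 C) : h = s * h1 + t * h2 ->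
  loc_mem q gens h1 -> loc_mem q gens h2 -> loc_mem q gens h.
Proof. by move=> -> H1 H2; apply: loc_memD; exact: loc_memM. Qed.

Lemma loc_mem_div q gens (s h h' : poly3 C) : evalp s q != 0 -> h' = s * h ->
  loc_mem q gens h' -> loc_mem q gens h.
Proof. by move=> s0 ->; exact: loc_mem_cancel. Qed.

Lemma on_curve_const (P : 'I_3 -> {poly C}) (x : 'rV[C]_3) t :
  (forall i, on_curve P (c i) = (x 0 i * t)%:P) ->
  exists2 u, forall i, coord_at E u i = x 0 i * t & forall h, on_curve P h = (evalp h u)%:P.
Proof.
move=> PE; exists ((t *: x) *m EC).
  by move=> i; rewrite (coord_at_mul EE) mxE mulrC.
elim/poly3_ind => [a|i|h1 h2 IH1 IH2|h1 h2 IH1 IH2].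
- by rewrite on_curveC evalpC.
- rewrite evalp_var (var_coord EE); apply: etrans (rmorph_sum _ _ _ _) _.
  rewrite [in RHS]mxE rmorph_sum; apply: eq_bigr => k _.
  apply: etrans (on_curveM _ _ _) _; rewrite PE on_curve_cst !mxE mulrC -polyCM.
  by rewrite (mulrC t).
- by rewrite on_curveD evalpD IH1 IH2 polyCD.
- by rewrite on_curveM evalpM IH1 IH2 polyCM.
Qed.

Lemma frame_lineP (x u : 'rV[C]_3) :
  u \in frame_line x <-> exists t, forall i, coord_at E u i = x 0 i * t.
Proof.
split=> [/vlineP[t ->]|[t H]].
  by exists t => i; rewrite coord_atZ (coord_at_mul EE) mulrC.
apply/vlineP; exists t; apply: (coord_at_inj EE) => i.
by rewrite H coord_atZ (coord_at_mul EE) mulrC.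
Qed.

(** When the local ideal contains the linear equations of the line, the plane cuts out a reduced
    point: the germ is constant and the parameter is 0. *)
Lemma line_mult_reduced ms (x : 'rV[C]_3) j : same_minors f ms -> x 0 j = 1 ->
  (forall q gens (t : C), t != 0 -> (forall i, evalp (c i) q = x 0 i * t) ->
     (forall h, h \in ms -> loc_mem q gens h) ->
     forall i, loc_mem q gens (c i - mpolyC 3 (x 0 i) * c j)) ->
  (forall u t, (forall i, coord_at E u i = x 0 i * t) -> V_Mf f u) ->
  line_mult f (frame_line x) 1.
Proof.
move=> sm xj red zer; apply: (line_mult_coord EE sm).
  by apply/eqP => x0; move/eqP: xj; rewrite x0 mxE eq_sym oner_eq0.
move=> l d d0 plane; exists (fun k => (x 0 k / d)%:P), 0; split.
- by move=> k; rewrite hornerC.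
- move=> q gens qE ms_mem; split; last by rewrite expr1; exact: loc_mem0.
  have m k : loc_mem q gens (c k - mpolyC 3 (x 0 k) * c j).
    apply: (red _ _ d^-1) => //; first by rewrite invr_eq0.
    by move=> h hm; apply: ms_mem; rewrite inE hm orbT.
  have pl : loc_mem q gens plane by apply: ms_mem; rewrite inE eqxx.
  have mj : loc_mem q gens (mpolyC 3 d * c j - 1).
    have -> : mpolyC 3 d * c j - 1 =
        plane - \sum_k mpolyC 3 (l 0 k) * (c k - mpolyC 3 (x 0 k) * c j).
      rewrite -(plane_reduced _ (fun k => mpolyC 3 (x 0 k))); congr (_ * _ - 1).
      by rewrite /d rmorph_sum; apply: eq_bigr => k _; rewrite rmorphM.
    apply: loc_memB => //; apply: (big_ind (loc_mem q gens)).
    + exact: loc_mem0.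
    + exact: loc_memD.
    + by move=> k _; apply: loc_memM; exact: m.
  move=> k; rewrite in_tauC.
  apply: (loc_mem_comb (s := 1) (t := mpolyC 3 (x 0 k / d)) _ (m k) mj).
  by apply: reduced_coord; rewrite -mpolyCM divfK.
- move=> P PE; split.
    by rewrite -[0]/(mpolyC 3 0 : poly3 C) on_curveC sub0r expr1 dvdpNr.
  move=> g; rewrite inE => /orP[/eqP ->|gm]; last first.
    have [u uE ->] := on_curve_const PE.
    by have /(same_minors_V _ sm)/(_ _ gm) -> := zer u _ uE; rewrite polyC0 dvdp0.
  rewrite /plane on_curve_plane (_ : \sum_k _ = 1%:P) ?subrr ?dvdp0//.
  rewrite -(mulfV d0) {1}/d mulr_suml rmorph_sum; apply: eq_bigr => k _.
  by rewrite PE -polyCM mulrA.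
Qed.

(** For a coordinate axis only two coordinates are prescribed along the germ; the third is solved
    from the equation of the plane, whose coefficient [l 0 j] is nonzero. *)
Lemma line_mult_graph ms j n : same_minors f ms ->
  (forall l : 'rV[C]_3, l 0 j != 0 ->
    let plane := \sum_k mpolyC 3 (l 0 k) * c k - 1 in
    exists (Q : 'I_3 -> {poly C}) (tau : poly3 C),
    [/\ forall k, k != j -> (Q k).[0] = 0,
        forall q gens, evalp (c j) q != 0 -> (forall k, k != j -> evalp (c k) q = 0) ->
          (forall h, h \in plane :: ms -> loc_mem q gens h) ->
          (forall k, k != j -> loc_mem q gens (c k - in_tau tau (Q k)))
          /\ loc_mem q gens (tau ^+ n)
      & forall P : 'I_3 -> {poly C}, (forall k, k != j -> on_curve P (c k) = Q k) ->
          on_curve P plane = 0 ->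
          'X^n %| on_curve P tau - 'X /\ (forall g, g \in ms -> 'X^n %| on_curve P g)]) ->
  line_mult f (frame_line (delta_mx 0 j)) n.
Proof.
move=> sm H; apply: (line_mult_coord EE sm).
  apply/eqP => /rowP/(_ j); rewrite !mxE !eqxx => /eqP; by rewrite oner_eq0.
move=> l d d0 plane.
have dE : d = l 0 j.
  rewrite /d (bigD1 j)//= big1 => [|k kj]; first by rewrite mxE !eqxx mulr1 addr0.
  by rewrite mxE (negPf kj) andbF mulr0.
rewrite dE in d0 *; have [Q [tau [Q0 J Dv]]] := H l d0.
pose Qj := (l 0 j)^-1 *: (1 - \sum_(k | k != j) l 0 k *: Q k).
exists (fun k => if k == j then Qj else Q k), tau; split.
- move=> k; case: eqP => [->|/eqP kj].
    rewrite /Qj mxE !eqxx mul1r hornerZ hornerD hornerN horner_sum big1 => [|i ij].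
      by rewrite subr0 -[1]/(1%:P) hornerC mulr1.
    by rewrite hornerZ Q0// mulr0.
  by rewrite Q0// mxE (negPf kj) andbF mul0r.
- move=> q gens qE ms_mem.
  have [|k kj|J1 J2] := J q gens _ _ ms_mem.
  + by rewrite qE mxE !eqxx mul1r invr_eq0.
  + by rewrite qE mxE (negPf kj) andbF mul0r.
  split=> // k; case: eqP => [->|/eqP kj]; last exact: J1.
  have pl : loc_mem q gens plane by apply: ms_mem; rewrite inE eqxx.
  apply: (loc_mem_div (s := mpolyC 3 (l 0 j)) (h' := plane - \sum_(k | k != j) mpolyC 3 (l 0 k) * (c k - in_tau tau (Q k)))).
  + by rewrite evalpC.
  + have -> : in_tau tau Qj = mpolyC 3 (l 0 j)^-1 * (1 - \sum_(k | k != j) mpolyC 3 (l 0 k) * in_tau tau (Q k)).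
      rewrite /Qj -mul_polyC in_tauM in_tauC in_tauB -(polyC1 C) in_tauC mpolyC1.
      congr (_ * (1 - _)); rewrite /in_tau rmorph_sum horner_sum; apply: eq_bigr => i _.
      by rewrite -mul_polyC; apply: etrans (in_tauM _ _ _) _; rewrite in_tauC.
    apply: (plane_graph (l := fun k => mpolyC 3 (l 0 k)) (fun k => in_tau tau (Q k)) c).
    by rewrite -rmorphM mulfV// mpolyC1.
  + apply: loc_memB => //; apply: (big_ind (loc_mem q gens)).
    * exact: loc_mem0.
    * exact: loc_memD.
    * by move=> i ij; apply: loc_memM; exact: J1.
- move=> P PE.
  have pl0 : on_curve P plane = 0.
    rewrite /plane on_curve_plane; under eq_bigr => k _ do rewrite PE.
    rewrite (bigD1 j)//= eqxx /Qj -mul_polyC mulrA -rmorphM mulfV// mul1r.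
    rewrite [X in _ + X - _](eq_bigr (fun k => l 0 k *: Q k)) => [|k kj].
      by rewrite subrK subrr.
    by rewrite (negPf kj) mul_polyC.
  have [|D1 D2] := Dv P _ pl0.
    by move=> k kj; rewrite PE (negPf kj).
  split=> // g; rewrite inE => /orP[/eqP ->|]; last exact: D2.
  by rewrite pl0 dvdp0.
Qed.

End LineLists.

Lemma all_list4 (T : eqType) (Q : T -> Prop) (a1 a2 a3 a4 : T) :
  (forall y, y \in [:: a1; a2; a3; a4] -> Q y) <-> [/\ Q a1, Q a2, Q a3 & Q a4].
Proof.
split=> [H|[h1 h2 h3 h4] y]; last by rewrite !inE => /or4P[] /eqP ->.
by split; apply: H; rewrite !inE eqxx ?orbT.
Qed.

Lemma iff_list4 (T : Type) (a1 a2 a3 a4 b1 b2 b3 b4 o : T) :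
  a1 = b1 -> a2 = b2 -> a3 = b3 -> a4 = b4 ->
  [/\ a1 = o, a2 = o, a3 = o & a4 = o] <-> [/\ b1 = o, b2 = o, b3 = o & b4 = o].
Proof. by move=> -> -> -> ->. Qed.

(** * Lines of the zero set in a simple frame *)

Section FrameLines.
Variable R : realType.
Local Notation C := (R[i]).
Local Notation poly3 := (mpoly 3).
Local Notation V3 := ('rV[R]_3).
Variable f : 'I_3 -> V3 -> R.
Hypothesis f_const : forall i, f i 0 = 0.
Hypothesis f_linear : forall i (v : V3), 'D_v (f i) 0 = 0.
Local Notation B := (hess f).
Variables e1 e2 e3 : V3.
Local Notation E := (rows3 e1 e2 e3).
Local Notation c := (coord E).
Local Notation rc := (real_complex R).
Local Notation line x := (frame_line e1 e2 e3 x).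

Lemma loc_mem_cancelr z gens (s h : poly3 C) :
  evalp s z != 0 -> loc_mem z gens (h * s) -> loc_mem z gens h.
Proof. by move=> s0; rewrite mulrC; exact: loc_mem_cancel. Qed.

Lemma loc_mem_coord0 z gens (h h' : poly3 C) a : a = 0 ->
  loc_mem z gens h -> loc_mem z gens (h - mpolyC 3 a * h').
Proof. by move=> ->; rewrite mpolyC0 mul0r subr0. Qed.

Lemma loc_mem_coord1 z gens (h : poly3 C) a : a = 1 -> loc_mem z gens (h - mpolyC 3 a * h).
Proof. by move=> ->; rewrite mpolyC1 mul1r subrr; exact: loc_mem0. Qed.

Lemma evM (x y : poly3 C) u a b : evalp x u = a -> evalp y u = b -> evalp (x * y) u = a * b.
Proof. by move=> <- <-; exact: evalpM. Qed.
Lemma evD (x y : poly3 C) u a b : evalp x u = a -> evalp y u = b -> evalp (x + y) u = a + b.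
Proof. by move=> <- <-; exact: evalpD. Qed.
Lemma evB (x y : poly3 C) u a b : evalp x u = a -> evalp y u = b -> evalp (x - y) u = a - b.
Proof. by move=> <- <-; rewrite evalpD evalpN. Qed.
Lemma evX (x : poly3 C) n u a : evalp x u = a -> evalp (x ^+ n) u = a ^+ n.
Proof. by move=> <-; exact: evalpX. Qed.

Lemma coord_at_row (u : 'rV[C]_3) (x : 'rV[C]_3) t :
  (forall i, coord_at E u i = x 0 i * t) ->
  [/\ coord_at E u 0 = x 0 0 * t, coord_at E u 1 = x 0 1 * t & coord_at E u 2%:R = x 0 2%:R * t].
Proof. by move=> H; rewrite !H. Qed.

Section Simple.
Variables dl p q : R.
Hypothesis sf : simple_frame B e1 e2 e3 dl p q.
Let al := 1 - dl + p ^+ 2.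
Let be := dl + q ^+ 2.
Let on : orthonormal e1 e2 e3. Proof. by have [[]] := sf. Qed.
Let sm : same_minors f (simple_minors e1 e2 e3 p q al be) := simple_same_minors f_const f_linear sf.

Lemma simple_V (u : 'rV[C]_3) : let x := coord_at E u in
  V_Mf f u <->
  [/\ x 2%:R * ((x 0 + rc p * x 2%:R) ^+ 2 - rc al * x 2%:R ^+ 2) = 0,
      x 2%:R * ((x 1 + rc q * x 2%:R) ^+ 2 - rc be * x 2%:R ^+ 2) = 0,
      x 1 * ((x 0 + rc p * x 2%:R) ^+ 2 - rc al * x 2%:R ^+ 2) = 0
    & x 0 * ((x 1 + rc q * x 2%:R) ^+ 2 - rc be * x 2%:R ^+ 2) = 0].
Proof.
apply: iff_trans (same_minors_V u sm) _; apply: iff_trans (all_list4 _ _ _ _ _) _.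
pose ec k := evalp_coord E u k.
pose Q1 := evB (evX 2 (evD (ec 0) (evM (evalp_cst p u) (ec 2%:R)))) (evM (evalp_cst al u) (evX 2 (ec 2%:R))).
pose Q2 := evB (evX 2 (evD (ec 1) (evM (evalp_cst q u) (ec 2%:R)))) (evM (evalp_cst be u) (evX 2 (ec 2%:R))).
exact: iff_list4 (evM (ec 2%:R) Q1) (evM (ec 2%:R) Q2) (evM (ec 1) Q1) (evM (ec 0) Q2).
Qed.

(** On this line [Q1] is a unit, so c2 Q1 and c1 Q1 yield the two linear equations. *)
Lemma simple_mult_e1 : line_mult f (line (vec3 1 0 0)) 1.
Proof.
have [v0 v1 v2] := vec3E (1 : C) 0 0.
apply: (line_mult_reduced on (j := 0) sm v0) => [z gens t t0 zE /all_list4[m1 m2 m3 m4] i|u t /coord_at_row].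
  have U : evalp ((c 0 + cst3 p * c 2%:R) ^+ 2 - cst3 al * c 2%:R ^+ 2) z != 0.
    rewrite (evB (evX 2 (evD (zE 0) (evM (evalp_cst p z) (zE 2%:R)))) (evM (evalp_cst al z) (evX 2 (zE 2%:R)))).
    rewrite v0 v2.
    by rewrite !mul0r expr0n !mulr0 subr0 addr0 mul1r expf_neq0.
  have n2 := loc_mem_cancelr U m1; have n1 := loc_mem_cancelr U m3.
  case: (ord3P i) => ->.
  - exact: loc_mem_coord1 v0.
  - exact: loc_mem_coord0 v1 n1.
  - exact: loc_mem_coord0 v2 n2.
rewrite v0 v1 v2 => -[x0 x1 x2]; apply/simple_V; rewrite x0 x1 x2.
by split; ring.
Qed.

Lemma simple_mult_e2 : line_mult f (line (vec3 0 1 0)) 1.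
Proof.
have [v0 v1 v2] := vec3E (0 : C) 1 0.
apply: (line_mult_reduced on (j := 1) sm v1) => [z gens t t0 zE /all_list4[m1 m2 m3 m4] i|u t /coord_at_row].
  have U : evalp ((c 1 + cst3 q * c 2%:R) ^+ 2 - cst3 be * c 2%:R ^+ 2) z != 0.
    rewrite (evB (evX 2 (evD (zE 1) (evM (evalp_cst q z) (zE 2%:R)))) (evM (evalp_cst be z) (evX 2 (zE 2%:R)))).
    rewrite v1 v2.
    by rewrite !mul0r expr0n !mulr0 subr0 addr0 mul1r expf_neq0.
  have n2 := loc_mem_cancelr U m2; have n0 := loc_mem_cancelr U m4.
  case: (ord3P i) => ->.
  - exact: loc_mem_coord0 v0 n0.
  - exact: loc_mem_coord1 v1.
  - exact: loc_mem_coord0 v2 n2.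
rewrite v0 v1 v2 => -[x0 x1 x2]; apply/simple_V; rewrite x0 x1 x2.
by split; ring.
Qed.

(** A difference of squares: the factor with the opposite root, times [y], is a unit at the point,
    so the other factor lies in the ideal. *)
Lemma loc_mem_factor z gens (x y P A s : poly3 C) : s * s = A ->
  evalp (y * (x + P * y + s * y)) z != 0 ->
  loc_mem z gens (y * ((x + P * y) ^+ 2 - A * y ^+ 2)) -> loc_mem z gens (x - (s - P) * y).
Proof.
move=> <- U H; apply: (loc_mem_cancel U); move: H; congr (loc_mem _ _ _).
by ring.
Qed.

Lemma simple_mult_e3 (a b : C) : a ^+ 2 = rc al -> b ^+ 2 = rc be -> a != 0 -> b != 0 ->
  line_mult f (line (vec3 (a - rc p) (b - rc q) 1)) 1.
Proof.
move=> aE bE a0 b0.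
have [v0 v1 v2] := vec3E (a - rc p) (b - rc q) 1.
apply: (line_mult_reduced on (j := 2%:R) sm v2) => [z gens t t0 zE /all_list4[m1 m2 m3 m4] i|u t /coord_at_row].
  case: (ord3P i) => ->.
  - rewrite v0 mpolyCB; apply: (@loc_mem_factor _ _ _ _ _ (cst3 al)).
    + by rewrite -mpolyCM -expr2 aE.
    + rewrite (evM (zE 2%:R) (evD (evD (zE 0) (evM (evalpC z _) (zE 2%:R))) (evM (evalpC z _) (zE 2%:R)))).
      rewrite v0 v2 mul1r mulf_neq0//.
      rewrite (_ : _ + _ = 2 * a * t); last by ring.
      by rewrite !mulf_neq0// pnatr_eq0.
    + exact: m1.
  - rewrite v1 mpolyCB; apply: (@loc_mem_factor _ _ _ _ _ (cst3 be)).
    + by rewrite -mpolyCM -expr2 bE.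
    + rewrite (evM (zE 2%:R) (evD (evD (zE 1) (evM (evalpC z _) (zE 2%:R))) (evM (evalpC z _) (zE 2%:R)))).
      rewrite v1 v2 mul1r mulf_neq0//.
      rewrite (_ : _ + _ = 2 * b * t); last by ring.
      by rewrite !mulf_neq0// pnatr_eq0.
    + exact: m2.
  - exact: loc_mem_coord1 v2.
rewrite v0 v1 v2 => -[x0 x1 x2]; apply/simple_V; rewrite x0 x1 x2 -aE -bE.
by split; ring.
Qed.

End Simple.

End FrameLines.

Lemma uniq_list6 (T : eqType) (x y a b c d : T) : x != y ->
  (a != x /\ a != y) -> (b != x /\ b != y) -> (c != x /\ c != y) -> (d != x /\ d != y) ->
  [/\ a != b, a != c & a != d] -> [/\ b != c, b != d & c != d] -> uniq [:: x; y; a; b; c; d].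
Proof.
move=> xy [ax ay] [bx b_y] [cx cy] [dx dy] [ab ac ad] [bc bd cd].
by rewrite /= !inE !negb_or xy !(eq_sym x) !(eq_sym y) ax ay bx b_y cx cy dx dy ab ac ad bc bd cd.
Qed.

Lemma mem_list4 (T : eqType) (s : seq T) (a b c d : T) :
  let l := s ++ [:: a; b; c; d] in [/\ a \in l, b \in l, c \in l & d \in l].
Proof. by rewrite /= !mem_cat !inE !eqxx !orbT. Qed.

Section LineSets.
Variable R : realType.
Local Notation C := (R[i]).
Local Notation V3 := ('rV[R]_3).
Variable f : 'I_3 -> V3 -> R.
Variables e1 e2 e3 : V3.
Hypothesis on : orthonormal e1 e2 e3.
Local Notation E := (rows3 e1 e2 e3).
Let EE : E *m E^T = 1%:M := orthonormal_mul_tr on.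
Local Notation rc := (real_complex R).
Local Notation line x := (frame_line e1 e2 e3 x).

Lemma coord_at_frame x k : coord_at E (x *m map_mx rc E) k = x 0 k.
Proof. exact: coord_at_mul. Qed.

Lemma frame_line_neq (x y : 'rV[C]_3) i j :
  x 0 i * y 0 j != x 0 j * y 0 i -> line x != line y.
Proof.
apply: contra => /eqP xy; have : x *m map_mx rc E \in line y by rewrite -xy memv_line.
move=> /(frame_lineP on)[t H]; have := H i; have := H j.
by rewrite !coord_at_frame => -> ->; apply/eqP; ring.
Qed.

Lemma dim_frame_line (x : 'rV[C]_3) j : x 0 j != 0 -> \dim (line x) = 1.
Proof.
move=> xj; rewrite dim_vline; case: eqP => // x0; case/negP: xj; apply/eqP.
by rewrite -(coord_at_frame x) x0 /coord_at mul0mx mxE.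
Qed.

Lemma real_frame_line (x : V3) j : x 0 j != 0 -> real_line (line (map_mx rc x)).
Proof.
move=> xj; exists (x *m E); last by rewrite map_mxM.
apply: contra xj => /eqP x0; rewrite -[x]mulmx1 -EE mulmxA x0 mul0mx mxE //.
Qed.

(** Normalising one coordinate to 1 fixes the complex scalar, so on a real line all coordinates
    become real. *)
Lemma real_frame_lineP (x : 'rV[C]_3) i j : x 0 j = 1 -> real_line (line x) ->
  exists s, x 0 i = rc s.
Proof.
move=> xj [r _ lr]; have : x *m map_mx rc E \in line x by rewrite memv_line.
rewrite lr => /vlineP[t tE].
have H k : x 0 k = t * rc ((r *m E^T) 0 k).
  rewrite -coord_at_frame tE coord_atZ /coord_at; congr (_ * _).
  by rewrite !mxE rmorph_sum; apply: eq_bigr => l _; rewrite !mxE -rmorphM.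
have sj : rc ((r *m E^T) 0 j) != 0.
  by apply/eqP => s0; move: (H j); rewrite s0 mulr0 xj => /eqP; rewrite oner_eq0.
have tV : t = (rc ((r *m E^T) 0 j))^-1 by apply: (mulIf sj); rewrite mulVf// -H.
by exists ((r *m E^T) 0 i / (r *m E^T) 0 j); rewrite fmorph_div H tV mulrC.
Qed.

Lemma frame_line3P w0 w1 w2 (u : 'rV[C]_3) : u \in line (vec3 w0 w1 w2) <->
  exists t, [/\ coord_at E u 0 = w0 * t, coord_at E u 1 = w1 * t & coord_at E u 2%:R = w2 * t].
Proof.
have [h0 h1 h2] := vec3E w0 w1 w2; apply: iff_trans (frame_lineP on _ _) _; split.
  by move=> [t /coord_at_row]; rewrite h0 h1 h2 => H; exists t.
by move=> [t [H0 H1 H2]]; exists t => i; case: (ord3P i) => ->; rewrite ?h0 ?h1 ?h2.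
Qed.

Lemma map_vec3 (a b d : R) : map_mx rc (vec3 a b d) = vec3 (rc a) (rc b) (rc d).
Proof.
have [a0 a1 a2] := vec3E a b d; have [b0 b1 b2] := vec3E (rc a) (rc b) (rc d).
by apply/rowP => i; rewrite mxE; case: (ord3P i) => ->; rewrite ?a0 ?a1 ?a2 ?b0 ?b1 ?b2.
Qed.

End LineSets.

Section SimpleLines.
Variable R : realType.
Local Notation C := (R[i]).
Local Notation V3 := ('rV[R]_3).
Variable f : 'I_3 -> V3 -> R.
Hypothesis f_const : forall i, f i 0 = 0.
Hypothesis f_linear : forall i (v : V3), 'D_v (f i) 0 = 0.
Variables (e1 e2 e3 : V3) (dl p q : R).
Hypothesis sf : simple_frame (hess f) e1 e2 e3 dl p q.
Local Notation al := (1 - dl + p ^+ 2).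
Local Notation be := (dl + q ^+ 2).
Let on : orthonormal e1 e2 e3. Proof. by have [[]] := sf. Qed.
Local Notation E := (rows3 e1 e2 e3).
Local Notation rc := (real_complex R).
Local Notation line x := (frame_line e1 e2 e3 x).

Definition simple_lines (a b : C) : seq {vspace 'rV[C]_3} :=
  [:: line (vec3 (a - rc p) (b - rc q) 1); line (vec3 (a - rc p) (- b - rc q) 1);
      line (vec3 (- a - rc p) (b - rc q) 1); line (vec3 (- a - rc p) (- b - rc q) 1)].

Variables a b : C.
Hypotheses (aE : a ^+ 2 = rc al) (bE : b ^+ 2 = rc be) (a0 : a != 0) (b0 : b != 0).

Let opp_neq (x : C) y : x != 0 -> x - y != - x - y.
Proof.
move=> x0; rewrite -subr_eq0 (_ : _ - _ = 2 * x); last by ring.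
by rewrite mulf_neq0// pnatr_eq0.
Qed.

Lemma simple_V_is_lines :
  V_is_lines f ([:: line (vec3 1 0 0); line (vec3 0 1 0)] ++ simple_lines a b).
Proof.
have inf x y : line (vec3 x y 1) != line (vec3 1 0 0) /\ line (vec3 x y 1) != line (vec3 0 1 0).
  have [? ? h] := vec3E x y 1; have [k0 k1 k2] := vec3E (1 : C) 0 0.
  have [l0 l1 l2] := vec3E (0 : C) 1 0.
  split; [apply: (frame_line_neq on (i := 0) (j := 2%:R))|apply: (frame_line_neq on (i := 1) (j := 2%:R))].
    by rewrite h k0 k2 mulr0 mulr1 eq_sym oner_eq0.
  by rewrite h l1 l2 mulr0 mulr1 eq_sym oner_eq0.
have aff0 x y x' y' : x != x' -> line (vec3 x y 1) != line (vec3 x' y' 1).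
  have [h0 h1 h2] := vec3E x y 1; have [k0 k1 k2] := vec3E x' y' 1.
  by move=> xx; apply: (frame_line_neq on (i := 0) (j := 2%:R)); rewrite h0 h2 k0 k2 mulr1 mul1r.
have aff1 x y x' y' : y != y' -> line (vec3 x y 1) != line (vec3 x' y' 1).
  have [h0 h1 h2] := vec3E x y 1; have [k0 k1 k2] := vec3E x' y' 1.
  by move=> xx; apply: (frame_line_neq on (i := 1) (j := 2%:R)); rewrite h1 h2 k1 k2 mulr1 mul1r.
have l01 : line (vec3 1 0 0) != line (vec3 0 1 0).
  have [k0 k1 k2] := vec3E (1 : C) 0 0; have [l0 l1 l2] := vec3E (0 : C) 1 0.
  apply: (frame_line_neq on (i := 0) (j := 1)); rewrite k0 l1 k1 l0 mulr1 mulr0 oner_eq0 //.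
have [aa bb] := (opp_neq (rc p) a0, opp_neq (rc q) b0).
split.
- apply: uniq_list6 (l01) (inf _ _) (inf _ _) (inf _ _) (inf _ _) _ _; split.
  + exact: aff1.
  + exact: aff0.
  + exact: aff0.
  + exact: aff0.
  + exact: aff0.
  + exact: aff1.
- have [k0 k1 k2] := vec3E (1 : C) 0 0; have [l0 l1 l2] := vec3E (0 : C) 1 0.
  have d x y : \dim (line (vec3 x y 1)) = 1%N.
    apply: (dim_frame_line on (j := 2%:R)).
    by have [_ _ ->] := vec3E x y 1; rewrite oner_neq0.
  move=> L; rewrite mem_cat !inE => /orP[/orP[]|/or4P[]] /eqP ->; try exact: d.
    by apply: (dim_frame_line on (j := 0)); rewrite k0 oner_neq0.
  by apply: (dim_frame_line on (j := 1)); rewrite l1 oner_neq0.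
move=> u; split.
  move=> /(simple_V f_const f_linear sf); set x := coord_at E u.
  have sq (s : C) r y z : s ^+ 2 = rc r -> y ^+ 2 - rc r * z ^+ 2 = 0 -> y = s * z \/ y = - s * z.
    move=> <- /eqP; rewrite -exprMn subr_sqr mulf_eq0 subr_eq0 addr_eq0 => /orP[]/eqP ->; first by left.
    by right; rewrite mulNr.
  have [z0|z0] := eqVneq (x 2%:R) 0.
    rewrite z0 expr0n !mulr0 !addr0 !subr0 => -[_ _ H1 H2].
    have /orP[/eqP y0|/eqP y0] : (x 0 == 0) || (x 1 == 0).
      move/eqP: H1; rewrite mulf_eq0 expf_eq0 /=; case/orP => ->; rewrite ?orbT //.
    - exists (line (vec3 0 1 0)); first by rewrite !inE eqxx ?orbT.
      by apply/(frame_line3P on); exists (x 1); rewrite ?z0 ?y0 ?mul0r ?mul1r.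
    - exists (line (vec3 1 0 0)); first by rewrite !inE eqxx ?orbT.
      by apply/(frame_line3P on); exists (x 0); rewrite ?z0 ?y0 ?mul0r ?mul1r.
  move=> [/eqP H1 /eqP H2 _ _]; move: H1 H2; rewrite !mulf_eq0 (negPf z0) /=.
  move=> /eqP/(sq _ _ _ _ aE) H1 /eqP/(sq _ _ _ _ bE) H2.
  have sh (s r y : C) : y + r * x 2%:R = s * x 2%:R -> y = (s - r) * x 2%:R.
    by rewrite mulrBl => <-; rewrite addrK.
  have m1 := esym (mul1r (x 2%:R)).
  have [M1 M2 M3 M4] := mem_list4 [:: line (vec3 1 0 0); line (vec3 0 1 0)]
    (line (vec3 (a - rc p) (b - rc q) 1)) (line (vec3 (a - rc p) (- b - rc q) 1))
    (line (vec3 (- a - rc p) (b - rc q) 1)) (line (vec3 (- a - rc p) (- b - rc q) 1)).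
  case: H1 => /sh H1; case: H2 => /sh H2.
  - exists (line (vec3 (a - rc p) (b - rc q) 1)); first exact: M1.
    by apply/(frame_line3P on); exists (x 2%:R); exact: And3 H1 H2 m1.
  - exists (line (vec3 (a - rc p) (- b - rc q) 1)); first exact: M2.
    by apply/(frame_line3P on); exists (x 2%:R); exact: And3 H1 H2 m1.
  - exists (line (vec3 (- a - rc p) (b - rc q) 1)); first exact: M3.
    by apply/(frame_line3P on); exists (x 2%:R); exact: And3 H1 H2 m1.
  - exists (line (vec3 (- a - rc p) (- b - rc q) 1)); first exact: M4.
    by apply/(frame_line3P on); exists (x 2%:R); exact: And3 H1 H2 m1.
move=> [L + uL] => LL; apply/(simple_V f_const f_linear sf).
have co w0 w1 w2 : L = line (vec3 w0 w1 w2) -> exists t,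
    [/\ coord_at E u 0 = w0 * t, coord_at E u 1 = w1 * t & coord_at E u 2%:R = w2 * t].
  by move=> LE; move: uL; rewrite LE => /(frame_line3P on).
move: LL; rewrite mem_cat !inE => /orP[/orP[]|/or4P[]] /eqP /co[t [-> -> ->]];
  rewrite -?aE -?bE; split; ring.
Qed.

Lemma simple_lines_mult L :
  L \in [:: line (vec3 1 0 0); line (vec3 0 1 0)] ++ simple_lines a b -> line_mult f L 1.
Proof.
have N (x : C) : x != 0 -> - x != 0 by rewrite oppr_eq0.
have N2 (x : C) r : x ^+ 2 = rc r -> (- x) ^+ 2 = rc r by rewrite sqrrN.
rewrite mem_cat !inE => /orP[/orP[]|/or4P[]] /eqP ->.
- exact: simple_mult_e1 sf.
- exact: simple_mult_e2 sf.
- exact: simple_mult_e3 sf _ _ aE bE a0 b0.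
- exact: simple_mult_e3 sf _ _ aE (N2 _ _ bE) a0 (N _ b0).
- exact: simple_mult_e3 sf _ _ (N2 _ _ aE) bE (N _ a0) b0.
- exact: simple_mult_e3 sf _ _ (N2 _ _ aE) (N2 _ _ bE) (N _ a0) (N _ b0).
Qed.

End SimpleLines.

Section SimpleClasses.
Variable R : realType.
Local Notation C := (R[i]).
Local Notation V3 := ('rV[R]_3).
Variable f : 'I_3 -> V3 -> R.
Hypothesis f_const : forall i, f i 0 = 0.
Hypothesis f_linear : forall i (v : V3), 'D_v (f i) 0 = 0.
Variables (e1 e2 e3 : V3) (dl p q : R).
Local Notation rc := (real_complex R).
Local Notation line x := (frame_line e1 e2 e3 x).

Let line_real (on : orthonormal e1 e2 e3) (x y : R) : real_line (line (vec3 (rc x) (rc y) 1)).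
Proof.
rewrite -(rmorph1 rc) -map_vec3; apply: (real_frame_line on (j := 2%:R)).
by have [_ _ ->] := vec3E x y 1; rewrite oner_neq0.
Qed.

Let line_real1 (on : orthonormal e1 e2 e3) : real_line (line (vec3 1 0 0)).
Proof.
rewrite -(rmorph1 rc) -(rmorph0 rc) -map_vec3; apply: (real_frame_line on (j := 0)).
by have [-> _ _] := vec3E (1 : R) 0 0; rewrite oner_neq0.
Qed.

Let line_real2 (on : orthonormal e1 e2 e3) : real_line (line (vec3 0 1 0)).
Proof.
rewrite -(rmorph1 rc) -(rmorph0 rc) -map_vec3; apply: (real_frame_line on (j := 1)).
by have [_ -> _] := vec3E (0 : R) 1 0; rewrite oner_neq0.
Qed.

Lemma roman_frame_lines : roman_frame (hess f) e1 e2 e3 dl p q -> V_six_real_lines f.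
Proof.
move=> [sf [al0 be0]]; have [[on _] _ _] := sf.
have rt (r : R) : 0 < r -> rc (Num.sqrt r) ^+ 2 = rc r /\ rc (Num.sqrt r) != 0.
  by move=> r0; rewrite -rmorphXn sqr_sqrtr ?ltW// fmorph_eq0 sqrtr_eq0 -ltNge.
have [aE a0] := rt _ al0; have [bE b0] := rt _ be0.
exists ([:: line (vec3 1 0 0); line (vec3 0 1 0)] ++ simple_lines e1 e2 e3 p q (rc (Num.sqrt (1 - dl + p ^+ 2))) (rc (Num.sqrt (dl + q ^+ 2)))).
split=> [//||]; first exact: (simple_V_is_lines f_const f_linear sf aE bE a0 b0).
move=> L LL; split; last exact: (simple_lines_mult f_const f_linear sf aE bE a0 b0 LL).
move: LL; rewrite mem_cat !inE => /orP[/orP[]|/or4P[]] /eqP ->.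
- exact: line_real1.
- exact: line_real2.
- by rewrite -!rmorphB; exact: line_real.
- by rewrite -(rmorphN rc (Num.sqrt _)) -!rmorphB; exact: line_real.
- by rewrite -(rmorphN rc (Num.sqrt _)) -!rmorphB; exact: line_real.
- by rewrite -!rmorphN -!rmorphD; exact: line_real.
Qed.

Lemma crosscap_frame_lines :
  crosscap_frame (hess f) e1 e2 e3 dl p q -> V_two_real_four_complex_lines f.
Proof.
move=> [sf ab]; have [[on _] _ _] := sf.
have al0 : 1 - dl + p ^+ 2 != 0 by apply/eqP => E; move: ab; rewrite E mul0r ltxx.
have be0 : dl + q ^+ 2 != 0 by apply/eqP => E; move: ab; rewrite E mulr0 ltxx.
pose a : C := sqrtC (rc (1 - dl + p ^+ 2)); pose b : C := sqrtC (rc (dl + q ^+ 2)).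
have aE : a ^+ 2 = rc (1 - dl + p ^+ 2) by exact: sqrtCK.
have bE : b ^+ 2 = rc (dl + q ^+ 2) by exact: sqrtCK.
have a0 : a != 0 by apply/eqP => z; move: aE; rewrite z expr0n => /esym/eqP; rewrite fmorph_eq0 (negPf al0).
have b0 : b != 0 by apply/eqP => z; move: bE; rewrite z expr0n => /esym/eqP; rewrite fmorph_eq0 (negPf be0).
exists [:: line (vec3 1 0 0); line (vec3 0 1 0)], (simple_lines e1 e2 e3 p q a b); split=> //.
- exact: (simple_V_is_lines f_const f_linear sf aE bE a0 b0).
- by move=> L; rewrite !inE => /orP[]/eqP ->; [exact: line_real1|exact: line_real2].
(* A real line would make both roots real and the product of the discriminants a product of
   squares. *)
- have nr (x y : C) : x ^+ 2 = rc (1 - dl + p ^+ 2) -> y ^+ 2 = rc (dl + q ^+ 2) ->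
      ~ real_line (line (vec3 (x - rc p) (y - rc q) 1)).
    have [v0 v1 v2] := vec3E (x - rc p) (y - rc q) 1; move=> xE yE lr.
    have [s] := real_frame_lineP on 0 v2 lr; have [t] := real_frame_lineP on 1 v2 lr.
    rewrite v0 v1 => /eqP; rewrite subr_eq -rmorphD => /eqP yr /eqP.
    rewrite subr_eq -rmorphD => /eqP xr.
    have := xE; have := yE; rewrite xr yr -!rmorphXn => /complexI ys /complexI xs.
    by move: ab; rewrite -xs -ys ltNge mulr_ge0// sqr_ge0.
  have N2 (x : C) r : x ^+ 2 = rc r -> (- x) ^+ 2 = rc r by rewrite sqrrN.
  move=> L; rewrite !inE => /or4P[] /eqP ->.
  + exact: nr aE bE.
  + exact: nr aE (N2 _ _ bE).
  + exact: nr (N2 _ _ aE) bE.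
  + exact: nr (N2 _ _ aE) (N2 _ _ bE).
- by move=> L LL; exact: (simple_lines_mult f_const f_linear sf aE bE a0 b0 LL).
Qed.

End SimpleClasses.

(** * Local ideals in a tangent frame *)

Section TangentIdeals.
Variable R : realType.
Local Notation C := (R[i]).
Local Notation poly3 := (mpoly 3).
Variables (z : 'rV[C]_3) (gens : seq (poly3 C)) (x y w h b : poly3 C).
Local Notation J := (loc_mem z gens).
Let L := y + h * w.
Hypothesis m1 : J (w ^+ 2 * L).
Hypothesis m2 : J (w ^+ 2 * (b * x + y)).
Hypothesis m3 : J (x * w * L).
Hypothesis m4 : J (x * L * (x - b * y) + h * y * w * (b * x + y)).

Let Jeq u v : v = u -> J u -> J v. Proof. by move=> ->. Qed.
Let U s u : evalp s z != 0 -> J (s * u) -> J u. Proof. exact: loc_mem_cancel. Qed.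

(** On the line of [e] with b nonzero, b x + y is a unit, so w^2 lies in the ideal; cancelling x and
    x - b y then gives [L]. *)
Lemma tangent_ideal_e5 : evalp x z != 0 -> evalp (b * x + y) z != 0 -> evalp (x - b * y) z != 0 ->
  J L /\ J (w ^+ 2).
Proof.
move=> x0 bx xb.
have w2 : J (w ^+ 2) by apply: (U bx); apply: Jeq m2; ring.
have wL : J (w * L) by apply: (U x0); apply: Jeq m3; ring.
have yw : J (y * w).
  by apply: (Jeq (u := w * L - h * w ^+ 2)); [rewrite /L; ring|apply: (loc_memB wL); exact: loc_memM].
split; last exact: w2.
apply: (U x0); apply: (U xb).
apply: (Jeq (u := x * L * (x - b * y) + h * y * w * (b * x + y) - h * (b * x + y) * (y * w))); first ring.
by apply: (loc_memB m4); exact: loc_memM.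
Qed.

(** For b = 0 the unit b x + y is lost; the identity h w^3 = w^2 L - w^2 y takes over, one order
    higher. *)
Lemma tangent_ideal_e6 : b = 0 -> evalp x z != 0 -> evalp h z != 0 -> J L /\ J (w ^+ 3).
Proof.
move=> b0 x0 h0.
have w2y : J (w ^+ 2 * y) by apply: Jeq m2; rewrite b0; ring.
have wL : J (w * L) by apply: (U x0); apply: Jeq m3; ring.
have w3 : J (w ^+ 3).
  apply: (U h0); apply: (Jeq (u := w ^+ 2 * L - w ^+ 2 * y)); first by rewrite /L; ring.
  exact: loc_memB.
split; last exact: w3.
apply: (U x0); apply: (U x0).
apply: (Jeq (u := x * L * (x - b * y) + h * y * w * (b * x + y) - (h * y * (w * L) - h * h * (w ^+ 2 * y)))).
  by rewrite b0 /L; ring.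
by apply: (loc_memB m4); apply: loc_memB; exact: loc_memM.
Qed.

Hypothesis L0 : evalp L z != 0.

Let w2 : J (w ^+ 2). Proof. by apply: (U L0); apply: Jeq m1; ring. Qed.
Let xw : J (x * w). Proof. by apply: (U L0); apply: Jeq m3; ring. Qed.

(** Here [L] is a unit, whence w^2, x w and x^2 lie in the ideal, and the last generator reduces to
    a unit times b x - h w. *)
Lemma tangent_ideal_f5 : evalp y z != 0 -> evalp (x - b * y) z != 0 ->
  J (b * x - h * w) /\ J (w ^+ 2).
Proof.
move=> y0 xb.
have x2 : J (x ^+ 2).
  apply: (U L0); apply: (U xb).
  apply: (Jeq (u := x * (x * L * (x - b * y) + h * y * w * (b * x + y)) - h * y * (b * x + y) * (x * w))).
    by ring.
  by apply: loc_memB; exact: loc_memM.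
split; last exact: w2.
apply: (U y0); apply: (U y0).
apply: (Jeq (u := L * x ^+ 2 - (x * L * (x - b * y) + h * y * w * (b * x + y)))); first by rewrite /L; ring.
by apply: (loc_memB _ m4); exact: loc_memM.
Qed.

(** For b = 0 the last generator gives x^2 + h y w, and x^3 lies in the ideal. Multiplied by w, the
    plane equation replaces l1 y by 1, since x w and w^2 vanish. *)
Lemma tangent_ideal_f6 (l0 l1 l2 : poly3 C) : b = 0 -> evalp y z != 0 ->
  J (l0 * x + l1 * y + l2 * w - 1) -> J (l1 * x ^+ 2 + h * w) /\ J (x ^+ 3).
Proof.
move=> b0 y0 pl.
have x3 : J (x ^+ 3).
  apply: (U L0).
  apply: (Jeq (u := x * (x * L * (x - b * y) + h * y * w * (b * x + y)) - h * y * y * (x * w))).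
    by rewrite b0; ring.
  by apply: loc_memB; exact: loc_memM.
have W : J (x ^+ 2 + h * y * w).
  apply: (U y0).
  apply: (Jeq (u := x * L * (x - b * y) + h * y * w * (b * x + y) - h * x * (x * w))).
    by rewrite b0 /L; ring.
  by apply: (loc_memB m4); exact: loc_memM.
split; last exact: x3.
apply: (Jeq (u := l1 * (x ^+ 2 + h * y * w) - h * w * (l0 * x + l1 * y + l2 * w - 1)
   + h * l0 * (x * w) + h * l2 * w ^+ 2)); first by ring.
apply: loc_memD; last exact: loc_memM.
apply: loc_memD; last exact: loc_memM.
by apply: loc_memB; exact: loc_memM.
Qed.

Lemma tangent_ideal_ef : evalp x z != 0 -> evalp y z != 0 -> J (x - b * y) /\ J w.
Proof.
move=> x0 y0; have w1 : J w by exact: (U x0).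
split; last exact: w1.
apply: (U x0); apply: (U L0).
apply: (Jeq (u := x * L * (x - b * y) + h * y * w * (b * x + y) - h * y * (b * x + y) * w)); first by ring.
by apply: (loc_memB m4); exact: loc_memM.
Qed.

End TangentIdeals.

Section TangentCurves.
Variable R : realType.
Local Notation C := (R[i]).
Local Notation poly3 := (mpoly 3).
Variable P : 'I_3 -> {poly C}.

Lemma ocM (x y : poly3 C) p q : on_curve P x = p -> on_curve P y = q -> on_curve P (x * y) = p * q.
Proof. by move=> <- <-; exact: on_curveM. Qed.
Lemma ocD (x y : poly3 C) p q : on_curve P x = p -> on_curve P y = q -> on_curve P (x + y) = p + q.
Proof. by move=> <- <-; exact: on_curveD. Qed.
Lemma ocB (x y : poly3 C) p q : on_curve P x = p -> on_curve P y = q -> on_curve P (x - y) = p - q.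
Proof. by move=> <- <-; exact: on_curveB. Qed.
Lemma ocX (x : poly3 C) n p : on_curve P x = p -> on_curve P (x ^+ n) = p ^+ n.
Proof. by move=> <-; exact: on_curveX. Qed.

Variables x y w h b : poly3 C.
Variables X Y W H B : {poly C}.
Hypotheses (xE : on_curve P x = X) (yE : on_curve P y = Y) (wE : on_curve P w = W)
  (hE : on_curve P h = H) (bE : on_curve P b = B).

Lemma tangent_on_curve n :
  'X^n %| W ^+ 2 * (Y + H * W) -> 'X^n %| W ^+ 2 * (B * X + Y) -> 'X^n %| X * W * (Y + H * W) ->
  'X^n %| X * (Y + H * W) * (X - B * Y) + H * Y * W * (B * X + Y) ->
  forall g, g \in [:: w ^+ 2 * (y + h * w); w ^+ 2 * (b * x + y); x * w * (y + h * w);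
     x * (y + h * w) * (x - b * y) + h * y * w * (b * x + y)] -> 'X^n %| on_curve P g.
Proof.
move=> d1 d2 d3 d4; pose L := ocD yE (ocM hE wE); pose N := ocD (ocM bE xE) yE.
apply/(all_list4 (fun g => 'X^n %| on_curve P g)); split.
- by rewrite (ocM (ocX 2 wE) L).
- by rewrite (ocM (ocX 2 wE) N).
- by rewrite (ocM (ocM xE wE) L).
- by rewrite (ocD (ocM (ocM xE L) (ocB xE (ocM bE yE))) (ocM (ocM (ocM hE yE) wE) N)).
Qed.

End TangentCurves.

Lemma sum3_eq (K : nmodType) (F : 'I_3 -> K) x y z :
  F 0 = x -> F 1 = y -> F 2%:R = z -> \sum_k F k = x + y + z.
Proof. by rewrite sum3 => -> -> ->. Qed.

Lemma dvdp_eqM (K : idomainType) (k p q : {poly K}) : p = k * q -> q %| p.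
Proof. by move=> ->; exact: dvdp_mulIr. Qed.

(** * Lines of the zero set in a tangent frame *)

Section TangentLines.
Variable R : realType.
Local Notation C := (R[i]).
Local Notation poly3 := (mpoly 3).
Local Notation V3 := ('rV[R]_3).
Variable f : 'I_3 -> V3 -> R.
Hypothesis f_const : forall i, f i 0 = 0.
Hypothesis f_linear : forall i (v : V3), 'D_v (f i) 0 = 0.
Variables (e1 e2 e3 : V3) (a b : R).
Hypothesis tf : tangent_frame (hess f) e1 e2 e3 a b.
Local Notation E := (rows3 e1 e2 e3).
Local Notation c := (coord E).
Local Notation rc := (real_complex R).
Local Notation line x := (frame_line e1 e2 e3 x).
Local Notation h := (a / 2).
Let on : orthonormal e1 e2 e3. Proof. by have [[]] := tf. Qed.
Let sm : same_minors f (tangent_minors e1 e2 e3 a b) := tangent_same_minors f_const f_linear tf.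

Lemma tangent_V (u : 'rV[C]_3) : let x := coord_at E u in let L := x 1 + rc h * x 2%:R in
  V_Mf f u <->
  [/\ x 2%:R ^+ 2 * L = 0, x 2%:R ^+ 2 * (rc b * x 0 + x 1) = 0, x 0 * x 2%:R * L = 0
    & x 0 * L * (x 0 - rc b * x 1) + rc h * x 1 * x 2%:R * (rc b * x 0 + x 1) = 0].
Proof.
move=> x L; rewrite /L /x.
apply: iff_trans (same_minors_V u sm) _; apply: iff_trans (all_list4 _ _ _ _ _) _.
pose ec k := evalp_coord E u k; pose eb := evalp_cst b u; pose eh := evalp_cst h u.
pose eL := evD (ec 1) (evM eh (ec 2%:R)); pose eN := evD (evM eb (ec 0)) (ec 1).
exact: iff_list4 (evM (evX 2 (ec 2%:R)) eL) (evM (evX 2 (ec 2%:R)) eN)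
  (evM (evM (ec 0) (ec 2%:R)) eL)
  (evD (evM (evM (ec 0) eL) (evB (ec 0) (evM eb (ec 1)))) (evM (evM (evM eh (ec 1)) (ec 2%:R)) eN)).
Qed.

Section Values.
Variables (z : 'rV[C]_3) (x0 x1 x2 : C).
Hypotheses (z0 : evalp (c 0) z = x0) (z1 : evalp (c 1) z = x1) (z2 : evalp (c 2%:R) z = x2).
Let ev_L : evalp (c 1 + cst3 h * c 2%:R) z = x1 + rc h * x2 := evD z1 (evM (evalp_cst h z) z2).
Let ev_N : evalp (cst3 b * c 0 + c 1) z = rc b * x0 + x1 := evD (evM (evalp_cst b z) z0) z1.
Let ev_M : evalp (c 0 - cst3 b * c 1) z = x0 - rc b * x1 := evB z0 (evM (evalp_cst b z) z1).
Lemma tangent_values : [/\ evalp (c 1 + cst3 h * c 2%:R) z = x1 + rc h * x2,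
  evalp (cst3 b * c 0 + c 1) z = rc b * x0 + x1 & evalp (c 0 - cst3 b * c 1) z = x0 - rc b * x1].
Proof. exact: And3 ev_L ev_N ev_M. Qed.
End Values.

Let in_tau1 (tau : poly3 C) r : in_tau tau (r%:P * 'X) = mpolyC 3 r * tau.
Proof. by rewrite in_tauM in_tauC -['X]expr1 in_tauX expr1. Qed.
Let in_tauX1 (tau : poly3 C) : in_tau tau 'X = tau.
Proof. by rewrite -['X]expr1 in_tauX expr1. Qed.

Let ne10 : 1 != 0 :> 'I_3. Proof. by []. Qed.
Let ne20 : 2%:R != 0 :> 'I_3. Proof. by []. Qed.
Let ne21 : 2%:R != 1 :> 'I_3. Proof. by []. Qed.
Let ne01 : 0 != 1 :> 'I_3. Proof. by []. Qed.

(* The germ of [y = - h w] parametrised by [w] *)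
Lemma tangent_mult_e n :
  (forall z gens, evalp (c 0) z != 0 -> evalp (c 1) z = 0 -> evalp (c 2%:R) z = 0 ->
     (forall g, g \in tangent_minors e1 e2 e3 a b -> loc_mem z gens g) ->
     loc_mem z gens (c 1 + cst3 h * c 2%:R) /\ loc_mem z gens (c 2%:R ^+ n)) ->
  (forall T : {poly C}, let Y := - (rc h)%:P * 'X in
     'X^n %| 'X ^+ 2 * ((rc b)%:P * T + Y) /\ 'X^n %| (rc h)%:P * Y * 'X * ((rc b)%:P * T + Y)) ->
  line_mult f (line (delta_mx 0 0)) n.
Proof.
move=> J D; apply: (line_mult_graph on (j := 0) sm) => l l0 plane.
exists (fun k => if k == 1 then - (rc h)%:P * 'X else 'X), (c 2%:R); split.
- by move=> k _; case: ifP => _; rewrite ?hornerM hornerX ?mulr0.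
- move=> z gens z0 zk ms.
  have [k1 k2] := J z gens z0 (zk 1 ne10) (zk 2%:R ne20) (fun g gm => ms g (mem_behead (s := plane :: _) gm)).
  split=> // k; case: (ord3P k) => -> // _.
    rewrite /= -polyCN in_tau1 mpolyCN mulNr opprK; exact: k1.
  by rewrite /= in_tauX1 subrr; exact: loc_mem0.
- move=> P PE _; have p1 := PE 1 ne10; have p2 := PE 2%:R ne20; rewrite /= in p1 p2.
  split; first by rewrite p2 subrr dvdp0.
  have [D1 D2] := D (on_curve P (c 0)).
  have L0 : - (rc h)%:P * 'X + (rc h)%:P * 'X = 0 :> {poly C} by rewrite mulNr addNr.
  apply: (tangent_on_curve erefl p1 p2 (on_curve_cst P h) (on_curve_cst P b)).
  + by rewrite L0 mulr0 dvdp0.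
  + exact: D1.
  + by rewrite L0 mulr0 dvdp0.
  + by rewrite L0 mulr0 mul0r add0r.
Qed.

Lemma tangent_mult_e5 : b != 0 -> line_mult f (line (delta_mx 0 0)) 2.
Proof.
move=> b0; apply: tangent_mult_e => [z gens z0 z1 z2 /all_list4[m1 m2 m3 m4]|T Y].
  have [vL vN vM] := tangent_values erefl z1 z2.
  apply: (tangent_ideal_e5 m2 m3 m4) => //.
    by rewrite vN addr0 mulf_neq0// fmorph_eq0.
  by rewrite vM mulr0 subr0.
split; first exact: dvdp_mulIl.
apply: dvdp_mulr; rewrite (_ : _ * _ = - (rc h)%:P ^+ 2 * 'X^2); first exact: dvdp_mulIr.
by rewrite /Y; move: (rc h)%:P => H; ring.
Qed.

Lemma tangent_mult_e6 : b = 0 -> a != 0 -> line_mult f (line (delta_mx 0 0)) 3.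
Proof.
move=> b0 a0; apply: tangent_mult_e => [z gens z0 z1 z2 /all_list4[m1 m2 m3 m4]|T Y].
  apply: (tangent_ideal_e6 m1 m2 m3 m4) => //.
    by rewrite b0; exact: rmorph0.
  by rewrite evalp_cst fmorph_eq0 mulf_neq0// invr_eq0 pnatr_eq0.
have -> : (rc b)%:P * T + Y = - (rc h)%:P * 'X by rewrite b0 rmorph0 mul0r add0r.
split; first by rewrite mulrCA -exprSr; apply: dvdp_mull; exact: dvdpp.
rewrite (_ : _ * _ = (rc h)%:P ^+ 3 * 'X ^+ 3); first by apply: dvdp_mull; exact: dvdpp.
by rewrite /Y; move: (rc h)%:P => H; ring.
Qed.

Lemma tangent_mult_f5 : b != 0 -> line_mult f (line (delta_mx 0 1)) 2.
Proof.
move=> b0; apply: (line_mult_graph on (j := 1) sm) => l l1 plane.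
have bC : rc b != 0 by rewrite fmorph_eq0.
(* The germ of b x = h w parametrised by w. *)
exists (fun k => if k == 0 then (rc h / rc b)%:P * 'X else 'X), (c 2%:R); split.
- by move=> k _; case: ifP => _; rewrite ?hornerM hornerX ?mulr0.
- move=> z gens z1 zk ms; have z0 := zk 0 ne01; have z2 := zk 2%:R ne21.
  have /all_list4[m1 m2 m3 m4] := (fun g gm => ms g (mem_behead (s := plane :: tangent_minors e1 e2 e3 a b) gm)).
  have [vL vN vM] := tangent_values z0 erefl z2.
  have [||k1 k2] := tangent_ideal_f5 m1 m3 m4 _ z1 _.
  + by rewrite vL mulr0 addr0.
  + by rewrite vM sub0r oppr_eq0 mulf_neq0.
  split=> // k; case: (ord3P k) => -> // _.
    rewrite /= in_tau1; apply: (loc_mem_div (s := mpolyC 3 (rc b)) _ _ k1).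
      by rewrite evalpC.
    by rewrite mulrBr mulrA -mpolyCM mulrCA mulfV// mulr1.
  by rewrite /= in_tauX1 subrr; exact: loc_mem0.
- move=> P PE _; have p0 := PE 0 ne01; have p2 := PE 2%:R ne21; rewrite /= in p0 p2.
  split; first by rewrite p2 subrr dvdp0.
  have bh : (rc b)%:P * (rc h / rc b)%:P = (rc h)%:P by rewrite -polyCM mulrCA mulfV// mulr1.
  apply: (tangent_on_curve p0 erefl p2 (on_curve_cst P h) (on_curve_cst P b)).
  + exact: dvdp_mulIl.
  + exact: dvdp_mulIl.
  + apply: dvdp_mulr; rewrite -[_ * 'X * 'X]mulrA; apply: dvdp_mull; exact: dvdpp.
  + move: (on_curve P (c 1)) (rc h / rc b)%:P (rc b)%:P (rc h)%:P bh => Y k B H <-.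
    rewrite (_ : _ + _ = (k ^+ 2 * (Y + B * k * 'X)) * 'X^2); last by ring.
    exact: dvdp_mulIr.
Qed.

Lemma tangent_mult_f6 : b = 0 -> a != 0 -> line_mult f (line (delta_mx 0 1)) 3.
Proof.
move=> b0 a0; apply: (line_mult_graph on (j := 1) sm) => l l1 plane.
have hC : rc h != 0 by rewrite fmorph_eq0 mulf_neq0// invr_eq0 pnatr_eq0.
have bC : cst3 b = 0 :> poly3 C by rewrite b0; exact: rmorph0.
(* From l1 x^2 + h w = 0: the germ is w = ka x^2, parametrised by x, and it depends on the plane. *)
pose ka := - l 0 1 / rc h.
exists (fun k => if k == 0 then 'X else ka%:P * 'X^2), (c 0); split.
- by move=> k _; case: ifP => _; rewrite ?hornerM ?hornerXn hornerX ?expr0n ?mulr0.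
- move=> z gens z1 zk ms; have z0 := zk 0 ne01; have z2 := zk 2%:R ne21.
  have pl := ms plane (mem_head _ _).
  have /all_list4[m1 m2 m3 m4] := (fun g gm => ms g (mem_behead (s := plane :: tangent_minors e1 e2 e3 a b) gm)).
  have [vL vN vM] := tangent_values z0 erefl z2.
  rewrite /plane sum3 in pl.
  have [|k1 k2] := tangent_ideal_f6 m1 m3 m4 _ bC z1 pl.
    by rewrite vL mulr0 addr0.
  split=> // k; case: (ord3P k) => -> // _.
    by rewrite /= in_tauX1 subrr; exact: loc_mem0.
  rewrite /= in_tauM in_tauC in_tauX; apply: (loc_mem_div (s := cst3 h) _ _ k1).
    by rewrite evalp_cst.
  have hk : cst3 h * mpolyC 3 ka = - mpolyC 3 (l 0 1).
    by rewrite -[cst3 h]/(mpolyC 3 (rc h)) -mpolyCM /ka mulrCA mulfV// mulr1 mpolyCN.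
  by rewrite mulrBr (mulrA (cst3 h)) hk mulNr opprK addrC.
- move=> P PE pl; have p0 := PE 0 ne01; have p2 := PE 2%:R ne21; rewrite /= in p0 p2.
  split; first by rewrite p0 subrr dvdp0.
  have := esym (sum3_eq (F := fun k => (l 0 k)%:P * on_curve P (c k))
    (congr1 _ p0) erefl (congr1 _ p2)).
  have -> : \sum_k (l 0 k)%:P * on_curve P (c k) = 1.
    by apply/eqP; rewrite -subr_eq0; apply/eqP; exact: etrans (esym (on_curve_plane P _ _)) pl.
  move=> /eqP; rewrite -subr_eq0 => /eqP.
  have -> : (l 0 1)%:P = - ((rc h)%:P * ka%:P).
    by rewrite -polyCM /ka mulrCA mulfV// mulr1 polyCN opprK.
  move=> {}pl; apply: (tangent_on_curve (B := 0) p0 erefl p2 (on_curve_cst P h)).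
  - by rewrite bC -(mpolyC0 3 C) on_curveC polyC0.
  all: move: (on_curve P (c 1)) (rc h)%:P ka%:P (l 0 0)%:P (l 0 2%:R)%:P pl => Y H k l0 l2 pl.
  + by apply: (dvdp_eqM (k := k ^+ 2 * 'X * (Y + H * (k * 'X^2)))); ring.
  + by apply: (dvdp_eqM (k := k ^+ 2 * 'X * Y)); ring.
  + by apply: (dvdp_eqM (k := k * (Y + H * (k * 'X^2)))); ring.
  + apply: (dvdp_eqM (k := Y * (l0 + l2 * k * 'X) + H * k * 'X)).
    apply/eqP; rewrite -subr_eq0; apply/eqP.
    transitivity (- 'X^2 * Y * (l0 * 'X + - (H * k) * Y + l2 * (k * 'X^2) - 1)); first by ring.
    by rewrite pl mulr0.
Qed.

Lemma tangent_mult_ef : b != 0 -> line_mult f (line (vec3 (rc b) 1 0)) 1.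
Proof.
move=> b0; have bC : rc b != 0 by rewrite fmorph_eq0.
have [v0 v1 v2] := vec3E (rc b) 1 0.
apply: (line_mult_reduced on (j := 1) sm v1) => [z gens t t0 zE /all_list4[m1 m2 m3 m4] i|u t /coord_at_row].
  have := zE 0; have := zE 1; have := zE 2%:R; rewrite v0 v1 v2 mul1r mul0r => z2 z1 z0.
  have [vL vN vM] := tangent_values z0 z1 z2.
  have [|||k0 k2] := tangent_ideal_ef m3 m4.
  - by rewrite vL mulr0 addr0.
  - by rewrite z0 mulf_neq0.
  - by rewrite z1.
  case: (ord3P i) => ->.
  - by rewrite v0; exact: k0.
  - exact: loc_mem_coord1 v1.
  - exact: loc_mem_coord0 v2 k2.
rewrite v0 v1 v2 => -[x0 x1 x2]; apply/tangent_V; rewrite x0 x1 x2.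
by split; ring.
Qed.

(** The partner of b e + f in the second decomposable member, scaled to n-coordinate 1; there w^2 is
    a unit and frees the two linear equations. *)
Lemma tangent_mult_n : b != 0 -> line_mult f (line (vec3 (rc h / rc b) (- rc h) 1)) 1.
Proof.
move=> b0; have bC : rc b != 0 by rewrite fmorph_eq0.
have [v0 v1 v2] := vec3E (rc h / rc b) (- rc h) 1.
have bh : rc b * (rc h / rc b) = rc h by rewrite mulrCA mulfV// mulr1.
apply: (line_mult_reduced on (j := 2%:R) sm v2) => [z gens t t0 zE /all_list4[m1 m2 _ _] i|u t /coord_at_row].
  have z2 : evalp (c 2%:R ^+ 2) z != 0.
    by rewrite (evX 2 (zE 2%:R)) v2 mul1r expf_neq0.
  have kL := loc_mem_cancel z2 m1; have kN := loc_mem_cancel z2 m2.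
  case: (ord3P i) => ->.
  - rewrite v0; apply: (loc_mem_div (s := cst3 b) (h' := cst3 b * c 0 + c 1 - (c 1 + cst3 h * c 2%:R))).
    + by rewrite evalp_cst.
    + rewrite mulrBr [cst3 b * (mpolyC 3 _ * _)]mulrA -[X in _ = _ - X * _](mpolyCM _ (rc b)) bh.
      by rewrite opprD addrA addrK.
    + exact: loc_memB.
  - by rewrite v1 mpolyCN mulNr opprK; exact: kL.
  - exact: loc_mem_coord1 v2.
rewrite v0 v1 v2 => -[x0 x1 x2]; apply/tangent_V; rewrite x0 x1 x2 (mulrA (rc b)) bh.
by split; ring.
Qed.

Let delta0 : delta_mx 0 0 = vec3 1 0 0 :> 'rV[C]_3.
Proof. by have [v0 v1 v2] := vec3E (1 : C) 0 0; apply/rowP => i; rewrite mxE; case: (ord3P i) => ->; rewrite ?v0 ?v1 ?v2. Qed.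
Let delta1 : delta_mx 0 1 = vec3 0 1 0 :> 'rV[C]_3.
Proof. by have [v0 v1 v2] := vec3E (0 : C) 1 0; apply/rowP => i; rewrite mxE; case: (ord3P i) => ->; rewrite ?v0 ?v1 ?v2. Qed.

Let real3 (x y w : R) j : vec3 x y w 0 j != 0 -> real_line (line (vec3 (rc x) (rc y) (rc w))).
Proof. by move=> xj; rewrite -map_vec3; exact: (real_frame_line on xj). Qed.

Let real_e : real_line (line (vec3 1 0 0)).
Proof. by rewrite -(rmorph1 rc) -(rmorph0 rc); apply: (@real3 _ _ _ 0); have [-> _ _] := vec3E (1 : R) 0 0; rewrite oner_neq0. Qed.
Let real_f : real_line (line (vec3 0 1 0)).
Proof. by rewrite -(rmorph1 rc) -(rmorph0 rc); apply: (@real3 _ _ _ 1); have [_ -> _] := vec3E (0 : R) 1 0; rewrite oner_neq0. Qed.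

Lemma uniq_list4 (T : eqType) (x y z w : T) :
  [/\ x != y, x != z & x != w] -> [/\ y != z, y != w & z != w] -> uniq [:: x; y; z; w].
Proof. by move=> [xy xz xw] [yz yw zw]; rewrite /= !inE !negb_or xy xz xw yz yw zw. Qed.

Lemma forall_mem4 (T : eqType) (P : T -> Prop) x y z w : P x -> P y -> P z -> P w ->
  forall t, t \in [:: x; y] ++ [:: z; w] -> P t.
Proof. by move=> Px Py Pz Pw t; rewrite !inE => /or4P[]/eqP ->. Qed.

Lemma type5_frame_lines : b != 0 -> V_four_real_lines f.
Proof.
move=> b0; have bC : rc b != 0 by rewrite fmorph_eq0.
have [k0 k1 k2] := vec3E (1 : C) 0 0; have [l0 l1 l2] := vec3E (0 : C) 1 0.
have [v0 v1 v2] := vec3E (rc b) 1 0; have [w0 w1 w2] := vec3E (rc h / rc b) (- rc h) 1.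
have bh : rc b * (rc h / rc b) = rc h by rewrite mulrCA mulfV// mulr1.
exists [:: line (vec3 1 0 0); line (vec3 0 1 0)],
  [:: line (vec3 (rc b) 1 0); line (vec3 (rc h / rc b) (- rc h) 1)]; split=> //.
- split.
  + apply: uniq_list4; split.
    * by apply: (frame_line_neq on (i := 0) (j := 1)); rewrite k0 k1 l0 l1 mulr1 mulr0 oner_neq0.
    * by apply: (frame_line_neq on (i := 0) (j := 1)); rewrite k0 k1 v0 v1 mulr1 mul0r oner_neq0.
    * by apply: (frame_line_neq on (i := 0) (j := 2%:R)); rewrite k0 k2 w0 w2 mulr1 mul0r oner_neq0.
    * by apply: (frame_line_neq on (i := 1) (j := 0)); rewrite l0 l1 v0 v1 mul1r mul0r.
    * by apply: (frame_line_neq on (i := 1) (j := 2%:R)); rewrite l1 l2 w1 w2 mulr1 mul0r oner_neq0.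
    * by apply: (frame_line_neq on (i := 1) (j := 2%:R)); rewrite v1 v2 w1 w2 mulr1 mul0r oner_neq0.
  + apply: forall_mem4.
    * by apply: (dim_frame_line on (j := 0)); rewrite k0 oner_neq0.
    * by apply: (dim_frame_line on (j := 1)); rewrite l1 oner_neq0.
    * by apply: (dim_frame_line on (j := 1)); rewrite v1 oner_neq0.
    * by apply: (dim_frame_line on (j := 2%:R)); rewrite w2 oner_neq0.
  move=> u; split.
    move=> /tangent_V; set x := coord_at E u => -[/eqP H1 /eqP H2 _ /eqP H4].
    have [M1 M2 M3 M4] := mem_list4 [::] (line (vec3 1 0 0)) (line (vec3 0 1 0))
      (line (vec3 (rc b) 1 0)) (line (vec3 (rc h / rc b) (- rc h) 1)).
    have [z0|z0] := eqVneq (x 2%:R) 0.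
      move: H4; rewrite z0 !mulr0 addr0 mul0r addr0 !mulf_eq0 subr_eq0 => /orP[/orP[]|] /eqP y0.
      * exists (line (vec3 0 1 0)); first exact: M2.
        by apply/(frame_line3P on); exists (x 1); rewrite -/x y0 z0 !mul0r mul1r.
      * exists (line (vec3 1 0 0)); first exact: M1.
        by apply/(frame_line3P on); exists (x 0); rewrite -/x y0 z0 !mul0r mul1r.
      * exists (line (vec3 (rc b) 1 0)); first exact: M3.
        by apply/(frame_line3P on); exists (x 1); rewrite -/x y0 z0 !mul0r mul1r.
    exists (line (vec3 (rc h / rc b) (- rc h) 1)); first exact: M4.
    move: H1 H2; rewrite !mulf_eq0 (negPf z0) /= addr_eq0 => /eqP H1.
    rewrite H1 subr_eq0 => /eqP H2.
    apply/(frame_line3P on); exists (x 2%:R); rewrite -/x mul1r mulNr; split=> //.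
    by apply: (mulfI bC); rewrite H2 mulrA bh.
  move=> [L + uL] => LL; apply/tangent_V.
  have co r0 r1 r2 : L = line (vec3 r0 r1 r2) -> exists t,
      [/\ coord_at E u 0 = r0 * t, coord_at E u 1 = r1 * t & coord_at E u 2%:R = r2 * t].
    by move=> LE; move: uL; rewrite LE => /(frame_line3P on).
  move: LL; rewrite mem_cat !inE => /orP[/orP[]|/orP[]] /eqP /co[t [-> -> ->]];
    rewrite ?(mulrA (rc b) (rc h / rc b)) ?bh; split; ring.
- apply: forall_mem4.
  + exact: real_e.
  + exact: real_f.
  + rewrite -(rmorph1 rc) -(rmorph0 rc); apply: (@real3 _ _ _ 1).
    by have [_ -> _] := vec3E b 1 0; rewrite oner_neq0.
  + rewrite -(rmorph1 rc) -(rmorphN rc) -(fmorph_div rc); apply: (@real3 _ _ _ 2%:R).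
    by have [_ _ ->] := vec3E (h / b) (- h) 1; rewrite oner_neq0.
- move=> L; rewrite !inE => /orP[]/eqP ->.
    by rewrite -delta0; exact: tangent_mult_e5.
  by rewrite -delta1; exact: tangent_mult_f5.
- move=> L; rewrite !inE => /orP[]/eqP ->; first exact: tangent_mult_ef.
  exact: tangent_mult_n.
Qed.

Lemma type6_frame_lines : b = 0 -> a != 0 -> V_two_real_lines f.
Proof.
move=> b0 a0; have [k0 k1 k2] := vec3E (1 : C) 0 0; have [l0 l1 l2] := vec3E (0 : C) 1 0.
have bC : rc b = 0 by rewrite b0 rmorph0.
have hC : rc h != 0 by rewrite fmorph_eq0 mulf_neq0// invr_eq0 pnatr_eq0.
exists [:: line (vec3 1 0 0); line (vec3 0 1 0)]; split=> //.
- split.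
  + rewrite /= inE andbT.
    by apply: (frame_line_neq on (i := 0) (j := 1)); rewrite k0 k1 l0 l1 mulr1 mulr0 oner_neq0.
  + move=> L; rewrite !inE => /orP[]/eqP ->.
    * by apply: (dim_frame_line on (j := 0)); rewrite k0 oner_neq0.
    * by apply: (dim_frame_line on (j := 1)); rewrite l1 oner_neq0.
  move=> u; split.
    move=> /tangent_V; set x := coord_at E u; rewrite bC !mul0r subr0 add0r => -[/eqP H1 /eqP H2 _ /eqP H4].
    have z0 : x 2%:R = 0.
      apply/eqP; move: H2 H1; rewrite mulf_eq0 expf_eq0 /= => /orP[//|/eqP ->].
      by rewrite add0r mulf_eq0 expf_eq0 mulf_eq0 (negPf hC) /= orbb.
    move: H4; rewrite z0 !mulr0 addr0 mul0r addr0 !mulf_eq0 => /orP[/orP[]|] /eqP y0.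
    + exists (line (vec3 0 1 0)); first by rewrite inE mem_head orbT.
      by apply/(frame_line3P on); exists (x 1); rewrite -/x y0 z0 !mul0r mul1r.
    + exists (line (vec3 1 0 0)); first exact: mem_head.
      by apply/(frame_line3P on); exists (x 0); rewrite -/x y0 z0 !mul0r mul1r.
    + exists (line (vec3 0 1 0)); first by rewrite inE mem_head orbT.
      by apply/(frame_line3P on); exists (x 1); rewrite -/x y0 z0 !mul0r mul1r.
  move=> [L + uL] => LL; apply/tangent_V.
  have co r0 r1 r2 : L = line (vec3 r0 r1 r2) -> exists t,
      [/\ coord_at E u 0 = r0 * t, coord_at E u 1 = r1 * t & coord_at E u 2%:R = r2 * t].
    by move=> LE; move: uL; rewrite LE => /(frame_line3P on).
  move: LL; rewrite !inE bC => /orP[]/eqP /co[t [-> -> ->]]; split; ring.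
- move=> L; rewrite !inE => /orP[]/eqP ->; split.
  + exact: real_e.
  + by rewrite -delta0; exact: tangent_mult_e6.
  + exact: real_f.
  + by rewrite -delta1; exact: tangent_mult_f6.
Qed.

End TangentLines.

(** * Zero sets containing a plane *)

Section Planes.
Variable R : realType.
Local Notation C := (R[i]).
Local Notation poly3 := (mpoly 3).
Local Notation V3 := ('rV[R]_3).
Variable f : 'I_3 -> V3 -> R.
Hypothesis f_const : forall i, f i 0 = 0.
Hypothesis f_linear : forall i (v : V3), 'D_v (f i) 0 = 0.
Variables (e1 e2 e3 : V3).
Local Notation E := (rows3 e1 e2 e3).
Local Notation c := (coord E).
Local Notation rc := (real_complex R).

Lemma mul_tr_dot (u v : V3) : u *m v^T = (dot u v)%:M.
Proof.
apply/matrixP => i j; rewrite !ord1 !mxE eqxx mulr1n.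
by apply: eq_bigr => k _; rewrite mxE.
Qed.

Lemma orthogonal_plane (v : V3) : dot v v = 1 ->
  exists2 P : {vspace V3}, \dim P = 2%N & forall u, u \in P <-> dot u v = 0.
Proof.
move=> v1; pose phi := linfun (mulmxr v^T : V3 -> 'M[R]_1).
have phiE u : phi u = (dot u v)%:M by rewrite lfunE /= mul_tr_dot.
have one0 : (1%:M : 'M[R]_1) != 0.
  by apply/eqP => /matrixP/(_ 0 0)/eqP; rewrite !mxE eqxx oner_eq0.
exists (lker phi).
  have := limg_ker_dim phi fullv; rewrite capfv dimvf => /=.
  have -> : \dim (limg phi) = 1%N.
    apply/eqP; rewrite eqn_leq; apply/andP; split.
      by apply: leq_trans (dimvS (subvf _)) _; rewrite dimvf.
    rewrite lt0n dimv_eq0; apply/eqP => l0; move: (memv_img phi (memvf v)).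
    by rewrite l0 memv0 phiE v1 (negPf one0).
  by rewrite addn1 => -[].
move=> u; rewrite memv_ker phiE; split=> [/eqP/matrixP/(_ 0 0)|->].
  by rewrite !mxE eqxx mulr1n.
by apply/eqP/matrixP => i j; rewrite !mxE mul0rn.
Qed.

Hypothesis on : orthonormal e1 e2 e3.

Lemma real_coord_at (u : V3) : [/\ coord_at E (map_mx rc u) 0 = rc (dot u e1),
  coord_at E (map_mx rc u) 1 = rc (dot u e2) & coord_at E (map_mx rc u) 2%:R = rc (dot u e3)].
Proof.
have H k : coord_at E (map_mx rc u) k = rc (dot u (row k E)).
  by rewrite /coord_at /dot !mxE rmorph_sum; apply: eq_bigr => l _; rewrite !mxE -rmorphM.
by have [r0 r1 r2] := rows3_row e1 e2 e3; rewrite !H r0 r1 r2.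
Qed.

Lemma dot_expand (u : V3) : u = dot u e1 *: e1 + dot u e2 *: e2 + dot u e3 *: e3.
Proof.
have [a [b [d uE]]] := indep3_span (orthonormal_indep on) u.
have [h1 h2 h3 [h4 h5 h6]] := on.
rewrite [in LHS]uE; congr (_ *: _ + _ *: _ + _ *: _); rewrite uE !dotDl !dotZl.
- by rewrite h1 (dotC e2) (dotC e3) h4 h5 !mulr0 mulr1 !addr0.
- by rewrite h2 h4 (dotC e3) h6 !mulr0 mulr1 addr0 add0r.
- by rewrite h3 h5 h6 !mulr0 mulr1 !add0r.
Qed.

Lemma truncated_cone_frame_plane : tangent_frame (hess f) e1 e2 e3 0 0 -> V_plane_and_line f.
Proof.
move=> tf; have [h1 h2 h3 [h4 h5 h6]] := on.
have [P dP inP] := orthogonal_plane h2.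
exists P, <[e2]>%VS; split=> //.
- by rewrite dim_vline; case: eqP => // z; move/eqP: h2; rewrite z dot0l eq_sym oner_eq0.
- by apply/negP => /subvP/(_ _ (memv_line e2))/inP; rewrite h2 => /eqP; rewrite oner_eq0.
apply/seteqP; split=> u /=.
  move=> /(tangent_V f_const f_linear tf) /=; have [-> -> ->] := real_coord_at u.
  have -> : rc (0 / 2) = 0 by rewrite mul0r rmorph0.
  rewrite !rmorph0 !mul0r !addr0 subr0 add0r => -[H1 _ _ H2].
  have [y0|y0] := eqVneq (dot u e2) 0; first by left; apply/inP.
  right; rewrite [u]dot_expand.
  have r0 : rc (dot u e2) == 0 = false by rewrite fmorph_eq0 (negPf y0).
  move/eqP: H1; move/eqP: H2; rewrite !mulf_eq0 r0 !orbF !orbb !fmorph_eq0 => /eqP -> /eqP ->.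
  by rewrite !scale0r add0r addr0; apply/vlineP; exists (dot u e2).
have goal (x1 x3 : R) : u = x1 *: e1 + dot u e2 *: e2 + x3 *: e3 ->
    (dot u e2 = 0 \/ (dot u e1 = 0 /\ dot u e3 = 0)) -> V_Mf_real f u.
  move=> _ H; apply/(tangent_V f_const f_linear tf) => /=; have [-> -> ->] := real_coord_at u.
  have -> : rc (0 / 2) = 0 by rewrite mul0r rmorph0.
  by case: H => [->|[-> ->]]; rewrite !rmorph0; split; ring.
move=> [/inP u2|/vlineP[k uE]]; apply: (goal _ _ (dot_expand u)); first by left.
by right; rewrite uE !dotZl h6 (dotC e2) h4 !mulr0.
Qed.

(** All generators are multiples of c2 and one of them is c2^3. *)
Lemma ellipsoid_frame_plane : ellipsoid_frame (hess f) e1 e2 e3 -> V_plane f.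
Proof.
move=> ef; have [h1 h2 h3 [h4 h5 h6]] := on.
have [P dP inP] := orthogonal_plane h3; exists P => //.
have sm := ellipsoid_same_minors f_const f_linear ef.
have VE u : V_Mf_real f u <-> dot u e3 = 0.
  apply: iff_trans (same_minors_V _ sm) _; apply: iff_trans (all_list4 _ _ _ _ _) _.
  pose ec k := evalp_coord E (map_mx rc u) k.
  apply: iff_trans (iff_list4 _ (evX 3 (ec 2%:R)) (evM (evX 2 (ec 2%:R)) (ec 0))
    (evM (evX 2 (ec 2%:R)) (ec 1)) (evM (ec 2%:R) (evD (evX 2 (ec 0)) (evX 2 (ec 1))))) _.
  have [-> -> ->] := real_coord_at u; split=> [[/eqP + _ _ _]|->].
    by rewrite expf_eq0 fmorph_eq0 => /eqP.
  by rewrite rmorph0; split; ring.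
by apply/seteqP; split=> u /=; [move=> /VE/inP|move=> /inP/VE].
Qed.

End Planes.

(** * The types of surface exclude each other *)

Section SurfaceExclusion.
Variable R : realType.
Local Notation V3 := ('rV[R]_3).
Variable g : V3 -> V3.

(** Each listed point is matched with its representative, up to sign, in the other list; the
    pairwise condition makes the matching injective. *)
Lemma singular_points_size s t :
  singular_points_are g s -> singular_points_are g t -> size s = size t.
Proof.
suff H s' t' : singular_points_are g s' -> singular_points_are g t' -> (size s' <= size t')%N.
  by move=> Hs Ht; apply/eqP; rewrite eqn_leq !H.
move=> [ps _ Hs] [_ _ Ht].
pose phi (a : V3) : V3 := nth 0 t' (find (fun c => (a == c) || (a == - c)) t').
have phiP a : a \in s' -> phi a \in t' /\ eqpm a (phi a).
  move=> sa; have /Ht[c tc ac] : singular_pt g a by apply/Hs; exists a => //; left.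
  have h : has (fun c => (a == c) || (a == - c)) t'.
    by apply/hasP; exists c => //; case: ac => ->; rewrite eqxx ?orbT.
  split; first by apply: mem_nth; rewrite -has_find.
  by have /orP[/eqP ?|/eqP ?] := nth_find 0 h; [left|right].
rewrite -(size_map phi); apply: uniq_leq_size; last first.
  by move=> x /mapP[a sa ->]; have [] := phiP a sa.
rewrite uniq_pairwise pairwise_map; apply: (sub_in_pairwise (P := mem s')) ps.
  move=> a b sa sb /= /andP[ab amb]; apply/eqP => E.
  have [_ Ha] := phiP a sa; have [_ Hb] := phiP b sb; rewrite E in Ha.
  move: (phi b) Ha Hb => c Ha Hb.
  by case: Ha => Ha; case: Hb => Hb; move: ab amb; rewrite Ha Hb ?opprK ?eqxx.
by apply/allP.
Qed.

(** A continuous curve with finitely many values is constant near 0, against its nonzero velocity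
    there. *)
Lemma regular_curve_infinite (C : set V3) (s : seq V3) :
  regular_closed_curve C -> ~ (C `<=` [set` s]).
Proof.
move=> [ga [sm d0 _ CE]] sub; case/eqP: (d0 0).
have cga : {for 0, continuous ga} by exact: (sm 0%N 0 I).
have av (c : V3) : c != ga 0 -> \forall t \near 0, ga t != c.
  move=> cg; have : nbhs (ga 0) [set y | y != c].
    apply: open_nbhs_nbhs; split; last by rewrite /= eq_sym.
    have -> : [set y | y != c] = ~` [set c] by apply/seteqP; split=> y /= /eqP.
    apply: closed_openC; apply: accessible_closed_set1; apply: hausdorff_accessible.
    exact: norm_hausdorff.
  by move=> /cga.
have ne : \forall t \near (0 : R), forall c, c \in s -> c != ga 0 -> ga t != c.
  elim: s {sub} => [|c s IH]; first by near=> t => x; rewrite in_nil.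
  have [cg|cg] := eqVneq c (ga 0).
    by apply: filterS IH => t H x; rewrite inE => /orP[/eqP ->|]; [rewrite cg eqxx|exact: H].
  apply: filterS2 IH (av c cg) => t H1 H2 x; rewrite inE => /orP[/eqP -> //|]; exact: H1.
have near_cst : \forall t \near (0 : R), ga t = cst (ga 0) t.
  apply: filterS ne => t H; apply/eqP; apply: contraT => /= tn.
  have : ga t \in s by apply: (sub (ga t)); rewrite CE; exists t.
  by move=> /H/(_ tn); rewrite eqxx.
by rewrite (near_eq_derive _ near_cst) ?derive_cst// oner_neq0.
Unshelve. all: by end_near. Qed.

Definition finitely_many_singular : Prop := exists s, singular_points_are g s.

Lemma curve_singular_infinite (C : set V3) : regular_closed_curve C ->
  (forall a, C a -> singular_pt g a) -> ~ finitely_many_singular.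
Proof.
move=> rC CS [s [_ _ Hs]]; apply: (regular_curve_infinite (s := s ++ [seq - c | c <- s]) rC).
move=> a /CS/Hs[c sc [->|->]] /=; rewrite mem_cat; first by rewrite sc.
by rewrite (map_f -%R sc) orbT.
Qed.

Lemma cone_singular_infinite : truncated_cone g -> ~ finitely_many_singular.
Proof.
move=> [A [ori [C [a0 [_ _ [rC _] _ [sing _]]]]]].
by apply: (curve_singular_infinite rC) => a Ca; apply/sing; left.
Qed.

Lemma ellipsoid_singular_infinite : ellipsoid g -> ~ finitely_many_singular.
Proof.
move=> [A [ori [C [_ _ rC sing _]]]].
by apply: (curve_singular_infinite rC) => a Ca; apply/sing.
Qed.

(* A sphere contains no midpoint of two distinct points of it, whereas a cone
   contains the segment from its vertex to a point of the base. *)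
Lemma cone_not_ellipsoid : truncated_cone g -> ~ ellipsoid g.
Proof.
move=> [A [ori [_ [_ [uA gE _ _ _]]]]] [A' [ori' [_ [uA' gE' _ _ _]]]].
have [w0 w1 w2] := vec3E (1 : R) 0 0; have [v0 v1 v2] := vec3E (0 : R) 0 1.
pose b : V3 := vec3 1 0 0.
have base : std_base b by rewrite /std_base /= w0 w1 w2 expr1n expr0n addr0.
have pt (s : R) : 0 <= s <= 1 -> exists2 u, S2 R u &
    u *m A' + ori' = (s *: @std_vertex R + (1 - s) *: b) *m A + ori.
  move=> s01; have : (g @` S2 R) ((s *: @std_vertex R + (1 - s) *: b) *m A + ori).
    by rewrite gE; exists (s *: @std_vertex R + (1 - s) *: b) => //; exists s => //; exists b.
  by rewrite gE' => -[u Su uE]; exists u.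
have [|u0 S0 E0] := pt 0; first by rewrite lexx ler01.
have [|u1 S1 E1] := pt 1; first by rewrite lexx ler01.
have [|u2 S2 E2] := pt 2^-1; first by rewrite invr_ge0 ler0n invf_le1 ?ltr0n ?ler1n.
have M : u2 = 2^-1 *: (u0 + u1).
  have E : (u2 - 2^-1 *: (u0 + u1)) *m A' = 0.
    have h2 : (1 - 2^-1 : R) = 2^-1 by lra.
    have -> : (u2 - 2^-1 *: (u0 + u1)) *m A' = (u2 *m A' + ori') - 2^-1 *: ((u0 *m A' + ori') + (u1 *m A' + ori')).
      rewrite mulmxBl -scalemxAl mulmxDl; move: (u2 *m _) (u0 *m _) (u1 *m _) => x y z.
      by apply/rowP => i; rewrite !mxE; lra.
    rewrite E0 E1 E2 h2 !mulmxDl -!scalemxAl; move: (_ *m A) (_ *m A) => x y.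
    by apply/rowP => i; rewrite !mxE; lra.
  apply/eqP; rewrite -subr_eq0; apply/eqP.
  by rewrite -[LHS](mulmxK uA') E mul0mx.
(* Parallelogram law, with [u0], [u1] and their midpoint all of length 1. *)
have D : dot (u0 - u1) (u0 - u1) = 0.
  have : dot u2 u2 = 1 by [].
  rewrite M dotZl dotZr !dotDl !dotDr; rewrite -scaleN1r !dotZl !dotZr.
  move: S0 S1; rewrite /S2 /= => -> ->; rewrite (dotC u1); lra.
have u01 : u0 = u1.
  apply/eqP; rewrite -subr_eq0; apply/eqP/rowP => i; rewrite [RHS]mxE.
  apply/eqP; rewrite -sqrf_eq0; apply/eqP.
  have := D; rewrite /dot => /eqP; rewrite psumr_eq0 => [/allP/(_ i)|k _]; last exact: sqr_ge0.
  by rewrite mem_index_enum => /(_ isT)/eqP; rewrite expr2.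
have : @std_vertex R = b.
  rewrite u01 in E0; have := etrans (esym E0) E1.
  rewrite subr0 subrr !scale0r !scale1r add0r addr0 => /addIr /(congr1 (mulmx^~ (invmx A))).
  by rewrite !mulmxK.
move/(congr1 (fun v : V3 => v 0 2%:R)); rewrite /std_vertex v2 w2.
by move/eqP; rewrite oner_eq0.
Qed.

End SurfaceExclusion.

(** * The types of zero set exclude each other *)

Section LineExclusion.
Variable R : realType.
Local Notation C := (R[i]).
Local Notation V3 := ('rV[R]_3).
Local Notation rc := (real_complex R).
Variable f : 'I_3 -> V3 -> R.

Lemma dim1_eq_line (K : fieldType) (V : vectType K) (L : {vspace V}) v :
  \dim L = 1%N -> v != 0 -> v \in L -> L = <[v]>%VS.
Proof.
move=> dL v0 vL; apply/esym/eqP; rewrite eqEdim dim_vline v0 dL leqnn andbT.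
by apply/subvP => w /vlineP[k ->]; exact: memvZ.
Qed.

(** A nonzero vector of a line of [s] lies on some line of [t], and one-dimensional spaces sharing a
    nonzero vector coincide. *)
Lemma V_lines_sub s t : V_is_lines f s -> V_is_lines f t -> {subset s <= t}.
Proof.
move=> [_ ds Vs] [_ dt Vt] L Ls; have dL := ds L Ls.
pose v := vpick L; have v0 : v != 0.
  by rewrite vpick0; apply/eqP => z; move: dL; rewrite z dimv0.
have vL : v \in L by exact: memv_pick.
have /Vt[L' L't vL'] : V_Mf f v by apply/Vs; exists L.
by rewrite (dim1_eq_line dL v0 vL) -(dim1_eq_line (dt L' L't) v0 vL').
Qed.

Lemma V_lines_size s t : V_is_lines f s -> V_is_lines f t -> size s = size t.
Proof.
move=> Hs Ht; have [us _ _] := Hs; have [ut _ _] := Ht.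
by apply/eqP; rewrite eqn_leq !uniq_leq_size//; exact: V_lines_sub.
Qed.

Lemma six_real_not_two_real : V_six_real_lines f -> ~ V_two_real_four_complex_lines f.
Proof.
move=> [s [_ Hs Rs]] [s' [t' [[_ t4] Ht _ cx _]]].
case: t' t4 Ht cx => [//|L t'] _ Ht cx; apply: (cx L (mem_head _ _)).
have Ls : L \in s by apply: (V_lines_sub Ht Hs); rewrite mem_cat mem_head orbT.
by have [] := Rs L Ls.
Qed.

(* Infinitely many points [x + k y] of a real plane lie on finitely many
   complex lines; two of them on the same line make [x] and [y] dependent. *)
Lemma lines_contain_no_plane s (P : {vspace V3}) :
  V_is_lines f s -> \dim P = 2%N -> ~ ([set` P] `<=` V_Mf_real f).
Proof.
move=> [us ds Vs] dP sub.
have := vbasisP P; move: (vbasis P); rewrite dP => X bX.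
pose x := X`_0; pose y := X`_1.
have xP : x \in P by apply: (basis_mem bX); apply: mem_nth; rewrite size_tuple.
have yP : y \in P by apply: (basis_mem bX); apply: mem_nth; rewrite size_tuple.
have y0 : y != 0.
  apply: contraTneq (basis_free bX) => z; apply/negP => /free_not0/(_ (mem_nth 0 _)) H.
  by have := H 1%N; rewrite size_tuple -/y z eqxx => /(_ isT).
have indep k : x != k *: y.
  apply/eqP => E; have := basis_free bX.
  have -> : val X = [:: x; y] by rewrite /x /y; case: (X) => [[|? [|? [|? ?]]] sX].
  by rewrite free_cons E memvZ ?andbF// memv_span ?mem_head.
pose z (k : nat) : 'rV[C]_3 := map_mx rc (x + k%:R *: y).
pose phi k := nth 0%VS s (find (fun L : {vspace 'rV[C]_3} => z k \in L) s).
have phiP k : phi k \in s /\ z k \in phi k.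
  have /Vs[L Ls zL] : V_Mf f (z k) by apply: sub => /=; rewrite memvD ?memvZ.
  have h : has (fun L : {vspace 'rV[C]_3} => z k \in L) s by apply/hasP; exists L.
  by split; [apply: mem_nth; rewrite -has_find|exact: (nth_find 0%VS h)].
have nu : ~~ uniq (map phi (iota 0 (size s).+1)).
  have im : {subset map phi (iota 0 (size s).+1) <= s}.
    by move=> L /mapP[k _ ->]; have [] := phiP k.
  by apply/negP => un; have := uniq_leq_size un im; rewrite size_map size_iota ltnn.
case/negP: nu; rewrite map_inj_in_uniq ?iota_uniq// => k l _ _ E; apply/eqP.
apply: contraT => kl.
have [Ls zk] := phiP k; have [_ zl] := phiP l; rewrite -E in zl.
have kl0 : k%:R - l%:R != 0 :> R by rewrite subr_eq0 eqr_nat.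
have yC0 : map_mx rc y != 0 by rewrite map_mx_eq0.
have yL : map_mx rc y \in phi k.
  have -> : map_mx rc y = rc (k%:R - l%:R)^-1 *: (z k - z l).
    rewrite -map_mxB -map_mxZ opprD addrACA subrr add0r -scalerBl scalerA mulVf// scale1r.
    by [].
  by rewrite memvZ// memvB.
have xL : map_mx rc x \in phi k.
  have -> : map_mx rc x = z k - rc k%:R *: map_mx rc y by rewrite /z map_mxD map_mxZ addrK.
  by rewrite memvB// memvZ.
move: xL; rewrite (dim1_eq_line (ds _ Ls) yC0 yL) => /vlineP[t tE].
have [i yi] : exists i, y 0 i != 0.
  apply/existsP; apply: contraT; rewrite negb_exists => /forallP H.
  by case/eqP: y0; apply/rowP => i; have := H i; rewrite negbK mxE => /eqP.
have tr : t = rc (x 0 i / y 0 i).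
  move/rowP/(_ i): tE; rewrite !mxE => H; apply: (mulIf (x := rc (y 0 i))).
    by rewrite fmorph_eq0.
  by rewrite -rmorphM divfK// H.
case/eqP: (indep (x 0 i / y 0 i)); apply: (map_mx_inj (f := rc)).
by rewrite tE map_mxZ tr.
Qed.

Lemma plane_and_line_not_plane : V_plane_and_line f -> ~ V_plane f.
Proof.
move=> [P [L [dP _ nLP VE]]] [P' dP' VE'].
have sub : [set` P] `|` [set` L] = [set` P'] by rewrite -VE.
have PP : P = P'.
  apply/eqP; rewrite eqEdim dP dP' leqnn andbT; apply/subvP => u uP.
  have : ([set` P] `|` [set` L]) u by left.
  by rewrite sub.
case/negP: nLP; apply/subvP => u uL; rewrite PP.
have : ([set` P] `|` [set` L]) u by right.
by rewrite sub.
Qed.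

Lemma plane_and_line_not_lines s : V_plane_and_line f -> ~ V_is_lines f s.
Proof.
move=> [P [L [dP _ _ VE]]] /lines_contain_no_plane H; apply: (H P dP).
by rewrite VE => u; left.
Qed.

Lemma plane_not_lines s : V_plane f -> ~ V_is_lines f s.
Proof. by move=> [P dP VE] /lines_contain_no_plane H; apply: (H P dP); rewrite VE. Qed.

End LineExclusion.

(** * From exclusive cases to equivalences *)

(** One case holds on both sides at once; exclusivity makes every other statement on either side
    false. *)
Lemma iff_of_exclusive6 (A1 A2 A3 A4 A5 A6 B1 B2 B3 B4 B5 B6 : Prop) :
  [/\ A1 -> ~ A2, A1 \/ A2 -> ~ A3, A1 \/ A2 \/ A3 -> ~ A4, A1 \/ A2 \/ A3 \/ A4 -> ~ A5
    & A1 \/ A2 \/ A3 \/ A4 \/ A5 -> ~ A6] ->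
  [/\ B1 -> ~ B2, B1 \/ B2 -> ~ B3, B1 \/ B2 \/ B3 -> ~ B4, B1 \/ B2 \/ B3 \/ B4 -> ~ B5
    & B1 \/ B2 \/ B3 \/ B4 \/ B5 -> ~ B6] ->
  (A1 /\ B1) \/ (A2 /\ B2) \/ (A3 /\ B3) \/ (A4 /\ B4) \/ (A5 /\ B5) \/ (A6 /\ B6) ->
  (A1 <-> B1) /\ (A2 <-> B2) /\ (A3 <-> B3) /\ (A4 <-> B4) /\ (A5 <-> B5) /\ (A6 <-> B6).
Proof. by move=> [? ? ? ? ?] [? ? ? ? ?]; tauto. Qed.

Section Exclusion.
Variable R : realType.
Local Notation V3 := ('rV[R]_3).

(** The number of singular points up to sign is 6, 2, 4, 2 or infinite; the two types with 2 differ
    by the presence of a cross-cap, the cone and the ellipsoid by the shape of the image. *)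
Lemma surfaces_exclusive (g : V3 -> V3) :
  [/\ roman_steiner g -> ~ crosscap_surface g,
      roman_steiner g \/ crosscap_surface g -> ~ type5_surface g,
      roman_steiner g \/ crosscap_surface g \/ type5_surface g -> ~ type6_surface g,
      roman_steiner g \/ crosscap_surface g \/ type5_surface g \/ type6_surface g ->
        ~ truncated_cone g
    & roman_steiner g \/ crosscap_surface g \/ type5_surface g \/ type6_surface g \/
        truncated_cone g -> ~ ellipsoid g].
Proof.
pose fin n := exists2 s : seq V3, singular_points_are g s & size s = n.
have finU n m : fin n -> fin m -> n = m.
  by move=> [s Hs <-] [t Ht <-]; exact: singular_points_size Hs Ht.
have f1 : roman_steiner g -> fin 6.
  by move=> [c1 [c2 [c3 [c4 [c5 [c6 [? [? [? [? [H _ _ _ _]]]]]]]]]]]; exists [:: c1; c2; c3; c4; c5; c6].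
have f2 : crosscap_surface g -> fin 2.
  by move=> [c1 [c2 [? [H _ _ _ _]]]]; exists [:: c1; c2].
have f3 : type5_surface g -> fin 4.
  by move=> [c1 [c2 [t1 [t2 [? [? [H _ _ _ _]]]]]]]; exists [:: c1; c2; t1; t2].
have f4 : type6_surface g -> fin 2.
  by move=> [t1 [t2 [? [H _ _ _ _]]]]; exists [:: t1; t2].
have some n : fin n -> finitely_many_singular g by move=> [s Hs _]; exists s.
split.
- by move=> /f1 H /f2 /(finU _ _ H).
- by move=> [/f1|/f2] H /f3 /(finU _ _ H).
- move=> [/f1 H /f4 /(finU _ _ H)|[|/f3 H /f4 /(finU _ _ H)]] //.
  by move=> [c1 [? [? [_ [cc _] _ _ _]]]] [? [? [? [_ /(_ c1) nc _ _ _]]]]; exact: nc.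
- by move=> H /cone_singular_infinite; apply; move: H => [/f1|[/f2|[/f3|/f4]]]; exact: some.
- move=> [/f1/some H|[/f2/some H|[/f3/some H|[/f4/some H|H]]]].
  1-4: by move=> /ellipsoid_singular_infinite; apply.
  exact: cone_not_ellipsoid.
Qed.

(** The number of lines is 6, 6, 4 or 2; the two types with 6 differ by the reality of the lines,
    and finitely many lines contain no real plane. *)
Lemma line_sets_exclusive (f : 'I_3 -> V3 -> R) :
  [/\ V_six_real_lines f -> ~ V_two_real_four_complex_lines f,
      V_six_real_lines f \/ V_two_real_four_complex_lines f -> ~ V_four_real_lines f,
      V_six_real_lines f \/ V_two_real_four_complex_lines f \/ V_four_real_lines f ->
        ~ V_two_real_lines f,
      V_six_real_lines f \/ V_two_real_four_complex_lines f \/ V_four_real_lines f \/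
        V_two_real_lines f -> ~ V_plane_and_line f
    & V_six_real_lines f \/ V_two_real_four_complex_lines f \/ V_four_real_lines f \/
        V_two_real_lines f \/ V_plane_and_line f -> ~ V_plane f].
Proof.
pose lin n := exists2 s : seq {vspace 'rV[R[i]]_3}, V_is_lines f s & size s = n.
have linU n m : lin n -> lin m -> n = m.
  by move=> [s Hs <-] [t Ht <-]; exact: V_lines_size Hs Ht.
have f1 : V_six_real_lines f -> lin 6 by move=> [s [? H _]]; exists s.
have f2 : V_two_real_four_complex_lines f -> lin 6.
  by move=> [s [t [[st tt] H _ _ _]]]; exists (s ++ t) => //; rewrite size_cat st tt.
have f3 : V_four_real_lines f -> lin 4.
  by move=> [s [t [[st tt] H _ _ _]]]; exists (s ++ t) => //; rewrite size_cat st tt.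
have f4 : V_two_real_lines f -> lin 2 by move=> [s [? H _]]; exists s.
split.
- exact: six_real_not_two_real.
- by move=> [/f1|/f2] H /f3 /(linU _ _ H).
- by move=> [/f1|[/f2|/f3]] H /f4 /(linU _ _ H).
- move=> [/f1|[/f2|[/f3|/f4]]] [s Hs _] pl; exact: plane_and_line_not_lines pl Hs.
- move=> [/f1|[/f2|[/f3|[/f4|]]]]; last exact: plane_and_line_not_plane.
  all: by move=> [s Hs _] pl; exact: plane_not_lines pl Hs.
Qed.

End Exclusion.

Theorem theorem3p1 (R : realType) (f : 'I_3 -> 'rV[R]_3 -> R)
    (f_smooth : forall i, smooth_near 0 (f i))
    (f_const : forall i, f i 0 = 0)
    (f_linear : forall i (v : 'rV[R]_3), 'D_v (f i) 0 = 0)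
    (f_substantial : substantial (curvature_locus f)) :
  (roman_steiner (eta f) <-> V_six_real_lines f) /\
  (crosscap_surface (eta f) <-> V_two_real_four_complex_lines f) /\
  (type5_surface (eta f) <-> V_four_real_lines f) /\
  (type6_surface (eta f) <-> V_two_real_lines f) /\
  (truncated_cone (eta f) <-> V_plane_and_line f) /\
  (ellipsoid (eta f) <-> V_plane f).
Proof.
apply: iff_of_exclusive6 (surfaces_exclusive _) (line_sets_exclusive _) _.
move: f_substantial; rewrite /curvature_locus (etaE f_smooth) => sub.
have sB := hess_sym f.
have [[e1 [e2 [e3 [dl [p [q fr]]]]]]|[[e1 [e2 [e3 [dl [p [q fr]]]]]]|[[e1 [e2 [e3 [a [b fr]]]]]|[e1 [e2 [e3 fr]]]]]] :=
  frame_classification sB (substantial_functional sub).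
- left; split; first exact (roman_frame_surface sB fr).
  exact (roman_frame_lines f_const f_linear fr).
- right; left; split; first exact (crosscap_frame_surface sB fr).
  exact (crosscap_frame_lines f_const f_linear fr).
(* A nonzero [b] yields a second pair of factors; for b = 0 the pair is unique unless a = 0, when it
   belongs to a continuous family. *)
- right; right; have [b0|b0] := eqVneq b 0; last first.
    left; split; first exact (type5_frame sB fr b0).
    exact (type5_frame_lines f_const f_linear fr b0).
  right; have [a0|a0] := eqVneq a 0; last first.
    left; split; last exact (type6_frame_lines f_const f_linear fr b0 a0).
    by apply: (type6_frame sB (a := a)); [rewrite -b0; exact: fr|].
  right; left; rewrite a0 b0 in fr; have [[on _] _ _] := fr.
  split; first exact (cone_frame_surface sB fr).
  exact (truncated_cone_frame_plane f_const f_linear on fr).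
- right; right; right; right; right; have [[on _] _ _] := fr.
  split; first exact (ellipsoid_frame_surface sB fr).
  exact (ellipsoid_frame_plane f_const f_linear on fr).
Qed.
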